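(* Let $\rho : G \to \mathrm{O}(V)$ be a polar representation of a compact connected Lie group $G$ on a real finite dimensional Euclidean vector space $V$. Let $\Sigma \subseteq V$ be a section, $W(\Sigma)=N_G(\Sigma)/Z_G(\Sigma)$ its generalized Weyl group, $\rho_\Sigma : W(\Sigma) \to \mathrm{O}(\Sigma)$ the induced representation, $d=d(\rho_\Sigma)$, and $k=k(\rho_\Sigma)$. Let $U \subseteq \mathbb{R}^q$ be open. Consider a mapping $f : U \to V/G = \sigma(V) \subseteq \mathbb{R}^n$ of class $C^k$. Then there exists an orthogonal lift $\bar f : U \to V$ of $f$ which is locally Lipschitz.
   Context: Let $\sigma_1,\ldots,\sigma_n$ be a minimal system of homogeneous generators (of positive degree) of the algebra $\mathbb{R}[V]^G$ of $G$-invariant polynomials on $V$, and let $\sigma = (\sigma_1,\ldots,\sigma_n) : V \to \mathbb{R}^n$. The map $\sigma$ induces a homeomorphism between the orbit space $V/G$ and the image $\sigma(V)$, and $V/G$ is identified with $\sigma(V) \subseteq \mathbb{R}^n$ in this way. A mapping $f : U \to \sigma(V)$ is said to be of class $C^m$ if it is of class $C^m$ as a mapping into $\mathbb{R}^n$. A mapping $\bar f : U \to V$ is a lift of $f$ if $\sigma \circ \bar f = f$. A locally Lipschitz lift $\bar f$ is orthogonal if it meets orbits orthogonally, i.e. at every point $x \in U$ where $\bar f$ is differentiable, the image of $d\bar f(x)$ is orthogonal to $T_{\bar f(x)}(G.\bar f(x))$. Polar representation: $\rho$ is polar if there exists a linear subspace $\Sigma \subseteq V$, called a section, which meets every $G$-orbit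 and meets orbits orthogonally, i.e. $\Sigma \perp T_x(G.x)$ for every $x \in \Sigma$. Here $N_G(\Sigma) = \{g \in G : \rho(g)(\Sigma) = \Sigma\}$ and $Z_G(\Sigma) = \{g \in G : \rho(g)(s) = s \text{ for all } s \in \Sigma\}$. The generalized Weyl group $W(\Sigma) = N_G(\Sigma)/Z_G(\Sigma)$ is a finite group acting orthogonally on $\Sigma$; this action is $\rho_\Sigma$. The numbers $d$ and $k$ of a finite group representation: let $\tau : H \to \mathrm{O}(E)$ be a representation of a finite group $H$ on a real finite dimensional Euclidean vector space $E$. Then $d(\tau)$ is the maximal degree of the elements of a minimal system of homogeneous generators of $\mathbb{R}[E]^H$ (independent of the choice of the system). Write $E = E_1 \oplus \cdots \oplus E_l$ as an orthogonal direct sum of irreducible subspaces, and for each $i$ choose $v_i \in E_i \setminus \{0\}$ such that the cardinality of the isotropy group $H_{v_i} = \{h \in H : h.v_i = v_i\}$ is maximal (among nonzero vectors of $E_i$). Put $k(\tau) := \max\{d(\tau), |H|/|H_{v_i}| : 1 \le i \le l\}$. These are applied to $\tau = \rho_\Sigma$, $H = W(\Sigma)$, $E = \Sigma$. *)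

(* Defs.v *)
From HB Require Import structures.
From mathcomp Require Import all_boot all_order all_algebra finmap.
From mathcomp Require Import generic_quotient.
From mathcomp Require Import all_classical all_reals all_analysis.
From mathcomp Require mpoly.
Import (canonicals, coercions) mpoly.

Set Implicit Arguments.
Unset Strict Implicit.
Unset Printing Implicit Defensive.

Import Order.TTheory GRing.Theory Num.Theory.
Import numFieldNormedType.Exports.

Local Open Scope classical_set_scope.
Local Open Scope ring_scope.

(* The definition is only meant for an open set [U], on which [differentiable],
   ['D_v] and [continuous] are the notions for the restriction of [f] to [U].
   In finite dimension, continuity of all the iterated directional derivatives
   amounts to continuity of the iterated differentials. *)
Fixpoint C_on (R : realType) (V W : normedModType R) (k : nat) (U : set V)
    (f : V -> W) : Prop :=
  if k is k'.+1 then
    (forall x, U x -> differentiable f x) /\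
    (forall v : V, C_on k' U (fun x => 'D_v f x))
  else forall x, U x -> {for x, continuous f}.

Definition smooth_on (R : realType) (V W : normedModType R) (U : set V)
    (f : V -> W) : Prop :=
  forall k, C_on k U f.

Definition locally_lipschitz (R : realType) (V W : normedModType R)
    (U : set V) (f : V -> W) : Prop :=
  forall x, U x -> exists2 B, nbhs x B & [lipschitz f y | y in B `&` U].

(* [chart_inv] is only relevant on [chart_im]. *)
Record chart (R : realType) (d : nat) (M : topologicalType) := Chart {
  chart_dom : set M;
  chart_map : M -> 'rV[R]_d;
  chart_inv : 'rV[R]_d -> M;
  chart_dom_open : open chart_dom;
  chart_im_open : open (chart_map @` chart_dom);
  chart_map_continuous : {within chart_dom, continuous chart_map};
  chart_inv_continuous :
    {within chart_map @` chart_dom, continuous chart_inv};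
  chart_mapK : {in chart_dom, cancel chart_map chart_inv}
}.

Definition chart_im (R : realType) d (M : topologicalType) (c : chart R d M) :=
  chart_map c @` chart_dom c.

(* Multiplication and inversion are read in the charts; the sets on which these
   expressions are required to be smooth are open, by continuity. *)
HB.mixin Record isLieGroup (R : realType) G of Group G & Topological G := {
  lie_dim : nat;
  lie_atlas : set (chart R lie_dim G);
  lie_hausdorff : hausdorff_space G;
  lie_second_countable : @second_countable G;
  lie_atlas_cover : forall x : G, exists2 c, lie_atlas c & chart_dom c x;
  lie_atlas_smooth : forall a b, lie_atlas a -> lie_atlas b ->
    smooth_on (chart_map a @` (chart_dom a `&` chart_dom b))
      (chart_map b \o chart_inv a);
  lie_mul_continuous : continuous (fun p : G * G => (p.1 * p.2)%g);
  lie_inv_continuous : continuous (fun x : G => x^-1%g);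
  lie_mul_smooth : forall a b c,
    lie_atlas a -> lie_atlas b -> lie_atlas c ->
    smooth_on
      [set p : 'rV[R]_lie_dim * 'rV[R]_lie_dim |
        [/\ chart_im a p.1, chart_im b p.2 &
            chart_dom c (chart_inv a p.1 * chart_inv b p.2)%g]]
      (fun p => chart_map c (chart_inv a p.1 * chart_inv b p.2)%g);
  lie_inv_smooth : forall a b, lie_atlas a -> lie_atlas b ->
    smooth_on
      [set p | chart_im a p /\ chart_dom b (chart_inv a p)^-1%g]
      (fun p => chart_map b (chart_inv a p)^-1%g)
}.

#[short(type="lieGroupType")]
HB.structure Definition LieGroup (R : realType) :=
  {G of isLieGroup R G & Group G & Topological G}.

HB.mixin Record isEuclidean (R : realType) V of Vector R V & NormedModule R V
  := {
  inner : V -> V -> R;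
  innerC : forall u v, inner u v = inner v u;
  innerDl : forall u v w, inner (u + v) w = inner u w + inner v w;
  innerZl : forall a u v, inner (a *: u) v = a * inner u v;
  inner_norm : forall v, inner v v = `|v| ^+ 2
}.

(* [V] is finite dimensional as a [vectType]; [innerDl], [innerZl] and [innerC]
   give bilinearity, and [inner_norm] positivity. *)
#[short(type="euclideanType")]
HB.structure Definition Euclidean (R : realType) :=
  {V of isEuclidean R V & Vector R V & NormedModule R V}.

Definition sub_inner (R : realType) (V : euclideanType R) (S : {vspace V})
    (u v : subvs_of S) : R :=
  inner (vsval u) (vsval v).

(* A homomorphism from [H] to O(E), where [E] carries the inner product [ip]. *)
Record orthrep (R : realType) (H : groupType) (E : vectType R)
    (ip : E -> E -> R) := OrthRep {
  rep_fun :> H -> 'End(E);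
  rep1 : rep_fun 1%g = \1%VF;
  repM : forall g h, rep_fun (g * h)%g = (rep_fun g \o rep_fun h)%VF;
  rep_orth : forall g u v, ip (rep_fun g u) (rep_fun g v) = ip u v
}.

Section Invariants.
Variables (R : realType) (H : groupType) (E : vectType R) (ip : E -> E -> R).
Variable tau : orthrep H ip.

Local Notation RE := (mpoly.mpoly (\dim {:E}) R).

(* R[E] is the polynomial ring in the coordinates given by a basis of [E];
   [peval p] is the polynomial function on [E] represented by [p]. *)
Definition peval (p : RE) (v : E) : R :=
  mpoly.meval (fun i => coord (vbasis {:E}) i v) p.

Definition invariant_poly (p : RE) : Prop :=
  forall h v, peval p (tau h v) = peval p v.

Definition generates_invariants n (s : n.-tuple RE) : Prop :=
  forall p, invariant_poly p ->
    exists P : mpoly.mpoly n R, p = mpoly.comp_mpoly s P.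

(* The last clause is minimality: no proper subfamily of [s] generates. *)
Definition minimal_generators n (s : n.-tuple RE) : Prop :=
  [/\ forall p : RE, p \in s -> invariant_poly p,
      forall p : RE, p \in s -> exists2 e,
        (0 < e)%N & p \is mpoly.ishomog1 e mpoly.mdeg,
      generates_invariants s &
      forall m (t : m.-tuple RE),
        subseq t s -> generates_invariants t -> m = n].

Definition orbit_map n (s : n.-tuple RE) (v : E) : 'rV[R]_n :=
  \row_i peval (tnth s i) v.

(* The value does not depend on the minimal system [s]. *)
Definition is_d (d : nat) : Prop :=
  exists n (s : n.-tuple RE), minimal_generators s /\
    d = \max_(p <- s) (mpoly.mmeasure mpoly.mdeg p).-1.

(* This is the cardinality of [A] when [A] is finite: [card_set] is only meant
   for finite groups [H]. *)
Definition card_set (A : set H) : nat := #|` fset_set A|.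

Definition isotropy (v : E) : set H := [set h | tau h v = v].

Definition irreducible_subspace (F : {vspace E}) : Prop :=
  [/\ F != 0%VS, forall h, (tau h @: F <= F)%VS &
      forall F' : {vspace E}, (F' <= F)%VS ->
        (forall h, (tau h @: F' <= F')%VS) -> F' = 0%VS \/ F' = F].

(* [is_k k] means that [k] is the value obtained for some choice of a minimal
   system of generators, of an orthogonal decomposition into irreducible
   subspaces [F i] and of vectors [v i] with isotropy group of maximal order. *)
Definition is_k (k : nat) : Prop :=
  exists (d l : nat) (F : 'I_l -> {vspace E}) (v : 'I_l -> E),
    [/\ is_d d,
        forall i, irreducible_subspace (F i),
        (forall i j, i != j -> forall x y, x \in F i -> y \in F j -> ip x y = 0)
          /\ (\sum_i F i)%VS = fullv,
        forall i, [/\ v i \in F i, v i != 0 &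
          forall w, w \in F i -> w != 0 ->
            (card_set (isotropy w) <= card_set (isotropy (v i)))%N] &
        k = maxn d
              (\max_i (card_set [set: H] %/ card_set (isotropy (v i))))%N].

End Invariants.

Section PolarRepresentation.
Variables (R : realType) (G : lieGroupType R) (V : euclideanType R).
Variable rho : orthrep G (@inner R V).

(* Continuous homomorphisms of Lie groups are automatically smooth. *)
Definition continuous_rep : Prop :=
  forall v, continuous (fun g : G => rho g v).

Definition orbit (v : V) : set V := [set rho g v | g in [set: G]].

(* The orbit of [v] is a submanifold of [V] (for [G] compact and [rho]
   continuous): its tangent space at [v] consists of the velocities at [v] of
   the smooth curves of [V] lying in the orbit. *)
Definition orbit_tangent (v : V) : set V :=
  [set w | exists c : R -> V,
    [/\ smooth_on [set: R] c, forall t, orbit v (c t), c 0 = v &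
        'D_1 c 0 = w]].

Definition is_section (S : {vspace V}) : Prop :=
  (forall v, exists2 w, orbit v w & w \in S) /\
  (forall x, x \in S -> forall s w, s \in S -> orbit_tangent x w ->
    inner s w = 0).

Definition orthogonal_on (q : nat) (U : set 'rV[R]_q) (fbar : 'rV[R]_q -> V)
  : Prop :=
  forall x, U x -> differentiable fbar x ->
    forall h w, orbit_tangent (fbar x) w -> inner ('d fbar x h) w = 0.

End PolarRepresentation.

Section Weyl.
Variables (R : realType) (G : groupType) (V : euclideanType R).
Variables (rho : orthrep G (@inner R V)) (S : {vspace V}).

Definition normalizer_pred : pred G := fun g => (rho g @: S)%VS == S.

Definition centralizer_pred : pred G :=
  fun g => `[< forall s, s \in S -> rho g s = s >].

Lemma repVK g : (rho g^-1%g \o rho g)%VF = \1%VF.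
Proof. by rewrite -repM mulVg rep1. Qed.

Lemma repVKf g v : rho g^-1%g (rho g v) = v.
Proof. by rewrite -comp_lfunE repVK lfunE. Qed.

Lemma repKVf g v : rho g (rho g^-1%g v) = v.
Proof. by rewrite -{1}(invgK g) repVKf. Qed.

Lemma normalizer_closed : group_closed normalizer_pred.
Proof.
split=> [|g h]; rewrite /in_mem /= /normalizer_pred.
  by rewrite rep1 lim1g.
move=> /eqP gS /eqP hS; have hVS : (rho h^-1%g @: S)%VS = S.
  by rewrite -{1}hS -limg_comp repVK lim1g.
by rewrite repM limg_comp hVS gS.
Qed.

Record normalizer := Normalizer {
  normalizer_val :> G;
  normalizer_valP : normalizer_pred normalizer_val
}.

HB.instance Definition _ := [isSub for normalizer_val].
HB.instance Definition _ := [Choice of normalizer by <:].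
HB.instance Definition _ :=
  SubChoice_isSubGroup.Build G normalizer_pred normalizer normalizer_closed.

(* [g Z = h Z], with [Z] the subgroup given by [centralizer_pred]. *)
Definition weyl_rel (g h : normalizer) : bool :=
  centralizer_pred ((val g)^-1 * val h)%g.

Lemma centralizerP (g : G) :
  reflect (forall s, s \in S -> rho g s = s) (centralizer_pred g).
Proof. exact: asboolP. Qed.

Lemma weyl_relP (g h : normalizer) :
  reflect (forall s, s \in S -> rho (val g) s = rho (val h) s) (weyl_rel g h).
Proof.
apply: (iffP (centralizerP _)) => eq_gh s sS.
  by rewrite -[in RHS](mulVKg (val g) (val h)) repM lfunE /= eq_gh.
by rewrite repM lfunE /= -eq_gh // repVKf.
Qed.

Lemma weyl_rel_refl : reflexive weyl_rel.
Proof. by move=> g; apply/weyl_relP. Qed.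

Lemma weyl_rel_sym : symmetric weyl_rel.
Proof.
by move=> g h; apply/weyl_relP/weyl_relP => e s sS; rewrite e.
Qed.

Lemma weyl_rel_trans : transitive weyl_rel.
Proof.
move=> h g k /weyl_relP gh /weyl_relP hk; apply/weyl_relP => s sS.
by rewrite gh ?hk.
Qed.

Canonical weyl_equiv :=
  EquivRel weyl_rel weyl_rel_refl weyl_rel_sym weyl_rel_trans.

Definition weyl := {eq_quot weyl_equiv}%qT.
HB.instance Definition _ := Choice.on weyl.
HB.instance Definition _ := EqQuotient.on weyl.

Definition weyl_pi (g : normalizer) : weyl := \pi_weyl%qT g.

Lemma weyl_piP g h : reflect (weyl_pi g = weyl_pi h) (weyl_rel g h).
Proof. exact: eqquotP. Qed.

Lemma weyl_reprK x : weyl_pi (repr x) = x.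
Proof. exact: reprK. Qed.

Lemma normalizer_stable (g : normalizer) s : s \in S -> rho (val g) s \in S.
Proof.
move=> sS; have /eqP <- := valP g; exact: memv_img.
Qed.

Lemma weyl_repr_pi g s :
  s \in S -> rho (val (repr (weyl_pi g))) s = rho (val g) s.
Proof.
by apply/weyl_relP; apply/weyl_piP; rewrite weyl_reprK.
Qed.

Lemma weyl_ind (P : weyl -> Prop) : (forall g, P (weyl_pi g)) -> forall x, P x.
Proof. by move=> Ppi x; rewrite -(weyl_reprK x). Qed.

Definition weyl_one : weyl := weyl_pi 1%g.
Definition weyl_mul (x y : weyl) : weyl := weyl_pi (repr x * repr y)%g.
Definition weyl_inv (x : weyl) : weyl := weyl_pi (repr x)^-1%g.

Lemma weyl_mul_pi g h : weyl_mul (weyl_pi g) (weyl_pi h) = weyl_pi (g * h)%g.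
Proof.
apply/weyl_piP/weyl_relP => s sS; rewrite !repM !lfunE /=.
by rewrite !weyl_repr_pi ?normalizer_stable.
Qed.

Lemma weyl_inv_pi g : weyl_inv (weyl_pi g) = weyl_pi g^-1%g.
Proof.
apply/weyl_piP/weyl_relP => s sS.
have tS := normalizer_stable g^-1%g sS.
have -> : s = rho (val (repr (weyl_pi g))) (rho (val g^-1%g) s).
  by rewrite weyl_repr_pi // repKVf.
by rewrite [LHS]repVKf weyl_repr_pi // repVKf.
Qed.

Lemma weyl_mulA : associative weyl_mul.
Proof.
elim/weyl_ind=> x; elim/weyl_ind=> y; elim/weyl_ind=> z.
by rewrite !weyl_mul_pi mulgA.
Qed.

Lemma weyl_mul1 : left_id weyl_one weyl_mul.
Proof. by elim/weyl_ind=> x; rewrite weyl_mul_pi mul1g. Qed.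

Lemma weyl_mulr1 : right_id weyl_one weyl_mul.
Proof. by elim/weyl_ind=> x; rewrite weyl_mul_pi mulg1. Qed.

Lemma weyl_mulV : left_inverse weyl_one weyl_inv weyl_mul.
Proof. by elim/weyl_ind=> x; rewrite weyl_inv_pi weyl_mul_pi mulVg. Qed.

Lemma weyl_mulrV : right_inverse weyl_one weyl_inv weyl_mul.
Proof. by elim/weyl_ind=> x; rewrite weyl_inv_pi weyl_mul_pi mulgV. Qed.

HB.instance Definition _ := isGroup.Build weyl
  weyl_mulA weyl_mul1 weyl_mulr1 weyl_mulV weyl_mulrV.

Definition weyl_fun (x : weyl) : 'End(subvs_of S) :=
  linfun (vsproj S \o (rho (val (repr x)) \o vsval)).

Lemma weyl_funE g u : vsval (weyl_fun (weyl_pi g) u) = rho (val g) (vsval u).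
Proof.
rewrite lfunE /= weyl_repr_pi ?subvsP // vsprojK //.
by rewrite normalizer_stable ?subvsP.
Qed.

Lemma weyl_fun1 : weyl_fun 1%g = \1%VF.
Proof.
apply/lfunP => u; apply: (can_inj (@vsvalK _ _ _)).
by rewrite -[weyl_fun _]/(weyl_fun (weyl_pi 1%g)) weyl_funE rep1 !lfunE.
Qed.

Lemma weyl_funM x y : weyl_fun (x * y)%g = (weyl_fun x \o weyl_fun y)%VF.
Proof.
elim/weyl_ind: x => g; elim/weyl_ind: y => h.
rewrite [(_ * _)%g]weyl_mul_pi; apply/lfunP => u; apply: (can_inj (@vsvalK _ _ _)).
by rewrite comp_lfunE !weyl_funE repM comp_lfunE.
Qed.

Lemma weyl_fun_orth x u v :
  sub_inner (weyl_fun x u) (weyl_fun x v) = sub_inner u v.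
Proof.
by elim/weyl_ind: x => g; rewrite /sub_inner !weyl_funE rep_orth.
Qed.

Definition weyl_rep : orthrep weyl (@sub_inner R V S) :=
  OrthRep weyl_fun1 weyl_funM weyl_fun_orth.

End Weyl.

(* Main.v *)
(* Let [Sigma] be the section and [K] the image of [G] in O(V). Around a regular
   point of [Sigma] the Lie algebra of [K] is described by roots [a_l]: in a
   suitable orthonormal basis [e_l] of the orthogonal complement of [Sigma], there
   are [X_l] in the Lie algebra with [X_l c = <a_l, c> e_l] for [c] in [Sigma],
   and every [X] acts on [Sigma] as a combination of the [X_l]. The reflections in
   the [a_l] are induced by [K], and they generate a finite group for which
   [C = {c | <a_l, c> >= 0}] is a strict fundamental domain.

   A polynomial on [Sigma] invariant under these reflections extends to an
   invariant polynomial on [V], hence is a polynomial in [sigma]. So [sigma] is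
   injective on [C], and [f] has a unique lift [fbar] with values in [C], which is
   continuous since [|v|^2] is a polynomial in [sigma]. As [fbar] takes its values
   in [Sigma], it is orthogonal.

   For [u] in the Weyl orbit of [v_i], the functions [<fbar, u>] are the roots of
   a polynomial of degree [|W| / |W_{v_i}| <= k] whose coefficients are
   polynomials in [f], hence of class C^k. By Bronshtein's theorem, along
   segments with uniform constants, these roots are locally Lipschitz; since the
   orbits of the [v_i] span [Sigma], so is [fbar].

   The extension theorem is proved by induction on the degree: an
   equivariant map on [Sigma] is extended by first extending its derivative, and
   the obstruction vanishes because a sum of squares does. Bronshtein's theorem
   is proved by centring and rescaling the roots, so that they split into two
   clusters, and by induction on their number. *)

Require Import Defs.
From HB Require Import structures.
From mathcomp Require Import all_boot all_order all_algebra finmap.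
From mathcomp Require Import all_classical all_reals all_analysis.
From mathcomp Require Import ring lra.
From mathcomp Require mpoly.
Import (canonicals, coercions) mpoly.

Set Implicit Arguments.
Unset Strict Implicit.
Unset Printing Implicit Defensive.

Import Order.TTheory GRing.Theory Num.Theory.
Import numFieldNormedType.Exports.

Local Open Scope classical_set_scope.
Local Open Scope ring_scope.

(** * Polynomial functions *)

(** The derivative [B] of an equivariant extension of [T] is forced on the section: in the direction
    [e_l] it is [X_l T(c) / <a_l, c>]. This is a polynomial only if [X_l T] vanishes on the wall of
    [a_l], and the obstruction is that [B] must satisfy the same condition in its turn. What ensures
    this is that the radial Laplacian of [T], the sum of the [d_j^2 T] and of the
    [(X_l B)(e_l) / <a_l, c>], is a polynomial: its residue along each wall must vanish, and this
    trace condition leads to a vanishing sum of squares. The iterated Laplacians have to be kept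
    polynomial for as many steps as the degree; for a reflection invariant polynomial they are,
    because its radial Laplacian is a reflection invariant polynomial again.

    The estimate on roots is stated for families over an arbitrary parameter type: rescaling around
    each point turns a family over [Om] into a family over points of [Om * R], and the constants
    must not depend on the point. *)

Section Dot.
Variable R : realType.

Definition dot n (u v : 'cV[R]_n) : R := \sum_i u i 0 * v i 0.

Lemma dotC n (u v : 'cV[R]_n) : dot u v = dot v u.
Proof. by apply: eq_bigr => i _; rewrite mulrC. Qed.

Lemma dotDl n (u v w : 'cV[R]_n) : dot (u + v) w = dot u w + dot v w.
Proof.
by rewrite -big_split; apply: eq_bigr => i _; rewrite /= mxE mulrDl.
Qed.

Lemma dotZl n k (u w : 'cV[R]_n) : dot (k *: u) w = k * dot u w.
Proof. by rewrite mulr_sumr; apply: eq_bigr => i _; rewrite mxE mulrA. Qed.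

Lemma dotDr n (u v w : 'cV[R]_n) : dot w (u + v) = dot w u + dot w v.
Proof. by rewrite dotC dotDl !(dotC w). Qed.

Lemma dotZr n k (u w : 'cV[R]_n) : dot w (k *: u) = k * dot w u.
Proof. by rewrite dotC dotZl dotC. Qed.

Lemma dotNl n (u w : 'cV[R]_n) : dot (- u) w = - dot u w.
Proof. by rewrite -scaleN1r dotZl mulN1r. Qed.

Lemma dotNr n (u w : 'cV[R]_n) : dot w (- u) = - dot w u.
Proof. by rewrite dotC dotNl dotC. Qed.

Lemma dotBl n (u v w : 'cV[R]_n) : dot (u - v) w = dot u w - dot v w.
Proof. by rewrite dotDl dotNl. Qed.

Lemma dotBr n (u v w : 'cV[R]_n) : dot w (u - v) = dot w u - dot w v.
Proof. by rewrite dotDr dotNr. Qed.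

Lemma dot0l n (w : 'cV[R]_n) : dot 0 w = 0.
Proof. by rewrite -(scale0r 0) dotZl mul0r. Qed.

Lemma dot0r n (w : 'cV[R]_n) : dot w 0 = 0.
Proof. by rewrite dotC dot0l. Qed.

Lemma dot_suml n (I : Type) (r : seq I) (P : pred I) (F : I -> 'cV[R]_n) w :
  dot (\sum_(i <- r | P i) F i) w = \sum_(i <- r | P i) dot (F i) w.
Proof.
by apply: (big_morph (fun u => dot u w)); [move=> u v; rewrite dotDl|rewrite dot0l].
Qed.

Lemma dot_sumr n (I : Type) (r : seq I) (P : pred I) (F : I -> 'cV[R]_n) w :
  dot w (\sum_(i <- r | P i) F i) = \sum_(i <- r | P i) dot w (F i).
Proof. by rewrite dotC dot_suml; apply: eq_bigr => i _; rewrite dotC. Qed.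

Lemma dot_ge0 n (u : 'cV[R]_n) : 0 <= dot u u.
Proof. by apply: sumr_ge0 => i _; rewrite -expr2 sqr_ge0. Qed.

Lemma dot_eq0 n (u : 'cV[R]_n) : (dot u u == 0) = (u == 0).
Proof.
apply/eqP/eqP => [u0|->]; last exact: dot0l.
apply/matrixP => i j; rewrite ord1 mxE; apply/eqP; rewrite -sqrf_eq0 expr2.
move/eqP: u0; rewrite psumr_eq0 => [/allP/(_ i)|k _]; last by rewrite -expr2 sqr_ge0.
by rewrite mem_index_enum => /(_ isT).
Qed.

Lemma dot_gt0 n (u : 'cV[R]_n) : (0 < dot u u) = (u != 0).
Proof. by rewrite lt_neqAle dot_ge0 andbT eq_sym dot_eq0. Qed.

Lemma dot_mulmx n p (A : 'M[R]_(n, p)) u v : dot (A *m u) v = dot u (A^T *m v).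
Proof.
rewrite /dot; under eq_bigr do rewrite mxE mulr_suml.
rewrite exchange_big; apply: eq_bigr => i _; rewrite mxE mulr_sumr.
by apply: eq_bigr => j _; rewrite mxE; ring.
Qed.

Lemma dot_delta n (u : 'cV[R]_n) i : dot u (delta_mx i 0) = u i 0.
Proof.
rewrite /dot (bigD1 i) //= mxE !eqxx mulr1 big1 ?addr0 // => j /negPf ji.
by rewrite mxE ji mulr0.
Qed.

Lemma dot_col_mx n p (u u' : 'cV[R]_n) (v v' : 'cV[R]_p) :
  dot (col_mx u v) (col_mx u' v') = dot u u' + dot v v'.
Proof.
rewrite /dot big_split_ord; congr (_ + _); apply: eq_bigr => i _.
  by rewrite !col_mxEu.
by rewrite !col_mxEd.
Qed.

Lemma colv_sum n (u : 'cV[R]_n) : u = \sum_i u i 0 *: delta_mx i 0.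
Proof.
by rewrite [LHS]matrix_sum_delta; apply: eq_bigr => i _; rewrite big_ord1.
Qed.

End Dot.

Section PolyFun.
Variables (R : realType) (n : nat).

(* Sealed: unification would otherwise unfold iterated derivatives to limits. *)
Fact pder_key : unit. Proof. exact: tt. Qed.
Definition pder (u : 'cV[R]_n) (f : 'cV[R]_n -> R) : 'cV[R]_n -> R :=
  locked_with pder_key ('D_u f).

Lemma pderE u f c : pder u f c = 'D_u f c.
Proof. by rewrite /pder unlock. Qed.

Lemma pder_cst u k c : pder u (cst k) c = 0.
Proof. by rewrite pderE derive_cst. Qed.

(** A predicate on functions rather than a type of polynomials: differentiation, substitution of
    linear maps and passage to limits all go by induction on the construction, with [polyfun_eq]
    absorbing changes of the defining expression. *)
Inductive polyfun : ('cV[R]_n -> R) -> Prop :=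
| polyfun_cst k : polyfun (fun=> k)
| polyfun_coord i : polyfun (fun c => c i 0)
| polyfunD f g : polyfun f -> polyfun g -> polyfun (fun c => f c + g c)
| polyfunM f g : polyfun f -> polyfun g -> polyfun (fun c => f c * g c)
| polyfun_eq f g : f =1 g -> polyfun f -> polyfun g.

Lemma polyfunZ k f : polyfun f -> polyfun (fun c => k * f c).
Proof. by move=> pf; apply: polyfunM => //; apply: polyfun_cst. Qed.

Lemma polyfunN f : polyfun f -> polyfun (fun c => - f c).
Proof.
by move=> /(polyfunZ (-1)); apply: polyfun_eq => c; rewrite mulN1r.
Qed.

Lemma polyfunB f g : polyfun f -> polyfun g -> polyfun (fun c => f c - g c).
Proof. by move=> pf pg; apply: polyfunD => //; apply: polyfunN. Qed.

Lemma polyfun_sum (I : Type) (r : seq I) (P : pred I) (F : I -> 'cV[R]_n -> R) :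
  (forall i, P i -> polyfun (F i)) ->
  polyfun (fun c => \sum_(i <- r | P i) F i c).
Proof.
move=> pF; elim: r => [|i r IH].
  by apply: polyfun_eq (polyfun_cst 0) => c; rewrite big_nil.
case Pi: (P i); last by apply: polyfun_eq IH => c; rewrite big_cons Pi.
apply: polyfun_eq (polyfunD (pF i Pi) IH) => c.
by rewrite big_cons Pi.
Qed.

Lemma polyfun_prod (I : Type) (r : seq I) (P : pred I) (F : I -> 'cV[R]_n -> R) :
  (forall i, P i -> polyfun (F i)) ->
  polyfun (fun c => \prod_(i <- r | P i) F i c).
Proof.
move=> pF; elim: r => [|i r IH].
  by apply: polyfun_eq (polyfun_cst 1) => c; rewrite big_nil.
case Pi: (P i); last by apply: polyfun_eq IH => c; rewrite big_cons Pi.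
apply: polyfun_eq (polyfunM (pF i Pi) IH) => c.
by rewrite big_cons Pi.
Qed.

Lemma polyfun_dot (a : 'cV[R]_n) : polyfun (dot a).
Proof.
by apply: polyfun_sum => i _; apply: polyfunZ; apply: polyfun_coord.
Qed.

Lemma polyfun_derivable f c u : polyfun f -> derivable f c u.
Proof.
elim=> {f} [k|i|f g _ df _ dg|f g _ df _ dg|f g fg _ df].
- exact: derivable_cst.
- by apply: diff_derivable; apply: differentiable_coord.
- exact: derivableD.
- exact: derivableM.
- by rewrite -(funext fg).
Qed.

Lemma deriveD_poly f g u c : polyfun f -> polyfun g ->
  pder u (fun c => f c + g c) c = pder u f c + pder u g c.
Proof. by move=> pf pg; rewrite !pderE; apply: deriveD; apply: polyfun_derivable. Qed.

Lemma deriveM_poly f g u c : polyfun f -> polyfun g ->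
  pder u (fun c => f c * g c) c = f c * pder u g c + g c * pder u f c.
Proof. by move=> pf pg; rewrite !pderE; apply: deriveM; apply: polyfun_derivable. Qed.

Lemma deriveZ_poly k f u c : polyfun f ->
  pder u (fun c => k * f c) c = k * pder u f c.
Proof.
move=> pf; rewrite deriveM_poly ?pder_cst ?mulr0 ?addr0 //.
exact: polyfun_cst.
Qed.

Lemma derive_sum_poly (I : Type) (r : seq I) (P : pred I) (F : I -> 'cV[R]_n -> R)
  u c : (forall i, P i -> polyfun (F i)) ->
  pder u (fun c => \sum_(i <- r | P i) F i c) c = \sum_(i <- r | P i) pder u (F i) c.
Proof.
move=> pF; elim: r => [|i r IH].
  rewrite big_nil (_ : (fun _ => _) = cst 0) ?pder_cst //.
  by apply/funext => x; rewrite big_nil.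
rewrite big_cons; case Pi: (P i); last first.
  by rewrite -IH; congr (pder u _ c); apply/funext => x; rewrite big_cons Pi.
rewrite -IH -deriveD_poly; [|exact: pF|exact: polyfun_sum].
by congr (pder u _ c); apply/funext => x; rewrite big_cons Pi.
Qed.

Lemma derive_coord u c i : pder u (fun c : 'cV[R]_n => c i 0) c = u i 0.
Proof.
rewrite pderE /derive (_ : (fun h => _) = (fun h => h^-1 *: (h * u i 0 : R))); last first.
  by apply/funext => h /=; rewrite !mxE addrK.
apply/cvg_lim => //; apply: cvg_near_cst.
near=> h; rewrite /GRing.scale /= mulrA mulVf ?mul1r //.
by near: h; apply: nbhs_dnbhs_neq.
Unshelve. all: by end_near.
Qed.

Lemma derive_dot (a u c : 'cV[R]_n) : pder u (dot a) c = dot a u.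
Proof.
rewrite derive_sum_poly => [|i _]; last exact/polyfunZ/polyfun_coord.
by apply: eq_bigr => i _; rewrite deriveZ_poly ?derive_coord //; exact: polyfun_coord.
Qed.

Lemma polyfun_derive f u : polyfun f -> polyfun (pder u f).
Proof.
elim=> {f} [k|i|f g pf df pg dg|f g pf df pg dg|f g fg _ df].
- by apply: polyfun_eq (polyfun_cst 0) => c; rewrite pder_cst.
- by apply: polyfun_eq (polyfun_cst (u i 0)) => c; rewrite derive_coord.
- by apply: polyfun_eq (polyfunD df dg) => c; rewrite deriveD_poly.
- apply: polyfun_eq (polyfunD (polyfunM pf dg) (polyfunM pg df)) => c.
  by rewrite deriveM_poly.
- by rewrite -(funext fg).
Qed.

Lemma derive_linear_poly f u c : polyfun f ->
  pder u f c = \sum_i u i 0 * pder (delta_mx i 0) f c.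
Proof.
elim=> {f} [k|j|f g pf df pg dg|f g pf df pg dg|f g fg _ df].
- by rewrite pder_cst big1 // => i _; rewrite pder_cst mulr0.
- rewrite derive_coord (bigD1 j) //= derive_coord mxE !eqxx mulr1 big1 ?addr0 //.
  by move=> i /negPf ij; rewrite derive_coord mxE eq_sym ij mulr0.
- rewrite deriveD_poly // df dg -big_split; apply: eq_bigr => i _ /=.
  by rewrite deriveD_poly // mulrDr.
- rewrite deriveM_poly // df dg !mulr_sumr -big_split; apply: eq_bigr => i _ /=.
  by rewrite deriveM_poly //; ring.
- by rewrite -(funext fg).
Qed.

Lemma deriveC_poly f (u v c : 'cV[R]_n) : polyfun f -> pder u (pder v f) c = pder v (pder u f) c.
Proof.
move=> pf; pose P (f : 'cV[R]_n -> R) := forall c, pder u (pder v f) c = pder v (pder u f) c.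
suff: P f by apply.
elim: pf => {f c} [k|j|f g pf df pg dg|f g pf df pg dg|f g fg _ df] c.
- have D0 (w : 'cV[R]_n) : pder w (fun=> k) = cst 0 :> ('cV[R]_n -> R).
    by apply/funext => x; rewrite pder_cst.
  by rewrite !D0 !pder_cst.
- have D0 (w : 'cV[R]_n) : pder w (fun c : 'cV[R]_n => c j 0) = cst (w j 0) :> ('cV[R]_n -> R).
    by apply/funext => x; rewrite derive_coord.
  by rewrite !D0 !pder_cst.
- have DD (w : 'cV[R]_n) : pder w (fun c : 'cV[R]_n => f c + g c) = (fun c : 'cV[R]_n => pder w f c + pder w g c).
    by apply/funext => x; rewrite deriveD_poly.
  by rewrite !DD !deriveD_poly; try exact: polyfun_derive; rewrite df dg.
- have DM (w : 'cV[R]_n) : pder w (fun c : 'cV[R]_n => f c * g c) = (fun c : 'cV[R]_n => f c * pder w g c + g c * pder w f c).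
    by apply/funext => x; rewrite deriveM_poly.
  have pd w h : polyfun h -> polyfun (pder w h) by apply: polyfun_derive.
  have E w w' : pder w' (pder w (fun c => f c * g c)) c =
      (f c * pder w' (pder w g) c + pder w g c * pder w' f c)
      + (g c * pder w' (pder w f) c + pder w f c * pder w' g c).
    rewrite DM deriveD_poly; [|exact/polyfunM/pd|exact/polyfunM/pd].
    by rewrite (deriveM_poly _ _ pf (pd _ _ pg)) (deriveM_poly _ _ pg (pd _ _ pf)).
  apply: etrans (E v u) _; apply: etrans _ (esym (E u v)).
  apply: etrans (addrACA _ _ _ _) _; apply: etrans _ (esym (addrACA _ _ _ _)).
  apply: (congr2 +%R).
    exact: (congr2 +%R (congr1 ( *%R (f c)) (dg c)) (congr1 ( *%R (g c)) (df c))).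
  by apply: etrans (addrC _ _) _; exact: (congr2 +%R (mulrC _ _) (mulrC _ _)).
- by rewrite -(funext fg).
Qed.

Lemma polyfun_line f c u : polyfun f ->
  exists p : {poly R}, forall t, f (c + t *: u) = p.[t].
Proof.
elim=> {f} [k|j|f g _ [p pf] _ [q qg]|f g _ [p pf] _ [q qg]|f g fg _ [p pf]].
- by exists k%:P => t; rewrite hornerC.
- by exists ((c j 0)%:P + (u j 0)%:P * 'X) => t; rewrite !hornerE !mxE mulrC.
- by exists (p + q) => t; rewrite hornerD pf qg.
- by exists (p * q) => t; rewrite hornerM pf qg.
- by exists p => t; rewrite -fg pf.
Qed.

Lemma poly_fun_eq0 (p : {poly R}) : (forall t, p.[t] = 0) -> p = 0.
Proof.
move=> p0; apply/eqP/negPn/negP => pn0.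
have := max_poly_roots pn0 (rs := [seq k%:R | k <- iota 0 (size p)]).
rewrite size_map size_iota ltnn => H; suff: false by []; apply: H.
  by apply/allP => x /mapP[k _ ->]; rewrite rootE p0.
by rewrite map_inj_uniq ?iota_uniq //; apply: mulrIn; rewrite oner_eq0.
Qed.

(** On the line joining a point where [f] is nonzero to one where [g] is nonzero, both become
    univariate polynomials, which form a domain. *)
Lemma polyfun_mul_eq0 f g : polyfun f -> polyfun g ->
  (forall c, f c * g c = 0) -> (exists c, g c != 0) -> forall c, f c = 0.
Proof.
move=> pf pg fg0 [c2 g2] c1; apply/eqP/negPn/negP => f1.
have [p pE] := polyfun_line c1 (c2 - c1) pf.
have [q qE] := polyfun_line c1 (c2 - c1) pg.
have /eqP : p * q = 0.
  by apply: poly_fun_eq0 => t; rewrite hornerM -pE -qE fg0.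
rewrite mulf_eq0 => /orP[]/eqP z.
  by move: f1; rewrite -[c1]addr0 -(scale0r (c2 - c1)) pE z horner0 eqxx.
by move: g2; rewrite -[c2](subrK c1) addrC -(scale1r (c2 - c1)) qE z horner0 eqxx.
Qed.

(** The source of all generic points below: finitely many nonzero polynomial conditions can be met
    at once. *)
Lemma polyfun_prod_neq0 (I : finType) (P : pred I) (F : I -> 'cV[R]_n -> R) :
  (forall i, P i -> polyfun (F i)) ->
  (forall i, P i -> exists c, F i c != 0) ->
  exists c, \prod_(i | P i) F i c != 0.
Proof.
move=> pF nF; elim: (index_enum I) => [|i r [c1 IH]].
  by exists 0; rewrite big_nil oner_eq0.
case Pi: (P i); last by exists c1; rewrite big_cons Pi.
apply: contrapT => /forallNP H.
have : forall c, F i c * \prod_(j <- r | P j) F j c = 0.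
  by move=> c; have := H c; rewrite big_cons Pi => /negP; rewrite negbK => /eqP.
move/(polyfun_mul_eq0 (pF i Pi) (polyfun_prod _ pF)) => H0.
have [c2] := nF i Pi; rewrite H0 ?eqxx //.
by exists c1.
Qed.

Lemma polyfun_comp_lin (A : 'M[R]_n) f : polyfun f -> polyfun (fun c => f (A *m c)).
Proof.
elim=> {f} [k|j|f g _ pf _ pg|f g _ pf _ pg|f g fg _ pf].
- exact: polyfun_cst.
- apply: polyfun_eq (polyfun_dot ((row j A)^T)) => c.
  by rewrite !mxE; apply: eq_bigr => i _; rewrite !mxE.
- exact: polyfunD.
- exact: polyfunM.
- by apply: polyfun_eq pf => c; rewrite fg.
Qed.

(** For [a != 0], the orthogonal projection to the hyperplane orthogonal to [a]. *)
Definition projh (a c : 'cV[R]_n) := c - (dot a c / dot a a) *: a.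

Lemma dot_projh a c : a != 0 -> dot a (projh a c) = 0.
Proof.
by rewrite -dot_eq0 => a0; rewrite dotBr dotZr divfK ?subrr.
Qed.

Lemma projh_id a c : dot a c = 0 -> projh a c = c.
Proof. by move=> ac; rewrite /projh ac mul0r scale0r subr0. Qed.

Lemma polyfun_projh a f : polyfun f -> polyfun (fun c => f (projh a c)).
Proof.
elim=> {f} [k|j|f g _ pf _ pg|f g _ pf _ pg|f g fg _ pf].
- exact: polyfun_cst.
- apply: (@polyfun_eq (fun c => c j 0 - (a j 0 / dot a a) * dot a c)).
    by move=> c; rewrite !mxE; ring.
  by apply: polyfunB; [exact: polyfun_coord|apply/polyfunZ/polyfun_dot].
- exact: polyfunD.
- exact: polyfunM.
- by apply: polyfun_eq pf => c; rewrite fg.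
Qed.

(** By induction on [f], the difference [f c - f (projh a c)] is divisible by [dot a] for every
    polynomial function; the vanishing hypothesis serves only to remove the second term. *)
Lemma polyfun_div a f : a != 0 -> polyfun f ->
  (forall c, dot a c = 0 -> f c = 0) ->
  exists2 g, polyfun g & forall c, f c = dot a c * g c.
Proof.
move=> a0 pf f0.
suff [g pg fg] : exists2 g, polyfun g & forall c, f c - f (projh a c) = dot a c * g c.
  by exists g => // c; rewrite -fg [f (projh a c)]f0 ?subr0 // dot_projh.
elim: pf => {f f0} [k|j|f g pf [f' pf' Ef] pg [g' pg' Eg]
  |f g pf [f' pf' Ef] pg [g' pg' Eg]|f g fg _ [f' pf' Ef]].
- by exists (fun=> 0) => [|c]; [exact: polyfun_cst|rewrite subrr mulr0].
- exists (fun=> a j 0 / dot a a) => [|c]; first exact: polyfun_cst.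
  by rewrite !mxE; ring.
- exists (fun c => f' c + g' c) => [|c]; first exact: polyfunD.
  by rewrite mulrDr -Ef -Eg; ring.
- exists (fun c => f' c * g c + f (projh a c) * g' c) => [|c].
    by apply: polyfunD; apply: polyfunM => //; apply: polyfun_projh.
  have -> : dot a c * (f' c * g c + f (projh a c) * g' c) =
     (dot a c * f' c) * g c + f (projh a c) * (dot a c * g' c) by ring.
  by rewrite -Ef -Eg; ring.
- by exists f' => // c; rewrite -!fg.
Qed.


Lemma derive_dirZ f k u c : polyfun f -> pder (k *: u) f c = k * pder u f c.
Proof.
move=> pf; rewrite !(derive_linear_poly _ _ pf) mulr_sumr.
by apply: eq_bigr => i _; rewrite mxE mulrA.
Qed.

Lemma derive_comp_lin (A : 'M[R]_n) (f : 'cV[R]_n -> R) (u c : 'cV[R]_n) :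
  pder u (fun c => f (A *m c)) c = pder (A *m u) f (A *m c).
Proof.
rewrite !pderE /derive; set g := (X in lim (X @ _)).
suff -> : g = (fun h => h^-1 *: ((f \o shift (A *m c)) (h *: (A *m u)) - f (A *m c))) by [].
by apply/funext => h; rewrite /g /= mulmxDr scalemxAr.
Qed.

Lemma derive_line (f : 'cV[R]_n -> R) c u (p : {poly R}) t :
  (forall t, f (c + t *: u) = p.[t]) -> pder u f (c + t *: u) = p^`().[t].
Proof.
move=> fE; rewrite pderE derivE derive1E /derive; set g := (X in lim (X @ _) = _).
set g' := (X in _ = lim (X @ _)); suff -> : g = g' by [].
apply/funext => h; rewrite /g /g' /= addrCA -scalerDl !fE.
by rewrite [h *: 1]mulr1.
Qed.

Lemma poly_deriv0_const (p : {poly R}) : p^`() = 0 -> p = (p.[0])%:P.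
Proof.
move=> p0; apply/polyP => i; rewrite coefC horner_coef0.
case: i => [|i] //=; have := congr1 (fun q : {poly R} => q`_i) p0.
by rewrite coef_deriv coef0 => /eqP; rewrite mulrn_eq0 /= => /eqP.
Qed.

(** On the ray through [c], with [p(t) = f(t c)], the hypothesis reads [t p'(t) = 0]. *)
Lemma euler0_const (f : 'cV[R]_n -> R) c : polyfun f -> (forall c, pder c f c = 0) -> f c = f 0.
Proof.
move=> pf f0; have [p pE] := polyfun_line 0 c pf.
have p'0 : p^`() = 0.
  have : 'X * p^`() = 0.
    apply: poly_fun_eq0 => t; rewrite hornerM hornerX -(derive_line t pE).
    by rewrite -derive_dirZ // add0r f0.
  by move/eqP; rewrite mulf_eq0 polyX_eq0 => /eqP.
have fE t : f (t *: c) = p.[t] by rewrite -pE add0r.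
by rewrite -[in LHS](scale1r c) -(scale0r c) !fE (poly_deriv0_const p'0) !hornerC.
Qed.

Lemma polyfun_euler (f : 'cV[R]_n -> R) : polyfun f -> polyfun (fun c => pder c f c).
Proof.
move=> pf; apply: (@polyfun_eq (fun c => \sum_i c i 0 * pder (delta_mx i 0) f c)).
  by move=> c; rewrite [RHS]derive_linear_poly.
apply: polyfun_sum => i _; apply: polyfunM; [exact: polyfun_coord|exact: polyfun_derive].
Qed.

(** Differentiating Euler's identity along [e_j] produces one extra copy of the derivative, which
    lowers the degree by one; second derivatives commute. *)
Lemma euler_derive k (f : 'cV[R]_n -> R) j c : polyfun f -> (forall c, pder c f c = k.+1%:R * f c) ->
  pder c (pder (delta_mx j 0) f) c = k%:R * pder (delta_mx j 0) f c.
Proof.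
move=> pf fE; set u := delta_mx j 0.
have pd i : polyfun (pder (delta_mx i 0) f) by apply: polyfun_derive.
have : pder u (fun c => pder c f c) c = k.+1%:R * pder u f c.
  by rewrite -deriveZ_poly //; congr (pder _ _ c); apply/funext => c'; rewrite fE.
have -> : (fun c => pder c f c) = (fun c => \sum_i c i 0 * pder (delta_mx i 0) f c).
  by apply/funext => c'; rewrite derive_linear_poly.
rewrite derive_sum_poly => [|i _]; last by apply: polyfunM => //; apply: polyfun_coord.
have E i : pder u (fun c : 'cV[R]_n => c i 0 * pder (delta_mx i 0) f c) c =
    c i 0 * pder (delta_mx i 0) (pder u f) c + pder (delta_mx i 0) f c * u i 0.
  rewrite (deriveM_poly u c (polyfun_coord i) (pd i)).
  rewrite (deriveC_poly _ _ _ pf).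
  rewrite derive_coord.
  by [].
under eq_bigr do rewrite E.
rewrite big_split /= [X in X + _](_ : _ = pder c (pder u f) c); last first.
  by rewrite [RHS]derive_linear_poly //; apply: polyfun_derive.
rewrite [X in _ + X](_ : _ = pder u f c); last first.
  by rewrite [RHS]derive_linear_poly //; apply: eq_bigr => i _; rewrite mulrC.
by rewrite -natr1 mulrDl mul1r => /addIr.
Qed.

End PolyFun.

(** * Extension of invariants from the section *)

Section Rep.
Variables (R : realType) (N : nat).

(* A representation of the Lie algebra of matrices on [rep_idx -> R], for which
   skew-symmetric matrices act by skew-symmetric operators. *)
Record rep := Rep {
  rep_idx : finType;
  rep_mat : 'M[R]_N -> rep_idx -> rep_idx -> R;
  rep_matD : forall X Y i j, rep_mat (X + Y) i j = rep_mat X i j + rep_mat Y i j;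
  rep_matZ : forall k X i j, rep_mat (k *: X) i j = k * rep_mat X i j;
  rep_skew : forall X, X^T = - X -> forall i j, rep_mat X i j = - rep_mat X j i;
  rep_br : forall X Y i j, rep_mat (X *m Y - Y *m X) i j =
    \sum_k rep_mat X i k * rep_mat Y k j - \sum_k rep_mat Y i k * rep_mat X k j
}.

Definition act (U : rep) (X : 'M[R]_N) (w : rep_idx U -> R) (i : rep_idx U) : R :=
  \sum_j rep_mat X i j * w j.

Lemma actDl (U : rep) X Y w i : @act U (X + Y) w i = act X w i + act Y w i.
Proof.
by rewrite /act -big_split; apply: eq_bigr => j _; rewrite rep_matD mulrDl.
Qed.

Lemma actZl (U : rep) k X w i : @act U (k *: X) w i = k * act X w i.
Proof.
by rewrite /act mulr_sumr; apply: eq_bigr => j _; rewrite rep_matZ mulrA.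
Qed.

Lemma act0l (U : rep) w i : @act U 0 w i = 0.
Proof. by rewrite -(scale0r 0) actZl mul0r. Qed.

Lemma act_suml (U : rep) (I : Type) (r : seq I) (P : pred I) F w i :
  @act U (\sum_(k <- r | P k) F k) w i = \sum_(k <- r | P k) act (F k) w i.
Proof.
by apply: (big_morph (fun X => act X w i)); [move=> X Y; rewrite actDl|rewrite act0l].
Qed.

Lemma eq_act (U : rep) X w w' i : (forall j, w j = w' j) -> @act U X w i = act X w' i.
Proof. by move=> ww; apply: eq_bigr => j _; rewrite ww. Qed.

Lemma actZr (U : rep) X k w i : @act U X (fun j => k * w j) i = k * act X w i.
Proof. by rewrite /act mulr_sumr; apply: eq_bigr => j _; rewrite mulrCA. Qed.

Lemma act_sumr (U : rep) X (I : Type) (r : seq I) (P : pred I) (F : I -> _) i :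
  @act U X (fun j => \sum_(k <- r | P k) F k j) i = \sum_(k <- r | P k) act X (F k) i.
Proof.
rewrite /act exchange_big; apply: eq_bigr => j _; by rewrite mulr_sumr.
Qed.

Lemma act0r (U : rep) X w i : (forall j, w j = 0) -> @act U X w i = 0.
Proof. by move=> w0; apply: big1 => j _; rewrite w0 mulr0. Qed.

Lemma act_br (U : rep) X Y w i :
  @act U (X *m Y - Y *m X) w i = act X (act Y w) i - act Y (act X w) i.
Proof.
have E X' Y' : act X' (act Y' w) i =
    \sum_j (\sum_k rep_mat X' i k * rep_mat Y' k j) * w j.
  rewrite /act; under eq_bigr do rewrite mulr_sumr.
  rewrite exchange_big; apply: eq_bigr => j _; rewrite mulr_suml.
  by apply: eq_bigr => k _; rewrite mulrA.
rewrite !E -sumrB; apply: eq_bigr => j _.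
by rewrite rep_br mulrBl.
Qed.

Lemma act_skew (U : rep) X w w' : X^T = - X ->
  \sum_i @act U X w i * w' i = - \sum_i w i * act X w' i.
Proof.
move=> Xs; under eq_bigr do rewrite mulr_suml.
rewrite exchange_big -sumrN; apply: eq_bigr => j _.
rewrite mulr_sumr -sumrN; apply: eq_bigr => i _.
by rewrite (rep_skew Xs); ring.
Qed.

(** The action [phi |-> X phi - phi X] on linear maps [phi] from [R^N] to the representation; the
    index [(u, i)] stands for coordinate [i] of [phi (e_u)]. *)
Definition hom_mat (U : rep) (X : 'M[R]_N) (p q : 'I_N * rep_idx U) : R :=
  (p.1 == q.1)%:R * rep_mat X p.2 q.2 - X q.1 p.1 * (p.2 == q.2)%:R.

Lemma sum_hom_mat (U : rep) X (w : 'I_N * rep_idx U -> R) p :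
  \sum_q hom_mat X p q * w q =
  act X (fun j => w (p.1, j)) p.2 - \sum_v X v p.1 * w (v, p.2).
Proof.
case: p => u i /=; under eq_bigr do rewrite mulrBl.
rewrite sumrB; congr (_ - _).
  transitivity (\sum_v \sum_j (u == v)%:R * rep_mat X i j * w (v, j)).
    by rewrite pair_bigA; apply: eq_bigr => -[].
  rewrite (bigD1 u) //= [X in _ + X]big1 ?addr0 => [|v /negPf vu].
    by rewrite /act; apply: eq_bigr => j _; rewrite eqxx mul1r.
  by apply: big1 => j _; rewrite eq_sym vu !mul0r.
transitivity (\sum_v \sum_j X v u * (i == j)%:R * w (v, j)).
  by rewrite pair_bigA; apply: eq_bigr => -[].
apply: eq_bigr => v _; rewrite (bigD1 i) //= eqxx mulr1 big1 ?addr0 // => j /negPf ji.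
by rewrite eq_sym ji mulr0 mul0r.
Qed.

Lemma hom_matD U X Y i j : @hom_mat U (X + Y) i j = hom_mat X i j + hom_mat Y i j.
Proof. by rewrite /hom_mat rep_matD mxE; ring. Qed.

Lemma hom_matZ U k X i j : @hom_mat U (k *: X) i j = k * hom_mat X i j.
Proof. by rewrite /hom_mat rep_matZ mxE; ring. Qed.

Lemma hom_skew U X : X^T = - X -> forall i j, @hom_mat U X i j = - hom_mat X j i.
Proof.
move=> Xs [u i] [v j]; rewrite /hom_mat /= (rep_skew Xs) (eq_sym u) (eq_sym i).
have -> : X v u = - X u v by have := congr1 (fun M : 'M[R]_N => M u v) Xs; rewrite !mxE.
ring.
Qed.

Lemma hom_br (U : rep) X Y p q : @hom_mat U (X *m Y - Y *m X) p q =
  \sum_k hom_mat X p k * hom_mat Y k q - \sum_k hom_mat Y p k * hom_mat X k q.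
Proof.
case: p q => u i [v j].
have E X' Y' : \sum_k @hom_mat U X' (u, i) k * hom_mat Y' k (v, j) =
   (u == v)%:R * (\sum_k rep_mat X' i k * rep_mat Y' k j)
   - Y' v u * rep_mat X' i j - X' v u * rep_mat Y' i j + (Y' *m X') v u * (i == j)%:R.
  rewrite (sum_hom_mat X' (fun k => hom_mat Y' k (v, j))) /=.
  rewrite /act /hom_mat /=.
  under eq_bigr do rewrite mulrBr.
  rewrite sumrB; under [X in _ - X = _]eq_bigr do rewrite mulrBr.
  rewrite sumrB opprB.
  have -> : \sum_k rep_mat X' i k * ((u == v)%:R * rep_mat Y' k j) =
      (u == v)%:R * \sum_k rep_mat X' i k * rep_mat Y' k j.
    by rewrite mulr_sumr; apply: eq_bigr => k _; rewrite mulrCA.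
  have -> : \sum_k rep_mat X' i k * (Y' v u * (k == j)%:R) = Y' v u * rep_mat X' i j.
    rewrite (bigD1 j) //= eqxx big1 ?addr0 ?mulr1 1?mulrC // => k /negPf ->.
    by rewrite !mulr0.
  have -> : \sum_k X' k u * ((k == v)%:R * rep_mat Y' i j) = X' v u * rep_mat Y' i j.
    rewrite (bigD1 v) //= eqxx big1 ?addr0 ?mul1r // => k /negPf ->.
    by rewrite mul0r mulr0.
  have -> : \sum_k X' k u * (Y' v k * (i == j)%:R) = (Y' *m X') v u * (i == j)%:R.
    by rewrite mxE mulr_suml; apply: eq_bigr => k _; ring.
  ring.
rewrite !E /hom_mat /= rep_br !mxE; ring.
Qed.

Definition hom_rep (U : rep) : rep :=
  Rep (@hom_matD U) (@hom_matZ U) (@hom_skew U) (@hom_br U).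

Lemma act_hom (U : rep) X (w : rep_idx (hom_rep U) -> R) u i :
  act X w (u, i) = @act U X (fun j => w (u, j)) i - \sum_v X v u * w (v, i).
Proof. exact: sum_hom_mat. Qed.

Definition triv_mat (X : 'M[R]_N) (i j : unit) : R := 0.

Lemma triv_skew X : X^T = - X -> forall i j, triv_mat X i j = - triv_mat X j i.
Proof. by move=> _ i j; rewrite /triv_mat oppr0. Qed.

Lemma triv_br X Y i j : triv_mat (X *m Y - Y *m X) i j =
  \sum_k triv_mat X i k * triv_mat Y k j - \sum_k triv_mat Y i k * triv_mat X k j.
Proof. by rewrite subrr. Qed.

Lemma triv_matD X Y i j : triv_mat (X + Y) i j = triv_mat X i j + triv_mat Y i j.
Proof. by rewrite /triv_mat addr0. Qed.

Lemma triv_matZ k X i j : triv_mat (k *: X) i j = k * triv_mat X i j.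
Proof. by rewrite /triv_mat mulr0. Qed.

Definition triv_rep : rep := Rep triv_matD triv_matZ triv_skew triv_br.

Lemma act_triv X w i : @act triv_rep X w i = 0.
Proof. by apply: big1 => j _; rewrite /= /triv_mat mul0r. Qed.

End Rep.

(** * The derivative of an equivariant extension *)

Section Extension.
Variables (R : realType) (s m : nat).

Definition section_incl (c : 'cV[R]_s) : 'cV[R]_(s + m) := col_mx c 0.

Definition nrm_vec (l : 'I_m) : 'cV[R]_(s + m) := delta_mx (rshift s l) 0.

Lemma incD c c' : section_incl (c + c') = section_incl c + section_incl c'.
Proof. by rewrite /section_incl add_col_mx addr0. Qed.

Lemma incZ k c : section_incl (k *: c) = k *: section_incl c.
Proof. by rewrite /section_incl scale_col_mx scaler0. Qed.

Lemma dot_inc c c' : dot (section_incl c) (section_incl c') = dot c c'.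
Proof. by rewrite dot_col_mx dot0l addr0. Qed.

Lemma inc_delta j : section_incl (delta_mx j 0) = delta_mx (lshift m j) 0.
Proof.
apply/matrixP => i k; rewrite (ord1 k) /section_incl; case: (split_ordP i) => h ->.
  by rewrite col_mxEu !mxE /= (inj_eq (@lshift_inj _ _)).
by rewrite col_mxEd !mxE /= eq_rlshift.
Qed.

Lemma mulmx_delta_entry n p (X : 'M[R]_(n, p)) u v : (X *m delta_mx u 0) v (0 : 'I_1) = X v u.
Proof. by rewrite -colE mxE. Qed.

Definition polymap n (I : Type) (T : 'cV[R]_n -> I -> R) :=
  forall i, polyfun (fun c => T c i).

Variable gl : 'M[R]_(s + m) -> Prop.
Variables (a : 'I_m -> 'cV[R]_s) (Xr : 'I_m -> 'M[R]_(s + m)).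

Hypothesis gl0 : gl 0.
Hypothesis glD : forall X Y, gl X -> gl Y -> gl (X + Y).
Hypothesis glZ : forall k X, gl X -> gl (k *: X).
Hypothesis gl_skew : forall X, gl X -> X^T = - X.
Hypothesis gl_br : forall X Y, gl X -> gl Y -> gl (X *m Y - Y *m X).
Hypothesis gl_root : forall X, gl X ->
  exists x : 'I_m -> R, forall c, X *m section_incl c = \sum_l (x l * dot (a l) c) *: nrm_vec l.
Hypothesis Xr_gl : forall l, gl (Xr l).
Hypothesis XrE : forall l c, Xr l *m section_incl c = dot (a l) c *: nrm_vec l.
Hypothesis a_neq0 : forall l, a l != 0.
(** A root of multiplicity greater than one appears as equal values [a k = a l] at different
    indices; the scale of the roots is normalised so that roots with the same wall are equal. *)
Hypothesis a_prop : forall k l x, a k = x *: a l -> a k = a l.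

Lemma glB X Y : gl X -> gl Y -> gl (X - Y).
Proof. by move=> gX gY; rewrite -scaleN1r; apply/glD/glZ. Qed.

Lemma gl_decomp X : gl X -> exists x : 'I_m -> R,
  (forall c, X *m section_incl c = \sum_l (x l * dot (a l) c) *: nrm_vec l) /\
  exists Z, [/\ gl Z, forall c, Z *m section_incl c = 0 & X = Z + \sum_l x l *: Xr l].
Proof.
move=> gX; have [x xE] := gl_root gX; exists x; split=> //.
exists (X - \sum_l x l *: Xr l); split; last by rewrite subrK.
  by apply: glB => //; elim/big_ind: _ => // l _; apply: glZ.
move=> c; rewrite mulmxBl xE mulmx_suml; apply/eqP; rewrite subr_eq0; apply/eqP.
by apply: eq_bigr => l _; rewrite -scalemxAl XrE scalerA.
Qed.

Lemma Xr_lshift k v j : Xr k v (lshift m j) = a k j 0 * (v == rshift s k)%:R.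
Proof.
by rewrite -mulmx_delta_entry -inc_delta XrE dot_delta !mxE eqxx andbT.
Qed.

Lemma Xr_skew k u v : Xr k u v = - Xr k v u.
Proof.
have := congr1 (fun M : 'M[R]_(s + m) => M v u) (gl_skew (Xr_gl k)).
by rewrite !mxE.
Qed.

Lemma a_nprop k l : a k != a l -> exists2 c, dot (a k) c = 0 & dot (a l) c != 0.
Proof.
move=> akl; exists (projh (a k) (a l)); first by rewrite dot_projh.
apply/eqP => H; set w := projh (a k) (a l).
have w0 : w = 0.
  apply/eqP; rewrite -dot_eq0 {1}/w /projh dotBl H dotZl dot_projh // mulr0 subrr //.
have : a l = (dot (a k) (a l) / dot (a k) (a k)) *: a k.
  by apply/eqP; rewrite -subr_eq0; apply/eqP; exact: w0.
by move/a_prop => /esym/eqP; rewrite (negPf akl).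
Qed.

Lemma dot_nonzero_ex l : exists c, dot (a l) c != 0.
Proof. by exists (a l); rewrite dot_eq0. Qed.

Section Field.
Variable U : rep R (s + m).
Implicit Types (T : 'cV[R]_s -> rep_idx U -> R).
Implicit Types (B : 'cV[R]_s -> rep_idx (hom_rep U) -> R).

Lemma polyfun_act X T i : polymap T -> polyfun (fun c => act X (T c) i).
Proof. by move=> pT; apply: polyfun_sum => j _; apply: polyfunZ. Qed.

Lemma derive_act X T u c i : polymap T ->
  pder u (fun c => act X (T c) i) c = act X (fun j => pder u (fun c => T c j) c) i.
Proof.
move=> pT; rewrite derive_sum_poly => [|j _]; last exact: polyfunZ.
by apply: eq_bigr => j _; rewrite deriveZ_poly.
Qed.

(* [B c] is the derivative at [section_incl c] of an equivariant map extending [T]. *)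
Definition isD T B := [/\ polymap B,
  forall c j i, B c (lshift m j, i) = pder (delta_mx j 0) (fun c => T c i) c &
  forall c l i, dot (a l) c * B c (rshift s l, i) = act (Xr l) (T c) i].

(** Conditions that any equivariant extension imposes on its restriction: what kills the point [c]
    must kill the value [T c]. This concerns the centraliser of the section and, on the wall of
    [a l], the element [Xr l]. *)
Definition base T := [/\ polymap T,
  forall Z, gl Z -> (forall c, Z *m section_incl c = 0) -> forall c i, act Z (T c) i = 0 &
  forall l c, dot (a l) c = 0 -> forall i, act (Xr l) (T c) i = 0].

Lemma base_D T : base T -> exists B, isD T B.
Proof.
move=> [pT _ vT].
have /choice[g gP] : forall p : 'I_m * rep_idx U, exists g, polyfun g /\
    forall c, act (Xr p.1) (T c) p.2 = dot (a p.1) c * g c.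
  move=> [l i] /=; have [g pg gE] := polyfun_div (a_neq0 l) (polyfun_act (Xr l) i pT)
    (fun c ac => vT l c ac i).
  by exists g.
exists (fun c p => match fintype.split p.1 with
  | inl j => pder (delta_mx j 0) (fun c => T c p.2) c | inr l => g (l, p.2) c end).
split=> [[u i] /=|c j i|c l i].
- case: (fintype.split u) => [j|l]; first exact/polyfun_derive.
  by have [] := gP (l, i).
- by rewrite /= -[lshift m j]/(fintype.unsplit (inl j)) fintype.unsplitK.
- rewrite /= -[rshift s l]/(fintype.unsplit (inr l)) fintype.unsplitK.
  by have [_ ->] := gP (l, i).
Qed.

(** Infinitesimal equivariance of the extension to be built, read on the section: the derivative in
    the direction [X c] is [X] applied to the value. The defining property of [B] gives it for the
    [Xr l], and [base] for the rest. *)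
Lemma act_gl T B X c i : base T -> isD T B -> gl X ->
  act X (T c) i = \sum_v (X *m section_incl c) v 0 * B c (v, i).
Proof.
move=> [_ zT _] [_ _ DT] gX; have [x [xE [Z [gZ Z0 XE]]]] := gl_decomp gX.
rewrite [in LHS]XE actDl zT // add0r act_suml xE.
under [RHS]eq_bigr do rewrite summxE mulr_suml.
rewrite [RHS]exchange_big; apply: eq_bigr => l _; rewrite actZl -DT.
rewrite (bigD1 (rshift s l)) //= !mxE !eqxx mulr1 [X in _ = _ + X]big1; first by ring.
by move=> v /negPf vl; rewrite !mxE vl mulr0 mul0r.
Qed.

(** Both sides are the second derivative in the directions [e_j] and [X_k c]; one differentiates
    along [e_j] the equation that defines [B] in the direction [e_k]. *)
Lemma isD_sym_tan T B k j c i : base T -> isD T B ->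
  dot (a k) c * pder (delta_mx j 0) (fun c => B c (rshift s k, i)) c =
  act (Xr k) (B c) (lshift m j, i).
Proof.
move=> [pT _ _] [pB tB nB]; rewrite act_hom.
rewrite (bigD1 (rshift s k)) //= [X in _ - (_ + X)]big1 ?addr0; last first.
  by move=> v /negPf vk; rewrite Xr_lshift vk mulr0 mul0r.
rewrite Xr_lshift eqxx mulr1.
have -> : act (Xr k) (fun j0 => B c (lshift m j, j0)) i =
    pder (delta_mx j 0) (fun c => act (Xr k) (T c) i) c.
  by rewrite derive_act //; apply: eq_act => i'; rewrite tB.
have -> : (fun c => act (Xr k) (T c) i) = (fun c => dot (a k) c * B c (rshift s k, i)).
  by apply/funext => c'; rewrite nB.
rewrite deriveM_poly //; last exact: polyfun_dot.
by rewrite derive_dot dot_delta; ring.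
Qed.

(** Symmetry of the second derivative in two normal directions. The two sides differ by [[X_l, X_k]
    T(c)] minus the derivative in the direction [[X_l, X_k] c], which is zero by [act_gl]. *)
Lemma isD_sym_nrm T B k l c i : base T -> isD T B ->
  dot (a k) c * act (Xr l) (B c) (rshift s k, i) =
  dot (a l) c * act (Xr k) (B c) (rshift s l, i).
Proof.
move=> bT dB; have [_ _ nB] := dB.
have E k' l' : dot (a k') c * act (Xr l') (B c) (rshift s k', i) =
   act (Xr l') (act (Xr k') (T c)) i
   - \sum_v (Xr l' *m Xr k' *m section_incl c) v 0 * B c (v, i).
  rewrite act_hom mulrBr -actZr; congr (_ - _).
    by apply: eq_act => j; rewrite nB.
  rewrite mulr_sumr; apply: eq_bigr => v _.
  by rewrite -mulmxA XrE -scalemxAr mxE mulmx_delta_entry mulrA.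
rewrite !E; have := act_br (Xr l) (Xr k) (T c) i.
rewrite (act_gl c i bT dB); last exact: gl_br.
have -> : \sum_v ((Xr l *m Xr k - Xr k *m Xr l) *m section_incl c) v 0 * B c (v, i) =
    \sum_v (Xr l *m Xr k *m section_incl c) v 0 * B c (v, i)
    - \sum_v (Xr k *m Xr l *m section_incl c) v 0 * B c (v, i).
  by rewrite -sumrB; apply: eq_bigr => v _; rewrite mulmxBl !mxE mulrBl.
by move=> ?; lra.
Qed.

End Field.

(** The product of all the roots is a nonzero polynomial, and it annihilates [f - g]. *)
Lemma eq_polyfun_regular (f g : 'cV[R]_s -> R) : polyfun f -> polyfun g ->
  (forall c, (forall l, dot (a l) c != 0) -> f c = g c) -> forall c, f c = g c.
Proof.
move=> pf pg fg c; apply/eqP; rewrite -subr_eq0; apply/eqP.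
move: c; apply: (polyfun_mul_eq0 (polyfunB pf pg)
  (polyfun_prod (index_enum 'I_m) (P := xpredT) (fun l _ => polyfun_dot (a l)))).
  move=> c; case: (boolP [forall l, dot (a l) c != 0]) => [/forallP/fg ->|].
    by rewrite subrr mul0r.
  rewrite negb_forall => /existsP[l]; rewrite negbK => /eqP al.
  by rewrite (bigD1 l) //= al mul0r mulr0.
apply: polyfun_prod_neq0 => [l _|l _]; first exact: polyfun_dot.
exact: dot_nonzero_ex.
Qed.

Lemma eq_polyfun_dot l (f g : 'cV[R]_s -> R) : polyfun f -> polyfun g ->
  (forall c, dot (a l) c * f c = dot (a l) c * g c) -> forall c, f c = g c.
Proof.
move=> pf pg fg; apply: eq_polyfun_regular => // c /(_ l) al.
exact: (mulfI al).
Qed.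

(** * The obstruction on a wall *)

Section Key.
Variables (U : rep R (s + m)) (alpha : 'cV[R]_s) (B : rep_idx (hom_rep U) -> R).
Let E := [pred l | a l == alpha].
(** [B] is meant to be the derivative at one point of the wall of [alpha], and [E] selects the roots
    equal to [alpha]. The hypotheses are what the symmetries of the second derivative and the
    polynomial Laplacian give at such a point. *)
Hypothesis BZ : forall Z, gl Z -> (forall c, Z *m section_incl c = 0) ->
  forall p, act Z B p = 0.
Hypothesis Btan : forall k, E k -> forall j i, act (Xr k) B (lshift m j, i) = 0.
Hypothesis Bnrm : forall k l, E k -> ~~ E l -> forall i, act (Xr k) B (rshift s l, i) = 0.
Hypothesis Bsym : forall k l, E k -> E l -> forall i,
  act (Xr k) B (rshift s l, i) = act (Xr l) B (rshift s k, i).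
Hypothesis Btr : forall i, \sum_(k | E k) act (Xr k) B (rshift s k, i) = 0.

Let S k l i := act (Xr k) B (rshift s l, i).

(** Apply [[X_k, X_l]] to a point [z] of the wall of [alpha] that is off the wall of [a l]. Since
    [X_k z = 0], the result is [dot (a l) z] times [X_k e_l], and by [gl_root] it has no component
    along [e_l'], whose root vanishes at [z]. *)
Lemma Xr_off k l l' : E k -> E l' -> ~~ E l -> Xr k (rshift s l) (rshift s l') = 0.
Proof.
move=> /eqP Ek /eqP El' El; rewrite Xr_skew; apply/eqP; rewrite oppr_eq0; apply/eqP.
have [|z zk zl] := @a_nprop k l; first by rewrite Ek eq_sym.
have [x xE] := gl_root (gl_br (Xr_gl k) (Xr_gl l)).
have := congr1 (fun M : 'cV[R]_(s + m) => M (rshift s l') 0) (xE z).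
rewrite mulmxBl -!mulmxA !XrE zk scale0r mulmx0 subr0 -scalemxAr mxE.
rewrite mulmx_delta_entry summxE big1 => [/eqP|i _].
  by rewrite mulf_eq0 (negPf zl) => /eqP.
rewrite !mxE (inj_eq (@rshift_inj _ _)); case: eqP => [<-|]; last by rewrite mulr0.
by rewrite El' -Ek zk mulr0 mul0r.
Qed.

(** The bracket kills the points of the wall, so only roots equal to [alpha] occur in its
    decomposition; their coefficients are read off at the point [alpha] itself. *)
Lemma Xr_br_comp k e' : E k -> E e' -> forall p,
  act (Xr k *m Xr e' - Xr e' *m Xr k) B p =
  \sum_(l | E l) (Xr k (rshift s l) (rshift s e') - Xr e' (rshift s l) (rshift s k))
     * act (Xr l) B p.
Proof.
move=> Ek Ee' p; have [x [xE [Z [gZ Z0 ->]]]] := gl_decomp (gl_br (Xr_gl k) (Xr_gl e')).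
rewrite actDl BZ // add0r act_suml (bigID E) /= [X in _ + X]big1 ?addr0.
  apply: eq_bigr => l /eqP El; rewrite actZl; congr (_ * _).
  have := congr1 (fun M : 'cV[R]_(s + m) => M (rshift s l) 0) (xE alpha).
  rewrite mulmxBl -!mulmxA !XrE (eqP Ek) (eqP Ee') -!scalemxAr -scalerBr.
  rewrite mxE [X in _ * X]mxE [X in _ * (_ + X)]mxE !mulmx_delta_entry.
  rewrite summxE (bigD1 l) //= !mxE !eqxx mulr1 El [X in _ = _ + X]big1 ?addr0.
    rewrite mulrC => H; apply/esym/(mulIf _ H).
    by rewrite dot_eq0 -El a_neq0.
  move=> i il; rewrite !mxE (inj_eq (@rshift_inj _ _)) eq_sym (negPf il) mulr0 //.
move=> l El; rewrite actZl; suff -> : x l = 0 by rewrite mul0r.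
have [|z zk zl] := @a_nprop k l; first by rewrite (eqP Ek) eq_sym.
have := congr1 (fun M : 'cV[R]_(s + m) => M (rshift s l) 0) (xE z).
rewrite mulmxBl -!mulmxA !XrE (eqP Ee') -(eqP Ek) zk !scale0r !mulmx0 subr0 mxE.
rewrite summxE (bigD1 l) //= !mxE !eqxx mulr1 [X in _ = _ + X]big1 ?addr0.
  by move/esym/eqP; rewrite mulf_eq0 (negPf zl) orbF => /eqP.
by move=> i il; rewrite !mxE (inj_eq (@rshift_inj _ _)) eq_sym (negPf il) mulr0.
Qed.

Lemma sum_skew_sym k i : E k ->
  \sum_(k' | E k') \sum_(l | E l) Xr k (rshift s l) (rshift s k') * S k' l i = 0.
Proof.
move=> Ek; set t := LHS; suff : t = - t by lra.
rewrite {1}/t exchange_big -sumrN; apply: eq_bigr => l El; rewrite -sumrN.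
by apply: eq_bigr => k' Ek'; rewrite Xr_skew mulNr /S Bsym.
Qed.

Let w e' := \sum_(k | E k) Xr k (rshift s e') (rshift s k).

(** A second-order sum of Casimir type reduces to first order on [B]. In the component of [e_l0],
    symmetry replaces [X_k B (e_l0)] by [X_l0 B (e_k)]; after [X_k] and [X_l0] are exchanged, the
    main term is [X_l0] applied to the trace, which vanishes. What remains are brackets and entries
    of the [X_k], where skew terms cancel against symmetric ones. *)
Lemma sum_XrXr u i : \sum_(k | E k) act (Xr k) (act (Xr k) B) (u, i) =
  \sum_(e' | E e') w e' * act (Xr e') B (u, i).
Proof.
have reduce k k' u' : E k' -> \sum_v Xr k v u' * act (Xr k') B (v, i) =
    \sum_(l | E l) Xr k (rshift s l) u' * S k' l i.
  move=> Ek; rewrite big_split_ord /= big1 ?add0r => [|j _]; last by rewrite Btan ?mulr0.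
  rewrite (bigID E) /= [X in _ + X]big1 ?addr0 // => l El.
  by rewrite Bnrm ?mulr0.
under eq_bigr => k Ek do rewrite act_hom reduce //.
case: (split_ordP u) => [j ->|l0 ->] /=.
  rewrite [RHS]big1 => [|e' Ee']; last by rewrite Btan ?mulr0.
  rewrite sumrB big1 ?sub0r => [|k Ek]; last by rewrite act0r // => i'; rewrite Btan.
  apply/eqP; rewrite oppr_eq0; apply/eqP.
  transitivity (alpha j 0 * \sum_(k | E k) S k k i); last by rewrite Btr mulr0.
  rewrite mulr_sumr; apply: eq_bigr => k Ek; rewrite (bigD1 k) //= [X in _ + X]big1.
    by rewrite addr0 Xr_lshift eqxx mulr1 (eqP Ek).
  by move=> l /andP[_ lk]; rewrite Xr_lshift (inj_eq (@rshift_inj _ _)) (negPf lk) mulr0 mul0r.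
have [El0|El0] := boolP (E l0); last first.
  rewrite [RHS]big1 => [|e' Ee']; last by rewrite Bnrm ?mulr0.
  apply: big1 => k Ek; rewrite act0r ?sub0r => [|i']; last by rewrite Bnrm.
  rewrite big1 ?oppr0 // => l El.
  by rewrite Xr_skew Xr_off // oppr0 mul0r.
under eq_bigr => k Ek.
  have -> : act (Xr k) (fun j => act (Xr k) B (rshift s l0, j)) i =
      act (Xr k) (fun j => act (Xr l0) B (rshift s k, j)) i.
    by apply: eq_act => j; rewrite Bsym.
  have -> : act (Xr k) (fun i' => act (Xr l0) B (rshift s k, i')) i =
      act (Xr k) (act (Xr l0) B) (rshift s k, i)
      + \sum_(l | E l) Xr k (rshift s l) (rshift s k) * S l0 l i.
    by rewrite act_hom reduce // subrK.
  have -> : act (Xr k) (act (Xr l0) B) (rshift s k, i) =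
      act (Xr l0) (act (Xr k) B) (rshift s k, i)
      + act (Xr k *m Xr l0 - Xr l0 *m Xr k) B (rshift s k, i).
    by rewrite act_br addrC subrK.
  rewrite act_hom reduce // Xr_br_comp //.
  over.
rewrite !(sumrB, big_split) /=.
have -> : \sum_(k | E k) act (Xr l0) (fun i' => act (Xr k) B (rshift s k, i')) i = 0.
  by rewrite -act_sumr act0r // => i'; rewrite Btr.
rewrite sum_skew_sym // subr0 add0r.
have -> : \sum_(k | E k) \sum_(l | E l) (Xr k (rshift s l) (rshift s l0)
      - Xr l0 (rshift s l) (rshift s k)) * act (Xr l) B (rshift s k, i) =
    \sum_(k | E k) \sum_(l | E l) Xr k (rshift s l) (rshift s l0) * S k l i.
  rewrite -[RHS]subr0 -[X in _ = _ - X](sum_skew_sym i El0) -sumrB.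
  apply: eq_bigr => k Ek.
  rewrite -sumrB; apply: eq_bigr => l El; rewrite /S.
  by rewrite (Bsym El Ek) mulrBl.
rewrite addrAC subrr add0r exchange_big; apply: eq_bigr => l El.
by rewrite /w mulr_suml; apply: eq_bigr => k Ek; rewrite /S Bsym.
Qed.

(** Pair the preceding identity with [B]. Skewness makes every [<X B, B>] zero on the right, and
    turns the left side into minus the sum of the [|X_k B|^2]. *)
Lemma key_vanish k p : E k -> act (Xr k) B p = 0.
Proof.
move=> Ek.
have H : \sum_p (\sum_(k | E k) act (Xr k) (act (Xr k) B) p) * B p = 0.
  have XX q : \sum_(k | E k) act (Xr k) (act (Xr k) B) q =
      \sum_(e' | E e') w e' * act (Xr e') B q by case: q => u i; exact: sum_XrXr.
  under eq_bigr do rewrite XX mulr_suml.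
  rewrite exchange_big big1 // => e' Ee'.
  under eq_bigr do rewrite -mulrA; rewrite -mulr_sumr.
  suff -> : \sum_i act (Xr e') B i * B i = 0 by rewrite mulr0.
  have := act_skew B B (gl_skew (Xr_gl e')).
  under [X in _ = - X -> _]eq_bigr do rewrite mulrC.
  by move=> ?; lra.
have {H} : \sum_(k | E k) \sum_p act (Xr k) B p ^+ 2 = 0.
  rewrite -[RHS]oppr0 -[in RHS]H; under [in RHS]eq_bigr do rewrite mulr_suml.
  rewrite [in RHS]exchange_big -sumrN; apply: eq_bigr => l El.
  rewrite [X in _ = - X]act_skew; last exact: gl_skew (Xr_gl l).
  by rewrite opprK; apply: eq_bigr => q _; rewrite expr2.
move/eqP; rewrite psumr_eq0; last by move=> l _; apply: sumr_ge0 => q _; exact: sqr_ge0.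
move=> /allP/(_ k); rewrite mem_index_enum => /(_ isT)/implyP/(_ Ek).
rewrite psumr_eq0; last by move=> q _; exact: sqr_ge0.
by move=> /allP/(_ p); rewrite mem_index_enum => /(_ isT)/=; rewrite sqrf_eq0 => /eqP.
Qed.

End Key.


(** * The radial Laplacian *)

Section Laplacian.
Variable U : rep R (s + m).
Implicit Types (T Q : 'cV[R]_s -> rep_idx U -> R).
Implicit Types (B : 'cV[R]_s -> rep_idx (hom_rep U) -> R).

(* [Q] is the restriction to the section of the Laplacian of the equivariant
   map extending [T]. *)
Definition isL T B Q := polymap Q /\
  forall c, (forall l, dot (a l) c != 0) -> forall i,
    Q c i = \sum_j pder (delta_mx j 0) (fun c => B c (lshift m j, i)) c
      + \sum_l act (Xr l) (B c) (rshift s l, i) / dot (a l) c.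

Lemma vanish_on_hyperplane l (f g : 'cV[R]_s -> R) : polyfun f -> polyfun g ->
  (forall c, dot (a l) c = 0 -> f c * g c = 0) ->
  (exists2 c, dot (a l) c = 0 & g c != 0) -> forall c, dot (a l) c = 0 -> f c = 0.
Proof.
move=> pf pg fg [c0 lc0 gc0] c lc; rewrite -(projh_id lc).
move: c {lc}; apply: (@polyfun_mul_eq0 _ _ (fun c => f (projh (a l) c))
  (fun c => g (projh (a l) c))); try exact: polyfun_projh.
- by move=> c; apply: fg; apply: dot_projh.
- by exists c0; rewrite projh_id.
Qed.

Lemma base_homZ T B Z c p : base T -> isD T B -> gl Z ->
  (forall c, Z *m section_incl c = 0) -> act Z (B c) p = 0.
Proof.
move=> bT dB gZ Z0; have [pT zT _] := bT; have [pB tB nB] := dB.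
case: p => u i; case: (split_ordP u) => [j ->|l ->].
  rewrite act_hom big1 ?subr0 => [|v _].
    have -> : act Z (fun j0 => B c (lshift m j, j0)) i =
        pder (delta_mx j 0) (fun c => act Z (T c) i) c.
      by rewrite derive_act //; apply: eq_act => i'; rewrite tB.
    rewrite (_ : (fun c => _) = cst 0) ?pder_cst //.
    by apply/funext => c'; rewrite zT.
  by rewrite -mulmx_delta_entry -inc_delta Z0 mxE mul0r.
move: c; apply: (@eq_polyfun_dot l _ (fun=> 0)) => [||c].
- exact: polyfun_act.
- exact: polyfun_cst.
rewrite mulr0 act_hom mulrBr -actZr mulr_sumr.
rewrite (eq_act _ (w' := act (Xr l) (T c))); last by move=> j; rewrite nB.
have := act_br Z (Xr l) (T c) i.
rewrite [act (Xr l) _ i]act0r => [|j]; last by rewrite zT.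
rewrite (act_gl c i bT dB); last exact: gl_br.
rewrite subr0 => <-; rewrite -sumrB big1 // => v _.
rewrite mulmxBl -!mulmxA Z0 mulmx0 subr0 XrE -scalemxAr mxE mulmx_delta_entry.
by rewrite mulrA subrr.
Qed.

(** The sum is the residue of the Laplacian along the wall of [a l0], and a polynomial has no pole
    there. The other denominators are cleared by [A], which is not identically zero on the wall. *)
Lemma isL_trace T B Q l0 c i : base T -> isD T B -> isL T B Q -> dot (a l0) c = 0 ->
  \sum_(k | a k == a l0) act (Xr k) (B c) (rshift s k, i) = 0.
Proof.
move=> bT dB [pQ QE]; have [pB _ _] := dB; move: c.
pose A c := \prod_(l | a l != a l0) dot (a l) c.
have pA : polyfun A by apply: polyfun_prod => l _; apply: polyfun_dot.
pose tau c := \sum_(k | a k == a l0) act (Xr k) (B c) (rshift s k, i).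
have pact k p : polyfun (fun c => act (Xr k) (B c) p) by apply: polyfun_act.
have ptau : polyfun tau by apply: polyfun_sum => k _; apply: pact.
apply: (vanish_on_hyperplane (l := l0) ptau pA) => [c lc|]; last first.
  have [||c Ac] := @polyfun_prod_neq0 _ s 'I_m (fun l => a l != a l0)
      (fun l c => dot (a l) (projh (a l0) c)).
    by move=> l _; apply: polyfun_projh; apply: polyfun_dot.
    move=> l /negbTE ll0; have [|c c0 cl] := @a_nprop l0 l.
      by rewrite eq_sym ll0.
    by exists c; rewrite projh_id.
  by exists (projh (a l0) c) => //; rewrite dot_projh.
pose rest c := \sum_(l | a l != a l0) act (Xr l) (B c) (rshift s l, i)
    * \prod_(l' | (a l' != a l0) && (l' != l)) dot (a l') c.
pose lap c := \sum_j pder (delta_mx j 0) (fun c => B c (lshift m j, i)) c.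
have plap : polyfun lap by apply: polyfun_sum => j _; apply/polyfun_derive.
have prest : polyfun rest.
  apply: polyfun_sum => k _; apply: polyfunM; first exact: pact.
  by apply: polyfun_prod => l _; apply: polyfun_dot.
suff : forall c, dot (a l0) c * (Q c i - lap c) * A c = tau c * A c + dot (a l0) c * rest c.
  by move/(_ c); rewrite lc !mul0r addr0.
have pd := polyfun_dot (a l0).
apply: eq_polyfun_regular.
- by apply: polyfunM => //; apply: polyfunM => //; apply: polyfunB.
- by apply: polyfunD; apply: polyfunM.
move=> {lc} c rc; rewrite QE // addrC addKr.
rewrite (bigID (fun l => a l == a l0)) /= mulrDr mulrDl; congr (_ + _).
  congr (_ * _); rewrite mulr_sumr; apply: eq_bigr => k /eqP kl.
  by rewrite kl mulrC divfK.
rewrite -mulrA; congr (_ * _); rewrite mulr_suml; apply: eq_bigr => l ll.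
rewrite /A (bigD1 l) //= mulrA divfK //.
Qed.

Lemma base_hom T B Q : base T -> isD T B -> isL T B Q -> @base (hom_rep U) B.
Proof.
move=> bT dB lQ; have [pB _ _] := dB.
have pact k p : polyfun (fun c => act (Xr k) (B c) p) by apply: polyfun_act.
split=> // [Z gZ Z0 c p|l c lc p]; first exact: (base_homZ c p bT dB gZ Z0).
apply: (@key_vanish U (a l) (B c)) => [Z gZ Z0 q|k /eqP kl j i|k l' /eqP kl l'l i
  |k l' /eqP kl /eqP l'l i|i|]; last exact: eqxx.
- exact: (base_homZ c q bT dB gZ Z0).
- by rewrite -(isD_sym_tan k j c i bT dB) kl lc mul0r.
- apply: (vanish_on_hyperplane (l := l) (pact k _) (polyfun_dot (a l'))) lc.
    move=> c' lc'; rewrite mulrC (isD_sym_nrm l' k c' i bT dB) kl lc' mul0r //.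
  by apply: a_nprop; rewrite eq_sym.
- move: c {lc}; apply: (eq_polyfun_dot (l := l)) => // c.
  by have := isD_sym_nrm l' k c i bT dB; rewrite kl l'l.
- exact: isL_trace lQ lc.
Qed.

Lemma act_hom2_sym X (W : rep_idx (hom_rep (hom_rep U)) -> R) :
  (forall u v i, W (u, (v, i)) = W (v, (u, i))) ->
  forall u v i, act X W (u, (v, i)) = act X W (v, (u, i)).
Proof.
move=> Ws u v i; rewrite !act_hom.
rewrite (eq_act _ (w' := fun j => W (v, (u, j)))); last by move=> j; rewrite Ws.
rewrite -!addrA; congr (_ + _); rewrite addrC; congr (- _ - _).
  by apply: eq_bigr => w _; rewrite Ws.
by apply: eq_bigr => w _; rewrite Ws.
Qed.

Lemma act_hom2_tr X (W : rep_idx (hom_rep (hom_rep U)) -> R) i : X^T = - X ->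
  \sum_u act X W (u, (u, i)) = act X (fun j => \sum_u W (u, (u, j))) i.
Proof.
move=> Xs; rewrite act_sumr; under eq_bigr do rewrite !act_hom -addrA.
rewrite big_split /= -[RHS]addr0; congr (_ + _).
under eq_bigr do rewrite -opprD; rewrite sumrN; apply/eqP; rewrite oppr_eq0; apply/eqP.
rewrite big_split /= [X in _ + X]exchange_big -big_split big1 // => u _.
rewrite -big_split big1 // => w _ /=.
have -> : X u w = - X w u by have := congr1 (fun M : 'M[R]_(s + m) => M w u) Xs; rewrite !mxE.
by rewrite mulNr subrr.
Qed.

End Laplacian.

Section LaplacianHom.
Variable U : rep R (s + m).
Variables (T Q : 'cV[R]_s -> rep_idx U -> R).
Variables (B DQ : 'cV[R]_s -> rep_idx (hom_rep U) -> R).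
Variable B2 : 'cV[R]_s -> rep_idx (hom_rep (hom_rep U)) -> R.
Hypotheses (bT : base T) (dB : isD T B) (bB : @base (hom_rep U) B).
Hypotheses (dB2 : @isD (hom_rep U) B B2) (lQ : isL T B Q) (dQ : isD Q DQ).

Lemma hessian_sym c u v i : B2 c (u, (v, i)) = B2 c (v, (u, i)).
Proof.
have [pT _ _] := bT; have [pB tB nB] := dB; have [pB2 tB2 nB2] := dB2.
have mixed l j c' : B2 c' (lshift m j, (rshift s l, i)) = B2 c' (rshift s l, (lshift m j, i)).
  move: c'; apply: (eq_polyfun_dot (l := l)) => // c'.
  by rewrite nB2 tB2 (isD_sym_tan l j c' i bT dB).
case: (split_ordP u) => [j ->|l ->]; case: (split_ordP v) => [j' ->|l' ->] //.
  rewrite !tB2.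
  have E j0 : (fun c => B c (lshift m j0, i)) = pder (delta_mx j0 0) (fun c => T c i).
    by apply/funext => c'; rewrite tB.
  by rewrite !E deriveC_poly.
move: c; apply: (eq_polyfun_dot (l := l)) => // c; move: c.
apply: (eq_polyfun_dot (l := l')) => [||c].
- by apply: polyfunM => //; apply: polyfun_dot.
- by apply: polyfunM => //; apply: polyfun_dot.
rewrite nB2 (isD_sym_nrm l' l c i bT dB) mulrCA; congr (_ * _).
by rewrite nB2.
Qed.

Lemma isL_hessian c i : Q c i = \sum_u B2 c (u, (u, i)).
Proof.
have [pB2 tB2 nB2] := dB2; have [pQ QE] := lQ; move: c.
apply: eq_polyfun_regular => [||c rc] //; first exact: polyfun_sum.
rewrite QE // big_split_ord /=; congr (_ + _); apply: eq_bigr => j _.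
  by rewrite tB2.
by rewrite -nB2 mulrAC divff ?mul1r.
Qed.

(** The Laplacian commutes with differentiation: [Q] is the trace of the second derivative, and the
    symmetry of the latter lets the additional derivative pass under the trace. *)
Lemma isL_hom : @isL (hom_rep U) B B2 DQ.
Proof.
have [pB tB nB] := dB; have [pB2 tB2 nB2] := dB2; have [pDQ tDQ nDQ] := dQ.
have [_ pQE] := lQ.
have QE i : (fun c => Q c i) = (fun c => \sum_u B2 c (u, (u, i))).
  by apply/funext => c; rewrite isL_hessian.
have sB2 X c := act_hom2_sym X (W := B2 c) (hessian_sym c).
split=> // c rc [u i]; case: (split_ordP u) => [j ->|l0 ->].
  rewrite tDQ QE derive_sum_poly // big_split_ord /=; congr (_ + _); apply: eq_bigr => l _.
    have -> : (fun c => B2 c (lshift m l, (lshift m l, i))) =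
        pder (delta_mx l 0) (fun c => B c (lshift m l, i)).
      by apply/funext => c'; rewrite tB2.
    rewrite deriveC_poly //; congr (pder _ _ c); apply/funext => c'.
    by rewrite -tB2 hessian_sym.
  rewrite sB2 -(@isD_sym_tan (hom_rep U) B B2 l j c (rshift s l, i) bB dB2).
  by rewrite mulrAC divff ?mul1r.
apply: (mulfI (rc l0)); rewrite nDQ.
have -> : act (Xr l0) (Q c) i = \sum_u act (Xr l0) (B2 c) (u, (u, i)).
  rewrite act_hom2_tr; last exact: gl_skew (Xr_gl l0).
  by apply: eq_act => j; rewrite isL_hessian.
rewrite big_split_ord mulrDr !mulr_sumr /=; congr (_ + _); apply: eq_bigr => l _.
  rewrite -(@isD_sym_tan (hom_rep U) B B2 l0 l c (lshift m l, i) bB dB2).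
  have -> : (fun c => B2 c (lshift m l, (rshift s l0, i))) =
      (fun c => B2 c (rshift s l0, (lshift m l, i))).
    by apply/funext => c'; rewrite hessian_sym.
  by [].
rewrite [in RHS]sB2 mulrA.
rewrite (@isD_sym_nrm (hom_rep U) B B2 l0 l c (rshift s l, i) bB dB2).
by rewrite mulrAC divff ?mul1r.
Qed.

End LaplacianHom.

(** The first [d] iterated radial Laplacians of [T] are polynomials satisfying [base]. Taking a
    derivative costs one level, so that an extension in degree [k] consumes [k] of them. *)
Fixpoint adm (d : nat) (U : rep R (s + m)) (T : 'cV[R]_s -> rep_idx U -> R) : Prop :=
  base T /\ if d is d'.+1 then
    exists B Q, [/\ isD T B, isL T B Q & adm d' Q] else True.

Lemma adm_base d U T : @adm d U T -> base T.
Proof. by case: d => [|d] []. Qed.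

Lemma adm_D d U T : @adm d.+1 U T -> exists B, isD T B /\ @adm d (hom_rep U) B.
Proof.
elim: d => [|d IH] in U T *; move=> [bT [B [Q [dB lQ aQ]]]].
  by exists B; split=> //; split=> //; apply: base_hom dB lQ.
exists B; split=> //.
have bB := base_hom bT dB lQ.
have [DQ [dDQ aDQ]] := IH _ _ aQ.
have [B2 dB2] := base_D bB.
split=> //; exists B2, DQ; split=> //.
exact: (isL_hom bT dB bB dB2 lQ dDQ).
Qed.


Lemma adm_extends k (U : rep R (s + m)) (T : 'cV[R]_s -> rep_idx U -> R) :
  adm k T -> (forall c i, pder c (fun c => T c i) c = k%:R * T c i) ->
  exists P : 'cV[R]_(s + m) -> rep_idx U -> R,
    [/\ polymap P, forall c i, P (section_incl c) i = T c i &
        forall X, gl X -> forall v i, pder (X *m v) (fun v => P v i) v = act X (P v) i].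
Proof.
elim: k => [|k IH] in U T *.
  move=> [[pT zT vT] _] ET.
  have TE c i : T c i = T 0 i.
    by apply: (@euler0_const _ _ (fun c => T c i)) => // c'; rewrite ET mul0r.
  exists (fun=> T 0); split=> [i|c i|X gX v i]; first exact: polyfun_cst.
    by rewrite TE.
  rewrite pder_cst; have [x [_ [Z [gZ Z0 ->]]]] := gl_decomp gX.
  rewrite actDl zT // add0r act_suml big1 // => l _.
  by rewrite actZl vT ?mulr0 // dot0r.
move=> aT ET; have [B [dB aB]] := adm_D aT.
have [pT _ _] := adm_base aT; have [pB tB nB] := dB.
have EB c p : pder c (fun c => B c p) c = k%:R * B c p.
  case: p => u i; case: (split_ordP u) => [j ->|l ->].
    have -> : (fun c => B c (lshift m j, i)) = pder (delta_mx j 0) (fun c => T c i).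
      by apply/funext => c'; rewrite tB.
    by rewrite tB (@euler_derive _ _ k).
  move: c; apply: (eq_polyfun_dot (l := l)) => [||c].
  - exact: polyfun_euler.
  - exact: polyfunZ.
  have pdl := polyfun_dot (a l).
  have : pder c (fun c => dot (a l) c * B c (rshift s l, i)) c =
      k.+1%:R * (dot (a l) c * B c (rshift s l, i)).
    have -> : (fun c => dot (a l) c * B c (rshift s l, i)) = (fun c => act (Xr l) (T c) i).
      by apply/funext => c'; rewrite nB.
    by rewrite nB derive_act // -actZr; apply: eq_act => i'.
  rewrite deriveM_poly // derive_dot -natr1 => H; lra.
have [Q [pQ QE Qeq]] := IH _ _ aB EB.
(* Euler's formula: a homogeneous map of degree [k + 1] is [1 / (k + 1)] times its derivative
   evaluated at the point, and [Q] extends the derivative. *)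
exists (fun (v : 'cV[R]_(s + m)) i => k.+1%:R^-1 * \sum_u v u 0 * Q v (u, i)); split=> [i|c i|X gX v i].
- apply: polyfunZ; apply: polyfun_sum => u _.
  by apply: polyfunM; [exact: polyfun_coord|exact: pQ].
- apply: (mulfI (x := k.+1%:R)); first by rewrite pnatr_eq0.
  rewrite mulVKf ?pnatr_eq0 // -ET derive_linear_poly // big_split_ord /=.
  rewrite [X in _ + X]big1 ?addr0 => [|l _].
    by apply: eq_bigr => j _; rewrite QE col_mxEu tB.
  by rewrite col_mxEd mxE mul0r.
have pcQ u : polyfun (fun v : 'cV[R]_(s + m) => v u 0 * Q v (u, i)).
  by apply: polyfunM; [exact: polyfun_coord|exact: pQ].
rewrite deriveZ_poly; last exact: polyfun_sum.
rewrite actZr; congr (_ * _); rewrite derive_sum_poly //.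
have E u : pder (X *m v) (fun v : 'cV[R]_(s + m) => v u 0 * Q v (u, i)) v =
    v u 0 * act X (fun j => Q v (u, j)) i
    + ((X *m v) u 0 * Q v (u, i) - \sum_w v u 0 * X w u * Q v (w, i)).
  rewrite deriveM_poly ?derive_coord; [|exact: polyfun_coord|exact: pQ].
  have -> : \sum_w v u 0 * X w u * Q v (w, i) = v u 0 * \sum_w X w u * Q v (w, i).
    by rewrite mulr_sumr; apply: eq_bigr => w _; rewrite mulrA.
  by rewrite Qeq // act_hom; ring.
under eq_bigr do rewrite E.
rewrite act_sumr big_split /= -[RHS]addr0; congr (_ + _).
  by apply: eq_bigr => u _; rewrite actZr.
rewrite sumrB exchange_big -sumrB big1 // => w _.
rewrite -mulr_suml -mulrBl mxE -sumrB big1 ?mul0r // => u _.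
by rewrite mulrC subrr.
Qed.

Definition refl_mx (v : 'cV[R]_s) : 'M[R]_s := 1%:M - (2 / dot v v) *: (v *m v^T).

Lemma refl_mxE v (c : 'cV[R]_s) : refl_mx v *m c = c - (2 * dot v c / dot v v) *: v.
Proof.
rewrite mulmxBl mul1mx -scalemxAl -mulmxA (_ : v^T *m c = (dot v c)%:M); last first.
  apply/matrixP => i j; rewrite !ord1 !mxE eqxx mulr1n.
  by apply: eq_bigr => k _; rewrite mxE.
by rewrite mul_mx_scalar scalerA mulrAC.
Qed.

Lemma refl_mx_tr v : (refl_mx v)^T = refl_mx v.
Proof. by rewrite /refl_mx linearB linearZ /= trmx1 trmx_mul trmxK. Qed.

Lemma dot_refl v c d : dot (refl_mx v *m c) d = dot c (refl_mx v *m d).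
Proof. by rewrite dot_mulmx refl_mx_tr. Qed.

Lemma refl_mxK v (c : 'cV[R]_s) : v != 0 -> refl_mx v *m (refl_mx v *m c) = c.
Proof.
rewrite -dot_eq0 => v0; rewrite !refl_mxE dotBr dotZr divfK //.
rewrite -addrA -opprD -scalerDl -mulrDl -mulrDr; set t := dot v c.
have -> : t + (t - 2 * t) = 0 by ring.
by rewrite mulr0 mul0r scale0r subr0.
Qed.

(* Conjugating the root decomposition by an element of the group that induces
   the reflection permutes the root lines; the squares of the coefficients
   [O i l] form a doubly stochastic matrix, which replaces a bijection of roots
   counted with multiplicities. *)
Hypothesis refl_perm : forall k, exists O : 'I_m -> 'I_m -> R,
  [/\ forall i, \sum_l O i l ^+ 2 = 1, forall l, \sum_i O i l ^+ 2 = 1 &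
      forall i l, O i l != 0 -> exists2 x, x != 0 & refl_mx (a k) *m a i = x *: a l].

Definition refl_invariant (h : 'cV[R]_s -> R) :=
  forall k c, h (refl_mx (a k) *m c) = h c.

Lemma refl_invariant_derive h k c : polyfun h -> refl_invariant h ->
  dot (a k) c = 0 -> pder (a k) h c = 0.
Proof.
move=> ph hr kc.
have : pder (a k) h c = pder (refl_mx (a k) *m a k) h (refl_mx (a k) *m c).
  by rewrite -derive_comp_lin; congr (pder _ _ c); apply/funext => c'; rewrite hr.
rewrite !refl_mxE kc mulr0 mul0r scale0r subr0 mulfK ?dot_eq0 //.
rewrite scaler_nat mulr2n opprD addrA subrr add0r -scaleN1r derive_dirZ //.
by move=> ?; lra.
Qed.

Lemma sum_orth_mx (A : 'M[R]_s) (H : 'I_s -> 'I_s -> R) : A *m A^T = 1%:M ->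
  \sum_j \sum_i \sum_i' A i j * A i' j * H i i' = \sum_i H i i.
Proof.
move=> AA; have AE i i' : \sum_j A i j * A i' j = (i == i')%:R.
  have := congr1 (fun M : 'M[R]_s => M i i') AA; rewrite !mxE => <-.
  by apply: eq_bigr => j _; rewrite mxE.
rewrite exchange_big; apply: eq_bigr => i _; rewrite exchange_big (bigD1 i) //=.
rewrite -mulr_suml AE eqxx mul1r big1 ?addr0 // => i' /negPf ii'.
by rewrite -mulr_suml AE eq_sym ii' mul0r.
Qed.

Lemma lap_orth (h : 'cV[R]_s -> R) (A : 'M[R]_s) c : polyfun h -> A *m A^T = 1%:M ->
  (forall c, h (A *m c) = h c) ->
  \sum_j pder (delta_mx j 0) (pder (delta_mx j 0) h) c =
  \sum_j pder (delta_mx j 0) (pder (delta_mx j 0) h) (A *m c).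
Proof.
move=> ph AA hA.
have E j c' : pder (delta_mx j 0) h c' = pder (A *m delta_mx j 0) h (A *m c').
  by rewrite -derive_comp_lin; congr (pder _ _ c'); apply/funext => x; rewrite hA.
have E2 j c' : pder (delta_mx j 0) (pder (delta_mx j 0) h) c' =
   pder (A *m delta_mx j 0) (pder (A *m delta_mx j 0) h) (A *m c').
  rewrite -derive_comp_lin; congr (pder _ _ c'); apply/funext => x.
  by rewrite E.
under eq_bigr => j _.
  rewrite E2 (derive_linear_poly _ _ (polyfun_derive _ ph)).
  under eq_bigr => i _.
    rewrite mulmx_delta_entry.
    have -> : pder (A *m delta_mx j 0) h =
      (fun x => \sum_i' A i' j * pder (delta_mx i' 0) h x).
      apply/funext => x; rewrite derive_linear_poly //.
      by apply: eq_bigr => i' _; rewrite mulmx_delta_entry.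
    over.
  over.
have pd i : polyfun (pder (delta_mx i 0) h) by apply: polyfun_derive.
transitivity (\sum_j \sum_i \sum_i' A i j * A i' j *
    pder (delta_mx i 0) (pder (delta_mx i' 0) h) (A *m c)).
  apply: eq_bigr => j _; apply: eq_bigr => i _.
  rewrite derive_sum_poly => [|i' _]; last exact: polyfunZ.
  by rewrite mulr_sumr; apply: eq_bigr => i' _; rewrite deriveZ_poly // mulrA.
exact: (sum_orth_mx (fun i i' => pder (delta_mx i 0) (pder (delta_mx i' 0) h) (A *m c)) AA).
Qed.

(** For the trivial representation the radial Laplacian is the flat Laplacian plus the sum of the
    [d_{a_l} h / <a_l, c>]. Reflection invariance makes [d_{a_l} h] vanish on the wall, so the
    quotients are polynomials, and their sum is reflection invariant again. *)
Lemma refl_invariant_adm d h : polyfun h -> refl_invariant h ->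
  @adm d (triv_rep R (s + m)) (fun c _ => h c).
Proof.
elim: d => [|d IH] in h * => ph hr.
  split=> //; split=> // [Z _ _ c i|l c _ i]; exact: act_triv.
have bh : @base (triv_rep R (s + m)) (fun c _ => h c).
  split=> // [Z _ _ c i|l c _ i]; exact: act_triv.
split=> //; have [B dB] := base_D bh; have [pB tB nB] := dB.
have B0 l c i : B c (rshift s l, i) = 0.
  move: c; apply: (@eq_polyfun_dot l _ (fun=> 0)) => // [|c]; first exact: polyfun_cst.
  by rewrite nB act_triv mulr0.
have /choice[g gP] : forall l, exists g, polyfun g /\ forall c, pder (a l) h c = dot (a l) c * g c.
  move=> l; have [|g pg gE] := polyfun_div (a_neq0 l) (polyfun_derive (a l) ph).
    by move=> c; apply: refl_invariant_derive.
  by exists g.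
have pg l : polyfun (g l) by have [] := gP l.
have gE l c : pder (a l) h c = dot (a l) c * g l c by have [_ ->] := gP l.
pose Q c := \sum_j pder (delta_mx j 0) (pder (delta_mx j 0) h) c + \sum_l g l c.
have pQ : polyfun Q.
  apply: polyfunD; apply: polyfun_sum => // j _.
  by apply: polyfun_derive; apply: polyfun_derive.
exists B, (fun c _ => Q c); split=> //.
  split=> // c rc i; congr (_ + _); apply: eq_bigr => l _.
    by congr (pder _ _ c); apply/funext => c'; rewrite tB.
  rewrite act_hom act_triv sub0r big_split_ord /= [X in _ + X]big1 => [|l' _]; last first.
    by rewrite B0 mulr0.
  rewrite addr0 -sumrN (_ : \sum_(j < s) _ = pder (a l) h c); last first.
    rewrite derive_linear_poly //; apply: eq_bigr => j _.
    by rewrite -mulNr -Xr_skew Xr_lshift eqxx mulr1 tB.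
  by rewrite gE mulrAC divff ?mul1r.
apply: IH => // k; have [W [Orow Ocol OP]] := refl_perm k.
have AA : refl_mx (a k) *m (refl_mx (a k))^T = 1%:M.
  apply/matrixP => i j; rewrite refl_mx_tr -[LHS](mulmx_delta_entry _ j i) -mulmxA.
  by rewrite refl_mxK // !mxE eqxx andbT.
apply: eq_polyfun_regular => [||c rc] //.
  exact: (@polyfun_comp_lin _ _ (refl_mx (a k)) Q).
rewrite /Q (lap_orth c ph AA (hr k)); congr (_ + _).
(* [Phi] depends only on the line of its argument, so the doubly stochastic weights [W i l ^+ 2]
   permute the sum over the roots. *)
pose Phi (v : 'cV[R]_s) := pder v h c / dot v c.
have PhiZ x v : x != 0 -> Phi (x *: v) = Phi v.
  by move=> x0; rewrite /Phi derive_dirZ // dotZl -mulf_div divff // mul1r.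
transitivity (\sum_i Phi (refl_mx (a k) *m a i)).
  apply: eq_bigr => i _; rewrite /Phi.
  have nz : dot (a i) (refl_mx (a k) *m c) != 0.
    rewrite -dot_refl; have [l Ol|O0] := pickP (fun l => W i l != 0).
      by have [x x0 ->] := OP _ _ Ol; rewrite dotZl mulf_neq0.
    have := Orow i; rewrite big1 => [/esym/eqP|l _]; first by rewrite oner_eq0.
    by have /negbT := O0 l; rewrite negbK => /eqP ->; rewrite expr0n.
  have -> : pder (refl_mx (a k) *m a i) h c = pder (a i) h (refl_mx (a k) *m c).
    rewrite -[in RHS](refl_mxK (a i) (a_neq0 k)) -derive_comp_lin.
    by congr (pder _ _ c); apply/funext => x; rewrite hr.
  by rewrite gE dot_refl mulrAC divff ?mul1r.
transitivity (\sum_i \sum_l W i l ^+ 2 * Phi (a l)).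
  apply: eq_bigr => i _; rewrite -[LHS]mul1r -(Orow i) mulr_suml; apply: eq_bigr => l _.
  have [->|/(OP i l)[x x0 ->]] := eqVneq (W i l) 0; first by rewrite expr0n !mul0r.
  by rewrite PhiZ.
rewrite exchange_big; apply: eq_bigr => l _; rewrite -mulr_suml Ocol mul1r /Phi gE.
by rewrite mulrAC divff ?mul1r.
Qed.

(* The infinitesimal form of the Chevalley restriction theorem. *)
Theorem refl_invariant_extends k h : polyfun h -> refl_invariant h ->
  (forall c, pder c h c = k%:R * h c) ->
  exists P, [/\ polyfun P, forall c, P (section_incl c) = h c &
    forall X, gl X -> forall v, pder (X *m v) P v = 0].
Proof.
move=> ph hr hE.
have [P [pP PE PX]] := adm_extends (refl_invariant_adm k ph hr) (fun c _ => hE c).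
exists (fun v => P v tt); split=> [|c|X gX v]; [exact: pP|by rewrite PE|].
by rewrite PX // act_triv.
Qed.


End Extension.

(** * Differentiable roots of polynomials *)

Section UltraLimits.
Variable R : realType.

Lemma ultra_nat_ex : exists F : set_system nat, UltraFilter F /\ \oo `<=` F.
Proof. exact: ultraFilterLemma. Qed.

Section OneFilter.
Variables (T : Type) (F : set_system T).
Context {FU : UltraFilter F}.

Lemma ultra_bounded_cvg (u : T -> R) (M : R) : (\forall x \near F, `|u x| <= M) ->
  exists l : R, u @ F --> l.
Proof.
move=> uM; have FP : ProperFilter (u @ F) by apply: fmap_proper_filter; apply: ultra_proper.
have [|l [_ lF]] := @segment_compact R (- M) M (u @ F) FP.
  by apply: filterS uM => x; rewrite ler_norml /= in_itv.
exists l => N Nl; rewrite /nbhs /=.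
have [//|FN] := in_ultra_setVsetC (u @^-1` N) FU.
have FN' : F (u @^-1` (u @` (~` (u @^-1` N)))) by apply: filterS FN => x nNx; exists x.
have [_ [[x nNx <-] Nx]] := lF _ _ FN' Nl.
by have := nNx.
Qed.

End OneFilter.

Lemma polyfun_cvg (T : Type) (F : set_system T) {FF : Filter F} n (f : 'cV[R]_n -> R)
    (u : T -> 'cV[R]_n) (l : 'cV[R]_n) :
  polyfun f -> (forall i, (fun x => u x i 0) @ F --> l i 0) ->
  (fun x => f (u x)) @ F --> f l.
Proof.
move=> + ul; elim=> {f} [k|i|f g _ cf _ cg|f g _ cf _ cg|f g fg _ cf].
- exact: cvg_cst.
- exact: ul.
- exact: cvgD.
- exact: cvgM.
- by rewrite -(funext fg).
Qed.

Lemma cvg_bigsum (T : Type) (F : set_system T) {FF : Filter F} (I : Type) (r : seq I)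
    (f : I -> T -> R) (l : I -> R) : (forall i, f i @ F --> l i) ->
  (fun x => \sum_(i <- r) f i x) @ F --> \sum_(i <- r) l i.
Proof.
move=> fl; elim: r => [|i r IH].
  rewrite big_nil (_ : (fun _ => _) = fun=> 0); first exact: cvg_cst.
  by apply/funext => x; rewrite big_nil.
rewrite big_cons (_ : (fun _ => _) = fun x => f i x + \sum_(j <- r) f j x).
  exact: cvgD.
by apply/funext => x; rewrite big_cons.
Qed.

End UltraLimits.

(** * Bounds on derivatives, uniform in families *)

Section CB.
Variable R : realType.
Implicit Types (u : R -> R).

Definition chain n (v : nat -> R -> R) := forall i, (i < n)%N ->
  forall t : R, `|t| < 1 -> is_derive t 1 (v i) (v i.+1 t).

(** The derivatives are given as a sequence [v], so that nothing is required outside [(-1, 1)]; the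
    last of them is bounded but need not be continuous. *)
Definition CB n (B : R) u := exists v : nat -> R -> R, [/\ v 0%N = u, chain n v &
  forall i, (i <= n)%N -> forall t : R, `|t| < 1 -> `|v i t| <= B].

Lemma CB0 B u : CB 0 B u <-> forall t : R, `|t| < 1 -> `|u t| <= B.
Proof.
split=> [[v [<- _ vB]] t t1|uB]; first exact: vB.
by exists (fun=> u).
Qed.

Lemma CBS n B u : CB n.+1 B u <-> (forall t : R, `|t| < 1 -> `|u t| <= B) /\
  exists2 u', (forall t : R, `|t| < 1 -> is_derive t 1 u (u' t)) & CB n B u'.
Proof.
split=> [[v [<- cv vB]]|[uB [u' uu' [v [vu' cv vB]]]]].
  split=> [t t1|]; first exact: vB.
  exists (v 1%N) => [t t1|]; first exact: cv.
  by exists (fun i => v i.+1); split=> // i ni; [apply: cv|apply: vB].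
exists (fun i => if i is j.+1 then v j else u); split=> // [[|i]|[|i]] ni t t1.
- by rewrite vu'; apply: uu'.
- exact: cv.
- exact: uB.
- exact: vB.
Qed.

Lemma CB_le n n' B B' u : (n' <= n)%N -> B <= B' -> CB n B u -> CB n' B' u.
Proof.
move=> nn BB [v [v0 cv vB]]; exists v; split=> // i ni t t1.
  by apply: cv => //; apply: leq_trans nn.
by apply: le_trans BB; apply: vB => //; apply: leq_trans nn.
Qed.

Lemma CB_bound n B u (t : R) : CB n B u -> `|t| < 1 -> `|u t| <= B.
Proof. by move=> [v [<- _ vB]]; apply: vB. Qed.

Lemma is_derive_continuous (f : R -> R) (x d : R) : is_derive x 1 f d -> {for x, continuous f}.
Proof.
by move=> fd; apply: differentiable_continuous; apply/derivable1_diffP; apply: ex_derive.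
Qed.

Lemma norm_itv_lt1 (x y z : R) : `|x| < 1 -> `|y| < 1 -> x <= z <= y -> `|z| < 1.
Proof.
rewrite !ltr_norml => /andP[x1 _] /andP[_ y1] /andP[xz zy].
by rewrite (lt_le_trans x1 xz) (le_lt_trans zy y1).
Qed.

Lemma MVT1 (u u' : R -> R) (x y : R) :
  (forall t : R, `|t| < 1 -> is_derive t 1 u (u' t)) -> `|x| < 1 -> `|y| < 1 ->
  exists2 c, (Num.min x y <= c <= Num.max x y) & u y - u x = u' c * (y - x).
Proof.
move=> uu'.
wlog xy : x y / x <= y => [H x1 y1|x1 y1].
  have [xy|yx] := leP x y; first by have [c cxy E] := H x y xy x1 y1; exists c; rewrite // minEle maxEle xy in cxy.
  have [c cxy E] := H y x (ltW yx) y1 x1; exists c.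
    by rewrite minEle maxEle (ltW yx) in cxy.
  by rewrite -opprB E -mulrN opprB.
have sub z : x <= z <= y -> `|z| < 1 by apply: norm_itv_lt1.
have [|z|c cxy ->] := @MVT_segment R u u' x y xy.
- by move=> z; rewrite in_itv /= => /andP[xz zy]; apply: uu'; apply: sub; rewrite !ltW.
- apply: continuous_in_subspaceT => w; rewrite inE /= in_itv /= => /sub w1.
  exact: is_derive_continuous (uu' _ w1).
by exists c => //; rewrite minEle maxEle xy; move: cxy; rewrite in_itv.
Qed.

Lemma MVT_bound (u u' : R -> R) (M x y : R) :
  (forall t : R, `|t| < 1 -> is_derive t 1 u (u' t)) ->
  (forall t : R, `|t| < 1 -> `|u' t| <= M) ->
  `|x| < 1 -> `|y| < 1 -> `|u y - u x| <= M * `|y - x|.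
Proof.
move=> uu' u'M x1 y1; have [c cxy ->] := MVT1 uu' x1 y1.
rewrite normrM ler_wpM2r // u'M //; move: cxy.
by case: (leP x y) => _; [apply: norm_itv_lt1 x1 y1|apply: norm_itv_lt1 y1 x1].
Qed.

Lemma CB_lip B u (x y : R) : CB 1 B u -> `|x| < 1 -> `|y| < 1 ->
  `|u y - u x| <= B * `|y - x|.
Proof.
move=> /CBS[_ [u' uu' /CB0 u'B]]; exact: MVT_bound uu' u'B.
Qed.

Lemma taylor2 B u u' (x y : R) : (forall t : R, `|t| < 1 -> is_derive t 1 u (u' t)) ->
  CB 1 B u' -> `|x| < 1 -> `|y| < 1 ->
  `|u y - u x - (y - x) * u' x| <= B * (y - x) ^+ 2.
Proof.
move=> uu' cu' x1 y1; have [c cxy ->] := MVT1 uu' x1 y1.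
have c1 : `|c| < 1.
  by move: cxy; case: (leP x y) => _; [apply: norm_itv_lt1 x1 y1|apply: norm_itv_lt1 y1 x1].
have B0 : 0 <= B by apply: le_trans (CB_bound cu' x1).
rewrite mulrC -mulrBr normrM.
apply: (@le_trans _ _ (`|y - x| * (B * `|c - x|))).
  by rewrite ler_wpM2l //; apply: CB_lip cu' x1 c1.
rewrite mulrCA ler_wpM2l // -(real_normK (num_real (y - x))) expr2 ler_wpM2l //.
move: cxy; case: (leP x y) => xy /andP[h1 h2].
  by rewrite !ger0_norm ?subr_ge0 // lerD2r.
by rewrite !ler0_norm ?subr_le0 ?(ltW xy) // lerN2 lerD2r.
Qed.

(** A derivative cannot be large on a whole interval if the function is bounded: take the points
    given by induction in the two outer thirds, and the mean value theorem between them. *)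
Lemma chain_point n : exists2 c : R, 0 <= c & forall (v : nat -> R -> R) (M a b : R),
  chain n v -> `|a| < 1 -> `|b| < 1 -> a < b ->
  (forall t : R, `|t| < 1 -> `|v 0%N t| <= M) ->
  exists2 x, a <= x <= b & `|v n x| <= c * M / (b - a) ^+ n.
Proof.
elim: n => [|n [c c0 IH]].
  exists 1 => // v M a b _ a1 b1 ab vM; exists a; first by rewrite lexx ltW.
  by rewrite expr0 divr1 mul1r vM.
exists (2 * 3 ^+ n.+1 * c) => [|v M a b cv a1 b1 ab vM].
  by rewrite mulr_ge0 // mulr_ge0 // exprn_ge0.
have M0 : 0 <= M by apply: le_trans (vM _ a1).
have cv' : chain n v by move=> i ni; apply: cv; apply: leqW.
set h := (b - a) / 3.
have h0 : 0 < h by rewrite divr_gt0 // subr_gt0.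
have hE : b = a + 3 * h by rewrite /h; field.
have mid z : a <= z <= b -> `|z| < 1 by apply: norm_itv_lt1.
have a'1 : `|a + h| < 1 by apply: mid; rewrite hE; lra.
have b'1 : `|b - h| < 1 by apply: mid; rewrite hE; lra.
have [||x ax xE] // := IH v M a (a + h) cv' a1 a'1; first by lra.
have [||y yb yE] // := IH v M (b - h) b cv' b'1 b1; first by lra.
have xy : h <= y - x by move: ax yb; rewrite hE => /andP[_ ?] /andP[? _]; lra.
have x1 : `|x| < 1 by apply: mid; move: ax; rewrite hE => /andP[? ?]; apply/andP; split; lra.
have y1 : `|y| < 1 by apply: mid; move: yb; rewrite hE => /andP[? ?]; apply/andP; split; lra.
have [z zxy zE] := MVT1 (cv n (ltnSn n)) x1 y1.
have xyle : x <= y by lra.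
exists z.
  move: zxy; rewrite minEle maxEle xyle => /andP[xz zy].
  by move: ax yb => /andP[ax _] /andP[_ yb]; rewrite (le_trans ax xz) (le_trans zy yb).
have D : `|v n y - v n x| <= 2 * (c * M / h ^+ n).
  rewrite (le_trans (ler_normB _ _)) // [2]/(1 + 1) mulrDl !mul1r lerD //.
    by move: yE; rewrite opprB addrCA subrr addr0.
  by move: xE; rewrite addrAC subrr add0r.
have -> : 2 * 3 ^+ n.+1 * c * M / (b - a) ^+ n.+1 = 2 * (c * M / h ^+ n) / h.
  rewrite /h !exprS !expr_div_n; field.
  have ba : b - a != 0 by rewrite subr_eq0 gt_eqF.
  by rewrite !expf_neq0 ?pnatr_eq0 ?ba.
rewrite ler_pdivlMr //; apply: le_trans D; rewrite zE normrM.
by rewrite ler_wpM2l // (le_trans xy) // ler_norm.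
Qed.

(** Interpolation of the intermediate derivatives. The derivative before the last is bounded at one
    point by [chain_point], hence everywhere because the last one is bounded, and induction goes
    down. It is needed because rescaling controls a function and its top derivative only. *)
Lemma chain_interp n : exists2 C : R, 0 <= C & forall (v : nat -> R -> R) (M : R),
  chain n v -> (forall t : R, `|t| < 1 -> `|v 0%N t| <= M) ->
  (forall t : R, `|t| < 1 -> `|v n t| <= M) -> CB n (C * M) (v 0%N).
Proof.
suff [C C0 H] : exists2 C : R, 0 <= C & forall (v : nat -> R -> R) (M : R), 0 <= M ->
  chain n v -> (forall t : R, `|t| < 1 -> `|v 0%N t| <= M) ->
  (forall t : R, `|t| < 1 -> `|v n t| <= M) ->
  forall i, (i <= n)%N -> forall t : R, `|t| < 1 -> `|v i t| <= C * M.
  exists C => // v M cv v0 vn; exists v; split=> //; apply: H => //.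
  by apply: (le_trans _ (v0 0 _)); rewrite ?normr0.
elim: n => [|n [C C0 IH]].
  exists 1 => // v M _ _ v0 _ i; rewrite leqn0 => /eqP -> t t1; rewrite mul1r; exact: v0.
have [c c0 P] := chain_point n.
exists ((C + 1) * (c + 2)) => [|v M M0 cv v0 vn i].
  by rewrite mulr_ge0 // addr_ge0.
have cv' : chain n v by move=> j jn; apply: cv; apply: leqW.
have h2 : `|1 / 2 : R| < 1 by rewrite ger0_norm //; lra.
have h2' : `|- (1 / 2) : R| < 1 by rewrite normrN.
have [||x xb xE] // := P v M (- (1/2)) (1/2) cv' h2' h2; first by lra.
have x1 : `|x| < 1 by apply: norm_itv_lt1 h2' h2 xb.
have vnB t : `|t| < 1 -> `|v n t| <= (c + 2) * M.
  move=> t1; rewrite -(subrK (v n x) (v n t)) (le_trans (ler_normD _ _)) //.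
  rewrite mulrDl addrC lerD //.
    by move: xE; rewrite opprK (_ : 1 / 2 + 1 / 2 = 1) ?expr1n ?divr1 //; field.
  rewrite (le_trans (MVT_bound (cv n (ltnSn n)) vn x1 t1)) // mulrC ler_wpM2r //.
  by rewrite (le_trans (ler_normB _ _)) //; lra.
have cM : 0 <= (c + 2) * M by rewrite mulr_ge0 // addr_ge0.
have v0B t : `|t| < 1 -> `|v 0%N t| <= (c + 2) * M.
  by move=> t1; rewrite (le_trans (v0 _ t1)) // -{1}(mul1r M) ler_wpM2r //; lra.
rewrite leq_eqVlt => /orP[/eqP -> t t1|ni t t1].
  rewrite (le_trans (vn _ t1)) // -{1}(mul1r M) ler_wpM2r //.
  by rewrite -(mul1r 1) ler_pM //; lra.
rewrite (le_trans (IH v _ cM cv' v0B vnB i ni t t1)) //.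
by rewrite -mulrA ler_wpM2r //; lra.
Qed.

Section Families.
Variable Om : Type.
Implicit Types (f g : Om -> R -> R).

Definition UCB n f := exists2 B : R, 0 <= B & forall w, CB n B (f w).

Lemma UCB_le n n' f : (n' <= n)%N -> UCB n f -> UCB n' f.
Proof. by move=> nn [B B0 fB]; exists B => // w; apply: CB_le nn (lexx B) (fB w). Qed.

Lemma UCB0 f : UCB 0 f <-> exists2 B : R, 0 <= B &
  forall w (t : R), `|t| < 1 -> `|f w t| <= B.
Proof.
by split=> -[B B0 fB]; exists B => // w; [apply/CB0|apply/CB0; apply: fB].
Qed.

Lemma UCBS n f : UCB n.+1 f <-> UCB 0 f /\
  exists2 f', (forall w (t : R), `|t| < 1 -> is_derive t 1 (f w) (f' w t)) & UCB n f'.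
Proof.
split=> [[B B0 fB]|[[B B0 fB] [f' ff' [B' B'0 fB']]]].
  split; first by exists B => // w; apply: CB_le (fB w).
  have /choice[f' H] : forall w, exists u', (forall t : R, `|t| < 1 ->
      is_derive t 1 (f w) (u' t)) /\ CB n B u'.
    by move=> w; have /CBS[_ [u' ? ?]] := fB w; exists u'.
  by exists f' => [w|]; [have [] := H w|exists B => // w; have [] := H w].
exists (B + B') => [|w]; first exact: addr_ge0.
apply/CBS; split=> [t t1|]; first by apply: le_trans (CB_bound (fB w) t1) _; rewrite lerDl.
by exists (f' w); [exact: ff'|apply: CB_le (fB' w) => //; rewrite lerDr].
Qed.

Lemma UCB_cst n (k : Om -> R) (B : R) : (forall w, `|k w| <= B) -> UCB n (fun w _ => k w).
Proof.
elim: n k B => [|n IH] k B kB.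
  apply/UCB0; exists (`|B|) => // w t _; rewrite (le_trans (kB w)) //; exact: ler_norm.
apply/UCBS; split.
  apply/UCB0; exists (`|B|) => // w t _; rewrite (le_trans (kB w)) //; exact: ler_norm.
exists (fun _ _ => 0) => [w t _|]; first exact: is_derive_cst.
by apply: (IH (fun=> 0) 0) => w; rewrite normr0.
Qed.

Lemma UCB_D n f g : UCB n f -> UCB n g -> UCB n (fun w t => f w t + g w t).
Proof.
elim: n => [|n IH] in f g *.
  move=> /UCB0[B B0 fB] /UCB0[B' B'0 gB]; apply/UCB0; exists (B + B') => [|w t t1].
    exact: addr_ge0.
  by rewrite (le_trans (ler_normD _ _)) // lerD ?fB ?gB.
move=> /UCBS[/UCB0[B B0 fB] [f' ff' uf']] /UCBS[/UCB0[B' B'0 gB] [g' gg' ug']].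
apply/UCBS; split.
  apply/UCB0; exists (B + B') => [|w t t1]; first exact: addr_ge0.
  by rewrite (le_trans (ler_normD _ _)) // lerD ?fB ?gB.
exists (fun w t => f' w t + g' w t) => [w t t1|]; last exact: IH.
by have := ff' w t t1; have := gg' w t t1 => ? ?; apply: is_deriveD.
Qed.

Lemma UCB_M n f g : UCB n f -> UCB n g -> UCB n (fun w t => f w t * g w t).
Proof.
have M0 : forall f g, UCB 0 f -> UCB 0 g -> UCB 0 (fun w t => f w t * g w t).
  move=> {}f {}g /UCB0[B B0 fB] /UCB0[B' B'0 gB]; apply/UCB0; exists (B * B') => [|w t t1].
    exact: mulr_ge0.
  by rewrite normrM ler_pM ?fB ?gB.
elim: n => [|n IH] in f g *; first exact: M0.
move=> uf ug; have /UCBS[f0 [f' ff' uf']] := uf; have /UCBS[g0 [g' gg' ug']] := ug.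
apply/UCBS; split; first exact: M0.
exists (fun w t => f w t * g' w t + g w t * f' w t) => [w t t1|]; last first.
  by apply: UCB_D; apply: IH => //; [apply: UCB_le uf|apply: UCB_le ug].
by have := ff' w t t1; have := gg' w t t1 => ? ?; apply: is_deriveM.
Qed.

Lemma UCB_V n f : UCB n f -> (exists2 e : R, 0 < e &
  forall w (t : R), `|t| < 1 -> e <= `|f w t|) -> UCB n (fun w t => (f w t)^-1).
Proof.
move=> + [e e0 fe].
have V0 : UCB 0 (fun w t => (f w t)^-1).
  apply/UCB0; exists e^-1 => [|w t t1]; first by rewrite invr_ge0 ltW.
  by rewrite normfV lef_pV2 ?posrE ?fe // (lt_le_trans e0) // fe.
elim: n => [|n IH] // uf; have /UCBS[f0 [f' ff' uf']] := uf.
have iV := IH (UCB_le (leqnSn n) uf).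
apply/UCBS; split=> //.
exists (fun w t => - f' w t * ((f w t)^-1 * (f w t)^-1)) => [w t t1|].
  have fn0 : f w t != 0 by rewrite -normr_gt0 (lt_le_trans e0) // fe.
  have := ff' w t t1 => fd.
  have dV : derivable (fun t => (f w t)^-1) t 1 by apply: derivableV => //; exact: ex_derive.
  apply: DeriveDef => //; rewrite (deriveV fn0); last exact: ex_derive.
  by rewrite derive_val /GRing.scale /= expr2 invfM mulrC mulNr mulrN.
apply: UCB_M; last exact: UCB_M.
have := UCB_M (UCB_cst n (k := fun=> -1) (B := 1) _) uf'.
have -> : (fun w t => -1 * f' w t) = (fun w t => - f' w t).
  by apply/funext => w; apply/funext => t; rewrite mulN1r.
by apply=> w; rewrite normrN normr1.
Qed.

Lemma UCB_sum n (I : Type) (r : seq I) (P : pred I) (F : I -> Om -> R -> R) :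
  (forall i, P i -> UCB n (F i)) -> UCB n (fun w t => \sum_(i <- r | P i) F i w t).
Proof.
move=> uF; elim: r => [|i r IH].
  rewrite (_ : (fun _ _ => _) = (fun _ _ => 0)); last first.
    by apply/funext => w; apply/funext => t; rewrite big_nil.
  by apply: (UCB_cst n (B := 0)) => _; rewrite normr0.
rewrite (_ : (fun _ _ => _) = (fun w t => (if P i then F i w t else 0)
    + \sum_(i <- r | P i) F i w t)); last first.
  by apply/funext => w; apply/funext => t; rewrite big_cons; case: ifP; rewrite ?add0r.
apply: UCB_D => //; case Pi: (P i); first exact: uF.
by apply: (UCB_cst n (B := 0)) => _; rewrite normr0.
Qed.

Lemma UCB_polyfun n k (f : 'cV[R]_k -> R) (u : Om -> R -> 'cV[R]_k) : polyfun f ->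
  (forall i, UCB n (fun w t => u w t i 0)) -> UCB n (fun w t => f (u w t)).
Proof.
move=> + uu; elim=> {f} [c|i|f g _ uf _ ug|f g _ uf _ ug|f g fg _ uf].
- by apply: (UCB_cst n (B := `|c|)) => _.
- exact: uu.
- exact: UCB_D.
- exact: UCB_M.
- by rewrite -(funext fg).
Qed.

End Families.
End CB.

(** * Monic polynomials with given roots *)

Section RootPoly.
Variables (R : realType) (I : eqType).
Implicit Types (r : seq I) (x : I -> R).

Definition rpoly r x : {poly R} := \prod_(i <- r) ('X - (x i)%:P).

Lemma rpoly_cons i r x : rpoly (i :: r) x = ('X - (x i)%:P) * rpoly r x.
Proof. by rewrite /rpoly big_cons. Qed.

Lemma size_rpoly r x : size (rpoly r x) = (size r).+1.
Proof. exact: size_prod_XsubC. Qed.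

Lemma rpoly_monic r x : rpoly r x \is monic.
Proof. exact: monic_prod_XsubC. Qed.

Lemma rpoly_lead r x : (rpoly r x)`_(size r) = 1.
Proof. by have /monicP := rpoly_monic r x; rewrite /lead_coef size_rpoly. Qed.

Lemma rpoly_over r x j : (size r < j)%N -> (rpoly r x)`_j = 0.
Proof. by move=> rj; rewrite nth_default // size_rpoly. Qed.

Lemma coef_XsubCM (c : R) (p : {poly R}) j :
  (('X - c%:P) * p)`_j = (if j is j'.+1 then p`_j' else 0) - c * p`_j.
Proof. by rewrite mulrBl coefB coefXM coefCM; case: j. Qed.

Lemma rpoly_coef_bound (C : R) r x j : 0 <= C -> (forall i, `|x i| <= C) ->
  `|(rpoly r x)`_j| <= (1 + C) ^+ size r.
Proof.
move=> C0 xC; elim: r j => [|i r IH] j.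
  by rewrite /rpoly big_nil coef1 expr0; case: j => [|j]; rewrite ?normr1 ?normr0.
rewrite rpoly_cons coef_XsubCM exprS mulrDl mul1r.
rewrite (le_trans (ler_normB _ _)) // lerD //.
  by case: j => [|j]; rewrite ?normr0 // exprn_ge0 // addr_ge0.
by rewrite normrM ler_pM.
Qed.

Lemma rpoly_cvg (T : Type) (F : set_system T) {FF : Filter F} r (x : T -> I -> R) y j :
  (forall i, (fun w => x w i) @ F --> y i) ->
  (fun w => (rpoly r (x w))`_j) @ F --> (rpoly r y)`_j.
Proof.
move=> xy; elim: r j => [|i r IH] j.
  rewrite (_ : (fun w => _) = fun=> (rpoly [::] y)`_j); first exact: cvg_cst.
  by apply/funext => w; rewrite /rpoly !big_nil.
rewrite (_ : (fun w => _) = fun w =>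
   (if j is j'.+1 then (rpoly r (x w))`_j' else 0) - x w i * (rpoly r (x w))`_j).
  rewrite rpoly_cons coef_XsubCM; apply: cvgB; last exact: cvgM.
  by case: j => [|j]; [exact: cvg_cst|exact: IH].
by apply/funext => w; rewrite rpoly_cons coef_XsubCM; case: j.
Qed.

Lemma rpoly_horner r x z : (rpoly r x).[z] = \prod_(i <- r) (z - x i).
Proof. by rewrite horner_prod; apply: eq_bigr => i _; rewrite hornerXsubC. Qed.

Lemma rpoly_coprime r1 r2 x : (forall i j, i \in r1 -> j \in r2 -> x i != x j) ->
  coprimep (rpoly r1 x) (rpoly r2 x).
Proof.
elim: r1 => [|i r1 IH] H; first by rewrite /rpoly big_nil coprime1p.
rewrite rpoly_cons coprimepMl IH => [|i' j ir jr]; last first.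
  by apply: H => //; rewrite in_cons ir orbT.
rewrite andbT coprimep_sym coprimep_XsubC rootE rpoly_horner.
have {}H j : j \in r2 -> x i != x j by move=> jr; apply: H => //; rewrite mem_head.
elim: r2 H {IH} => [|j r2 IH] H; first by rewrite big_nil oner_neq0.
rewrite big_cons mulf_neq0 ?IH //; first by rewrite subr_eq0 H // mem_head.
by move=> j' jr; apply: H; rewrite in_cons jr orbT.
Qed.

Lemma rpoly_scale (k : R) r x j : (j <= size r)%N ->
  (rpoly r (fun i => k * x i))`_j = k ^+ (size r - j) * (rpoly r x)`_j.
Proof.
elim: r j => [|i r IH] j; first by rewrite leqn0 => /eqP ->; rewrite /rpoly !big_nil mul1r.
rewrite !rpoly_cons !coef_XsubCM /= => jr.
have -> : k * x i * (rpoly r (fun i => k * x i))`_j =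
    k ^+ ((size r).+1 - j) * (x i * (rpoly r x)`_j).
  move: jr; rewrite leq_eqVlt => /orP[/eqP ->|jr].
    by rewrite !rpoly_over // !mulr0.
  by rewrite IH // subSn // exprS; ring.
case: j jr => [|j] jr; first by rewrite !sub0r mulrN.
by rewrite IH // subSS mulrBr.
Qed.

(* Multiplying by ['X^2] avoids the truncated subtraction [size r - 2]. *)
Lemma rpoly_coef12 r x : (rpoly r x * 'X^2)`_(size r).+1 = - \sum_(i <- r) x i /\
  2 * (rpoly r x * 'X^2)`_(size r) =
  (\sum_(i <- r) x i) ^+ 2 - \sum_(i <- r) x i ^+ 2.
Proof.
elim: r => [|i r [IH1 IH2]].
  by rewrite /rpoly !big_nil mul1r !coefXn /=; split; ring.
rewrite rpoly_cons -mulrA !coef_XsubCM /= IH1 !big_cons mulrBr IH2.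
have -> : (rpoly r x * 'X^2)`_(size r).+2 = 1.
  by rewrite coefMXn /= subn2 rpoly_lead.
by split; ring.
Qed.

End RootPoly.

(** * Splitting a polynomial into coprime factors *)

Section Split.
Variables (R : realType) (I : finType).
Variables (r1 r2 : seq I).
Local Notation m1 := (size r1).
Local Notation m2 := (size r2).
Local Notation N := (m1 + m2)%N.

Lemma polyfun_det n p (F : 'cV[R]_n -> 'M[R]_p) :
  (forall i j, polyfun (fun c => F c i j)) -> polyfun (fun c => \det (F c)).
Proof.
move=> pF; apply: polyfun_sum => s _; apply: polyfunZ.
by apply: polyfun_prod => i _.
Qed.

Lemma polyfun_adj n p (F : 'cV[R]_n -> 'M[R]_p) i j :
  (forall i j, polyfun (fun c => F c i j)) -> polyfun (fun c => (\adj (F c)) i j).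
Proof.
move=> pF; apply: (@polyfun_eq _ _ (fun c => (-1) ^+ (j + i) * \det (row' j (col' i (F c))))).
  by move=> c; rewrite mxE.
apply: polyfunZ; apply: polyfun_det => k l.
by apply: polyfun_eq (pF (lift j k) (lift i l)) => c; rewrite !mxE.
Qed.

Definition monp (n : nat) (c : 'I_n -> R) : {poly R} := 'X^n + \sum_(i < n) (c i)%:P * 'X^i.

Lemma coef_monp n (c : 'I_n -> R) j :
  (monp c)`_j = (j == n)%:R + \sum_(i < n) c i * (j == i)%:R.
Proof.
rewrite coefD coefXn coef_sum; congr (_ + _); apply: eq_bigr => i _.
by rewrite coefCM coefXn.
Qed.

Lemma rpoly_monp (r : seq I) (x : I -> R) : rpoly r x = monp (fun i : 'I_(size r) => (rpoly r x)`_i).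
Proof.
apply/polyP => j; rewrite coef_monp; have [jr|jr|->] := ltngtP j (size r).
- rewrite add0r (bigD1 (Ordinal jr)) //= eqxx mulr1 big1 ?addr0 // => i ij.
  have -> : (j == i) = false by apply: contraNF ij => /eqP ?; apply/eqP/val_inj.
  by rewrite mulr0.
- rewrite rpoly_over // add0r big1 // => i _.
  by rewrite (gtn_eqF (ltn_trans (ltn_ord i) jr)) mulr0.
- rewrite rpoly_lead big1 ?addr0 // => i _.
  by rewrite (gtn_eqF (ltn_ord i)) mulr0.
Qed.

(* The matrix of [(U, V) |-> U * q2 + V * q1] in the monomial bases, where
   [q1] and [q2] are monic with lower coefficients [c]. *)
Definition syl (c : 'cV[R]_N) : 'M[R]_N := \matrix_(k, j)
  match fintype.split k with
  | inl i => ('X^i * monp (fun l => c (rshift m1 l) 0))`_j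
  | inr i => ('X^i * monp (fun l => c (lshift m2 l) 0))`_j
  end.

Lemma polyfun_syl k j : polyfun (fun c => syl c k j).
Proof.
have pm n (g : 'I_n -> 'I_N) l : polyfun (fun c : 'cV[R]_N => (monp (fun i => c (g i) 0))`_l).
  apply: (@polyfun_eq _ _ (fun c => (l == n)%:R + \sum_(i < n) (l == i)%:R * c (g i) 0)).
    by move=> c; rewrite coef_monp; under eq_bigr do rewrite mulrC.
  apply: polyfunD; first exact: polyfun_cst.
  by apply: polyfun_sum => i _; apply/polyfunZ/polyfun_coord.
have pX n (g : 'I_n -> 'I_N) i :
    polyfun (fun c : 'cV[R]_N => ('X^i * monp (fun i => c (g i) 0))`_j).
  apply: (@polyfun_eq _ _ (fun c => if (j < i)%N then 0 else (monp (fun i => c (g i) 0))`_(j - i))).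
    by move=> c; rewrite coefXnM.
  by case: (j < i)%N; [exact: polyfun_cst|exact: pm].
case E: (fintype.split k) => [i|i].
  by apply: polyfun_eq (pX m2 (@rshift m1 m2) i) => c; rewrite mxE E.
by apply: polyfun_eq (pX m1 (@lshift m1 m2) i) => c; rewrite mxE E.
Qed.

(** The two factors take separate roots because [split_diff] evaluates them at two different
    times. *)
Definition cf (x y : I -> R) : 'cV[R]_N :=
  col_mx (\col_(i < m1) (rpoly r1 x)`_i) (\col_(i < m2) (rpoly r2 y)`_i).

Definition polyrow n (w : 'I_n -> R) : {poly R} := \sum_(i < n) (w i)%:P * 'X^i.

Lemma coef_polyrow n (w : 'I_n -> R) j :
  (polyrow w)`_j = if insub j is Some i then w i else 0.
Proof.
rewrite coef_sum; under eq_bigr do rewrite coefCM coefXn.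
case: insubP => [i jn <-|jn].
  rewrite (bigD1 i) //= eqxx mulr1 big1 ?addr0 // => k ki.
  have -> : (i == k :> nat) = false by apply: contraNF ki => /eqP ?; apply/eqP/val_inj.
  by rewrite mulr0.
rewrite big1 // => i _; have -> : (j == i) = false by apply: contraNF jn => /eqP ->.
by rewrite mulr0.
Qed.

Lemma size_polyrow n (w : 'I_n -> R) : (size (polyrow w) <= n)%N.
Proof.
apply/leq_sizeP => j nj; rewrite coef_polyrow insubF //.
by apply/negbTE; rewrite -leqNgt.
Qed.

Lemma mul_syl (x y : I -> R) (w : 'rV[R]_N) j : (w *m syl (cf x y)) 0 j =
  (polyrow (fun i => w 0 (lshift m2 i)) * rpoly r2 y
   + polyrow (fun i => w 0 (rshift m1 i)) * rpoly r1 x)`_j.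
Proof.
have E1 : monp (fun l => cf x y (lshift m2 l) 0) = rpoly r1 x.
  rewrite [RHS]rpoly_monp; congr monp; apply/funext => l.
  by rewrite /cf col_mxEu mxE.
have E2 : monp (fun l => cf x y (rshift m1 l) 0) = rpoly r2 y.
  rewrite [RHS]rpoly_monp; congr monp; apply/funext => l.
  by rewrite /cf col_mxEd mxE.
rewrite mxE big_split_ord coefD !mulr_suml !coef_sum; congr (_ + _).
  apply: eq_bigr => i _; rewrite mxE -[lshift m2 i]/(fintype.unsplit (inl i)).
  by rewrite fintype.unsplitK /= E2 -mulrA coefCM.
apply: eq_bigr => i _; rewrite mxE -[rshift m1 i]/(fintype.unsplit (inr i)).
by rewrite fintype.unsplitK /= E1 -mulrA coefCM.
Qed.

(** The determinant is a resultant: a kernel vector is a relation [U q2 + V q1 = 0] with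
    [deg U < deg q1], while coprimality makes [q1] divide [U]. *)
Lemma det_syl_neq0 (x y : I -> R) : coprimep (rpoly r1 x) (rpoly r2 y) ->
  \det (syl (cf x y)) != 0.
Proof.
move=> cop; apply/negP => /det0P[w w0 wM]; case/negP: w0; apply/eqP.
set U := polyrow (fun i => w 0 (lshift m2 i)).
set V := polyrow (fun i => w 0 (rshift m1 i)).
have q0 (r' : seq I) (x' : I -> R) : rpoly r' x' != 0 by apply: monic_neq0; apply: rpoly_monic.
have UV0 : U * rpoly r2 y + V * rpoly r1 x = 0.
  apply/polyP => j; rewrite coef0; have [jN|jN] := ltnP j N.
    by rewrite -(mul_syl _ _ _ (Ordinal jN)) wM mxE.
  rewrite nth_default // (leq_trans _ jN) // (leq_trans (size_polyD _ _)) //.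
  have b n k (p : {poly R}) (r' : seq I) (x' : I -> R) : (size p <= n)%N -> size r' = k ->
      (size (p * rpoly r' x')%R <= n + k)%N.
    move=> pn rk; rewrite (leq_trans (size_polyMleq _ _)) // size_rpoly addnS /= rk.
    by rewrite leq_add2r.
  by rewrite geq_max (b m1 m2) ?size_polyrow //= addnC (b m2 m1) ?size_polyrow.
have U0 : U = 0.
  apply/eqP/negPn/negP => Un0.
  have : rpoly r1 x %| U.
    rewrite -(Gauss_dvdpl _ cop); apply/dvdpP; exists (- V).
    by rewrite mulNr; apply/eqP; rewrite -subr_eq0 opprK UV0.
  move/(dvdp_leq Un0); rewrite size_rpoly leqNgt ltnS.
  by rewrite size_polyrow.
have V0 : V = 0.
  by move/eqP: UV0; rewrite U0 mul0r add0r mulf_eq0 (negPf (q0 _ _)) orbF => /eqP.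
apply/matrixP => i j; rewrite ord1 mxE; case: (split_ordP j) => k ->.
  have := congr1 (fun p : {poly R} => p`_k) U0; rewrite coef_polyrow coef0.
  rewrite insubT //= => kk wk; apply: etrans wk; congr (w _ (lshift _ _)); exact: val_inj.
have := congr1 (fun p : {poly R} => p`_k) V0; rewrite coef_polyrow coef0.
rewrite insubT //= => kk wk; apply: etrans wk; congr (w _ (rshift _ _)); exact: val_inj.
Qed.

(** Compactness: configurations with determinants tending to 0 have a limit along an ultrafilter.
    Its clusters are still separated by [g], so its factors are coprime and its determinant is not
    0. *)
Lemma det_syl_lb (C g : R) : 0 < g -> exists2 e : R, 0 < e & forall x : I -> R,
  (forall i, `|x i| <= C) ->
  (forall i j, i \in r1 -> j \in r2 -> g <= `|x i - x j|) ->
  e <= `|\det (syl (cf x x))|.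
Proof.
move=> g0; apply: contrapT => H.
have {}H n : exists x : I -> R, [/\ forall i, `|x i| <= C,
   forall i j, i \in r1 -> j \in r2 -> g <= `|x i - x j| &
   `|\det (syl (cf x x))| < n.+1%:R^-1].
  apply: contrapT => /forallNP Hn; apply: H; exists n.+1%:R^-1; first by rewrite invr_gt0.
  move=> x xC xg; rewrite leNgt; apply/negP => xn; exact: (Hn x).
have /choice[x xP] := H.
have [F [FU oF]] := ultra_nat_ex.
have FP : ProperFilter F by exact: ultra_proper.
have /choice[y yP] : forall i, exists l : R, (fun n => x n i) @ F --> l.
  move=> i; apply: (@ultra_bounded_cvg R nat F FU _ C).
  by apply: nearW => n; have [] := xP n.
have ccf k : (fun n => cf (x n) (x n) k 0) @ F --> cf y y k 0.
  case: (split_ordP k) => i ->.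
    rewrite /cf (_ : (fun n => _) = fun n => (rpoly r1 (x n))`_i).
      by rewrite col_mxEu mxE; apply: rpoly_cvg.
    by apply/funext => n; rewrite col_mxEu mxE.
  rewrite /cf (_ : (fun n => _) = fun n => (rpoly r2 (x n))`_i).
    by rewrite col_mxEd mxE; apply: rpoly_cvg.
  by apply/funext => n; rewrite col_mxEd mxE.
have cdet : (fun n => \det (syl (cf (x n) (x n)))) @ F --> \det (syl (cf y y)).
  exact: polyfun_cvg (polyfun_det polyfun_syl) ccf.
have /negP[] : \det (syl (cf y y)) != 0.
  apply/det_syl_neq0/rpoly_coprime => i j ir jr; rewrite -subr_eq0 -normr_gt0.
  have H1 : (fun n => `|x n i - x n j|) @ F --> `|y i - y j|.
    by apply: cvg_norm; apply: cvgB.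
  apply: lt_le_trans g0 (cvgr_to_ge H1 _).
  by apply: nearW => n; have [_ /(_ i j ir jr)] := xP n.
rewrite -normr_le0; apply/ler_addgt0Pl => e e0; rewrite addr0.
have H2 : (fun n => `|\det (syl (cf (x n) (x n)))|) @ F --> `|\det (syl (cf y y))|.
  by apply: cvg_norm; exact: cdet.
apply: (cvgr_to_le H2).
apply: oF; near=> n; have [_ _ /ltW] := xP n; move/le_trans; apply.
by apply/ltW; near: n; apply: near_infty_natSinv_lt (PosNum e0).
Unshelve. all: by end_near. Qed.

Section SplitFamily.
Variables (Om : Type) (x : Om -> I -> R -> R) (C g : R).
Hypothesis g0 : 0 < g.
Hypothesis x_cont : forall w i (t : R), `|t| < 1 -> {for t, continuous (x w i)}.
Hypothesis x_bound : forall w i (t : R), `|t| < 1 -> `|x w i t| <= C.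
Hypothesis x_sep : forall w i j (t : R), `|t| < 1 -> i \in r1 -> j \in r2 ->
  g <= `|x w i t - x w j t|.

Let P w t := rpoly r1 (x w ^~ t) * rpoly r2 (x w ^~ t).
Let c w t := cf (x w ^~ t) (x w ^~ t).

(** With [P = q1 q2], the increment is [P' - P = (q1' - q1) q2' + (q2' - q2) q1], which is linear in
    the increments of the two factors; Cramer's rule solves it. *)
Lemma split_diff w (t t' : R) j : `|t| < 1 -> 
  \det (syl (cf (x w ^~ t) (x w ^~ t'))) * (c w t' j 0 - c w t j 0) =
  \sum_(k < N) ((P w t')`_k - (P w t)`_k) * (\adj (syl (cf (x w ^~ t) (x w ^~ t')))) k j.
Proof.
move=> t1; set S := syl _; set d : 'rV[R]_N := (c w t' - c w t)^T.
have dS (k : 'I_N) : (d *m S) 0 k = (P w t')`_k - (P w t)`_k.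
  rewrite mul_syl.
  have pr (r : seq I) : polyrow (fun i : 'I_(size r) => (rpoly r (x w ^~ t'))`_i
      - (rpoly r (x w ^~ t))`_i) = rpoly r (x w ^~ t') - rpoly r (x w ^~ t).
    apply/polyP => l; rewrite coef_polyrow coefB; case: insubP => [i _ <-|] //.
    rewrite -leqNgt leq_eqVlt => /orP[/eqP <-|rl]; first by rewrite !rpoly_lead subrr.
    by rewrite !rpoly_over ?subrr.
  have -> : (fun i => d 0 (lshift m2 i)) = (fun i : 'I_m1 => (rpoly r1 (x w ^~ t'))`_i
      - (rpoly r1 (x w ^~ t))`_i).
    by apply/funext => i; rewrite !mxE /c /cf -![lshift m2 i]/(fintype.unsplit (inl i)) !fintype.unsplitK !mxE.
  have -> : (fun i => d 0 (rshift m1 i)) = (fun i : 'I_m2 => (rpoly r2 (x w ^~ t'))`_i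
      - (rpoly r2 (x w ^~ t))`_i).
    by apply/funext => i; rewrite !mxE /c /cf -![rshift m1 i]/(fintype.unsplit (inr i)) !fintype.unsplitK !mxE.
  rewrite !pr -coefB; set q := _ + _; suff -> : q = P w t' - P w t by [].
  by rewrite /q /P; ring.
transitivity ((d *m S *m \adj S) 0 j).
  by rewrite -mulmxA mul_mx_adj mul_mx_scalar !mxE.
by rewrite mxE; apply: eq_bigr => k _; rewrite dS.
Qed.

(** The coefficients of the factors are as regular as those of the product: [split_diff], divided by
    the time increment, has in the limit a derivative expressed by the derivative of [P] and by the
    coefficients themselves, with the resultant as denominator. Hence one order is gained at each
    step. *)
Lemma split_UCB n : (forall j, UCB n (fun w t => (P w t)`_j)) ->
  forall j : 'I_N, UCB n (fun w t => c w t j 0).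
Proof.
have c0 j : UCB 0 (fun w t => c w t j 0).
  apply/UCB0; have [t0 t01] : exists t : R, `|t| < 1 by exists 0; rewrite normr0.
  exists ((1 + `|C|) ^+ m1 + (1 + `|C|) ^+ m2); first by rewrite addr_ge0 ?exprn_ge0 ?addr_ge0.
  move=> w t t1; rewrite /c /cf.
  have xC i : `|x w i t| <= `|C| by rewrite (le_trans (x_bound _ _ t1)) ?ler_norm.
  case: (split_ordP j) => i ->; rewrite ?col_mxEu ?col_mxEd mxE.
    rewrite (le_trans (rpoly_coef_bound _ _ _ xC)) // lerDl exprn_ge0 // addr_ge0 //.
  rewrite (le_trans (rpoly_coef_bound _ _ _ xC)) // lerDr exprn_ge0 // addr_ge0 //.
elim: n => [|n IH] // uP j; apply/UCBS; split=> //.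
have {}IH k : UCB n (fun w t => c w t k 0).
  by apply: IH => k'; apply: UCB_le (uP k').
have /choice[P' P'P] : forall k, exists P', (forall w (t : R), `|t| < 1 ->
    is_derive t 1 (fun t => (P w t)`_k) (P' w t)) /\ UCB n P'.
  by move=> k; have /UCBS[_ [P' ? ?]] := uP k; exists P'.
have [e e0 eP] := det_syl_lb C g0.
have det_lb w t : `|t| < 1 -> e <= `|\det (syl (c w t))|.
  by move=> t1; apply: eP => [i|i k ir kr]; [exact: x_bound|exact: x_sep].
exists (fun w t => (\sum_(k < N) P' k w t * (\adj (syl (c w t))) k j) * (\det (syl (c w t)))^-1).
  move=> w t t1.
  have H : (fun h : R => h^-1 *: (((fun t => c w t j 0) \o shift t) (h *: 1) - c w t j 0)) @ 0^' -->
      (\sum_(k < N) P' k w t * (\adj (syl (c w t))) k j) * (\det (syl (c w t)))^-1.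
    pose cc h := cf (x w ^~ t) (x w ^~ (h + t)).
    have ccv i : (fun h => cc h i 0) @ 0^' --> c w t i 0.
      rewrite /cc /c /cf; case: (split_ordP i) => l ->.
        rewrite (_ : (fun h => _) = fun=> (rpoly r1 (x w ^~ t))`_l).
          by rewrite col_mxEu mxE; apply: cvg_cst.
        by apply/funext => h; rewrite col_mxEu mxE.
      rewrite (_ : (fun h => _) = fun h => (rpoly r2 (x w ^~ (h + t)))`_l).
        rewrite col_mxEd mxE; apply: rpoly_cvg => i'.
        have := @x_cont w i' t t1; rewrite /prop_for /continuous_at.
        move=> xc; apply: (@cvg_comp _ _ _ (fun h => h + t) (x w i') _ (nbhs t)) => //.
        apply: cvg_trans; first by apply: cvg_app; apply: nbhs_dnbhs.
        by rewrite -[X in _ --> X]add0r; apply: cvgD; [exact: cvg_id|exact: cvg_cst].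
      by apply/funext => h; rewrite col_mxEd mxE.
    have cdet : (fun h => \det (syl (cc h))) @ 0^' --> \det (syl (c w t)).
      exact: polyfun_cvg (polyfun_det polyfun_syl) ccv.
    have cadj k : (fun h => (\adj (syl (cc h))) k j) @ 0^' --> (\adj (syl (c w t))) k j.
      exact: polyfun_cvg (polyfun_adj _ _ polyfun_syl) ccv.
    have dn0 : \det (syl (c w t)) != 0.
      by rewrite -normr_gt0 (lt_le_trans e0) // det_lb.
    have dnear : \forall h \near 0^', \det (syl (cc h)) != 0.
      have dn1 : 0 < `|\det (syl (c w t))| by rewrite normr_gt0.
      near=> h; rewrite -normr_gt0; near: h; exact: cvgr_norm_gt cdet _ dn1.
    apply: cvg_trans (_ : (fun h => (\sum_(k < N)
        (h^-1 *: ((P w (h *: 1 + t))`_k - (P w t)`_k)) * (\adj (syl (cc h))) k j)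
        * (\det (syl (cc h)))^-1) @ 0^' --> _).
      apply: near_eq_cvg; near=> h.
      have hd : \det (syl (cc h)) != 0 by near: h; exact: dnear.
      apply: (mulIf hd); rewrite mulfVK // /GRing.scale /= mulr1 -mulrA [_ * \det _]mulrC.
      rewrite (split_diff w (h + t) j t1) mulr_sumr.
      by apply: eq_bigr => k _; rewrite -mulrA.
    apply: cvgM; last exact: cvgV.
    apply: cvg_bigsum => k; apply: cvgM; last exact: cadj.
    have [/(_ w t t1) dP _] := P'P k.
    have := @ex_derive _ _ _ _ _ _ _ dP; rewrite /derivable => /cvg_ex[l lP].
    have := derive_val (is_derive := dP).
    by rewrite /derive (cvg_lim _ lP) // => <-.
  by apply: DeriveDef; [apply: cvgP; exact: H|apply: (cvg_lim _ H)].
apply: UCB_M.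
  apply: UCB_sum => k _; apply: UCB_M; first by have [] := P'P k.
  exact: (UCB_polyfun (polyfun_adj _ _ polyfun_syl)).
apply: UCB_V; last by exists e.
exact: (UCB_polyfun (polyfun_det polyfun_syl)).
Unshelve. all: by end_near. Qed.

End SplitFamily.
End Split.

(** * Gaps between roots *)

Section Bronshtein.
Variable R : realType.

Lemma is_derive_affine (v : R -> R) (c k s t d : R) : is_derive (k + s * t) 1 v d ->
  is_derive t 1 (fun t => c * v (k + s * t)) (c * s * d).
Proof.
move=> vd.
have lin : is_derive t 1 (fun t => k + s * t) s.
  have h1 : is_derive t 1 (fun t : R => s * t) (s * 1).
    have := @is_deriveZ R _ _ (fun t : R => t) s t 1 1 (is_derive_id _ _).
    by [].
  have := @is_deriveD R _ _ (fun=> k) _ t 1 0 _ (is_derive_cst _ _ _) h1.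
  by rewrite mulr1 add0r.
have comp := @is_derive1_comp R v (fun t => k + s * t) t d s vd lin.
have := @is_deriveZ R _ _ _ c t 1 _ comp.
by rewrite /GRing.scale /= [d * s]mulrC mulrA.
Qed.

Lemma CB_affine n (B c k s : R) u : (forall t : R, `|t| < 1 -> `|k + s * t| < 1) ->
  `|s| <= 1 -> CB n B u -> CB n (`|c| * B) (fun t => c * u (k + s * t)).
Proof.
move=> ks s1 [v [<- cv vB]]; exists (fun i t => c * s ^+ i * v i (k + s * t)); split.
- by apply/funext => t; rewrite expr0 mulr1.
- move=> i ni t t1; have := is_derive_affine (c * s ^+ i) (cv i ni _ (ks t t1)).
  by rewrite exprSr mulrA.
- move=> i ni t t1; rewrite !normrM -mulrA ler_wpM2l //.
  rewrite -[leRHS]mul1r ler_pM ?vB ?ks // normrX exprn_ile1 //.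
Qed.

Lemma chain_affine n (c k s : R) v : (forall t : R, `|t| < 1 -> `|k + s * t| < 1) ->
  chain n v -> chain n (fun i t => c * s ^+ i * v i (k + s * t)).
Proof.
move=> ks cv i ni t t1; have := is_derive_affine (c * s ^+ i) (cv i ni _ (ks t t1)).
by rewrite exprSr mulrA.
Qed.

Lemma sorted_gap (s : seq R) (x g : R) : path <=%R x s -> g * (size s)%:R < last x s - x ->
  exists u v, [/\ u \in x :: s, v \in x :: s, g < v - u &
    forall z, z \in x :: s -> z <= u \/ v <= z].
Proof.
elim: s x => [|y s IH] x /=; first by rewrite mulr0 subrr ltxx.
move=> /andP[xy ps] H.
have ymin z : z \in y :: s -> y <= z.
  rewrite in_cons => /orP[/eqP -> //|zs].
  by have /allP/(_ z zs) := order_path_min le_trans ps.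
have [gxy|xyg] := ltP g (y - x).
  exists x, y; split; rewrite ?in_cons ?eqxx ?orbT //.
  by move=> z /orP[/eqP ->|zs]; [left|right; apply: ymin].
have [|u [v [us vs uv H']]] := IH y ps.
  by move: H; rewrite -natr1 mulrDr mulr1 => H; lra.
exists u, v; split=> //; try by rewrite in_cons ?us ?vs orbT.
move=> z; rewrite in_cons => /orP[/eqP ->|/H' //].
by left; rewrite (le_trans xy) // ymin.
Qed.

Lemma path_le_last (s : seq R) (x z : R) : path <=%R x s -> z \in x :: s -> z <= last x s.
Proof.
elim: s x z => [|y s IH] x z /=; first by rewrite inE => _ /eqP ->.
move=> /andP[xy ps]; rewrite in_cons => /orP[/eqP ->|]; last exact: IH.
by rewrite (le_trans xy) // IH // mem_head.
Qed.

Variable I : finType.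

(** Let [m] be the number of roots. As the squares add up to 1, some root has absolute value at
    least [1 / m]; as the sum is 0, another has the opposite sign. The spread exceeds [1 / m] and
    consists of [m - 1] gaps, one of which exceeds [1 / m ^ 2]; [th] is its midpoint and [g] half of
    that bound. *)
Lemma root_gap (r : seq I) : exists2 g : R, 0 < g <= 1 & forall y : I -> R,
  \sum_(i <- r) y i = 0 -> \sum_(i <- r) y i ^+ 2 = 1 ->
  exists2 th : R, `|th| <= 1 & [/\ forall i, i \in r -> g <= `|y i - th|,
    exists2 i, i \in r & y i < th & exists2 i, i \in r & th < y i].
Proof.
case: (posnP (size r)) => [/size0nil ->|r0].
  exists 1 => [|y _]; first by rewrite lexx ltr01.
  by rewrite big_nil => /esym/eqP; rewrite oner_eq0.
set m : R := (size r)%:R; have m1 : 1 <= m by rewrite /m ler1n.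
have m0 : 0 < m by apply: lt_le_trans m1.
have g2 : 0 < m^-1 ^+ 2 by rewrite exprn_gt0 // invr_gt0.
have g21 : m^-1 ^+ 2 <= 1 by rewrite exprn_ile1 ?invr_ge0 ?(ltW m0) // invf_le1.
exists (m^-1 ^+ 2 / 2) => [|y y0 y1]; first by apply/andP; split; lra.
have sq_le i : i \in r -> y i ^+ 2 <= 1.
  move=> ir; rewrite -y1 (big_rem i) //= lerDl sumr_ge0 // => j _; exact: sqr_ge0.
have abs_le i : i \in r -> `|y i| <= 1.
  by move=> /sq_le; rewrite -[X in _ <= X](expr1n _ 2) -(real_normK (num_real (y i))) ler_pXn2r // nnegrE.
have [i ir yi] : exists2 i, i \in r & m^-1 <= `|y i|.
  apply: contrapT => H; have : \sum_(i <- r) y i ^+ 2 < 1.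
    apply: (@le_lt_trans _ _ (\sum_(i <- r) m^-1 * `|y i|)).
      rewrite big_seq [leRHS]big_seq; apply: ler_sum => i ir.
      rewrite -(real_normK (num_real (y i))) expr2 ler_wpM2r // ltW // ltNge.
      by apply/negP => yi; apply: H; exists i.
    apply: (@le_lt_trans _ _ (\sum_(i <- r) m^-1 * m^-1)).
      rewrite big_seq [leRHS]big_seq; apply: ler_sum => i ir.
      rewrite ler_pM2l ?invr_gt0 // ltW // ltNge.
      by apply/negP => yi; apply: H; exists i.
    rewrite big_const_seq count_predT iter_addr_0 -mulr_natr -/m mulfVK ?gt_eqF //.
    rewrite lt_neqAle invf_le1 // m1 andbT; apply: contraPneq y1.
    move=> mm; have {}mm : m = 1 by rewrite -(invrK m) mm invr1.
    have /eqP s1 : size r == 1%N by rewrite -(eqr_nat R) -/m mm.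
    case: r s1 {r0 m m1 m0 g2 g21 mm sq_le abs_le H} y0 => [|j [|]] //= _.
    by rewrite !big_seq1 => ->; rewrite expr0n => /eqP; rewrite eq_sym oner_eq0.
  by rewrite y1 ltxx.
have opp (z : I -> R) : \sum_(i <- r) z i = 0 -> 0 < z i -> exists2 j, j \in r & z j < 0.
  move=> z0 zi; apply: contrapT => H.
  have zp j : j \in r -> 0 <= z j by move=> jr; rewrite leNgt; apply/negP => zj; apply: H; exists j.
  move: z0; rewrite (big_rem i) //= => /eqP; rewrite paddr_eq0 ?(ltW zi) //.
    by rewrite gt_eqF.
  by rewrite big_seq sumr_ge0 // => j /mem_rem; apply: zp.
have [lo [hi [lor hir lohi]]] : exists lo hi, [/\ lo \in r, hi \in r & m^-1 < y hi - y lo].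
  have im : 0 < m^-1 by rewrite invr_gt0.
  case: (lerP 0 (y i)) => yi0; move: yi; [rewrite ger0_norm //|rewrite ltr0_norm //] => yi.
    have [|j jr yj] := opp y y0; first exact: lt_le_trans yi.
    by exists j, i; split=> //; lra.
  have [||j jr yj] := opp (fun i => - y i); rewrite ?sumrN ?y0 ?oppr0 ?oppr_gt0 //.
  by exists i, j; split=> //; lra.
set s := sort <=%R (map y r).
have ss : sorted <=%R s by apply: sort_sorted; apply: le_total.
have ms z : z \in s -> exists2 j, j \in r & z = y j.
  by rewrite mem_sort => /mapP[j jr ->]; exists j.
have ys j : j \in r -> y j \in s by move=> jr; rewrite mem_sort map_f.
have szs : size s = size r by rewrite size_sort size_map.
case Es: s ss szs ms ys => [|x0 s'] ss szs ms ys; first by have := ys _ ir.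
have xmin z : z \in x0 :: s' -> x0 <= z.
  rewrite in_cons => /orP[/eqP -> //|zs].
  by have /allP/(_ z zs) := order_path_min le_trans ss.
have [|u [v [us vs uv uvP]]] := @sorted_gap s' x0 (m^-1 ^+ 2) ss.
  have h1 : y hi <= last x0 s' by apply: path_le_last => //; exact: ys.
  have h2 : x0 <= y lo by apply: xmin; exact: ys.
  apply: (@lt_le_trans _ _ m^-1); last by lra.
  rewrite expr2 -mulrA -[ltRHS]mulr1 ltr_pM2l ?invr_gt0 // mulrC ltr_pdivrMr // mul1r.
  by rewrite /m ltr_nat -szs /=.
have [[iu iur Eu] [iv ivr Ev]] := (ms _ us, ms _ vs).
exists ((u + v) / 2).
  have := abs_le _ iur; have := abs_le _ ivr; rewrite -Eu -Ev !ler_norml.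
  by move=> /andP[? ?] /andP[? ?]; apply/andP; split; lra.
split=> [j jr||]; last 2 first.
- by exists iu => //; rewrite -Eu; lra.
- by exists iv => //; rewrite -Ev; lra.
by have [?|?] := uvP _ (ys _ jr); rewrite ler_normr; apply/orP; [right|left]; lra.
Qed.

Lemma stay_below (f : R -> R) (z d : R) : d <= 1 ->
  (forall t : R, `|t| < 1 -> {for t, continuous f}) ->
  (forall t : R, `|t| < d -> f t != z) -> f 0 < z -> forall t : R, `|t| < d -> f t < z.
Proof.
move=> d1 fc fz f0 t td; rewrite ltNge; apply/negP => zt.
have [c [cd fcz]] : exists c : R, `|c| < d /\ f c = z.
  have [t0|/ltW t0] := leP 0 t.
    have [||c cI fcz] := @IVT R f 0 t z t0.
    - apply: continuous_in_subspaceT => w; rewrite inE /= in_itv /= => /andP[w0 wt].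
      apply: fc; rewrite ger0_norm //; move: td; rewrite ger0_norm // => td.
      by rewrite (le_lt_trans wt) // (lt_le_trans td).
    - by rewrite ge_min le_max (ltW f0) zt orbT.
    exists c; split=> //; move: cI; rewrite in_itv /= => /andP[c0 ct].
    by rewrite ger0_norm // (le_lt_trans ct) // -(ger0_norm t0).
  have [||c cI fcz] := @IVT R f t 0 z t0.
  - apply: continuous_in_subspaceT => w; rewrite inE /= in_itv /= => /andP[tw w0].
    apply: fc; rewrite ler0_norm //; move: td; rewrite ler0_norm // => td.
    by rewrite (@le_lt_trans _ _ (- t)) ?lerN2 // (lt_le_trans td).
  - by rewrite ge_min le_max (ltW f0) zt orbT.
  exists c; split=> //; move: cI; rewrite in_itv /= => /andP[tc c0].
  by rewrite ler0_norm // (@le_lt_trans _ _ (- t)) ?lerN2 // -(ler0_norm t0).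
by have := fz c cd; rewrite fcz eqxx.
Qed.

Lemma stay_above (f : R -> R) (z d : R) : d <= 1 ->
  (forall t : R, `|t| < 1 -> {for t, continuous f}) ->
  (forall t : R, `|t| < d -> f t != z) -> z < f 0 -> forall t : R, `|t| < d -> z < f t.
Proof.
move=> d1 fc fz f0 t td; rewrite -ltrN2.
apply: (@stay_below (fun t => - f t) (- z) d) => //.
- by move=> w w1; apply: continuousN; exact: fc.
- by move=> w wd; rewrite eqr_opp fz.
- by rewrite ltrN2.
Qed.

End Bronshtein.

(** * Localisation and separation of clusters *)

Section BronshteinStep.
Variables (R : realType) (I : finType).

(** Glaeser's inequality: nonnegativity at [t0 + k / 2] and [t0 - k / 2], with Taylor's formula,
    bounds [|p' t0|] by a multiple of [A sqrt (p t0)]. Over times of order [sqrt (p t0) / A] the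
    function therefore keeps its order of magnitude; the factor 8 leaves room for the bounds 1/2 and
    3/2. *)
Lemma glaeser (A : R) (p p' : R -> R) (t0 : R) : 1 <= A ->
  (forall t : R, `|t| < 1 -> 0 <= p t <= A) ->
  (forall t : R, `|t| < 1 -> is_derive t 1 p (p' t)) -> CB 1 A p' ->
  `|t0| < 1 / 2 -> 0 < p t0 ->
  forall t : R, `|t| < 1 -> `|t0 + Num.sqrt (p t0) / (8 * A) * t| < 1 /\
    p t0 / 2 <= p (t0 + Num.sqrt (p t0) / (8 * A) * t) <= 3 / 2 * p t0.
Proof.
move=> A1 pA pp' cp' t0h p0 t t1; set rho := Num.sqrt (p t0).
have A0 : 0 < A by apply: lt_le_trans A1.
have t01 : `|t0| < 1 by lra.
have rho2 : rho ^+ 2 = p t0 by rewrite sqr_sqrtr // ltW.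
have rho0 : 0 < rho by rewrite sqrtr_gt0.
have rhoA : rho <= A.
  rewrite -(@ler_pXn2r _ 2) ?nnegrE ?(ltW rho0) ?(ltW A0) // rho2.
  have /andP[_ H] := pA t0 t01; rewrite (le_trans H) // expr2.
  by rewrite -{1}(mul1r A) ler_wpM2r // ltW.
set k := rho / A; have k0 : 0 < k by rewrite divr_gt0.
have k1 : k <= 1 by rewrite ler_pdivrMr // mul1r.
have kA : A * k ^+ 2 <= rho ^+ 2.
  rewrite /k expr_div_n mulrCA expr2 -!mulrA invfM mulVKf ?gt_eqF //.
  by rewrite mulrA -expr2 ler_pdivrMr // ler_peMr // sqr_ge0.
have -> : rho / (8 * A) * t = k / 8 * t by rewrite /k; field; rewrite gt_eqF.
set h := k / 8 * t.
have hk : `|h| <= k / 8.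
  rewrite /h normrM (gtr0_norm (_ : 0 < k / 8)) ?divr_gt0 //.
  by rewrite ler_piMr ?ltW // divr_gt0.
have inside d : `|d| <= 1 / 2 -> `|t0 + d| < 1.
  by move=> d1; rewrite (le_lt_trans (ler_normD _ _)) //; lra.
have h1 : `|t0 + h| < 1 by apply: inside; lra.
split=> //.
have T d : `|d| <= 1 / 2 -> `|p (t0 + d) - p t0 - d * p' t0| <= A * d ^+ 2.
  move=> d1; have := taylor2 pp' cp' t01 (inside d d1).
  by have -> : t0 + d - t0 = d by ring.
have k2 : `|k / 2| <= 1 / 2 by rewrite ger0_norm ?divr_ge0 ?(ltW k0) //; lra.
have k2' : `|- (k / 2)| <= 1 / 2 by rewrite normrN.
have P' : k / 2 * `|p' t0| <= 5 / 4 * rho ^+ 2.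
  have /andP[pos1 _] := pA _ (inside _ k2); have /andP[pos2 _] := pA _ (inside _ k2').
  have := T _ k2; have := T _ k2'; rewrite !ler_norml sqrrN => /andP[_ u1] /andP[_ u2].
  have e : A * (k / 2) ^+ 2 <= rho ^+ 2 / 4 by rewrite expr_div_n mulrA; lra.
  rewrite -rho2 in u1 u2.
  by case: (ger0P (p' t0)) => _; lra.
have := T h (le_trans hk _); rewrite -rho2.
have hp : `|h * p' t0| <= 5 / 16 * rho ^+ 2.
  rewrite normrM (le_trans (ler_wpM2r (normr_ge0 _) hk)) //; lra.
have hA : A * h ^+ 2 <= rho ^+ 2 / 64.
  have : h ^+ 2 <= (k / 8) ^+ 2.
    by rewrite -(real_normK (num_real h)) ler_pXn2r ?nnegrE ?divr_ge0 ?(ltW rho0) ?(ltW A0).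
  move/(ler_wpM2l (ltW A0)) => H; apply: le_trans H _.
  by rewrite expr_div_n mulrA; lra.
have rr := sqr_ge0 rho.
move: hp; rewrite ler_norml => /andP[h3 h4] H.
have /H : k / 8 <= 1 / 2 by lra.
by rewrite ler_norml => /andP[h5 h6]; apply/andP; split; lra.
Qed.

(** At time 0 the polynomial is at least [g ^ m] in absolute value at [z]. Its coefficients are
    Lipschitz in time and [|z| <= 3], so its value at [z] varies by at most [D |t|]. *)
Lemma roots_persist (Om : Type) (r : seq I) (y : Om -> I -> R -> R) (g : R) :
  0 < g <= 1 -> (forall j, UCB 1 (fun w t => (rpoly r (y w ^~ t))`_j)) ->
  exists2 d : R, 0 < d <= 1 & forall w (z : R), `|z| <= 3 ->
    (forall i, i \in r -> g <= `|z - y w i 0|) ->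
    forall t : R, `|t| < d -> forall i, i \in r -> y w i t != z.
Proof.
move=> /andP[g0 g1] uy; have /choice[B BP] : forall j, exists B : R, 0 <= B /\
    forall w, CB 1 B (fun t => (rpoly r (y w ^~ t))`_j).
  by move=> j; have [B B0 HB] := uy j; exists B.
set m := size r; pose D := \sum_(j < m.+1) B j * 3 ^+ j.
have D0 : 0 <= D by apply: sumr_ge0 => j _; rewrite mulr_ge0 ?exprn_ge0 //; have [] := BP j.
have gm : 0 < g ^+ m <= 1 by rewrite exprn_gt0 // exprn_ile1 // ltW.
have D1 : 0 < D + 1 by lra.
exists (g ^+ m / (D + 1)) => [|w z z3 zy t td i ir].
  rewrite divr_gt0 ?(andP gm).1 //= ler_pdivrMr // mul1r.
  by move/andP: gm => [_ gm]; lra.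
have t1 : `|t| < 1.
  rewrite (lt_le_trans td) // ler_pdivrMr // mul1r; move/andP: gm => [_ gm]; lra.
have t0 : `|0 : R| < 1 by rewrite normr0.
apply/eqP => yz.
have Pt0 : (rpoly r (y w ^~ t)).[z] = 0.
  rewrite rpoly_horner (big_rem i) //= yz subrr mul0r //.
have P0 : g ^+ m <= `|(rpoly r (y w ^~ 0)).[z]|.
  rewrite rpoly_horner normr_prod /m; elim: (r) zy => [|j s IH] zy.
    by rewrite big_nil expr0.
  rewrite big_cons exprS ler_pM ?exprn_ge0 ?(ltW g0) //.
    by apply: zy; rewrite mem_head.
  by apply: IH => j' js; apply: zy; rewrite in_cons js orbT.
have : `|(rpoly r (y w ^~ 0)).[z]| <= D * `|t|.
  have -> : (rpoly r (y w ^~ 0)).[z] = (rpoly r (y w ^~ 0)).[z] - (rpoly r (y w ^~ t)).[z].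
    by rewrite Pt0 subr0.
  rewrite distrC.
  rewrite !(@horner_coef_wide _ m.+1) ?size_rpoly // -sumrB.
  rewrite (le_trans (ler_norm_sum _ _ _)) // mulr_suml; apply: ler_sum => j _.
  rewrite -mulrBl normrM mulrAC ler_pM //.
    by have [_ HB] := BP j; have := CB_lip (HB w) t0 t1; rewrite subr0.
  by rewrite normrX lerXn2r ?nnegrE.
have [D00|Dn0] := eqVneq D 0.
  by rewrite D00 mul0r => H; have := lt_le_trans (andP gm).1 (le_trans P0 H); rewrite ltxx.
rewrite leNgt => /negP; apply.
apply: lt_le_trans P0; apply: (@le_lt_trans _ _ ((D + 1) * `|t|)).
  by rewrite ler_wpM2r //; lra.
by rewrite mulrC -ltr_pdivlMr.
Qed.

(* The conclusion of Bronshtein's theorem, uniform in the parameter [w]. *)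
Definition lipschitz_roots (r : seq I) := forall (Om : Type) (x : Om -> I -> R -> R),
  (forall w i (t : R), `|t| < 1 -> {for t, continuous (x w i)}) ->
  (forall j, UCB (size r) (fun w t => (rpoly r (x w ^~ t))`_j)) ->
  exists2 L : R, 0 <= L & forall w i, i \in r -> forall t s : R,
    `|t| < 1 / 2 -> `|s| < 1 / 2 -> `|x w i t - x w i s| <= L * `|t - s|.

Lemma rpoly_filter (r : seq I) (A : {set I}) (x : I -> R) :
  rpoly r x = rpoly [seq i <- r | i \in A] x * rpoly [seq i <- r | i \notin A] x.
Proof. by rewrite /rpoly !big_filter (bigID (mem A)). Qed.

Lemma lipschitz_split (Om : Type) (r : seq I) (A : {set I}) (y : Om -> I -> R -> R) (g : R) :
  lipschitz_roots [seq i <- r | i \in A] -> lipschitz_roots [seq i <- r | i \notin A] ->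
  0 < g -> (forall w i (t : R), `|t| < 1 -> {for t, continuous (y w i)}) ->
  (forall w i (t : R), `|t| < 1 -> `|y w i t| <= 2) ->
  (forall w i j (t : R), `|t| < 1 -> i \in r -> j \in r -> i \in A -> j \notin A ->
     g <= `|y w i t - y w j t|) ->
  (forall j, UCB (size r) (fun w t => (rpoly r (y w ^~ t))`_j)) ->
  exists2 L : R, 0 <= L & forall w i, i \in r -> forall t s : R,
    `|t| < 1 / 2 -> `|s| < 1 / 2 -> `|y w i t - y w i s| <= L * `|t - s|.
Proof.
set r1 := [seq i <- r | i \in A]; set r2 := [seq i <- r | i \notin A].
move=> L1 L2 g0 yc y2 ysep uy.
have sz : (size r1 + size r2)%N = size r by rewrite !size_filter count_predC.
have ucf k : UCB (size r) (fun w t => cf r1 r2 (y w ^~ t) (y w ^~ t) k 0).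
  apply: (split_UCB (C := 2) g0 yc y2) => [w i j t t1 ir jr|j].
    by move: ir jr; rewrite !mem_filter => /andP[iA ir] /andP[jA jr]; apply: ysep.
  have := uy j; congr UCB; apply/funext => w; apply/funext => t.
  by rewrite (rpoly_filter r A).
have cst0 n : @UCB R Om n (fun _ _ => 0) by apply: (UCB_cst n (B := 0)) => _; rewrite normr0.
have cst1 n : @UCB R Om n (fun _ _ => 1) by apply: (UCB_cst n (B := 1)) => _; rewrite normr1.
have u1 j : UCB (size r1) (fun w t => (rpoly r1 (y w ^~ t))`_j).
  have [jr|jr|->] := ltngtP j (size r1).
  - apply: (@UCB_le _ _ (size r)); first by rewrite -sz leq_addr.
    have := ucf (lshift (size r2) (Ordinal jr)); congr UCB.
    by apply/funext => w; apply/funext => t; rewrite /cf col_mxEu mxE.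
  - rewrite (_ : (fun _ _ => _) = (fun _ _ => 0)) //.
    by apply/funext => w; apply/funext => t; rewrite rpoly_over.
  - rewrite (_ : (fun _ _ => _) = (fun _ _ => 1)) //.
    by apply/funext => w; apply/funext => t; rewrite rpoly_lead.
have u2 j : UCB (size r2) (fun w t => (rpoly r2 (y w ^~ t))`_j).
  have [jr|jr|->] := ltngtP j (size r2).
  - apply: (@UCB_le _ _ (size r)); first by rewrite -sz leq_addl.
    have := ucf (rshift (size r1) (Ordinal jr)); congr UCB.
    by apply/funext => w; apply/funext => t; rewrite /cf col_mxEd mxE.
  - rewrite (_ : (fun _ _ => _) = (fun _ _ => 0)) //.
    by apply/funext => w; apply/funext => t; rewrite rpoly_over.
  - rewrite (_ : (fun _ _ => _) = (fun _ _ => 1)) //.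
    by apply/funext => w; apply/funext => t; rewrite rpoly_lead.
have [M1 M10 M1P] := L1 _ y yc u1; have [M2 M20 M2P] := L2 _ y yc u2.
exists (M1 + M2) => [|w i ir t s th sh]; first exact: addr_ge0.
rewrite mulrDl; have [iA|iA] := boolP (i \in A).
  by rewrite (le_trans (M1P w i _ t s th sh)) ?mem_filter ?iA // lerDl mulr_ge0.
by rewrite (le_trans (M2P w i _ t s th sh)) ?mem_filter ?iA // lerDr mulr_ge0.
Qed.

(* The roots at time 0 have a gap of size [g]: the two clusters stay apart for a
   uniform time, during which the polynomial splits. *)
Lemma lipschitz_normalized (Om : Type) (r : seq I) (y : Om -> I -> R -> R) :
  (forall r', (size r' < size r)%N -> lipschitz_roots r') ->
  (forall w i (t : R), `|t| < 1 -> {for t, continuous (y w i)}) ->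
  (forall w i (t : R), `|t| < 1 -> `|y w i t| <= 2) ->
  (forall w, \sum_(i <- r) y w i 0 = 0) -> (forall w, \sum_(i <- r) y w i 0 ^+ 2 = 1) ->
  (0 < size r)%N ->
  (forall j, UCB (size r) (fun w t => (rpoly r (y w ^~ t))`_j)) ->
  exists2 d : R, 0 < d <= 1 & exists2 L : R, 0 <= L & forall w i, i \in r -> forall t : R,
    `|t| < d -> `|y w i t - y w i 0| <= L * `|t|.
Proof.
move=> IH yc y2 y0 y1 r0 uy.
have [g /andP[g0 g1] gP] := root_gap R r.
have g2 : 0 < g / 2 <= 1 by apply/andP; split; lra.
have [d d01 dP] := roots_persist g2 (fun j => UCB_le r0 (uy j)).
have /andP[d0 d1] := d01.
have /choice[th thP] : forall w, exists th : R, `|th| <= 1 /\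
    [/\ forall i, i \in r -> g <= `|y w i 0 - th|,
     exists2 i, i \in r & y w i 0 < th & exists2 i, i \in r & th < y w i 0].
  by move=> w; have [th ? ?] := gP _ (y0 w) (y1 w); exists th.
have ne w z i : i \in r -> z = th w - g / 2 \/ z = th w + g / 2 ->
    forall t : R, `|t| < d -> y w i t != z.
  move=> ir zE t td; have [th1 [thg _ _]] := thP w.
  apply: dP => // [|j jr].
    by move: th1; rewrite !ler_norml => /andP[? ?]; case: zE => ->; apply/andP; split; lra.
  have := thg j jr; rewrite !ler_normr => /orP[H|H]; apply/orP; case: zE => ->; lra.
have side w i : i \in r -> (y w i 0 < th w -> forall t : R, `|t| < d -> y w i t < th w - g / 2)
    /\ (th w < y w i 0 -> forall t : R, `|t| < d -> th w + g / 2 < y w i t).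
  move=> ir; have [_ [thg _ _]] := thP w; have := thg i ir.
  rewrite ler_normr => tg; split=> H.
    apply: (stay_below d1 (yc w i)) => [t td|]; first by apply: ne => //; left.
    by case/orP: tg => tg; lra.
  apply: (stay_above d1 (yc w i)) => [t td|]; first by apply: ne => //; right.
  by case/orP: tg => tg; lra.
(* The set of roots below the threshold depends on [w]. It takes finitely many values [A]: the
   constants are found on each subfamily with a given [A], and are added up in the end. *)
have /choice[L LP] : forall A : {set I}, exists L : R, 0 <= L /\
    forall w, A = [set i | y w i 0 < th w]%SET -> forall i, i \in r -> forall t s : R,
    `|t| < 1 / 2 -> `|s| < 1 / 2 -> `|y w i (d * t) - y w i (d * s)| <= L * `|t - s|.
  move=> A; pose Om' := {w : Om | A = [set i | y w i 0 < th w]%SET}.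
  have [[w wA]|none] := pselect (exists w, A = [set i | y w i 0 < th w]%SET); last first.
    by exists 0; split=> // w wA; case: none; exists w.
  have [_ [_ [i1 i1r i1A] [i2 i2r i2A]]] := thP w.
  have lt1 : (size [seq i <- r | i \in A] < size r)%N.
    rewrite size_filter -(count_predC (mem A) r) -[X in (X < _)%N]addn0 ltn_add2l.
    by rewrite -has_count; apply/hasP; exists i2 => //=; rewrite wA inE -leNgt ltW.
  have lt2 : (size [seq i <- r | i \notin A] < size r)%N.
    rewrite size_filter -(count_predC (mem A) r) -[X in (X < _)%N]add0n ltn_add2r.
    by rewrite -has_count; apply/hasP; exists i1 => //=; rewrite wA inE.
  pose z (q : Om') i t := y (projT1 q) i (d * t).
  have dt (t : R) : `|t| < 1 -> `|d * t| < d.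
    by move=> t1; rewrite normrM gtr0_norm // gtr_pMr.
  have dt1 (t : R) : `|t| < 1 -> `|d * t| < 1 by move=> /dt H; apply: lt_le_trans d1.
  have [||||L L0 LP] := lipschitz_split (y := z) (IH _ lt1) (IH _ lt2) g0.
  - move=> q i t t1; have := yc (projT1 q) i (d * t) (dt1 t t1).
    move=> H; rewrite /z; apply: (@continuous_comp _ _ _ (fun t => d * t) (y (projT1 q) i)) => //.
    exact: mulrl_continuous.
  - by move=> q i t t1; apply: y2; apply: dt1.
  - move=> [q qA] i j t t1 ir jr iA jA; rewrite /z /=.
    have [sb _] := side q i ir; have [_ sa] := side q j jr.
    have qi : y q i 0 < th q by move: iA; rewrite qA inE.
    have qj : th q < y q j 0.
      move: jA; rewrite qA inE -leNgt le_eqVlt => /orP[/eqP E|//].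
      have [_ [thg _ _]] := thP q; have := thg j jr; rewrite E subrr normr0.
      by rewrite leNgt g0.
    have h1 := sb qi _ (dt t t1); have h2 := sa qj _ (dt t t1).
    by rewrite ler_normr; apply/orP; right; lra.
  - move=> j; have [B B0 HB] := uy j; exists (`|1| * B) => [|q]; first by rewrite mulr_ge0.
    have := @CB_affine R (size r) B 1 0 d _ _ _ (HB (projT1 q)).
    rewrite (_ : (fun t => _) = (fun t => (rpoly r (z q ^~ t))`_j)).
      apply=> [t t1|]; first by rewrite add0r dt1.
      by rewrite gtr0_norm.
    by apply/funext => t; rewrite mul1r add0r.
  exists L; split=> // w' wA' i ir t s th' sh'.
  exact: (LP (exist _ w' wA') i ir t s th' sh').
exists (d / 2); first by apply/andP; split; lra.
exists ((\sum_A L A) / d) => [|w i ir t td].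
  by rewrite divr_ge0 ?(ltW d0) // sumr_ge0 // => A _; have [] := LP A.
have td2 : `|t / d| < 1 / 2.
  by rewrite normrM normfV (gtr0_norm d0) ltr_pdivrMr //; lra.
have h0 : `|0 : R| < 1 / 2 by rewrite normr0; lra.
have [LA0 LA] := LP [set i | y w i 0 < th w]%SET.
have := LA w erefl i ir _ _ td2 h0.
rewrite mulr0 mulrCA divff ?mulr1 ?gt_eqF // subr0 => H; apply: le_trans H _.
rewrite normrM normfV (gtr0_norm d0) -mulrA [d^-1 * _]mulrC ler_wpM2r //.
  by rewrite divr_ge0 // ltW.
rewrite (bigD1 [set i | y w i 0 < th w]%SET) //= lerDl sumr_ge0 // => A _.
by have [] := LP A.
Qed.

End BronshteinStep.

Section PolyFamilies.
Variables (R : realType) (Om : Type).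
Implicit Types (p q : Om -> R -> {poly R}).

Definition polyUCB n p := forall j, UCB n (fun w t => (p w t)`_j).

Lemma polyUCB_M n p q : polyUCB n p -> polyUCB n q -> polyUCB n (fun w t => p w t * q w t).
Proof.
move=> up uq j.
rewrite (_ : (fun _ _ => _) = (fun w t => \sum_(i < j.+1) (p w t)`_i * (q w t)`_(j - i))).
  by apply: UCB_sum => i _; apply: UCB_M; [exact: up|exact: uq].
by apply/funext => w; apply/funext => t; rewrite coefM.
Qed.

Lemma polyUCB_C n f : UCB n f -> polyUCB n (fun w t => (f w t)%:P).
Proof.
move=> uf [|j].
  by have := uf; congr UCB; apply/funext => w; apply/funext => t; rewrite coefC.
rewrite (_ : (fun _ _ => _) = (fun _ _ => 0)).
  by apply: (UCB_cst n (B := 0)) => _; rewrite normr0.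
by apply/funext => w; apply/funext => t; rewrite coefC.
Qed.

Lemma polyUCB_cst n (p : {poly R}) : polyUCB n (fun _ _ => p).
Proof. by move=> j; apply: (UCB_cst n (B := `|p`_j|)). Qed.

Lemma polyUCB_D n p q : polyUCB n p -> polyUCB n q -> polyUCB n (fun w t => p w t + q w t).
Proof.
move=> up uq j; have := UCB_D (up j) (uq j); congr UCB.
by apply/funext => w; apply/funext => t; rewrite coefD.
Qed.

Lemma polyUCB_comp n m p q : (forall w t, size (p w t) = m) -> polyUCB n p -> polyUCB n q ->
  polyUCB n (fun w t => p w t \Po q w t).
Proof.
move=> sp up uq j.
have uX i : polyUCB n (fun w t => q w t ^+ i).
  elim: i => [|i IH] //; first exact: polyUCB_cst.
  rewrite (_ : (fun _ _ => _) = (fun w t => q w t * q w t ^+ i)); first exact: polyUCB_M.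
  by apply/funext => w; apply/funext => t; rewrite exprS.
rewrite (_ : (fun _ _ => _) =
    (fun w t => \sum_(i < m) (p w t)`_i * (q w t ^+ i)`_j)).
  by apply: UCB_sum => i _; apply: UCB_M; [exact: up|exact: uX].
apply/funext => w; apply/funext => t; rewrite comp_polyE sp coef_sum.
by apply: eq_bigr => i _; rewrite coefZ.
Qed.

End PolyFamilies.

(** * Lipschitz continuity of the roots *)

Section Bronshtein.
Variables (R : realType) (I : finType).

Lemma rescale_point (t s rho A : R) : 0 < rho -> 0 < A ->
  t + rho / (8 * A) * ((s - t) / (rho / (8 * A))) = s.
Proof.
move=> rho0 A0; have k0 : rho / (8 * A) != 0 by rewrite gt_eqF // divr_gt0 // mulr_gt0.
by rewrite mulrCA divff // mulr1 addrC subrK.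
Qed.

Lemma rescale_close (x0 x1 rho A L t s : R) : 0 < rho -> 0 < A ->
  `|rho^-1 * x1 - rho^-1 * x0| <= L * `|(s - t) / (rho / (8 * A))| ->
  `|x0 - x1| <= 8 * A * L * `|t - s|.
Proof.
move=> rho0 A0; rewrite -mulrBr normrM normfV (gtr0_norm rho0) distrC.
rewrite ler_pdivrMl // => H; apply: le_trans H _.
rewrite normrM normfV (gtr0_norm (_ : 0 < rho / (8 * A))) ?divr_gt0 ?mulr_gt0 //.
rewrite distrC le_eqVlt; apply/orP; left; apply/eqP; field.
by rewrite !gt_eqF.
Qed.

(** The times are at least [d] apart after rescaling, so [rho] itself is at most [8 A / d] times
    [|t - s|]. *)
Lemma rescale_far (x0 rho A d t s : R) : 0 < rho -> 0 < A -> 0 < d -> `|x0| <= rho ->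
  d <= `|(s - t) / (rho / (8 * A))| -> `|x0| <= 8 * A / d * `|t - s|.
Proof.
move=> rho0 A0 d0 xr; apply: contraLR; rewrite -!ltNge => H.
rewrite normrM normfV (gtr0_norm (_ : 0 < rho / (8 * A))) ?divr_gt0 ?mulr_gt0 //.
rewrite ltr_pdivrMr ?divr_gt0 ?mulr_gt0 // distrC.
have := lt_le_trans H xr; rewrite mulrAC ltr_pdivrMr // => H'.
rewrite mulrA ltr_pdivlMr ?mulr_gt0 // mulrC (lt_le_trans H') //.
by rewrite mulrC.
Qed.

(** Let [rho ^ 2] be the sum of the squares of the roots at time [t], a polynomial in the
    coefficients. Around each [t] with [rho > 0], the roots are divided by [rho] and time is
    stretched by [8 A / rho]. By [glaeser] the roots stay bounded, and the points [(w, t)] become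
    the parameters of a normalised family with uniform bounds. *)
Lemma lipschitz_centred (Om : Type) (r : seq I) (x : Om -> I -> R -> R) :
  (forall r' : seq I, (size r' < size r)%N -> lipschitz_roots R r') ->
  (forall w i (t : R), `|t| < 1 -> {for t, continuous (x w i)}) ->
  (forall w t, \sum_(i <- r) x w i t = 0) -> (1 < size r)%N ->
  (forall j, UCB (size r) (fun w t => (rpoly r (x w ^~ t))`_j)) ->
  exists2 L : R, 0 <= L & forall w i, i \in r -> forall t s : R,
    `|t| < 1 / 2 -> `|s| < 1 / 2 -> `|x w i t - x w i s| <= L * `|t - s|.
Proof.
set m := size r => IH xc x0 r1 ux.
pose p2 w t := \sum_(i <- r) x w i t ^+ 2.
have p2E w t : p2 w t = -2 * (rpoly r (x w ^~ t) * 'X^2)`_m.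
  by have [_] := rpoly_coef12 r (x w ^~ t); rewrite x0 expr0n sub0r mulNr => ->; rewrite opprK.
have up2 : UCB 2 p2.
  apply: (UCB_le r1); rewrite -/m (_ : p2 = fun w t => -2 * (rpoly r (x w ^~ t) * 'X^2)`_m).
    apply: UCB_M; first by apply: (UCB_cst m (B := `|-2|)).
    by apply: polyUCB_M => //; exact: polyUCB_cst.
  by apply/funext => w; apply/funext => t.
have p2_ge w t : 0 <= p2 w t by apply: sumr_ge0 => i _; exact: sqr_ge0.
have x_le w t i : i \in r -> x w i t ^+ 2 <= p2 w t.
  move=> ir; rewrite /p2 (big_rem i) //= lerDl.
  by apply: sumr_ge0 => j _; exact: sqr_ge0.
have /UCBS[/UCB0[B1 B10 p2B] [p2' pp' [B2 B20 p2'B]]] := up2.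
set A := 1 + B1 + B2.
have A1 : 1 <= A by rewrite /A; lra.
have A0 : 0 < A by apply: lt_le_trans A1.
have pA w (t : R) : `|t| < 1 -> 0 <= p2 w t <= A.
  by move=> t1; rewrite p2_ge (le_trans (ler_norm _)) // (le_trans (p2B w t t1)) // /A; lra.
have cp' w : CB 1 A (p2' w) by apply: CB_le (p2'B w) => //; rewrite /A; lra.
pose Om' := {q : Om * R | `|q.2| < 1 / 2 /\ 0 < p2 q.1 q.2}.
pose ww (q : Om') := (projT1 q).1; pose tt (q : Om') := (projT1 q).2.
pose rho q := Num.sqrt (p2 (ww q) (tt q)).
pose z q τ := tt q + rho q / (8 * A) * τ.
(* The value 0 outside [r] makes the bound by 2 hold for every index, as [lipschitz_normalized]
   requires. *)
pose y q i τ := if i \in r then (rho q)^-1 * x (ww q) i (z q τ) else 0.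
have tth q : `|tt q| < 1 / 2 by case: q => -[w t] [].
have p2q q : 0 < p2 (ww q) (tt q) by case: q => -[w t] [].
have G q := glaeser A1 (pA (ww q)) (pp' (ww q)) (cp' (ww q)) (tth q) (p2q q).
have z1 q (t : R) : `|t| < 1 -> `|z q t| < 1 by move=> /(G q)[].
have rho0 q : 0 < rho q by rewrite sqrtr_gt0.
have rho2 q : rho q ^+ 2 = p2 (ww q) (tt q) by rewrite sqr_sqrtr // ltW.
have rhoA q : rho q <= A.
  rewrite -(@ler_pXn2r _ 2) ?nnegrE ?(ltW (rho0 q)) ?(ltW A0) // rho2.
  have tt1 : `|tt q| < 1 by have := tth q; lra.
  have /andP[_ H] := pA (ww q) (tt q) tt1.
  by rewrite (le_trans H) // expr2 -{1}(mul1r A) ler_wpM2r // ltW.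
have y2 q i (t : R) : `|t| < 1 -> `|y q i t| <= 2.
  move=> t1; rewrite /y; case: (boolP (i \in r)) => [ir|_]; last by rewrite normr0.
  rewrite -(@ler_pXn2r _ 2) ?nnegrE // real_normK ?num_real // exprMn exprVn rho2.
  rewrite mulrC ler_pdivrMr // (le_trans (x_le _ _ _ ir)) //.
  by have [_ /andP[_ H]] := G q t t1; rewrite (le_trans H) //; have := p2q q; lra.
have rpy q t : rpoly r (y q ^~ t) = rpoly r (fun i => (rho q)^-1 * x (ww q) i (z q t)).
  by apply: eq_big_seq => i ir; rewrite /y ir.
have [|||||d /andP[d0 d1] [L L0 LP]] := lipschitz_normalized (y := y) IH _ y2.
- move=> q i t t1; rewrite /y; case: (i \in r); last exact: cst_continuous.
  have := xc (ww q) i (z q t) (z1 q t t1) => H.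
  have zc : {for t, continuous (z q)}.
    apply: continuousD; first exact: cst_continuous.
    exact: mulrl_continuous.
  apply: (@continuousM _ _ (fun=> (rho q)^-1)); first exact: cst_continuous.
  exact: (@continuous_comp _ _ _ (z q) (x (ww q) i)).
- move=> q; transitivity (\sum_(i <- r) (rho q)^-1 * x (ww q) i (tt q)).
    by apply: eq_big_seq => i ir; rewrite /y ir /z mulr0 addr0.
  by rewrite -mulr_sumr x0 mulr0.
- move=> q; transitivity (\sum_(i <- r) (rho q ^+ 2)^-1 * x (ww q) i (tt q) ^+ 2).
    by apply: eq_big_seq => i ir; rewrite /y ir /z mulr0 addr0 exprMn exprVn.
  by rewrite -mulr_sumr rho2 mulVf // gt_eqF.
- exact: ltnW.
- move=> j; have [jm|jm] := leqP j m; last first.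
    rewrite (_ : (fun _ _ => _) = (fun _ _ => 0)).
      by apply: (UCB_cst m (B := 0)) => _; rewrite normr0.
    by apply/funext => q; apply/funext => t; rewrite rpoly_over.
  have [Bc Bc0 Bcy] : exists2 B : R, 0 <= B & forall q (t : R), `|t| < 1 ->
      `|(rpoly r (y q ^~ t))`_j| <= B.
    have C2 : 0 <= (2 : R) by [].
    eexists; last first.
      move=> q t t1; apply: (rpoly_coef_bound r j C2) => i; exact: y2.
    by rewrite exprn_ge0 // addr_ge0.
  have [B B0 HB] := ux j; have [C C0 HC] := chain_interp R m.
  have AB : 0 <= A ^+ j * B by rewrite mulr_ge0 // exprn_ge0 // ltW.
  exists (C * (Bc + A ^+ j * B)) => [|q]; first by rewrite mulr_ge0 // addr_ge0.
  have [v [v0 cv vB]] := HB (ww q).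
  have := chain_affine ((rho q)^-1 ^+ (m - j)) (z1 q) cv.
  set v' := fun _ _ => _ => cv'.
  have v'0 : v' 0%N = fun t => (rpoly r (y q ^~ t))`_j.
    by apply/funext => t; rewrite /v' v0 expr0 mulr1 rpy rpoly_scale.
  rewrite -v'0; apply: HC => // t t1.
    by rewrite v'0 (le_trans (Bcy q t t1)) // lerDl.
  rewrite (@le_trans _ _ (A ^+ j * B)) ?lerDr //.
  rewrite /v' normrM ler_pM ?vB ?z1 //.
  rewrite ger0_norm; last first.
    by rewrite mulr_ge0 // exprn_ge0 // ?invr_ge0 ?divr_ge0 ?mulr_ge0 // ltW.
  (* The coefficient of index [j] has degree [m - j] in the roots, while [m] derivatives in time
     gain [(rho / (8 A)) ^ m]: the powers of [rho] left over are nonnegative. This is where as many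
     derivatives as roots are used. *)
  have -> : (rho q)^-1 ^+ (m - j) * (rho q / (8 * A)) ^+ m = rho q ^+ j / (8 * A) ^+ m.
    rewrite expr_div_n mulrA; congr (_ / _).
    by rewrite -{2}(subnK jm) exprD mulrA -exprMn mulVf ?gt_eqF // expr1n mul1r.
  rewrite ler_pdivrMr ?exprn_gt0 ?mulr_gt0 // -[leLHS]mulr1 ler_pM //.
  - by rewrite exprn_ge0 // ltW.
  - by rewrite lerXn2r ?nnegrE // ltW.
  - by rewrite exprn_ege1 //; lra.
(* If [s] is close to [t] at the scale of [t], the normalised estimate applies; otherwise
   [|x w i t| <= rho] is itself small compared with [|t - s|]. When the second case occurs both from
   [t] and from [s], the two roots are bounded separately, whence the factor 2 in the constant
   below. *)
have key w i (t s : R) : i \in r -> `|t| < 1 / 2 ->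
    `|x w i t - x w i s| <= 8 * A * L * `|t - s| \/ `|x w i t| <= 8 * A / d * `|t - s|.
  move=> ir th; have [pt|pt] := eqVneq (p2 w t) 0.
    right; have := x_le w t i ir; rewrite pt => H.
    have : x w i t ^+ 2 = 0 by apply/eqP; rewrite eq_le H sqr_ge0.
    move/eqP; rewrite sqrf_eq0 => /eqP ->; rewrite normr0.
    by rewrite mulr_ge0 // divr_ge0 ?mulr_ge0 // ltW.
  have {}pt : 0 < p2 w t by rewrite lt_def pt p2_ge.
  pose q : Om' := exist _ (w, t) (conj th pt).
  have [close|far] := ltP `|(s - t) / (rho q / (8 * A))| d.
    have zE : z q ((s - t) / (rho q / (8 * A))) = s.
      exact: (rescale_point t s (rho0 q) A0).
    have z0 : z q 0 = t by rewrite /z mulr0 addr0.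
    have H := LP q i ir _ close; rewrite /y ir zE z0 in H.
    left; exact: (rescale_close (rho0 q) A0 H).
  right; have xr : `|x w i t| <= rho q.
    rewrite -(@ler_pXn2r _ 2) ?nnegrE ?(ltW (rho0 q)) // rho2 real_normK ?num_real //.
    exact: x_le.
  exact: (rescale_far (rho0 q) A0 d0 xr far).
have AL : 0 <= 8 * A * L by rewrite mulr_ge0 // mulr_ge0 // ltW.
have Ad : 0 <= 8 * A / d by rewrite divr_ge0 ?mulr_ge0 // ltW.
exists (8 * A * L + 2 * (8 * A / d)) => [|w i ir t s th sh].
  by rewrite addr_ge0 // mulr_ge0.
have ts := normr_ge0 (t - s).
have [H|H] := key w i t s ir th; first by rewrite (le_trans H) // ler_wpM2r //; lra.
have [H'|H'] := key w i s t ir sh.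
  by rewrite distrC (le_trans H') // distrC ler_wpM2r //; lra.
rewrite (le_trans (ler_normB _ _)) // (le_trans (lerD H H')) // (distrC s t).
by rewrite -mulrDl ler_wpM2r //; lra.
Qed.

Theorem bronshtein (r : seq I) : lipschitz_roots R r.
Proof.
have [m] := ubnP (size r); elim: m => // m IHm in r *; rewrite ltnS => rm.
have IH (r' : seq I) : (size r' < size r)%N -> lipschitz_roots R r'.
  by move=> rr; apply: IHm; apply: leq_trans rr rm.
move=> Om x xc ux.
case: (posnP (size r)) => [/size0nil ->|r0]; first by exists 0.
pose S w t := \sum_(i <- r) x w i t.
have uS : UCB (size r) S.
  have := polyUCB_M ux (polyUCB_cst Om (size r) 'X^2) (size r).+1.
  move/(UCB_M (UCB_cst (size r) (k := fun=> -1) (B := 1) _)).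
  rewrite (_ : (fun _ _ => _) = S); last first.
    apply/funext => w; apply/funext => t; have [+ _] := rpoly_coef12 r (x w ^~ t).
    by rewrite /= => ->; rewrite mulN1r opprK.
  by apply=> w; rewrite normrN normr1.
have [L L0 LP] : exists2 L : R, 0 <= L & forall w (t s : R), `|t| < 1 -> `|s| < 1 ->
    `|S w t - S w s| <= L * `|t - s|.
  have [L L0 SL] := UCB_le r0 uS; exists L => // w t s t1 s1.
  by rewrite (CB_lip (SL w) s1 t1).
have half (t : R) : `|t| < 1 / 2 -> `|t| < 1 by move=> h; lra.
move: r0; rewrite leq_eqVlt => /orP[/eqP r1|r1].
  exists L => // w i ir t s /half t1 /half s1; have := LP w t s t1 s1.
  case: (r) ir r1 @S {uS LP} => [//|j [|//]] /=; rewrite inE => /eqP -> _.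
  by rewrite !big_seq1.
pose c w t := S w t / (size r)%:R.
have sr0 : (size r)%:R != 0 :> R by rewrite pnatr_eq0 -lt0n ltnW.
have uc : UCB (size r) c.
  have := UCB_M uS (UCB_cst (size r) (k := fun=> (size r)%:R^-1) (B := (size r)%:R^-1) _).
  by apply=> w; rewrite ger0_norm.
have [|||L' L'0 LP'] := lipschitz_centred (x := fun w i t => x w i t - c w t) IH _ _ r1.
- move=> w i t t1; apply: continuousB; first exact: xc.
  have /UCBS[_ [c' cc' _]] := UCB_le (ltnW r1) uc.
  exact: is_derive_continuous (cc' w t t1).
- move=> w t; rewrite sumrB big_const_seq count_predT iter_addr_0 -mulr_natr.
  by rewrite divfK // subrr.
- have ucX : polyUCB (size r) (fun w t => 'X + (c w t)%:P).
    by apply: polyUCB_D; [exact: polyUCB_cst|exact: polyUCB_C].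
  have szr (w : Om) (t : R) : size (rpoly r (x w ^~ t)) = (size r).+1 by rewrite size_rpoly.
  move=> j; have := polyUCB_comp szr ux ucX j; congr UCB.
  apply/funext => w; apply/funext => t; congr ((_ : {poly R})`_j).
  rewrite /rpoly rmorph_prod; apply: eq_bigr => i _ /=.
  by rewrite comp_polyB comp_polyX comp_polyC polyCB; ring.
exists (L' + L) => [|w i ir t s th sh]; first exact: addr_ge0.
have -> : x w i t - x w i s = (x w i t - c w t - (x w i s - c w s)) + (c w t - c w s) by ring.
rewrite (le_trans (ler_normD _ _)) // mulrDl lerD ?LP' //.
rewrite -mulrBl normrM normfV normr_nat (le_trans _ (LP w t s (half _ th) (half _ sh))) //.
by rewrite ler_piMr // invf_le1 ?ler1n ?ltr0n ltnW.
Qed.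

End Bronshtein.

(** * Closed linear groups *)

Section MatrixNorm.
Variable R : realType.
Implicit Types (m n p : nat).

Definition mn m n (A : 'M[R]_(m, n)) : R := \sum_i \sum_j `|A i j|.

Lemma mn_ge0 m n (A : 'M[R]_(m, n)) : 0 <= mn A.
Proof. by apply: sumr_ge0 => i _; apply: sumr_ge0. Qed.

Lemma mn_entry m n (A : 'M[R]_(m, n)) i j : `|A i j| <= mn A.
Proof.
rewrite /mn (bigD1 i) //= (bigD1 j) //= -addrA lerDl addr_ge0 ?sumr_ge0 //.
by move=> k _; apply: sumr_ge0.
Qed.

Lemma mn_eq0 m n (A : 'M[R]_(m, n)) : mn A = 0 -> A = 0.
Proof.
move=> A0; apply/matrixP => i j; rewrite mxE; apply/eqP.
by rewrite -normr_le0 -A0 mn_entry.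
Qed.

Lemma mn0 m n : mn (0 : 'M[R]_(m, n)) = 0.
Proof. by rewrite /mn big1 // => i _; rewrite big1 // => j _; rewrite mxE normr0. Qed.

Lemma mnD m n (A B : 'M[R]_(m, n)) : mn (A + B) <= mn A + mn B.
Proof.
rewrite -big_split; apply: ler_sum => i _; rewrite -big_split; apply: ler_sum => j _ /=.
by rewrite mxE ler_normD.
Qed.

Lemma mnZ m n c (A : 'M[R]_(m, n)) : mn (c *: A) = `|c| * mn A.
Proof.
rewrite mulr_sumr; apply: eq_bigr => i _; rewrite mulr_sumr; apply: eq_bigr => j _.
by rewrite mxE normrM.
Qed.

Lemma mnN m n (A : 'M[R]_(m, n)) : mn (- A) = mn A.
Proof. by rewrite -scaleN1r mnZ normrN normr1 mul1r. Qed.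

Lemma mn_tr m n (A : 'M[R]_(m, n)) : mn A^T = mn A.
Proof.
by rewrite /mn exchange_big; apply: eq_bigr => i _; apply: eq_bigr => j _; rewrite mxE.
Qed.

Lemma mnM m n p (A : 'M[R]_(m, n)) (B : 'M[R]_(n, p)) : mn (A *m B) <= mn A * mn B.
Proof.
have H i j : `|(A *m B) i j| <= \sum_k `|A i k| * `|B k j|.
  by rewrite mxE (le_trans (ler_norm_sum _ _ _)) //; apply: ler_sum => k _; rewrite normrM.
apply: (@le_trans _ _ (\sum_i \sum_j \sum_k `|A i k| * `|B k j|)).
  by apply: ler_sum => i _; apply: ler_sum => j _.
rewrite /mn mulr_suml; apply: ler_sum => i _; rewrite exchange_big mulr_suml.
apply: ler_sum => k _ /=; rewrite -mulr_sumr ler_wpM2l //.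
rewrite (bigD1 k) //= lerDl; apply: sumr_ge0 => l _; exact: sumr_ge0.
Qed.

Definition orth n (A : 'M[R]_n) := A^T *m A = 1%:M.

Lemma orthC n (A : 'M[R]_n) : orth A -> A *m A^T = 1%:M.
Proof. exact: mulmx1C. Qed.

Lemma orth_mn n (A : 'M[R]_n) : orth A -> mn A <= (n * n)%:R.
Proof.
move=> oA; have e1 i j : `|A i j| <= 1.
  rewrite -(@ler_pXn2r _ 2) ?nnegrE // real_normK ?num_real // expr1n.
  have := congr1 (fun M : 'M[R]_n => M j j) oA; rewrite !mxE eqxx mulr1n => <-.
  rewrite (bigD1 i) //= mxE -expr2 lerDl; apply: sumr_ge0 => k _.
  by rewrite mxE -expr2 sqr_ge0.
apply: (@le_trans _ _ (\sum_(i < n) \sum_(j < n) 1)).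
  by apply: ler_sum => i _; apply: ler_sum => j _.
by rewrite !sumr_const !card_ord -mulrnA.
Qed.

Lemma dot_le_mn n (u v : 'cV[R]_n) : `|dot u v| <= mn u * mn v.
Proof.
have -> : dot u v = (u^T *m v) 0 0 by rewrite mxE; apply: eq_bigr => i _; rewrite mxE.
by rewrite (le_trans (mn_entry _ _ _)) // (le_trans (mnM _ _)) // mn_tr.
Qed.

Definition mpow n (g : 'M[R]_n) p := iter p (mulmx g) 1%:M.

Lemma mpowD n (g : 'M[R]_n) p q : mpow g (p + q) = mpow g p *m mpow g q.
Proof. by elim: p => [|p IH]; rewrite ?mul1mx //= IH mulmxA. Qed.

Lemma mpowSr n (g : 'M[R]_n) p : mpow g p.+1 = mpow g p *m g.
Proof. by rewrite -addn1 mpowD /= mulmx1. Qed.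

Lemma mpow_tr n (g : 'M[R]_n) p : mpow g^T p = (mpow g p)^T.
Proof.
by elim: p => [|p IH]; rewrite ?trmx1 //= IH -trmx_mul -mpowSr.
Qed.

(* Meant for an orthogonal [g], whose inverse is [g^T]. *)
Definition zpow n (g : 'M[R]_n) (z : int) :=
  match z with Posz p => mpow g p | Negz p => mpow g^T p.+1 end.

Lemma zpowNn n (g : 'M[R]_n) (p : nat) : zpow g (- p%:Z) = (mpow g p)^T.
Proof. by case: p => [|p]; rewrite ?trmx1 // -NegzE /zpow mpow_tr. Qed.

Lemma mpow_orth n (g : 'M[R]_n) p : orth g -> orth (mpow g p).
Proof.
move=> og; rewrite /orth; elim: p => [|p IH]; rewrite ?trmx1 ?mulmx1 //= trmx_mul -mulmxA.
by rewrite [g^T *m _]mulmxA og mul1mx.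
Qed.

Lemma zpow_sub n (g : 'M[R]_n) (p q : nat) : orth g ->
  zpow g (p%:Z - q%:Z) = mpow g p *m (mpow g q)^T.
Proof.
move=> og; have inv r := orthC (mpow_orth r og).
case: (leqP q p) => [/subnK|/ltnW/subnK] <-.
  by rewrite PoszD addrK /= mpowD -mulmxA inv mulmx1.
by rewrite PoszD opprD addrCA subrr addr0 zpowNn mpowD trmx_mul mulmxA inv mul1mx.
Qed.

Lemma zpowD n (g : 'M[R]_n) (a b : int) : orth g -> zpow g (a + b) = zpow g a *m zpow g b.
Proof.
move=> og; have nat2 (c : int) : exists p q : nat, c = p%:Z - q%:Z.
  by case: c => p; [exists p, 0%N; rewrite subr0|exists 0%N, p.+1; rewrite sub0r NegzE].
have [p [q aE]] := nat2 a; have [p' [q' bE]] := nat2 b.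
have aE' : a = (p + p')%N%:Z - (q + p')%N%:Z by rewrite aE !PoszD; ring.
have bE' : b = (q + p')%N%:Z - (q + q')%N%:Z by rewrite bE !PoszD; ring.
have -> : a + b = (p + p')%N%:Z - (q + q')%N%:Z by rewrite aE' bE'; ring.
rewrite aE' bE' !zpow_sub // mulmxA -[_ *m _ *m mpow _ _]mulmxA.
by rewrite mpow_orth // mulmx1.
Qed.

(** Powers of an orthogonal matrix are bounded independently of the exponent, so the errors of the
    expansion only add up; this bound becomes the remainder in [onep]. *)
Lemma mpow_quad n (g : 'M[R]_n) p : orth g ->
  mn (mpow g p - 1%:M - p%:R *: (g - 1%:M)) <= (n * n)%:R * p%:R ^+ 2 * mn (g - 1%:M) ^+ 2.
Proof.
move=> og; set B : R := (n * n)%:R; set e := mn (g - 1%:M).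
have e0 : 0 <= e by apply: mn_ge0.
have L q : mn (mpow g q - 1%:M) <= B * q%:R * e.
  elim: q => [|q IH]; first by rewrite subrr mn0 mulr0 mul0r.
  have -> : mpow g q.+1 - 1%:M = mpow g q *m (g - 1%:M) + (mpow g q - 1%:M).
    by rewrite mpowSr mulmxBr mulmx1 addrA subrK.
  rewrite (le_trans (mnD _ _)) // -natr1 mulrDr mulr1 mulrDl addrC lerD //.
  by rewrite (le_trans (mnM _ _)) // ler_wpM2r // orth_mn //; apply: mpow_orth.
elim: p => [|p IH]; first by rewrite scale0r !subr0 subrr mn0 expr0n mulr0 mul0r.
have -> : mpow g p.+1 - 1%:M - p.+1%:R *: (g - 1%:M) =
    (mpow g p - 1%:M) *m (g - 1%:M) + (mpow g p - 1%:M - p%:R *: (g - 1%:M)).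
  rewrite mpowSr -natr1 scalerDl scale1r mulmxBr mulmx1 mulmxBl mul1mx.
  by apply/matrixP => i j; rewrite !mxE; ring.
rewrite (le_trans (mnD _ _)) //.
have H : mn ((mpow g p - 1%:M) *m (g - 1%:M)) <= B * p%:R * e ^+ 2.
  by rewrite (le_trans (mnM _ _)) // expr2 mulrA ler_wpM2r.
rewrite (le_trans (lerD H IH)) // -mulrDl ler_wpM2r ?sqr_ge0 // -mulrDr ler_wpM2l //.
by rewrite -natr1; have : 0 <= p%:R :> R by []; nra.
Qed.

End MatrixNorm.

(* Limits along a fixed ultrafilter replace the extraction of subsequences. *)
Definition omega : set_system nat := projT1 (cid ultra_nat_ex).

Instance omega_ultra : UltraFilter omega.
Proof. by have [] := projT2 (cid ultra_nat_ex). Qed.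

Instance omega_proper : ProperFilter omega.
Proof. exact: ultra_proper. Qed.

Instance omega_filter : Filter omega.
Proof. exact: filter_filter. Qed.

Lemma omega_oo : \oo `<=` omega.
Proof. by have [] := projT2 (cid ultra_nat_ex). Qed.

Section MatrixLimits.
Variable R : realType.
Local Notation F := omega.

Definition mlim m n (g : nat -> 'M[R]_(m, n)) (L : 'M[R]_(m, n)) :=
  forall i j, (fun k => g k i j) @ F --> L i j.

Lemma mlim_ext m n g g' (L : 'M[R]_(m, n)) : g =1 g' -> mlim g L -> mlim g' L.
Proof. by move=> /funext ->. Qed.

Lemma mlim_cst m n (L : 'M[R]_(m, n)) : mlim (fun=> L) L.
Proof. by move=> i j; apply: cvg_cst. Qed.

Lemma mlimD m n g g' (L L' : 'M[R]_(m, n)) : mlim g L -> mlim g' L' ->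
  mlim (fun k => g k + g' k) (L + L').
Proof.
move=> gL gL' i j; rewrite (_ : (fun _ => _) = (fun k => g k i j + g' k i j)).
  by rewrite mxE; apply: cvgD.
by apply/funext => k; rewrite mxE.
Qed.

Lemma mlimZ m n c (s : R) g (L : 'M[R]_(m, n)) : (c : nat -> R) @ F --> s -> mlim g L ->
  mlim (fun k => c k *: g k) (s *: L).
Proof.
move=> cs gL i j; rewrite (_ : (fun _ => _) = (fun k => c k * g k i j)).
  by rewrite mxE; apply: cvgM.
by apply/funext => k; rewrite mxE.
Qed.

Lemma mlimN m n g (L : 'M[R]_(m, n)) : mlim g L -> mlim (fun k => - g k) (- L).
Proof.
move=> gL; have c1 : (fun _ : nat => -1 : R) @ F --> (-1 : R) by apply: cvg_cst.
have := mlimZ c1 gL.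
by rewrite scaleN1r => H; apply: (mlim_ext _ H) => k; rewrite scaleN1r.
Qed.

Lemma mlimB m n g g' (L L' : 'M[R]_(m, n)) : mlim g L -> mlim g' L' ->
  mlim (fun k => g k - g' k) (L - L').
Proof. by move=> gL /mlimN; apply: mlimD. Qed.

Lemma mlimM m n p (g : nat -> 'M[R]_(m, n)) (g' : nat -> 'M[R]_(n, p)) L L' :
  mlim g L -> mlim g' L' -> mlim (fun k => g k *m g' k) (L *m L').
Proof.
move=> gL gL' i j; rewrite (_ : (fun _ => _) = (fun k => \sum_l g k i l * g' k l j)).
  by rewrite mxE; apply: cvg_bigsum => l; apply: cvgM.
by apply/funext => k; rewrite mxE.
Qed.

Lemma mlim_tr m n g (L : 'M[R]_(m, n)) : mlim g L -> mlim (fun k => (g k)^T) L^T.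
Proof.
move=> gL i j; rewrite (_ : (fun _ => _) = (fun k => g k j i)) ?mxE //.
by apply/funext => k; rewrite mxE.
Qed.

Lemma mlim_unique m n g (L L' : 'M[R]_(m, n)) : mlim g L -> mlim g L' -> L = L'.
Proof.
by move=> gL gL'; apply/matrixP => i j; apply: norm_cvg_unique (gL i j) (gL' i j).
Qed.

Lemma mlim_mn m n g (L : 'M[R]_(m, n)) : mlim g L -> (fun k => mn (g k)) @ F --> mn L.
Proof.
by move=> gL; apply: cvg_bigsum => i; apply: cvg_bigsum => j; apply: cvg_norm; apply: gL.
Qed.

Lemma mlim_dot n (g g' : nat -> 'cV[R]_n) L L' : mlim g L -> mlim g' L' ->
  (fun k => dot (g k) (g' k)) @ F --> dot L L'.
Proof. by move=> gL gL'; apply: cvg_bigsum => i; apply: cvgM; [exact: gL|exact: gL']. Qed.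

Lemma mlim_squeeze m n g (L : 'M[R]_(m, n)) (b : nat -> R) : b @ F --> (0 : R) ->
  (\forall k \near F, mn (g k - L) <= b k) -> mlim g L.
Proof.
move=> b0 gb i j; apply/cvgrPdist_le => e e0.
have /cvgrPdist_le/(_ e e0) := b0; apply: filterS2 gb => k gk; rewrite sub0r normrN => bk.
rewrite distrC; apply: le_trans bk; apply: le_trans (ler_norm _); apply: le_trans gk.
by have := mn_entry (g k - L) i j; rewrite !mxE.
Qed.

Lemma mlim_ex m n (g : nat -> 'M[R]_(m, n)) (M : R) : (\forall k \near F, mn (g k) <= M) ->
  exists L, mlim g L.
Proof.
move=> gM; have /choice[l lP] : forall q : 'I_m * 'I_n, exists l : R, (fun k => g k q.1 q.2) @ F --> l.
  move=> q; apply: (ultra_bounded_cvg (M := M)); apply: filterS gM => k.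
  by apply: le_trans; apply: mn_entry.
by exists (\matrix_(i, j) l (i, j)) => i j; rewrite mxE; apply: (lP (i, j)).
Qed.

End MatrixLimits.

Arguments mlim_cst {R m n} L.

(** * One-parameter groups and tangent directions *)

Section OneParam.
Variables (R : realType) (N : nat).
Implicit Types (E : R -> 'M[R]_N) (X : 'M[R]_N).

(** [E t] is the exponential of [t X], described by the group law and by an expansion whose
    quadratic remainder is uniform in [t]; this is the form in which it arises as a limit of
    powers. *)
Definition onep E X := [/\ E 0 = 1%:M, forall s t, E (s + t) = E s *m E t &
  exists C : R, forall t, mn (E t - 1%:M - t *: X) <= C * t ^+ 2].

Lemma onep_commute E X s t : onep E X -> E s *m E t = E t *m E s.
Proof. by case=> _ ED _; rewrite -!ED addrC. Qed.

End OneParam.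

Section ClosedGroup.
Variables (R : realType) (N : nat).
Local Notation F := omega.

(** Compact groups of orthogonal matrices: the transpose is the inverse, and boundedness gives every
    sequence a limit along [omega], which stays in the group. *)
Record closed_group (K : set 'M[R]_N) : Prop := ClosedGroup {
  cg1 : K 1%:M;
  cgM : forall g h, K g -> K h -> K (g *m h);
  cgT : forall g, K g -> K g^T;
  cg_orth : forall g, K g -> orth g;
  cg_lim : forall g L, (forall n : nat, K (g n)) -> mlim g L -> K L
}.

Definition lie (K : set 'M[R]_N) X := exists2 E, onep E X & forall t, K (E t).

Variable K : set 'M[R]_N.
Hypothesis cgK : closed_group K.

Lemma cg_seq (g : nat -> 'M[R]_N) : (forall n, K (g n)) -> exists2 L, K L & mlim g L.
Proof.
move=> Kg; have [|L gL] := mlim_ex (g := g) (M := (N * N)%:R).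
  by apply: nearW => n; apply: orth_mn; apply: (cg_orth cgK).
by exists L => //; apply: (cg_lim cgK Kg gL).
Qed.

Lemma cg_zpow g z : K g -> K (zpow g z).
Proof.
have P h p : K h -> K (mpow h p).
  by move=> Kh; elim: p => [|p IH]; [apply: cg1|apply: cgM].
by move=> Kg; case: z => p; apply: P => //; apply: (cgT cgK).
Qed.

Lemma tan_quad (g : nat -> 'M[R]_N) (d : nat -> R) (p : nat -> nat) X L tau :
  (forall n, orth (g n)) -> (forall n, 0 < d n) ->
  mlim (fun n => (d n)^-1 *: (g n - 1%:M)) X ->
  (fun n => (p n)%:R * d n) @ F --> (tau : R) -> mlim (fun n => mpow (g n) (p n)) L ->
  mn (L - 1%:M - tau *: X) <= (N * N)%:R * tau ^+ 2 * mn X ^+ 2.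
Proof.
move=> go d0 gX pt gL.
have l1 : mlim (fun n => mpow (g n) (p n) - 1%:M - ((p n)%:R * d n) *: ((d n)^-1 *: (g n - 1%:M)))
    (L - 1%:M - tau *: X).
  by apply: mlimB; [apply: mlimB => //; exact: mlim_cst|apply: mlimZ].
have mX := mlim_mn gX.
have l2 : (fun n => (N * N)%:R * ((p n)%:R * d n) ^+ 2 * mn ((d n)^-1 *: (g n - 1%:M)) ^+ 2) @ F
    --> (N * N)%:R * tau ^+ 2 * mn X ^+ 2.
  have sq (u : nat -> R) (l : R) : u @ F --> l -> (fun n => u n ^+ 2) @ F --> l ^+ 2.
    move=> ul; rewrite expr2 (_ : (fun _ => _) = (fun n => u n * u n)); first exact: cvgM.
    by apply/funext => n; rewrite expr2.
  by apply: cvgM; [apply: cvgM; [exact: cvg_cst|exact: sq]|exact: (sq _ _ mX)].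
apply: ler_cvg_to (mlim_mn l1) l2 _; apply: nearW => n.
rewrite scalerA mulfK ?gt_eqF // (le_trans (mpow_quad (p n) (go n))) //.
rewrite mnZ normfV gtr0_norm // !exprMn exprVn.
rewrite le_eqVlt; apply/orP; left; apply/eqP; field.
by rewrite gt_eqF.
Qed.

Lemma skew_tan (g : nat -> 'M[R]_N) (d : nat -> R) X :
  (forall n, orth (g n)) -> (forall n, 0 < d n) -> d @ F --> (0 : R) ->
  mlim (fun n => (d n)^-1 *: (g n - 1%:M)) X -> X^T = - X.
Proof.
move=> go d0 dl gX; apply/eqP; rewrite -addr_eq0; apply/eqP.
have l := mlimD (mlimD (mlim_tr gX) gX) (mlimZ dl (mlimM (mlim_tr gX) gX)).
rewrite scale0r addr0 in l; apply: mlim_unique l _.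
rewrite (_ : (fun _ => _) = (fun=> 0)); first exact: mlim_cst.
apply/funext => n; have dn0 : d n != 0 by rewrite gt_eqF.
rewrite linearZ /= -scalemxAl -scalemxAr !scalerA mulfV // mul1r -!scalerDr.
rewrite linearB /= trmx1 mulmxBl mul1mx mulmxBr go mulmx1.
by apply/matrixP => i j; rewrite !mxE; ring.
Qed.

Lemma tan_lim1 (g : nat -> 'M[R]_N) (d : nat -> R) X : (forall n, 0 < d n) ->
  d @ F --> (0 : R) -> mlim (fun n => (d n)^-1 *: (g n - 1%:M)) X -> mlim g 1%:M.
Proof.
move=> d0 dl gX; have := mlimD (mlimZ dl gX) (mlim_cst 1%:M).
rewrite scale0r add0r => H; apply: (mlim_ext _ H) => n.
by rewrite scalerA mulfV ?gt_eqF // scale1r subrK.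
Qed.

Lemma floor_add (x y : R) : exists2 e : int, e = 0 \/ e = 1 &
  Num.floor (x + y) = Num.floor x + Num.floor y + e.
Proof.
have /andP[x1 x2] := floor_itv x; have /andP[y1 y2] := floor_itv y.
have /andP[z1 z2] := floor_itv (x + y).
rewrite intrD in x2; rewrite intrD in y2; rewrite intrD in z2.
exists (Num.floor (x + y) - Num.floor x - Num.floor y); last by ring.
set a := Num.floor (x + y) in z1 z2 *; set b := Num.floor x in x1 x2 *.
set c := Num.floor y in y1 y2 *.
have h1 : (-1 : R) < (a - b - c)%:~R by rewrite !rmorphB /=; lra.
have h2 : (a - b - c)%:~R < (2 : R) by rewrite !rmorphB /=; lra.
have {}h1 : -1 < a - b - c by rewrite -(ltr_int R).
have {}h2 : a - b - c < 2 by rewrite -(ltr_int R).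
by move: h1 h2; set z := a - b - c; case: z => [[|[|z]]|z] //; auto.
Qed.

Lemma floor_cvg (d : nat -> R) (t : R) : (forall n, 0 < d n) -> d @ F --> (0 : R) ->
  (fun n => (Num.floor (t / d n))%:~R * d n) @ F --> t.
Proof.
move=> d0 dl; apply/cvgrPdist_le => e e0; have /cvgrPdist_le/(_ e e0) := dl.
apply: filterS => n; rewrite sub0r normrN (gtr0_norm (d0 n)) => de.
have /andP[h1 h2] := floor_itv (t / d n); rewrite intrD in h2.
rewrite ler_pdivlMr // in h1; rewrite ltr_pdivrMr // mulrDl mul1r in h2.
by rewrite ger0_norm; lra.
Qed.

(** The closed subgroup argument: [E t] is the limit of [g n] raised to the power [floor (t / d n)].
    Floors are additive up to 0 or 1, and an additional factor [g n] tends to 1, so the limit is a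
    one-parameter group in [K]. *)
Theorem lie_tan (g : nat -> 'M[R]_N) (d : nat -> R) X :
  (forall n, K (g n)) -> (forall n, 0 < d n) -> d @ F --> (0 : R) ->
  mlim (fun n => (d n)^-1 *: (g n - 1%:M)) X -> lie K X.
Proof.
move=> Kg d0 dl gX.
have go n : orth (g n) := cg_orth cgK (Kg n).
have /choice[E EP] : forall t : R, exists L, K L /\
    mlim (fun n => zpow (g n) (Num.floor (t / d n))) L.
  move=> t; have [|L KL HL] := @cg_seq (fun n => zpow (g n) (Num.floor (t / d n))).
    by move=> n; apply: cg_zpow.
  by exists L.
exists E => [|t]; last by have [] := EP t.
split.
- have [_] := EP 0; rewrite (_ : (fun _ => _) = (fun=> 1%:M)).
    by move=> H; apply: mlim_unique H (mlim_cst _).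
  by apply/funext => n; rewrite mul0r floor0.
- move=> s t; have [_ Hst] := EP (s + t); have [_ Hs] := EP s; have [_ Ht] := EP t.
  apply: mlim_unique Hst _.
  have /choice[e eP] : forall n, exists e : int, (e = 0 \/ e = 1) /\
      Num.floor ((s + t) / d n) = Num.floor (s / d n) + Num.floor (t / d n) + e.
    by move=> n; rewrite mulrDl; have [e ? ?] := floor_add (s / d n) (t / d n); exists e.
  have e1 : mlim (fun n => zpow (g n) (e n)) 1%:M.
    have l := mlim_mn (mlimB (tan_lim1 d0 dl gX) (mlim_cst 1%:M)).
    rewrite subrr mn0 in l; apply: mlim_squeeze l _; apply: nearW => n.
    by have [[->|->] _] := eP n; rewrite /= ?mulmx1 // subrr mn0 mn_ge0.
  have := mlimM (mlimM Hs Ht) e1; rewrite mulmx1 => H; apply: (mlim_ext _ H) => n.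
  by have [_ ->] := eP n; rewrite !zpowD.
- exists ((N * N)%:R * mn X ^+ 2) => t; have [_ Ht] := EP t; rewrite mulrAC.
  have fl := @floor_cvg d t d0 dl.
  have [t0|t0] := leP 0 t.
    apply: (tan_quad (p := fun n => `|Num.floor (t / d n)|%N) go d0 gX).
      apply: cvg_trans fl; apply: near_eq_cvg; apply: nearW => n /=; congr (_ * _).
      by rewrite -[RHS]/((Posz _)%:~R) abszE ger0_norm // floor_ge0 divr_ge0 // ltW.
    apply: (mlim_ext _ Ht) => n.
    have : 0 <= Num.floor (t / d n) by rewrite floor_ge0 divr_ge0 // ltW.
    by case: (Num.floor _).
  (* For negative [t] the powers are those of the inverses [(g n)^T], whose direction is
     [X^T = - X]. *)
  have gT n : orth (g n)^T by rewrite /orth trmxK orthC.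
  have gXT : mlim (fun n => (d n)^-1 *: ((g n)^T - 1%:M)) X^T.
    apply: (mlim_ext _ (mlim_tr gX)) => n.
    by rewrite linearZ linearB /= trmx1.
  have := tan_quad (p := fun n => `|Num.floor (t / d n)|%N) gT d0 gXT.
  move/(_ (E t) (- t)); rewrite (skew_tan go d0 dl gX) scalerN scaleNr opprK sqrrN mnN.
  have fneg n : Num.floor (t / d n) < 0.
    by rewrite floor_lt0 pmulr_llt0 // invr_gt0.
  apply.
    have fl' : (fun n => - ((Num.floor (t / d n))%:~R * d n)) @ F --> - t by apply: cvgN.
    apply: cvg_trans fl'; apply: near_eq_cvg; apply: nearW => n /=.
    by rewrite -mulNr -rmorphN -(ltr0_norm (fneg n)) -abszE.
  apply: (mlim_ext _ Ht) => n.
  by have := fneg n; case: (Num.floor _).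
Qed.

End ClosedGroup.

(** * The Lie algebra of a closed group *)

Section LieAlgebra.
Variables (R : realType) (N : nat).
Local Notation F := omega.
Implicit Types (E : R -> 'M[R]_N) (X Y : 'M[R]_N).

Lemma cvg_invn : (fun n => n.+1%:R^-1 : R) @ F --> (0 : R).
Proof. exact: cvg_trans (cvg_app _ omega_oo) cvg_harmonic. Qed.

Lemma onep_tan E X (d : nat -> R) : onep E X -> (forall n, d n != 0) -> d @ F --> (0 : R) ->
  mlim (fun n => (d n)^-1 *: (E (d n) - 1%:M)) X.
Proof.
move=> [_ _ [C EC]] d0 dl.
have b0 : (fun n => C * `|d n|) @ F --> (0 : R).
  rewrite -[0](mulr0 C) -(@normr0 _ R); apply: cvgM; first exact: cvg_cst.
  exact: cvg_norm.
apply: mlim_squeeze b0 _; apply: nearW => n.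
have -> : (d n)^-1 *: (E (d n) - 1%:M) - X = (d n)^-1 *: (E (d n) - 1%:M - d n *: X).
  by rewrite [RHS]scalerBr scalerA mulVf // scale1r.
rewrite mnZ normfV ler_pdivrMl ?normr_gt0 // mulrCA -expr2 real_normK ?num_real //.
Qed.

Lemma onep_lim1 E X (d : nat -> R) : onep E X -> d @ F --> (0 : R) -> mlim (fun n => E (d n)) 1%:M.
Proof.
move=> [_ _ [C EC]] dl.
have b0 : (fun n => C * d n ^+ 2 + `|d n| * mn X) @ F --> (0 : R).
  have -> : (0 : R) = C * 0 ^+ 2 + `|0 : R| * mn X by rewrite normr0 mul0r addr0 expr2 !mulr0.
  have sq : (fun n => d n ^+ 2) @ F --> (0 : R) ^+ 2.
    rewrite expr2 (_ : (fun _ => _) = (fun n => d n * d n)); first exact: cvgM.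
    by apply/funext => n; rewrite expr2.
  apply: cvgD; apply: cvgM => //; try exact: cvg_cst.
  exact: cvg_norm.
apply: mlim_squeeze b0 _; apply: nearW => n.
rewrite -[E _ - _](subrK (d n *: X)) (le_trans (mnD _ _)) // lerD ?EC //.
by rewrite mnZ.
Qed.

Lemma onep_commX E X t : onep E X -> E t *m X = X *m E t.
Proof.
move=> oE; have d0 n : n.+1%:R^-1 != 0 :> R by rewrite invr_eq0 pnatr_eq0.
have lX := onep_tan oE d0 cvg_invn; have cE := mlim_cst (E t).
apply: mlim_unique (mlimM cE lX) _; apply: (mlim_ext _ (mlimM lX cE)) => n.
rewrite -scalemxAl -scalemxAr mulmxBl mulmxBr mul1mx mulmx1.
by rewrite (onep_commute _ _ oE).
Qed.

Lemma quad_derive (V : normedModType R) (f : R -> V) (C t : R) (d : V) :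
  (forall h : R, `|f (t + h) - f t - h *: d| <= C * h ^+ 2) -> is_derive t 1 f d.
Proof.
move=> fC; have H : (fun h => h^-1 *: ((f \o shift t) (h *: 1) - f t)) @ 0^' --> d.
  apply/cvgrPdist_le => e e0; near=> h.
  have h0 : h != 0 by near: h; exact: nbhs_dnbhs_neq.
  have he : `|h| <= e / (`|C| + 1).
    near: h; apply: dnbhs0_le; rewrite divr_gt0 // ltr_wpDl //.
  rewrite /= [h *: 1]mulr1 distrC.
  have -> : h^-1 *: (f (h + t) - f t) - d = h^-1 *: (f (t + h) - f t - h *: d).
    by rewrite [RHS]scalerBr scalerA mulVf // scale1r [h + t]addrC.
  rewrite normrZ normfV ler_pdivrMl ?normr_gt0 // (le_trans (fC h)) //.
  rewrite -(real_normK (num_real h)) expr2 mulrCA ler_wpM2l //.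
  have C1 : C <= `|C| + 1 by rewrite (le_trans (ler_norm C)) // lerDl.
  rewrite (le_trans (ler_wpM2r (normr_ge0 h) C1)) //.
  by rewrite mulrC -ler_pdivlMr // ltr_wpDl.
by split; [exact: cvgP H|exact: cvg_lim H].
Unshelve. all: by end_near.
Qed.

Lemma onep_derive E X (t : R) i j : (forall t, orth (E t)) -> onep E X ->
  is_derive t 1 (fun t : R => E t i j) ((E t *m X) i j).
Proof.
move=> oE [E0 ED [C EC]]; apply: (@quad_derive _ _ ((N * N)%:R * C)) => h.
have -> : E (t + h) i j - E t i j - h * (E t *m X) i j = (E t *m (E h - 1%:M - h *: X)) i j.
  by rewrite ED !mulmxBr mulmx1 -scalemxAr !mxE.
rewrite (le_trans (mn_entry _ _ _)) // (le_trans (mnM _ _)) // -mulrA ler_pM ?mn_ge0 //.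
exact: orth_mn.
Qed.

Lemma onep_derivev E X (t : R) (v : 'cV[R]_N) i : (forall t, orth (E t)) -> onep E X ->
  is_derive t 1 (fun t => (E t *m v) i 0) ((X *m (E t *m v)) i 0).
Proof.
move=> oE oX.
have -> : (fun t => (E t *m v) i 0) = \sum_j (fun t => v j 0 * E t i j).
  by apply/funext => s; rewrite fct_sumE mxE; apply: eq_bigr => j _; rewrite mulrC.
have -> : (X *m (E t *m v)) i 0 = \sum_j v j 0 * (E t *m X) i j.
  rewrite mulmxA -(onep_commX _ oX) mxE; apply: eq_bigr => j _; exact: mulrC.
apply: is_derive_sum => j; apply: is_deriveZ; exact: onep_derive.
Qed.

Lemma onep_fix E X v t : (forall t, orth (E t)) -> onep E X -> X *m v = 0 -> E t *m v = v :> 'cV_N.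
Proof.
move=> oE oX Xv; apply/matrixP => i j; rewrite ord1.
have [E0 _ _] := oX; transitivity ((E 0 *m v) i 0); last by rewrite E0 mul1mx.
apply: (@is_derive_0_is_cst R (fun t => (E t *m v) i 0)) => s.
have := onep_derivev s v i oE oX.
by rewrite mulmxA -(onep_commX _ oX) -mulmxA Xv mulmx0 mxE.
Qed.

Lemma polyfun_chain n (f : 'cV[R]_n -> R) (u : R -> 'cV[R]_n) (t : R) (w : 'cV[R]_n) : polyfun f ->
  (forall i, is_derive t 1 (fun t => u t i 0) (w i 0)) ->
  is_derive t 1 (fun t => f (u t)) (pder w f (u t)).
Proof.
move=> pf uw; elim: pf => {f} [k|i|f g pf df pg dg|f g pf df pg dg|f g fg _ df].
- by rewrite pder_cst; exact: is_derive_cst.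
- by rewrite derive_coord.
- by rewrite deriveD_poly //; exact: is_deriveD.
- by rewrite deriveM_poly //; exact: is_deriveM.
- by rewrite -(funext fg).
Qed.

Lemma onep_polyfun E X (f : 'cV[R]_N -> R) t v : (forall t, orth (E t)) -> onep E X ->
  polyfun f -> (forall w, pder (X *m w) f w = 0) -> f (E t *m v) = f v.
Proof.
move=> oE oX pf fX; have [E0 _ _] := oX; transitivity (f (E 0 *m v)); last by rewrite E0 mul1mx.
apply: (@is_derive_0_is_cst R (fun t => f (E t *m v))) => s.
rewrite -(fX (E s *m v)); apply: polyfun_chain => // i; exact: onep_derivev.
Qed.

Variable K : set 'M[R]_N.
Hypothesis cgK : closed_group K.

Lemma cg_onep_orth E : (forall t, K (E t)) -> forall t, orth (E t).
Proof. by move=> KE t; apply: (cg_orth cgK). Qed.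

Lemma lie_skew X : lie K X -> X^T = - X.
Proof.
move=> [E oE KE]; have d0 n : (0 : R) < n.+1%:R^-1 by rewrite invr_gt0.
apply: (skew_tan (fun n => cg_onep_orth KE n.+1%:R^-1) d0 cvg_invn).
by apply: onep_tan cvg_invn => // n; rewrite gt_eqF.
Qed.

Lemma lie0 : lie K 0.
Proof.
exists (fun=> 1%:M) => [|t]; last exact: cg1.
split=> // [s t|]; first by rewrite mulmx1.
by exists 0 => t; rewrite subrr scaler0 subr0 mn0 mul0r.
Qed.

Lemma lieZ c X : lie K X -> lie K (c *: X).
Proof.
move=> [E [E0 ED [C EC]] KE]; exists (fun t => E (t * c)) => [|t]; last exact: KE.
split=> [|s t|]; [by rewrite mul0r|by rewrite mulrDl|exists (C * c ^+ 2) => t].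
by rewrite scalerA (le_trans (EC _)) // exprMn mulrA mulrAC.
Qed.

Lemma lie_of_curve X (g : R -> 'M[R]_N) (d : R -> R) : (forall n : nat, K (g n.+1%:R^-1)) ->
  (forall n : nat, 0 < d n.+1%:R^-1) -> (fun n => d n.+1%:R^-1) @ F --> (0 : R) ->
  mlim (fun n => (d n.+1%:R^-1)^-1 *: (g n.+1%:R^-1 - 1%:M)) X -> lie K X.
Proof. by move=> Kg d0 dl; exact: (lie_tan cgK Kg d0 dl). Qed.

Let dn0 (n : nat) : n.+1%:R^-1 != 0 :> R.
Proof. by rewrite invr_eq0 pnatr_eq0. Qed.

Lemma lieD X Y : lie K X -> lie K Y -> lie K (X + Y).
Proof.
move=> [E oE KE] [E' oE' KE']; apply: (@lie_of_curve _ (fun t => E t *m E' t) id).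
- by move=> n; apply: (cgM cgK).
- by move=> n; rewrite invr_gt0.
- exact: cvg_invn.
have l1 := onep_tan oE dn0 cvg_invn; have l2 := onep_tan oE' dn0 cvg_invn.
have l3 := onep_lim1 oE' cvg_invn.
have := mlimD (mlimM l1 l3) l2; rewrite mulmx1 => H; apply: (mlim_ext _ H) => n.
by rewrite -scalemxAl -scalerDr mulmxBl mul1mx addrA subrK.
Qed.

Lemma lie_sum (I : Type) (r : seq I) (P : pred I) (f : I -> 'M[R]_N) :
  (forall i, P i -> lie K (f i)) -> lie K (\sum_(i <- r | P i) f i).
Proof. by move=> Kf; apply: (big_ind (lie K)) => //; [exact: lie0|exact: lieD]. Qed.

Lemma lie_conj k X : K k -> lie K X -> lie K (k *m X *m k^T).
Proof.
move=> Kk [E [E0 ED [C EC]] KE]; have ok := cg_orth cgK Kk.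
exists (fun t => k *m E t *m k^T) => [|t]; last by do !apply: (cgM cgK) => //; apply: (cgT cgK).
split=> [|s t|]; first by rewrite E0 mulmx1 orthC.
  by rewrite ED !mulmxA -[_ *m k^T *m k]mulmxA ok mulmx1.
exists (mn k * C * mn k^T) => t.
have -> : k *m E t *m k^T - 1%:M - t *: (k *m X *m k^T) = k *m (E t - 1%:M - t *: X) *m k^T.
  by rewrite !mulmxBr !mulmxBl mulmx1 orthC // -scalemxAr -scalemxAl.
rewrite (le_trans (mnM _ _)) // mulrAC ler_wpM2r ?mn_ge0 // (le_trans (mnM _ _)) //.
by rewrite -mulrA ler_wpM2l ?mn_ge0.
Qed.

(** The commutator of [E t] and [E' t] deviates from 1 by [t ^ 2 [X, Y]] to leading order; the time
    scale is therefore [t * t]. *)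
Lemma lie_br X Y : lie K X -> lie K Y -> lie K (X *m Y - Y *m X).
Proof.
move=> [E oE KE] [E' oE' KE'].
apply: (@lie_of_curve _ (fun t => E t *m E' t *m (E t)^T *m (E' t)^T) (fun t => t * t)).
- by move=> n; do !apply: (cgM cgK) => //; apply: (cgT cgK).
- by move=> n; rewrite mulr_gt0 ?invr_gt0.
- by rewrite -[0](mulr0 0); apply: cvgM; exact: cvg_invn.
have l1 := onep_tan oE dn0 cvg_invn; have l2 := onep_tan oE' dn0 cvg_invn.
have l3 := mlimM (mlim_tr (onep_lim1 oE cvg_invn)) (mlim_tr (onep_lim1 oE' cvg_invn)).
have := mlimM (mlimB (mlimM l1 l2) (mlimM l2 l1)) l3; rewrite !trmx1 !mulmx1 => H.
apply: (mlim_ext _ H) => n; set t := n.+1%:R^-1; set a := E t; set b := E' t.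
have oa : orth a := cg_onep_orth KE t; have ob : orth b := cg_onep_orth KE' t.
rewrite -!scalemxAl -!scalemxAr !scalerA -scalerBr -scalemxAl invfM; congr (_ *: _).
have -> : (a - 1%:M) *m (b - 1%:M) - (b - 1%:M) *m (a - 1%:M) = a *m b - b *m a.
  rewrite !mulmxBl !mulmxBr !mul1mx !mulmx1.
  by apply/matrixP => i j; rewrite !mxE; ring.
rewrite mulmxBl !mulmxA; congr (_ - _).
by rewrite -[b *m a *m a^T]mulmxA orthC // mulmx1 orthC.
Qed.

Lemma fixator_closed_group (T : Type) (f : T -> 'cV[R]_N) :
  closed_group [set k | K k /\ forall t, k *m f t = f t].
Proof.
split.
- by split; [exact: cg1|move=> t; rewrite mul1mx].
- move=> h h' [Kh hf] [Kh' hf']; split; first exact: cgM.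
  by move=> t; rewrite -mulmxA hf' hf.
- move=> h [Kh hf]; split; first exact: cgT.
  by move=> t; rewrite -{1}(hf t) mulmxA (cg_orth cgK Kh) mul1mx.
- by move=> h [Kh _]; apply: (cg_orth cgK).
- move=> h L Hh hL; split; first by apply: (cg_lim cgK) hL => n; have [] := Hh n.
  move=> t; have l := mlimM hL (mlim_cst (f t)); apply: mlim_unique l _.
  by apply: (mlim_ext _ (mlim_cst _)) => n; have [_ ->] := Hh n.
Qed.

Lemma subgroup_minimizer (H : set 'M[R]_N) k : closed_group H -> K k ->
  exists2 h, H h & forall h', H h' -> mn (k *m h - 1%:M) <= mn (k *m h' - 1%:M).
Proof.
move=> cgH Kk; pose A := [set mn (k *m h - 1%:M) | h in H].
have iA : has_inf A.
  split; first by exists (mn (k *m 1%:M - 1%:M)); exists 1%:M => //; apply: cg1.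
  by exists 0 => _ [h _ <-]; apply: mn_ge0.
have /choice[h hP] : forall n : nat, exists h, H h /\ mn (k *m h - 1%:M) < inf A + n.+1%:R^-1.
  move=> n; have [|_ [h Hh <-] lt] := @inf_adherent _ A n.+1%:R^-1 _ iA.
    by rewrite invr_gt0.
  by exists h.
have [L HL hL] := cg_seq cgH (fun n => (hP n).1).
exists L => // h' Hh'; apply: (@le_trans _ _ (inf A)).
  have l1 := mlim_mn (mlimB (mlimM (mlim_cst k) hL) (mlim_cst 1%:M)).
  have l2 : (fun n => inf A + n.+1%:R^-1) @ F --> inf A + 0.
    by apply: cvgD; [exact: cvg_cst|exact: cvg_invn].
  rewrite -[inf A]addr0; apply: ler_cvg_to l1 l2 _; apply: nearW => n.
  by have [_ /ltW] := hP n.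
by apply: ge_inf; [exact: iA.2|exists h'].
Qed.

(* [h n] brings [k n] as close to 1 as [H] allows, so that the limiting direction
   [X] is not tangent to [H]. *)
Theorem transversal_direction (H : set 'M[R]_N) (k : nat -> 'M[R]_N) :
  closed_group H -> H `<=` K -> (forall n, K (k n)) -> (\forall n \near F, ~ H (k n)) ->
  mlim k 1%:M ->
  exists (h : nat -> 'M[R]_N) (d : nat -> R) X,
    [/\ forall n, H (h n), forall n, 0 < d n,
        mlim (fun n => (d n)^-1 *: (k n *m h n - 1%:M)) X, lie K X &
        forall E, onep E X -> ~ forall t, H (E t)].
Proof.
move=> cgH HK Kk nHk k1.
have /choice[h hP] : forall n, exists h, H h /\
    forall h', H h' -> mn (k n *m h - 1%:M) <= mn (k n *m h' - 1%:M).
  by move=> n; have [h ? ?] := subgroup_minimizer cgH (Kk n); exists h.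
pose e n := mn (k n *m h n - 1%:M).
have e0 : \forall n \near F, 0 < e n.
  apply: filterS nHk => n nHkn; rewrite lt_neqAle mn_ge0 andbT eq_sym; apply/eqP => /mn_eq0/eqP.
  rewrite subr_eq0 => /eqP kh; apply: nHkn; have [Hh _] := hP n.
  have -> : k n = (h n)^T.
    by rewrite -[k n]mulmx1 -(orthC (cg_orth cgH Hh)) mulmxA kh mul1mx.
  exact: (cgT cgH).
(* The default keeps [d n] positive for all [n]; along [omega] it equals [e n]. *)
pose d n := if 0 < e n then e n else n.+1%:R^-1.
have d0 n : 0 < d n by rewrite /d; case: ifP => // _; rewrite invr_gt0.
have de : \forall n \near F, d n = e n by apply: filterS e0 => n en; rewrite /d en.
have ek n : e n <= mn (k n - 1%:M).
  by have [_ H1] := hP n; have := H1 1%:M (cg1 cgH); rewrite mulmx1.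
have mk := mlim_mn (mlimB k1 (mlim_cst 1%:M)); rewrite subrr mn0 in mk.
have el : e @ F --> (0 : R).
  by apply: squeeze_cvgr (cvg_cst 0) mk; apply: nearW => n; rewrite mn_ge0 ek.
have dl : d @ F --> (0 : R).
  by apply: cvg_trans el; apply: near_eq_cvg; apply: filterS de => n ->.
have [|X gX] := mlim_ex (g := fun n => (d n)^-1 *: (k n *m h n - 1%:M)) (M := 1).
  apply: filterS de => n den; rewrite mnZ normfV (gtr0_norm (d0 n)) den -/(e n) mulVf //.
  by rewrite -den gt_eqF.
have Kg n : K (k n *m h n) by apply: (cgM cgK) => //; apply: HK; have [] := hP n.
exists h, d, X; split=> // [n||E oE HE]; [by have [] := hP n|exact: lie_tan gX|].
have dn n : - d n != 0 by rewrite oppr_eq0 gt_eqF.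
have dnl : (fun n => - d n) @ F --> (0 : R) by rewrite -oppr0; apply: cvgN.
have g1 := tan_lim1 d0 dl gX.
have l1 := onep_tan oE dn dnl; have lE := onep_lim1 oE dnl.
(* [k h E(-d) - 1 = ((k h - 1) - d X) E(-d) + (E(-d) - 1) + d X E(-d)] *)
have l := mlimD (mlimM (mlimB gX (mlim_cst X)) lE) (mlimB (mlimM (mlim_cst X) lE) l1).
rewrite subrr mul0mx add0r mulmx1 subrr in l.
have := mlim_mn l; rewrite mn0 => l'.
have : (1 : R) <= 0.
  have l1' : (fun _ : nat => 1 : R) @ F --> (1 : R) by apply: cvg_cst.
  apply: ler_cvg_to l1' l' _; apply: filterS de => n den.
  (* If [X] were tangent to [H], then [h E(- d)] would be a competitor in [H] at distance [o(d)]
     from the goal, whereas the minimal distance is [d]. *)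
  have [Hh Hmin] := hP n; have := Hmin _ (cgM cgH Hh (HE (- d n))).
  rewrite -/(e n) -den => H1.
  have -> : ((d n)^-1 *: (k n *m h n - 1%:M) - X) *m E (- d n) +
      (X *m E (- d n) - (- d n)^-1 *: (E (- d n) - 1%:M)) =
      (d n)^-1 *: (k n *m (h n *m E (- d n)) - 1%:M).
    rewrite invrN scaleNr opprK mulmxBl addrA subrK -scalemxAl -scalerDr.
    by rewrite mulmxBl mul1mx mulmxA addrA subrK.
  by rewrite mnZ normfV (gtr0_norm (d0 n)) ler_pdivlMl // mulr1.
by rewrite ler10.
Qed.

End LieAlgebra.

(** * Root decomposition of a polar representation *)

Section Eigenbasis.
Variables (R : realType) (m : nat).
Implicit Types (A : 'M[R]_m) (x y : 'cV[R]_m).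

Lemma mn_dot x : dot x x = 1 -> mn x <= m%:R.
Proof.
move=> x1; apply: (@le_trans _ _ (\sum_(i < m) 1)); last by rewrite sumr_const card_ord.
apply: ler_sum => i _; rewrite big_ord1 -(@ler_pXn2r _ 2) ?nnegrE // real_normK ?num_real //.
rewrite expr1n -x1 /dot (bigD1 i) //= -expr2 lerDl; apply: sumr_ge0 => j _.
by rewrite -expr2 sqr_ge0.
Qed.

Definition clsub (W : set 'cV[R]_m) := (forall c x y, W x -> W y -> W (c *: x + y)) /\
  (forall g L, (forall n : nat, W (g n)) -> mlim g L -> W L).

Lemma clsub_eq0 n (W : set 'cV[R]_m) (B : 'M[R]_(n, m)) : clsub W -> clsub [set x | W x /\ B *m x = 0].
Proof.
move=> [Wl Wc]; split=> [c x y [Wx Bx] [Wy By]|g L Wg gL].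
  by split; [exact: Wl|rewrite mulmxDr -scalemxAr Bx By scaler0 addr0].
split; first by apply: Wc gL => k; have [] := Wg k.
have l := mlimM (mlim_cst B) gL; apply: mlim_unique l _.
by apply: (mlim_ext _ (mlim_cst 0)) => k; have [] := Wg k.
Qed.

Lemma rayleigh (W : set 'cV[R]_m) A : clsub W -> A^T = A -> (forall x, W x -> W (A *m x)) ->
  (exists2 x, W x & x != 0) -> exists l x, [/\ W x, x != 0 & A *m x = l *: x].
Proof.
move=> [Wl Wc] AT AW [x0 Wx0 x00].
have W0 : W 0 by rewrite -(subrr x0) -scaleN1r addrC; apply: Wl.
have WZ c x : W x -> W (c *: x) by move=> Wx; rewrite -[_ *: _]addr0; apply: Wl.
have unit x : x != 0 -> exists c, dot (c *: x) (c *: x) = 1.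
  rewrite -dot_gt0 => xx; exists (Num.sqrt (dot x x))^-1.
  by rewrite dotZl dotZr mulrA -invfM -expr2 sqr_sqrtr ?mulVf ?gt_eqF // ltW.
pose V := [set dot (A *m x) x | x in [set x | W x /\ dot x x = 1]].
have sV : has_sup V.
  split.
    have [c c1] := unit _ x00.
    by exists (dot (A *m (c *: x0)) (c *: x0)); exists (c *: x0) => //; split; [exact: WZ|].
  exists (mn A * m%:R * m%:R) => _ [x [Wx x1] <-].
  apply: le_trans (ler_norm _) _; apply: le_trans (dot_le_mn _ _) _; apply: ler_pM; rewrite ?mn_ge0 ?mn_dot //.
  by rewrite (le_trans (mnM _ _)) // ler_wpM2l ?mn_ge0 ?mn_dot.
set l := sup V.
have lmax x : W x -> dot (A *m x) x <= l * dot x x.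
  move=> Wx; have [->|xn0] := eqVneq x 0; first by rewrite !dot0r mulr0.
  have [c c1] := unit x xn0; have := ub_le_sup sV.2 (x := dot (A *m (c *: x)) (c *: x)) _.
  have : V (dot (A *m (c *: x)) (c *: x)) by exists (c *: x) => //; split=> //; apply: WZ.
  move=> Vx /(_ Vx); rewrite -/l -scalemxAr !dotZl !dotZr => H.
  have c0 : 0 < c * c.
    rewrite -expr2 lt_def sqr_ge0 andbT sqrf_eq0; apply/eqP => cz.
    by move: c1; rewrite cz scale0r dot0l => /eqP; rewrite eq_sym oner_eq0.
  have := c1; rewrite dotZl dotZr mulrA => c1'.
  by rewrite -(ler_pM2l c0) [leRHS]mulrCA c1' mulr1 -mulrA.
have /choice[g gP] : forall n : nat, exists x, [/\ W x, dot x x = 1 & l - n.+1%:R^-1 < dot (A *m x) x].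
  move=> n; have [|_ [x [Wx x1] <-] lt] := @sup_adherent _ V n.+1%:R^-1 _ sV.
    by rewrite invr_gt0.
  by exists x.
have [|x gx] := mlim_ex (g := g) (M := m%:R).
  by apply: nearW => n; have [_ x1 _] := gP n; apply: mn_dot.
have Wx : W x by apply: Wc gx => n; have [] := gP n.
have x1 : dot x x = 1.
  apply: (norm_cvg_unique (mlim_dot gx gx)); rewrite (_ : (fun _ => _) = fun=> 1); first exact: cvg_cst.
  by apply/funext => n; have [] := gP n.
have xl : l <= dot (A *m x) x.
  have l1 : (fun n => l - n.+1%:R^-1) @ omega --> l - 0.
    by apply: cvgB; [exact: cvg_cst|exact: cvg_invn].
  rewrite -[l]subr0; apply: ler_cvg_to l1 (mlim_dot (mlimM (mlim_cst A) gx) gx) _.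
  by apply: nearW => n; have [_ _ /ltW] := gP n.
exists l, x; split=> //; first by rewrite -dot_gt0 x1.
(* The quadratic form [l |y|^2 - <A y, y>] is nonnegative on [W] and vanishes at [x]. *)
have Wy : W (A *m x - l *: x) by rewrite -scaleN1r scalerA addrC; apply: Wl => //; apply: AW.
apply/eqP; rewrite -subr_eq0; move: Wy; have [y yE] : exists y, y = A *m x - l *: x by eexists.
rewrite -yE -dot_eq0 => Wy; apply/eqP.
have q t : 0 <= l * dot (x + t *: y) (x + t *: y) - dot (A *m (x + t *: y)) (x + t *: y).
  by rewrite subr_ge0 lmax // addrC; apply: Wl.
have Axy : dot (A *m x) y = dot y y + l * dot x y.
  by rewrite -dotZl -dotDl yE subrK.
have Ayx : dot (A *m y) x = dot (A *m x) y by rewrite dot_mulmx AT dotC.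
have {}q t : 0 <= t ^+ 2 * (l * dot y y - dot (A *m y) y) - 2 * t * dot y y.
  have := q t; rewrite mulmxDr -scalemxAr !(dotDl, dotDr, dotZl, dotZr) Ayx Axy x1.
  rewrite (dotC y x) => H; apply: le_trans H _.
  have := xl; set u := dot (A *m x) x; set v := dot x y; set z := dot y y.
  by set w := dot (A *m y) y => ul; nra.
set z := dot y y in q *; set w := _ - _ in q.
have z0 : 0 <= z := dot_ge0 y.
apply/eqP; rewrite eq_le z0 andbT leNgt; apply/negP => zp.
have W0' : 0 < `|w| + 1 by rewrite ltr_wpDl.
have := q (z / (`|w| + 1)); rewrite leNgt => /negP; apply.
set t := z / (`|w| + 1); have t0 : 0 < t by rewrite divr_gt0.
have tw : t * w < z.
  rewrite /t mulrAC ltr_pdivrMr // ltr_pM2l // (le_lt_trans (ler_norm _)) //.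
  by rewrite ltrDl.
have : t * (t * w) < t * z by rewrite ltr_pM2l.
rewrite expr2; nra.
Qed.

Lemma common_eigenvector (r : seq 'M[R]_m) (W : set 'cV[R]_m) : clsub W ->
  (forall A, A \in r -> A^T = A) -> (forall A B, A \in r -> B \in r -> A *m B = B *m A) ->
  (forall A x, A \in r -> W x -> W (A *m x)) -> (exists2 x, W x & x != 0) ->
  exists x, [/\ W x, x != 0 & forall A, A \in r -> exists l, A *m x = l *: x].
Proof.
elim: r W => [|A r IH] W cW rT rC rW Wn0; first by have [x Wx x0] := Wn0; exists x.
have Ar : A \in A :: r by rewrite mem_head.
have rr B : B \in r -> B \in A :: r by rewrite in_cons orbC => ->.
have [l [x [Wx x0 Ax]]] := rayleigh cW (rT _ Ar) (fun x => rW A x Ar) Wn0.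
have E y : (A - l%:M) *m y = A *m y - l *: y by rewrite mulmxBl mul_scalar_mx.
have [|||||y [[Wy Ay] y0 yr]] := IH [set x | W x /\ (A - l%:M) *m x = 0].
- exact: clsub_eq0.
- by move=> B /rr; apply: rT.
- by move=> B C /rr Br /rr Cr; apply: rC.
- move=> B y /rr Br [Wy Ay]; split; first exact: rW.
  rewrite E mulmxA rC // -mulmxA; move/eqP: Ay; rewrite E subr_eq0 => /eqP ->.
  by rewrite -scalemxAr subrr.
- by exists x => //; split=> //; rewrite E Ax subrr.
exists y; split=> // B; rewrite in_cons => /orP[/eqP ->|]; last exact: yr.
by exists l; move/eqP: Ay; rewrite E subr_eq0 => /eqP.
Qed.

Theorem common_eigenbasis (r : seq 'M[R]_m) :
  (forall A, A \in r -> A^T = A) -> (forall A B, A \in r -> B \in r -> A *m B = B *m A) ->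
  exists2 Q : 'M[R]_m, orth Q & forall A l, A \in r -> exists c : R, A *m col l Q = c *: col l Q.
Proof.
move=> rT rC.
suff [Q [oQ QA]] : exists Q : 'M[R]_(m, m), Q^T *m Q = 1%:M /\
    forall A l, A \in r -> exists c : R, A *m col l Q = c *: col l Q by exists Q.
suff: forall j, (j <= m)%N -> exists Q : 'M[R]_(m, j), Q^T *m Q = 1%:M /\
    forall A l, A \in r -> exists c : R, A *m col l Q = c *: col l Q by apply.
elim=> [|j IH] jm.
  by exists 0; split=> [|A []//]; rewrite [RHS]flatmx0 [LHS]flatmx0.
have [Q [QQ QA]] := IH (ltnW jm).
pose W := [set x : 'cV[R]_m | Q^T *m x = 0].
have cW : clsub W.
  have cT : clsub setT by [].
  by have := clsub_eq0 Q^T cT; rewrite (_ : [set _ | _] = W) //; apply/seteqP; split=> x; [case|].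
have QW x : W x <-> forall l, dot (col l Q) x = 0.
  have E l : dot (col l Q) x = (Q^T *m x) l 0.
    by rewrite mxE; apply: eq_bigr => i _; rewrite !mxE.
  split=> [Wx l|H]; first by rewrite E Wx mxE.
  by apply/matrixP => l i; rewrite ord1 -E H mxE.
have [||x [Wx x0 xA]] := common_eigenvector cW rT rC.
- move=> A x Ar /QW Wx; apply/QW => l; rewrite -{1}(rT A Ar) -dot_mulmx.
  by have [y ->] := QA A l Ar; rewrite dotZl Wx mulr0.
- have : kermx Q != 0.
    by rewrite -mxrank_eq0 mxrank_ker subn_eq0 -ltnNge (leq_ltn_trans (rank_leq_col _)).
  case/rowV0Pn => v /sub_kermxP vQ v0; exists v^T.
    by rewrite /W /= -trmx_mul vQ trmx0.
  by rewrite -(inj_eq (@trmx_inj _ _ _)) trmxK trmx0.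
set c := (Num.sqrt (dot x x))^-1.
have c1 : dot (c *: x) (c *: x) = 1.
  rewrite dotZl dotZr mulrA -invfM -expr2 sqr_sqrtr ?dot_ge0 // mulVf //.
  by rewrite dot_eq0.
have xQ : Q^T *m (c *: x) = 0 by rewrite -scalemxAr Wx scaler0.
have xx : (c *: x)^T *m (c *: x) = 1%:M.
  apply/matrixP => i k; rewrite !ord1 [RHS]mxE eqxx -c1 mxE; apply: eq_bigr => l _.
  by rewrite mxE.
have cQ (l : 'I_(1 + j)) : col l (row_mx (c *: x) Q) = c *: x \/
    exists l', col l (row_mx (c *: x) Q) = col l' Q.
  case: (split_ordP l) => l' ->; [left|right].
    by rewrite [l']ord1; apply/matrixP => a b; rewrite ord1 [LHS]mxE row_mxEl.
  by exists l'; apply/matrixP => a b; rewrite ord1 [LHS]mxE row_mxEr [RHS]mxE.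
have orthQ : (row_mx (c *: x) Q)^T *m row_mx (c *: x) Q = 1%:M.
  rewrite tr_row_mx mul_col_row xx xQ QQ.
  have -> : (c *: x)^T *m Q = 0 by rewrite -[LHS]trmxK trmx_mul trmxK xQ trmx0.
  by rewrite -scalar_mx_block.
exists (row_mx (c *: x) Q); split=> [|A l Ar]; first exact: orthQ.
case: (cQ l) => [->|[l' ->]]; last exact: QA.
by have [y Ay] := xA A Ar; exists y; rewrite -scalemxAr Ay !scalerA mulrC.
Qed.

End Eigenbasis.

Lemma row_free_gram (R : realType) (r n : nat) (B : 'M[R]_(r, n)) :
  row_free B = (\det (B *m B^T) != 0).
Proof.
rewrite -unitfE -unitmxE -row_free_unit; apply/idP/idP => fB; last first.
  by rewrite -row_leq_rank (leq_trans _ (mxrankM_maxl B B^T)) // row_leq_rank.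
rewrite -kermx_eq0; apply/eqP/row_matrixP => i; rewrite row0.
set x := row i _; have xB : x *m (B *m B^T) = 0 by apply/sub_kermxP; apply: row_sub.
have : dot (x *m B)^T (x *m B)^T = 0.
  have -> : dot (x *m B)^T (x *m B)^T = ((x *m (B *m B^T)) *m x^T) 0 0.
    rewrite mulmxA -mulmxA -trmx_mul mxE; apply: eq_bigr => j _; rewrite !mxE.
    by congr (_ * _); rewrite mxE.
  by rewrite xB mul0mx mxE.
move/eqP; rewrite dot_eq0 -trmx0 (inj_eq (@trmx_inj _ _ _)) => /eqP.
by move/eqP; rewrite mulmx_free_eq0 // => /eqP.
Qed.

(** The determinant of [(B + t C) B^T] is a polynomial in [t] whose value at 0 is the Gram
    determinant of [B]. *)
Lemma row_free_perturb (R : realType) (r n : nat) (B C : 'M[R]_(r, n)) : row_free B ->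
  exists2 t, t != 0 & row_free (B + t *: C).
Proof.
move=> fB; pose P := map_mx polyC (B *m B^T) + 'X *: map_mx polyC (C *m B^T).
have PE t : (\det P).[t] = \det ((B + t *: C) *m B^T).
  rewrite -horner_evalE -det_map_mx; congr (\det _); apply/matrixP => i j.
  by rewrite mulmxDl -scalemxAl !mxE /= /horner_eval !hornerE.
have Pn0 : \det P != 0.
  apply/eqP => P0; move: fB; rewrite row_free_gram; have := PE 0.
  by rewrite scale0r addr0 P0 horner0 => <-; rewrite eqxx.
have [t t0 Pt] : exists2 t, t != 0 & (\det P).[t] != 0.
  apply: contrapT => H; have : 'X * \det P = 0.
    apply: poly_fun_eq0 => t; rewrite hornerM hornerX; apply/eqP; rewrite mulf_eq0.
    by apply/negPn/negP; rewrite negb_or => /andP[t0 Pt]; apply: H; exists t.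
  by move/eqP; rewrite mulf_eq0 polyX_eq0 (negPf Pn0).
exists t => //; rewrite -row_leq_rank; move: Pt; rewrite PE -unitfE -unitmxE -row_free_unit.
by rewrite -row_leq_rank => /leq_trans; apply; apply: mxrankM_maxl.
Qed.

Lemma row_free_adjoin (R : realType) (r n : nat) (B : 'M[R]_(r, n)) (w : 'rV[R]_n) :
  row_free B -> ~~ (w <= B)%MS -> row_free (col_mx B w).
Proof.
move=> fB wB; rewrite -row_leq_rank -addsmxE addn1.
have : (\rank B < \rank (B + w)%MS)%N.
  rewrite (ltn_leqif (mxrank_leqif_sup (addsmxSl B w))); apply: contra wB.
  exact: submx_trans (addsmxSr B w).
by move/eqP: fB => ->.
Qed.

Lemma poly_near_eq0 (R : realType) (p : {poly R}) :
  (\forall n \near omega, p.[n.+1%:R^-1] = 0) -> p = 0.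
Proof.
have [m] := ubnP (size p); elim: m => // m IH in p *; rewrite ltnS => pm pz.
have hc (q : {poly R}) : (fun n => q.[n.+1%:R^-1]) @ omega --> q.[0].
  elim/poly_ind: q => [|q c IHq].
    rewrite horner0 (_ : (fun _ => _) = fun=> 0); first exact: cvg_cst.
    by apply/funext => n; rewrite horner0.
  rewrite hornerMXaddC mulr0 (_ : (fun _ => _) = fun n => q.[n.+1%:R^-1] * n.+1%:R^-1 + c).
    rewrite -(mulr0 q.[0]); apply: cvgD; last exact: cvg_cst.
    by apply: cvgM => //; exact: cvg_invn.
  by apply/funext => n; rewrite hornerMXaddC.
have p0 : p.[0] = 0.
  have z : (fun _ : nat => 0 : R) @ omega --> (0 : R) by apply: cvg_cst.
  apply: norm_cvg_unique (hc p) _; apply: cvg_trans z; apply: near_eq_cvg.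
  by apply: filterS pz => n ->.
have /factor_theorem[q qE] : root p 0 by rewrite rootE p0.
rewrite subr0 in qE; have [->|pn0] := eqVneq p 0; first by [].
have qn0 : q != 0 by apply: contraNneq pn0 => q0; rewrite qE q0 mul0r.
move: pn0; rewrite qE (IH q) ?mul0r ?eqxx //.
  by move: pm; rewrite qE size_mulX // => /(leq_trans _); apply.
apply: filterS pz => n; rewrite qE hornerM hornerX => /eqP.
by rewrite mulf_eq0 invr_eq0 pnatr_eq0 orbF => /eqP.
Qed.

(** * Regular points and their normal spaces *)

Section Polar.
Variables (R : realType) (s m : nat).
Local Notation inc := (@section_incl R s m).
Implicit Types (X : 'M[R]_(s + m)) (c : 'cV[R]_s).

Record polar (K : set 'M[R]_(s + m)) : Prop := Polar {
  polar_cg : closed_group K;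
  polar_meet : forall v, exists2 k, K k & exists c, k *m v = inc c;
  polar_perp : forall X c c', lie K X -> dot (X *m inc c) (inc c') = 0
}.

Lemma inc_lin c c' x : inc (x *: c + c') = x *: inc c + inc c'.
Proof. by rewrite incD incZ. Qed.

Lemma inc_ds (v : 'cV[R]_(s + m)) : dsubmx v = 0 -> v = inc (usubmx v).
Proof. by move=> v0; rewrite -[LHS]vsubmxK v0. Qed.

Lemma ds_inc c : dsubmx (inc c) = 0.
Proof. exact: col_mxKd. Qed.

Lemma us_inc c : usubmx (inc c) = c.
Proof. exact: col_mxKu. Qed.

Variable K : set 'M[R]_(s + m).
Hypothesis pK : polar K.
Let cgK := polar_cg pK.

Lemma polar_conj k X c c' : K k -> lie K X -> dot (X *m (k *m inc c)) (k *m inc c') = 0.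
Proof.
move=> Kk lX; have := polar_perp pK c c' (lie_conj cgK (cgT cgK Kk) lX).
by rewrite trmxK -!mulmxA dot_mulmx trmxK.
Qed.

(** The orbit of [v] has dimension at least [r]. *)
Definition rk (v : 'cV[R]_(s + m)) r := exists Xs : 'I_r -> 'M[R]_(s + m),
  (forall i, lie K (Xs i)) /\ row_free (\matrix_i (Xs i *m v)^T).

Lemma rk_add v r (Xs : 'I_r -> 'M[R]_(s + m)) X : (forall i, lie K (Xs i)) -> lie K X ->
  row_free (col_mx (\matrix_i (Xs i *m v)^T) (X *m v)^T) -> rk v (r + 1).
Proof.
move=> Xl lX fr; exists (fun i => match fintype.split i with inl j => Xs j | inr _ => X end).
split=> [i|]; first by case: (fintype.split i).
move: fr; congr (is_true (row_free _)); apply/matrixP => i j; rewrite [RHS]mxE.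
case: (split_ordP i) => i' ->; first by rewrite col_mxEu mxE.
by rewrite col_mxEd ord1.
Qed.

Lemma regular_ex : exists p r, rk (inc p) r /\ forall v, ~ rk v (r + 1).
Proof.
pose P r := `[< exists v, rk v r >].
have P0 : exists r, P r.
  exists 0%N; apply/asboolP; exists 0, (fun=> 0); split=> [[]//|].
  by rewrite -row_leq_rank.
have Pb r : P r -> (r <= s + m)%N.
  move=> /asboolP[v [Xs [_]]]; rewrite -row_leq_rank => /leq_trans; apply; exact: rank_leq_col.
have [r /asboolP[v [Xs [lX fr]]] rmax] := ex_maxnP P0 Pb.
have [k Kk [p kv]] := polar_meet pK v.
exists p, r; split; last first.
  move=> w rw; have /rmax : P (r + 1)%N by apply/asboolP; exists w.
  by rewrite addn1 ltnn.
exists (fun i => k *m Xs i *m k^T); split=> [i|]; first exact: lie_conj.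
have ok := cg_orth cgK Kk.
have fk : row_free k^T.
  by rewrite row_free_unit; have [] := mulmx1_unit ok.
have -> : \matrix_i (k *m Xs i *m k^T *m inc p)^T = \matrix_i (Xs i *m v)^T *m k^T.
  apply/row_matrixP => i; rewrite row_mul !rowK -kv -!mulmxA [k^T *m _]mulmxA ok mul1mx.
  by rewrite trmx_mul.
by rewrite /row_free mxrankMfree.
Qed.

Section Regular.
Variables (p : 'cV[R]_s) (r : nat) (Xs : 'I_r -> 'M[R]_(s + m)).
Hypothesis Xs_lie : forall i, lie K (Xs i).
Hypothesis Xs_free : row_free (\matrix_i (Xs i *m inc p)^T).
Hypothesis r_max : forall v, ~ rk v (r + 1).

Let span v : (v^T <= \matrix_i (Xs i *m inc p)^T)%MS -> exists2 Y, lie K Y & Y *m inc p = v.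
Proof.
move=> /submxP[D vE]; exists (\sum_i D 0 i *: Xs i); first by apply: lie_sum => // i _; apply: lieZ.
apply: trmx_inj; rewrite vE mulmx_sum_row mulmx_suml linear_sum; apply: eq_bigr => i _ /=.
by rewrite rowK -scalemxAl linearZ.
Qed.

(** If [X] kills [p] but [X v] is not tangent to the orbit of [p], some point [p + t v] has an orbit
    of larger dimension: [t^-1 X] maps it to [X v], which is independent of the perturbed tangent
    vectors. *)
Lemma stab_span X v : lie K X -> X *m inc p = 0 -> exists2 Y, lie K Y & Y *m inc p = X *m v.
Proof.
move=> lX Xp; apply: span; apply/negPn/negP => nspan.
have := row_free_adjoin Xs_free nspan.
move=> /(row_free_perturb (col_mx (\matrix_i (Xs i *m v)^T) 0))[t t0 ft].
apply: (r_max (v := inc p + t *: v)); apply: (@rk_add _ r Xs (t^-1 *: X) Xs_lie); first exact: lieZ.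
move: ft; congr (is_true (row_free _)); rewrite scale_col_mx scaler0 add_col_mx addr0.
congr col_mx; last by rewrite mulmxDr -!scalemxAl Xp scaler0 add0r -scalemxAr scalerA mulVf ?scale1r.
apply/row_matrixP => i; rewrite linearD linearZ /= !rowK mulmxDr -scalemxAr.
by rewrite linearD linearZ.
Qed.

(** Write [X xi = Y p] by [stab_span]. Then [|X xi|^2 = <X xi, Y p> = - <xi, [X, Y] p>] because
    [X p = 0], and this is zero since [xi] and [p] lie in the section [k Sigma]. *)
Lemma stab_fixes_section k X c : K k -> lie K X -> X *m inc p = 0 ->
  (exists c0, inc p = k *m inc c0) -> X *m (k *m inc c) = 0.
Proof.
move=> Kk lX Xp [c0 pE]; set xi := k *m inc c.
have [Y lY YE] := stab_span xi lX Xp.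
apply/eqP; rewrite -dot_eq0 -{2}YE; apply/eqP.
have skX := lie_skew cgK lX.
rewrite dot_mulmx skX mulNmx dotNr mulmxA.
have -> : X *m Y *m inc p = (X *m Y - Y *m X) *m inc p.
  by rewrite mulmxBl -[Y *m X *m _]mulmxA Xp mulmx0 subr0.
by rewrite dotC pE polar_conj ?oppr0 //; apply: lie_br.
Qed.

(* The normal space of a regular orbit is the section: sections through points
   [p + t w_0 + t^2 w_1 + ...] converge, and are eventually constant. *)
Lemma sections_through (q : nat) (w : 'I_q -> 'cV[R]_(s + m)) :
  (forall i X, lie K X -> dot (X *m inc p) (w i) = 0) ->
  exists2 k, K k & forall i, exists c, w i = k *m inc c.
Proof.
move=> wp; pose v n := inc p + \sum_(i < q) n.+1%:R^-1 ^+ i.+1 *: w i : 'cV[R]_(s + m).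
have /choice[g gP] : forall n, exists g, K g /\ exists c, v n = g *m inc c.
  move=> n; have [k Kk [c kv]] := polar_meet pK (v n); exists k^T; split; first exact: cgT.
  by exists c; rewrite -kv mulmxA (cg_orth cgK Kk) mul1mx.
have Kg n : K (g n) by have [] := gP n.
have /choice[c cP] : forall n, exists c, v n = g n *m inc c by move=> n; have [] := gP n.
have [k Kk gk] := cg_seq cgK Kg.
have ok := cg_orth cgK Kk; have og n := cg_orth cgK (Kg n).
have vp : mlim v (inc p).
  have t0 i : (fun n => (n.+1%:R^-1 : R) ^+ i.+1) @ omega --> (0 : R).
    elim: i => [|i IH]; first exact: cvg_invn.
    rewrite -(mulr0 0) (_ : (fun _ => _) = fun n => n.+1%:R^-1 * n.+1%:R^-1 ^+ i.+1).
      by apply: cvgM => //; exact: cvg_invn.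
    by apply/funext => n; rewrite exprS.
  have S : mlim (fun n => \sum_(i < q) n.+1%:R^-1 ^+ i.+1 *: w i) (\sum_(i < q) 0 *: w i).
    move=> a b; rewrite summxE (_ : (fun _ => _) = fun n => \sum_(i < q) n.+1%:R^-1 ^+ i.+1 * w i a b).
      apply: cvg_bigsum => i; rewrite mxE; apply: cvgM => //; exact: cvg_cst.
    by apply/funext => n; rewrite summxE; apply: eq_bigr => i _; rewrite mxE.
  have := mlimD (mlim_cst (inc p)) S.
  by rewrite big1 ?addr0 // => i _; rewrite scale0r.
have Ec n : inc (c n) = (g n)^T *m v n by rewrite cP mulmxA og mul1mx.
have cl := mlimM (mlim_tr gk) vp.
have [c0 c0E] : exists c0, inc p = k *m inc c0.
  exists (usubmx (k^T *m inc p)); rewrite -inc_ds ?mulmxA ?orthC ?mul1mx //.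
  apply/matrixP => i j; rewrite [LHS]mxE [RHS]mxE; apply: (norm_cvg_unique (cl _ _)).
  rewrite (_ : (fun _ => _) = fun=> 0); first exact: cvg_cst.
  by apply/funext => n; rewrite -Ec col_mxEd mxE.
pose H := [set h | K h /\ forall c, h *m (k *m inc c) = k *m inc c].
have cgH : closed_group H := fixator_closed_group cgK (fun c => k *m inc c).
pose k' n := g n *m k^T.
have Kk' n : K (k' n) by apply: (cgM cgK) => //; apply: cgT.
have k'1 : mlim k' 1%:M.
  by have := mlimM gk (mlim_cst k^T); rewrite orthC.
have k'k n c' : k' n *m (k *m inc c') = g n *m inc c'.
  by rewrite /k' -mulmxA [k^T *m _]mulmxA ok mul1mx.
have nearH : \forall n \near omega, H (k' n).
  (* Otherwise there is a direction [X] transversal to the fixator [H] of the limit section.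
     Polarity gives [X p = 0], so [X] kills that section and its one-parameter group lies in [H], a
     contradiction. *)
  have [//|nH] := in_ultra_setVsetC [set n | H (k' n)] omega_ultra.
  have [h [d [X [Hh d0 gX lX noX]]]] := transversal_direction cgK cgH (fun h => @proj1 _ _) Kk' nH k'1.
  have Xp : X *m inc p = 0.
    have uE n : (k' n *m h n) *m (k *m inc (c n)) = v n.
      by have [_ hk] := Hh n; rewrite -mulmxA hk k'k -cP.
    have ul : mlim (fun n => k *m inc (c n)) (inc p).
      have := mlimM (mlim_cst k) cl; rewrite mulmxA orthC // mul1mx => l.
      by apply: (mlim_ext _ l) => n; rewrite -Ec.
    have l := mlim_dot (mlim_cst (X *m inc p)) (mlimM gX ul).
    apply/eqP; rewrite -dot_eq0; apply/eqP; apply: norm_cvg_unique l _.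
    rewrite (_ : (fun _ => _) = fun=> 0); first exact: cvg_cst.
    apply/funext => n; rewrite -scalemxAl dotZr mulmxBl mul1mx uE.
    have -> : v n - k *m inc (c n) = \sum_(i < q) n.+1%:R^-1 ^+ i.+1 *: w i + k *m inc (c0 - c n).
      rewrite /v -[c0 - c n]addrC -[- c n]scaleN1r inc_lin mulmxDr -c0E -scalemxAr scaleN1r.
      by rewrite addrAC addrC [- _ + _]addrC.
    rewrite dotDr {2}c0E polar_conj // addr0 dot_sumr big1 ?mulr0 // => i _.
    by rewrite dotZr wp // mulr0.
  exfalso; have [E oE KE] := lX; apply: (noX E oE) => t; split=> // c'.
  apply: (onep_fix _ _ oE); first by move=> u; apply: (cg_orth cgK).
  by apply: (stab_fixes_section _ Kk lX Xp); exists c0.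
exists k => // i; exists (usubmx (k^T *m w i)).
rewrite -inc_ds ?mulmxA ?orthC ?mul1mx //.
apply/matrixP => a b; rewrite [RHS]mxE ord1.
(* The normal component of [k^T (p + t w_0 + ...)] is a polynomial in [t] that vanishes for almost
   all [t = 1 / (n + 1)]; its coefficients are the normal components of the [k^T w_i]. *)
pose P : {poly R} := \sum_(i < q) ((dsubmx (k^T *m w i)) a 0)%:P * 'X^(i.+1).
have P0 : P = 0.
  apply: poly_near_eq0; apply: filterS nearH => n [_ Hn].
  have vk : v n = k *m inc (c n) by rewrite -Hn k'k -cP.
  transitivity ((dsubmx (k^T *m v n)) a 0); last by rewrite vk mulmxA ok mul1mx ds_inc mxE.
  have -> : k^T *m v n = inc c0 + \sum_(i < q) n.+1%:R^-1 ^+ i.+1 *: (k^T *m w i).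
    rewrite /v mulmxDr c0E mulmxA ok mul1mx mulmx_sumr; congr (_ + _).
    by apply: eq_bigr => j _; rewrite scalemxAr.
  rewrite linearD linear_sum /= ds_inc add0r summxE horner_sum; apply: eq_bigr => j _.
  by rewrite linearZ /= [RHS]mxE !hornerE mulrC.
have := congr1 (fun P : {poly R} => P`_i.+1) P0; rewrite coef0 coef_sum => <-.
rewrite (bigD1 i) //= coefCM coefXn eqxx mulr1 big1 ?addr0 // => j ji.
by rewrite coefCM coefXn eqSS (inj_eq val_inj) eq_sym (negPf ji) mulr0.
Qed.

(** [sections_through] is applied to [v] together with a basis of the section: the section obtained
    contains the given one, hence equals it, and it contains [v]. *)
Lemma normal_section v : (forall X, lie K X -> dot (X *m inc p) v = 0) -> dsubmx v = 0.
Proof.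
move=> vp; pose w (i : 'I_(1 + s)) := match fintype.split i with inl _ => v | inr j => inc (delta_mx j 0) end.
have [|k Kk wk] := @sections_through _ w.
  move=> i X lX; rewrite /w; case: (fintype.split i) => j; first exact: vp.
  exact: (polar_perp pK).
have ok := cg_orth cgK Kk.
have wl : exists c, v = k *m inc c.
  by have [c] := wk (lshift s ord0); rewrite /w (unsplitK (inl ord0)); exists c.
have /choice[u uE] : forall j, exists c, inc (delta_mx j 0) = k *m inc c.
  by move=> j; have [c] := wk (rshift 1 j); rewrite /w (unsplitK (inr j)); exists c.
pose A : 'M[R]_s := \matrix_(i, j) u j i 0.
have uA c : inc c = k *m inc (A *m c).
  rewrite {1}(colv_sum c).
  have L (f : 'I_s -> 'cV[R]_s) : inc (\sum_i c i 0 *: f i) = \sum_i c i 0 *: inc (f i).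
    elim/big_rec2: _ => [|i y1 y2 _ IH]; first by rewrite /section_incl col_mx0.
    by rewrite inc_lin IH.
  rewrite L; have -> : A *m c = \sum_i c i 0 *: u i.
    apply/matrixP => a b; rewrite ord1 mxE summxE; apply: eq_bigr => i _.
    by rewrite !mxE mulrC.
  by rewrite L mulmx_sumr; apply: eq_bigr => i _; rewrite uE scalemxAr.
have dA c c' : dot (A *m c) (A *m c') = dot c c'.
  by rewrite -[RHS](dot_inc m) (uA c) (uA c') [RHS]dot_mulmx mulmxA ok mul1mx dot_inc.
have AA : A^T *m A = 1%:M.
  apply/matrixP => i j; rewrite -[LHS](mulmx_delta_entry _ j i) -mulmxA -dot_delta.
  by rewrite dot_mulmx trmxK dA dot_delta !mxE eq_sym eqxx andbT.
have [c ->] := wl.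
by rewrite -[c]mul1mx -(mulmx1C AA) -mulmxA -uA ds_inc.
Qed.

End Regular.
End Polar.

Section Conjugation.
Variables (R : realType) (N : nat).
Implicit Types (B X : 'M[R]_N) (K : set 'M[R]_N).

Definition conj_set B K := [set B^T *m k *m B | k in K].

Lemma conj_setP B K k : orth B -> conj_set B K k <-> K (B *m k *m B^T).
Proof.
move=> oB; split=> [[g Kg <-]|Kk].
  by rewrite !mulmxA orthC // mul1mx -mulmxA orthC // mulmx1.
by exists (B *m k *m B^T) => //; rewrite !mulmxA oB mul1mx -mulmxA oB mulmx1.
Qed.

Lemma closed_group_conj B K : orth B -> closed_group K -> closed_group (conj_set B K).
Proof.
move=> oB cgK; split.
- by apply/(conj_setP _ _ oB); rewrite mulmx1 orthC //; exact: cg1.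
- move=> g h /(conj_setP _ _ oB) Kg /(conj_setP _ _ oB) Kh; apply/(conj_setP _ _ oB).
  have := cgM cgK Kg Kh; rewrite !mulmxA -[B *m g *m B^T *m B]mulmxA oB mulmx1.
  by [].
- move=> g /(conj_setP _ _ oB) Kg; apply/(conj_setP _ _ oB).
  by have := cgT cgK Kg; rewrite !trmx_mul trmxK mulmxA.
- move=> g [k Kk <-]; rewrite /orth !trmx_mul trmxK !mulmxA.
  rewrite -[_ *m B *m B^T]mulmxA orthC // mulmx1 -[_ *m k^T *m k]mulmxA (cg_orth cgK Kk) mulmx1.
  by rewrite oB.
- move=> g L Kg gL; apply/(conj_setP _ _ oB).
  apply: (cg_lim cgK (g := fun n => B *m g n *m B^T)) => [n|].
    exact/(conj_setP _ _ oB).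
  by apply: mlimM (mlim_cst _); apply: mlimM gL; exact: mlim_cst.
Qed.

Lemma lie_conj_set B K X : orth B -> lie K X -> lie (conj_set B K) (B^T *m X *m B).
Proof.
move=> oB [E [E0 ED [C EC]] KE]; exists (fun t => B^T *m E t *m B) => [|t]; last by exists (E t).
split=> [|t u|]; first by rewrite E0 mulmx1.
  by rewrite ED !mulmxA -[_ *m B *m B^T]mulmxA orthC // mulmx1.
exists (mn B^T * C * mn B) => t.
have -> : B^T *m E t *m B - 1%:M - t *: (B^T *m X *m B) = B^T *m (E t - 1%:M - t *: X) *m B.
  by rewrite !mulmxBr !mulmxBl mulmx1 oB -scalemxAr -scalemxAl.
rewrite (le_trans (mnM _ _)) // mulrAC ler_wpM2r ?mn_ge0 // (le_trans (mnM _ _)) //.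
by rewrite -mulrA ler_wpM2l ?mn_ge0.
Qed.

Lemma orth_tr B : orth B -> orth B^T.
Proof. by move=> oB; rewrite /orth trmxK orthC. Qed.

Lemma conj_setK B K : orth B -> conj_set B^T (conj_set B K) = K.
Proof.
move=> oB; apply/seteqP; split=> k.
  move=> /(conj_setP _ _ (orth_tr oB))/(conj_setP _ _ oB).
  by rewrite trmxK !mulmxA orthC // mul1mx -mulmxA orthC // mulmx1.
move=> Kk; apply/(conj_setP _ _ (orth_tr oB))/(conj_setP _ _ oB).
by rewrite trmxK !mulmxA orthC // mul1mx -mulmxA orthC // mulmx1.
Qed.

Lemma lie_conj_setV B K X : orth B -> lie (conj_set B K) X -> lie K (B *m X *m B^T).
Proof.
move=> oB lX; rewrite -[K](conj_setK _ oB).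
by have := lie_conj_set (orth_tr oB) lX; rewrite trmxK.
Qed.

End Conjugation.

(** * The roots *)

Section RootDecomposition.
Variables (R : realType) (s m : nat).
Local Notation inc := (@section_incl R s m).
Local Notation nrm := (@nrm_vec R s m).

(** The last field fixes the scale of the roots by a regular point: proportional roots become equal,
    and the point lies inside the chamber where all roots are positive. *)
Record root_data (K : set 'M[R]_(s + m)) (a : 'I_m -> 'cV[R]_s) : Prop := RootData {
  root_polar : polar K;
  root_elt : exists Xr, forall l, lie K (Xr l) /\ forall c, Xr l *m inc c = dot (a l) c *: nrm l;
  root_expand : forall X, lie K X -> exists x : 'I_m -> R,
    forall c, X *m inc c = \sum_l (x l * dot (a l) c) *: nrm l;
  root_reg : exists p, forall l, dot (a l) p = 1
}.

Variable K : set 'M[R]_(s + m).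
Hypothesis pK : polar K.
Let cgK := polar_cg pK.

Lemma us_lie X c : lie K X -> usubmx (X *m inc c) = 0.
Proof.
move=> lX; apply/eqP; rewrite -dot_eq0; apply/eqP.
have := polar_perp pK c (usubmx (X *m inc c)) lX.
by rewrite -{1}[X *m inc c]vsubmxK dot_col_mx dot0r addr0.
Qed.

(** The difference of the two sides is, up to sign, [<c, [X, Y] c'>], which polarity makes zero. *)
Lemma lie_swap X Y c c' : lie K X -> lie K Y ->
  dot (X *m inc c) (Y *m inc c') = dot (Y *m inc c) (X *m inc c').
Proof.
move=> lX lY; rewrite !dot_mulmx (lie_skew cgK lX) (lie_skew cgK lY) !mulNmx !dotNr.
apply/eqP; rewrite eqr_opp -subr_eq0 -dotBr !mulmxA -mulmxBl dotC.
by rewrite (polar_perp pK) //; apply: lie_br.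
Qed.

(** At a regular point [p] the tangent space of the orbit is the whole complement of the section, so
    there are [X_i] with [X_i p = e_i]. The matrix [A c] with columns [X_i c] is symmetric, and
    these matrices commute, both by [lie_swap]; they depend linearly on [c], so their common
    eigenvalues are linear forms, the roots. As [A p = 1], all roots are 1 at [p]. *)
Theorem polar_normal_form : exists2 Q : 'M[R]_m, orth Q &
  exists a, root_data (conj_set (block_mx 1%:M 0 0 Q) K) a.
Proof.
have [p [r [[Xs [Xs_lie Xs_free]] r_max]]] := regular_ex pK.
have full X : lie K X -> ((X *m inc p)^T <= \matrix_i (Xs i *m inc p)^T)%MS.
  move=> lX; apply/negPn/negP => nspan.
  exact: (r_max (inc p) (rk_add Xs_lie lX (row_free_adjoin Xs_free nspan))).
pose M := \matrix_(i < r) (dsubmx (Xs i *m inc p))^T.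
have Mfull : row_full M.
  rewrite /row_full -mxrank_tr -/(row_free M^T) -kermx_eq0; apply/eqP/row_matrixP => i.
  rewrite row0; set x := row i _; have xM : x *m M^T = 0 by apply/sub_kermxP; apply: row_sub.
  have xs j : dot (Xs j *m inc p) (col_mx 0 x^T) = 0.
    rewrite -[Xs j *m _]vsubmxK us_lie // dot_col_mx dot0l add0r.
    have := congr1 (fun w : 'rV[R]_r => w 0 j) xM; rewrite [RHS]mxE => <-.
    by rewrite mxE; apply: eq_bigr => k _; rewrite [x^T _ _]mxE mulrC; congr (_ * _); do 3 rewrite [RHS]mxE.
  suff : dsubmx (col_mx 0 x^T : 'cV[R]_(s + m)) = 0.
    by rewrite col_mxKd => /(congr1 trmx); rewrite trmxK trmx0.
  apply: (normal_section pK Xs_lie Xs_free r_max) => X lX.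
  have /submxP[D /(congr1 trmx)] := full X lX; rewrite trmxK => ->.
  rewrite mulmx_sum_row linear_sum dot_suml big1 // => j _ /=.
  by rewrite rowK linearZ /= trmxK dotZl xs mulr0.
have /choice[X XP] : forall i, exists X, lie K X /\ dsubmx (X *m inc p) = delta_mx i 0.
  move=> i; have /submxP[D DE] := submx_full (delta_mx 0 i : 'rV_m) Mfull.
  exists (\sum_j D 0 j *: Xs j); split.
    by apply: lie_sum => // j _; apply: lieZ.
  apply: trmx_inj; rewrite trmx_delta DE mulmx_sum_row mulmx_suml !linear_sum.
  by apply: eq_bigr => j _ /=; rewrite rowK -scalemxAl !linearZ.
pose A c : 'M[R]_m := \matrix_(j, i) (dsubmx (X i *m inc c)) j 0.
have Xl i : lie K (X i) := (XP i).1.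
have AE c i j : (A c) j i = dot (X i *m inc c) (X j *m inc p).
  rewrite -[X i *m _]vsubmxK -[X j *m _]vsubmxK !us_lie // dot_col_mx dot0l add0r.
  by rewrite (XP j).2 dot_delta mxE.
have AT c : (A c)^T = A c.
  by apply/matrixP => i j; rewrite mxE !AE lie_swap.
have AAE c c' i j : ((A c)^T *m A c') i j = dot (X i *m inc c) (X j *m inc c').
  rewrite -[X i *m _]vsubmxK -[X j *m _]vsubmxK !us_lie // dot_col_mx dot0l add0r mxE.
  by apply: eq_bigr => k _; rewrite !mxE.
have AC c c' : A c *m A c' = A c' *m A c.
  have := AAE c c'; have := AAE c' c; rewrite !AT => E1 E2; apply/matrixP => i j.
  by rewrite E2 lie_swap // dotC -E1.
have Alin c v : A c *m v = \sum_j c j 0 *: (A (delta_mx j 0) *m v).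
  rewrite {1}(colv_sum c); have -> : A (\sum_j c j 0 *: delta_mx j 0) = \sum_j c j 0 *: A (delta_mx j 0).
    apply/matrixP => a b; rewrite mxE summxE.
    have -> : inc (\sum_j c j 0 *: delta_mx j 0) = \sum_j c j 0 *: inc (delta_mx j 0).
      elim/big_rec2: _ => [|i y1 y2 _ IH]; first by rewrite /section_incl col_mx0.
      by rewrite inc_lin IH.
    rewrite mulmx_sumr linear_sum summxE; apply: eq_bigr => j _ /=.
    by rewrite -scalemxAr linearZ /= !mxE.
  by rewrite mulmx_suml; apply: eq_bigr => j _; rewrite -scalemxAl.
have [||Q oQ QA] := @common_eigenbasis R m [seq A (delta_mx j 0) | j <- enum 'I_s].
- by move=> _ /mapP[j _ ->].
- by move=> _ _ /mapP[j _ ->] /mapP[i _ ->].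
have /choice[a aP] : forall l, exists a : 'cV[R]_s,
    forall c, A c *m col l Q = dot a c *: col l Q.
  move=> l; have /choice[x xP] : forall j, exists x : R,
      A (delta_mx j 0) *m col l Q = x *: col l Q.
    by move=> j; apply: QA; apply: map_f; rewrite mem_enum.
  exists (\col_j x j) => c; rewrite Alin dotC scaler_suml; apply: eq_bigr => j _.
  by rewrite xP scalerA mxE.
have Qn0 l : col l Q != 0.
  apply/eqP => Ql; have := congr1 (fun M : 'M[R]_m => M l l) oQ; rewrite mxE big1 => [|k _].
    by rewrite mxE eqxx => /eqP; rewrite eq_sym oner_eq0.
  by have := congr1 (fun w : 'cV[R]_m => w k 0) Ql; rewrite !mxE => ->; rewrite mulr0.
have Ap : A p = 1%:M.
  by apply/matrixP => i j; rewrite mxE (XP j).2 !mxE andbT.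
have colQ (d : 'cV[R]_m) : d = \sum_l (Q^T *m d) l 0 *: col l Q.
  rewrite -[LHS]mul1mx -(orthC oQ) -mulmxA; apply/matrixP => i j; rewrite ord1 mxE summxE.
  by apply: eq_bigr => l _; rewrite !mxE mulrC.
have XE (d : 'cV[R]_m) c : (\sum_i d i 0 *: X i) *m inc c = col_mx 0 (A c *m d).
  rewrite mulmx_suml -[LHS]vsubmxK !linear_sum /=; congr col_mx.
    by rewrite big1 // => i _; rewrite -scalemxAl linearZ /= us_lie ?scaler0.
  apply/matrixP => i j; rewrite ord1 summxE mxE; apply: eq_bigr => k _.
  by rewrite -scalemxAl linearZ /= !mxE mulrC.
pose B : 'M[R]_(s + m) := block_mx 1%:M 0 0 Q.
have oB : orth B.
  rewrite /orth tr_block_mx mulmx_block !trmx0 trmx1 !mulmx0 !mul0mx oQ.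
  by rewrite mulmx1 !add0r addr0 -scalar_mx_block.
have Binc c : B *m inc c = inc c by rewrite mul_block_col mul1mx !mulmx0 mul0mx !addr0.
have BTinc c : B^T *m inc c = inc c by rewrite -{1}(Binc c) mulmxA oB mul1mx.
have Bnrm l : B^T *m col_mx 0 (col l Q) = nrm l.
  rewrite tr_block_mx mul_block_col !mulmx0 !trmx0 mul0mx !add0r.
  have -> : Q^T *m col l Q = delta_mx l 0 by rewrite colE mulmxA oQ mul1mx.
  apply/matrixP => i j; rewrite ord1 [RHS]mxE; case: (split_ordP i) => h ->.
    by rewrite col_mxEu mxE eq_lrshift.
  by rewrite col_mxEd mxE eq_rshift.
have root0 c l : B^T *m col_mx 0 (A c *m col l Q) = dot (a l) c *: nrm l.
  by rewrite aP -[0](scaler0 _ (dot (a l) c)) -scale_col_mx -scalemxAr Bnrm.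
exists Q => //; exists a; split.
- split; first exact: closed_group_conj.
    move=> v; have [k Kk [c kc]] := polar_meet pK (B *m v).
    exists (B^T *m k *m B); first by exists k.
    by exists c; rewrite -!mulmxA kc BTinc.
  move=> Y c c' /(lie_conj_setV oB) lY; have := polar_perp pK c c' lY.
  by rewrite -!mulmxA BTinc dot_mulmx BTinc.
- exists (fun l => B^T *m (\sum_i Q i l *: X i) *m B) => l; split.
    by apply: lie_conj_set => //; apply: lie_sum => // i _; apply: lieZ.
  move=> c; rewrite -!mulmxA Binc -(root0 c l) -XE; congr (_ *m (_ *m _)).
  by apply: eq_bigr => i _; rewrite mxE.
- move=> Y /(lie_conj_setV oB); set Z := B *m Y *m B^T => lZ.
  pose d := dsubmx (Z *m inc p).
  (* [Z] minus the combination of the [X_i] with the same value at [p] kills [p], hence kills the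
     section. *)
  have Zc c : Z *m inc c = col_mx 0 (A c *m d).
    rewrite -XE; apply/eqP; rewrite -subr_eq0 -mulmxBl; apply/eqP.
    have lD : lie K (Z - \sum_i d i 0 *: X i).
      apply: lieD => //; rewrite -scaleN1r; apply: lieZ => //.
      by apply: lie_sum => // i _; apply: lieZ.
    have := stab_fixes_section pK Xs_lie Xs_free r_max c (cg1 cgK) lD.
    rewrite mul1mx; apply; last by exists p; rewrite mul1mx.
    rewrite mulmxBl XE Ap mul1mx -[Z *m inc p]vsubmxK us_lie // subrr //.
  exists (fun l => (Q^T *m d) l 0) => c.
  have -> : Y *m inc c = B^T *m (Z *m inc c).
    by rewrite /Z -mulmxA BTinc -mulmxA mulmxA oB mul1mx.
  rewrite Zc {1}(colQ d) mulmx_sumr.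
  have -> : col_mx 0 (\sum_i A c *m ((Q^T *m d) i 0 *: col i Q)) =
      \sum_i (Q^T *m d) i 0 *: (col_mx 0 (A c *m col i Q) : 'cV[R]_(s + m)).
    apply/matrixP => i j; rewrite summxE ord1; case: (split_ordP i) => h ->.
      by rewrite col_mxEu mxE big1 // => k _; rewrite mxE col_mxEu [X in _ * X]mxE mulr0.
    rewrite col_mxEd summxE; apply: eq_bigr => k _.
    by rewrite -scalemxAr [RHS]mxE col_mxEd mxE.
  rewrite mulmx_sumr; apply: eq_bigr => l _.
  by rewrite -scalemxAr root0 scalerA.
- exists p => l; apply/eqP; rewrite -subr_eq0; have := aP l p; rewrite Ap mul1mx => /eqP.
  rewrite -{1}[col l Q]scale1r -subr_eq0 -scalerBl scaler_eq0 (negPf (Qn0 l)) orbF.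
  by rewrite -oppr_eq0 opprB.
Qed.

End RootDecomposition.

(** * The Weyl group and its chambers *)

Section WeylMatrices.
Variables (R : realType) (s m : nat).
Local Notation inc := (@section_incl R s m).
Local Notation nrm := (@nrm_vec R s m).
Variables (K : set 'M[R]_(s + m)) (a : 'I_m -> 'cV[R]_s).
Hypothesis rK : root_data K a.
Let pK := root_polar rK.
Let cgK := polar_cg pK.

Lemma dot_ext n (u v : 'cV[R]_n) : (forall c, dot u c = dot v c) -> u = v.
Proof.
move=> uv; apply/eqP; rewrite -subr_eq0 -dot_eq0 dotBl uv subrr //.
Qed.

Lemma root_neq0 l : a l != 0.
Proof.
have [p ap] := root_reg rK; apply/eqP => al; have := ap l.
by rewrite al dot0l => /eqP; rewrite eq_sym oner_eq0.
Qed.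

Lemma root_proportional k l x : a k = x *: a l -> a k = a l.
Proof.
have [p ap] := root_reg rK => kl; have := ap k; rewrite kl dotZl ap mulr1 => ->.
by rewrite scale1r.
Qed.

Definition weyl_mx := [set w : 'M[R]_s | exists2 k, K k & forall c, k *m inc c = inc (w *m c)].

Lemma weyl_mx_dot w c c' : weyl_mx w -> dot (w *m c) (w *m c') = dot c c'.
Proof.
move=> [k Kk kw]; rewrite -(dot_inc m) -!kw dot_mulmx mulmxA (cg_orth cgK Kk) mul1mx.
exact: dot_inc.
Qed.

Lemma orth_dot n (w : 'M[R]_n) : (forall c c', dot (w *m c) (w *m c') = dot c c') -> orth w.
Proof.
move=> wd; apply/matrixP => i j; rewrite -[LHS](mulmx_delta_entry _ j i) -mulmxA -dot_delta.
by rewrite dot_mulmx trmxK wd dot_delta !mxE eq_sym andbT.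
Qed.

Lemma weyl_mx_orth w : weyl_mx w -> orth w.
Proof. by move=> Ww; apply: orth_dot => c c'; apply: weyl_mx_dot. Qed.

Lemma weyl_mx1 : weyl_mx 1%:M.
Proof. by exists 1%:M; [exact: cg1|move=> c; rewrite !mul1mx]. Qed.

Lemma weyl_mxM w w' : weyl_mx w -> weyl_mx w' -> weyl_mx (w *m w').
Proof.
move=> [k Kk kw] [k' Kk' kw']; exists (k *m k'); first exact: cgM.
by move=> c; rewrite -mulmxA kw' kw mulmxA.
Qed.

Lemma weyl_mx_tr w k : orth w -> K k -> (forall c, k *m inc c = inc (w *m c)) ->
  forall c, k^T *m inc c = inc (w^T *m c).
Proof.
move=> ow Kk kw c; rewrite -{1}[c]mul1mx -(orthC ow) -mulmxA -kw mulmxA.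
by rewrite (cg_orth cgK Kk) mul1mx.
Qed.

Lemma weyl_mxT w : weyl_mx w -> weyl_mx w^T.
Proof.
move=> Ww; have [k Kk kw] := Ww; exists k^T; first exact: cgT.
exact: weyl_mx_tr (weyl_mx_orth Ww) Kk kw.
Qed.

Lemma dot_inc_nrm c l : dot (inc c) (nrm l) = 0.
Proof. by rewrite /nrm_vec dot_delta col_mxEd mxE. Qed.

Lemma nrm_norm l : dot (nrm l) (nrm l) = 1.
Proof. by rewrite {2}/nrm_vec dot_delta mxE !eqxx. Qed.

Lemma dot_normal (u v : 'cV[R]_(s + m)) : usubmx u = 0 ->
  dot u v = \sum_l dot u (nrm l) * dot v (nrm l).
Proof.
move=> u0; rewrite -{1}[u]vsubmxK -{1}[v]vsubmxK u0 dot_col_mx dot0l add0r.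
by apply: eq_bigr => l _; rewrite !dot_delta !mxE.
Qed.

Lemma weyl_normal w k l : orth w -> K k -> (forall c, k *m inc c = inc (w *m c)) ->
  usubmx (k *m nrm l) = 0.
Proof.
move=> ow Kk kw; apply: dot_ext => c; rewrite dot0l.
transitivity (dot (k *m nrm l) (inc c)).
  by rewrite -[k *m _]vsubmxK dot_col_mx dot0r addr0 col_mxKu.
by rewrite dot_mulmx (weyl_mx_tr ow Kk kw) dotC dot_inc_nrm.
Qed.

(** [W] is the matrix of [k] on the complement of the section, hence orthogonal. On the section
    [k X_i k^T] is [c |-> <w a_i, c> k e_i]; its component along [e_l] must be a multiple of
    [<a_l, c>], which gives the proportionality wherever [W i l != 0]. *)
Theorem weyl_root_perm w : weyl_mx w -> exists W : 'I_m -> 'I_m -> R,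
  [/\ forall i, \sum_l W i l ^+ 2 = 1, forall l, \sum_i W i l ^+ 2 = 1 &
    forall i l, W i l != 0 -> exists2 x, x != 0 & w *m a i = x *: a l].
Proof.
move=> Ww; have ow := weyl_mx_orth Ww; have [k Kk kw] := Ww.
have ok := cg_orth cgK Kk.
exists (fun i l => dot (k *m nrm i) (nrm l)); split=> [i|l|i l Wil].
- transitivity (dot (k *m nrm i) (k *m nrm i)).
    by rewrite [RHS]dot_normal ?(weyl_normal i ow Kk kw).
  by rewrite dot_mulmx mulmxA ok mul1mx nrm_norm.
- have kT := weyl_mx_tr ow Kk kw; have owT : orth w^T by rewrite /orth trmxK orthC.
  transitivity (dot (k^T *m nrm l) (k^T *m nrm l)).
    rewrite [RHS]dot_normal ?(weyl_normal l owT (cgT cgK Kk) kT) //; apply: eq_bigr => i _.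
    by rewrite dot_mulmx dotC expr2.
  by rewrite dot_mulmx trmxK mulmxA orthC // mul1mx nrm_norm.
have [Xr XrP] := root_elt rK; have [Xl XlE] := XrP i.
have [x xE] := root_expand rK (lie_conj cgK Kk Xl).
have E c : dot (k *m nrm i) (nrm l) * dot (w *m a i) c = x l * dot (a l) c.
  transitivity (dot (k *m Xr i *m k^T *m inc c) (nrm l)); last first.
    rewrite xE dot_suml (bigD1 l) //= dotZl nrm_norm mulr1 big1 ?addr0 // => j jl.
    by rewrite dotZl /nrm_vec dot_delta mxE (inj_eq (@rshift_inj _ _)) eq_sym (negPf jl) mulr0.
  by rewrite -!mulmxA (weyl_mx_tr ow Kk kw) XlE -scalemxAr dotZl [dot (w *m _) c]dot_mulmx mulrC.
have wE : w *m a i = (x l / dot (k *m nrm i) (nrm l)) *: a l.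
  by apply: dot_ext => c; rewrite dotZl mulrAC -E mulrAC divff ?mul1r.
exists (x l / dot (k *m nrm i) (nrm l)) => //.
apply: contraNneq (root_neq0 i) => x0; have := congr1 (mulmx w^T) wE.
by rewrite x0 scale0r mulmx0 mulmxA ow mul1mx => ->.
Qed.

Lemma cg_min n (H : set 'M[R]_n) (x y : 'cV[R]_n) : closed_group H ->
  exists2 h, H h & forall h', H h' -> dot (h *m x) y <= dot (h' *m x) y.
Proof.
move=> cgH; pose A := [set dot (h *m x) y | h in H].
have iA : has_inf A.
  split; first by exists (dot (1%:M *m x) y); exists 1%:M => //; apply: cg1.
  exists (- ((n * n)%:R * mn x * mn y)) => _ [h Hh <-].
  rewrite lerNl (le_trans (ler_norm _)) // normrN (le_trans (dot_le_mn _ _)) // ler_wpM2r ?mn_ge0 //.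
  by rewrite (le_trans (mnM _ _)) // ler_wpM2r ?mn_ge0 // orth_mn //; apply: (cg_orth cgH).
have /choice[h hP] : forall k : nat, exists h, H h /\ dot (h *m x) y < inf A + k.+1%:R^-1.
  move=> k; have [|_ [h Hh <-] lt] := @inf_adherent _ A k.+1%:R^-1 _ iA.
    by rewrite invr_gt0.
  by exists h.
have [L HL hL] := cg_seq cgH (fun n => (hP n).1).
exists L => // h' Hh'; apply: (@le_trans _ _ (inf A)).
  have l1 := mlim_dot (mlimM hL (mlim_cst x)) (mlim_cst y).
  have l2 : (fun n => inf A + n.+1%:R^-1) @ omega --> inf A + 0.
    by apply: cvgD; [exact: cvg_cst|exact: cvg_invn].
  rewrite -[inf A]addr0; apply: ler_cvg_to l1 l2 _; apply: nearW => k.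
  by have [_ /ltW] := hP k.
by apply: ge_inf; [exact: iA.2|exists h'].
Qed.

Lemma linear_term0 (b C : R) : (forall t, 0 <= t * b + C * t ^+ 2) -> b = 0.
Proof.
move=> H; apply/eqP/negPn/negP => b0.
have C1 : 0 < `|C| + 1 by rewrite ltr_wpDl.
have := H (- (b / (`|C| + 1))); rewrite leNgt => /negP; apply.
have bb : 0 < b ^+ 2 by rewrite lt_def sqr_ge0 andbT sqrf_eq0.
have -> : - (b / (`|C| + 1)) * b + C * (- (b / (`|C| + 1))) ^+ 2 =
    b ^+ 2 / (`|C| + 1) ^+ 2 * (C - (`|C| + 1)) by field; rewrite gt_eqF.
have pos : 0 < b ^+ 2 / (`|C| + 1) ^+ 2 by rewrite divr_gt0 // exprn_gt0.
by rewrite (pmulr_rlt0 _ pos) subr_lt0 (le_lt_trans (ler_norm _)) // ltrDl.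
Qed.

Lemma generic_in_wall b : b != 0 -> exists2 q, dot b q = 0 &
  forall i, (forall x, a i <> x *: b) -> dot (a i) q != 0.
Proof.
move=> b0; pose P i := `[< forall x, a i <> x *: b >].
have [||c] := @polyfun_prod_neq0 R s _ P (fun i c => dot (a i) (projh b c)).
- by move=> i _; apply: polyfun_projh; exact: polyfun_dot.
- move=> i /asboolP ai; exists (projh b (a i)).
  rewrite projh_id ?dot_projh //.
  have -> : dot (a i) (projh b (a i)) = dot (projh b (a i)) (projh b (a i)).
    by rewrite [RHS]dotBl dotZl dot_projh // mulr0 subr0.
  by rewrite dot_eq0 subr_eq0; apply/eqP.
rewrite prodf_seq_neq0 => /allP H; exists (projh b c); first exact: dot_projh.
move=> i ai; have := H i (mem_index_enum i).
by move/implyP; apply; apply/asboolP.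
Qed.

(* The fixator of the wall of [a l] contains a rotation turning [a l] around; the
   element of that group minimising [<k a, a>] acts as the reflection. *)
Theorem weyl_refl l : weyl_mx (refl_mx (a l)).
Proof.
set b := a l; have b0 : b != 0 := root_neq0 l.
have bb0 : dot b b != 0 by rewrite dot_eq0.
pose H := [set k | K k /\ forall c, k *m inc (projh b c) = inc (projh b c)].
have cgH : closed_group H := fixator_closed_group cgK (fun c => inc (projh b c)).
have Hfix h c : H h -> dot b c = 0 -> h *m inc c = inc c.
  by move=> [_ hf] bc; rewrite -(projh_id bc) hf.
have [Xr XrP] := root_elt rK.
have HE i E : a i = b -> onep E (Xr i) -> (forall t, K (E t)) -> forall t, H (E t).
  move=> aib oE KE t; split=> // c; apply: (onep_fix _ _ oE) => [u|].
    exact: (cg_orth cgK).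
  by have [_ ->] := XrP i; rewrite aib dot_projh // scale0r.
have [k Hk kmin] := cg_min (inc b) (inc b) cgH.
have [Kk _] := Hk; have kfix c := Hfix k c Hk; have ok := cg_orth cgK Kk.
have KkT := cgT cgK Kk; have kTfix c := Hfix k^T c (cgT cgH Hk).
set u := k^T *m inc b.
(* The image [u] of [b] has no normal components. For a root equal to [b], [k E(t)] competes with
   the minimiser [k], so the term of first order in [t] vanishes. For any other root, [k] fixes a
   generic point [q] of the wall of [b], and polarity gives [<X_i q, u> = 0]. *)
have un i : dot (nrm i) u = 0.
  have [aib|aib] := eqVneq (a i) b.
    have [[E oE KE] XiE] := XrP i.
    suff : dot (k *m (Xr i *m inc b)) (inc b) = 0.
      rewrite XiE aib -scalemxAr dotZl => /eqP; rewrite mulf_eq0 (negPf bb0) /= => /eqP.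
      by rewrite dot_mulmx.
    have [_ _ [C EC]] := oE.
    apply: (@linear_term0 _ (mn (inc b) * (mn k * C * mn (inc b)))) => t.
    have := kmin _ (cgM cgH Hk (HE i E aib oE KE t)).
    set D := E t - 1%:M - t *: Xr i.
    have -> : E t = 1%:M + t *: Xr i + D by rewrite /D addrC -[E t - _ - _]addrA -opprD subrK.
    rewrite mulmxDr mulmxDr mulmx1 -scalemxAr !mulmxDl -scalemxAl !dotDl dotZl -addrA lerDl.
    move/le_trans; apply; rewrite -[k *m Xr i *m _]mulmxA lerD2l.
    rewrite dotC (le_trans (ler_norm _)) // (le_trans (dot_le_mn _ _)) // -mulrA ler_wpM2l ?mn_ge0 // (le_trans (mnM _ _)) //.
    rewrite [leRHS]mulrAC ler_wpM2r ?mn_ge0 // (le_trans (mnM _ _)) // -mulrA.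
    by rewrite ler_wpM2l ?mn_ge0 //; exact: EC.
  have [q bq qP] := generic_in_wall b0.
  have [Xl XiE] := XrP i.
  have := polar_conj pK q b KkT Xl; rewrite kTfix // XiE dotZl => /eqP.
  rewrite mulf_eq0 (negPf (qP i _)) /= => [/eqP //|x].
  by move/root_proportional/eqP; apply/negP.
have ud : dsubmx u = 0.
  by apply/matrixP => i j; rewrite ord1 [RHS]mxE -(un i) dotC dot_delta mxE.
have uE := inc_ds ud; set d := usubmx u in uE.
have dperp c : dot b c = 0 -> dot d c = 0.
  by move=> bc; rewrite -(dot_inc m) -uE /u dot_mulmx trmxK kfix // dot_inc.
set x := dot b d / dot b b.
have dE : d = x *: b.
  apply/eqP; rewrite -subr_eq0 -/(projh b d) -dot_eq0 {1}/projh dotBl dotZl dot_projh // mulr0 subr0.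
  by rewrite dperp // dot_projh.
have x2 : x ^+ 2 = 1.
  have : dot u u = dot b b by rewrite /u dot_mulmx trmxK mulmxA orthC // mul1mx dot_inc.
  rewrite uE dot_inc dE dotZl dotZr mulrA -expr2 => /eqP.
  by rewrite -subr_eq0 -{2}[dot b b]mul1r -mulrBl mulf_eq0 (negPf bb0) orbF subr_eq0 => /eqP.
move/eqP: x2; rewrite sqrf_eq1 => /orP[/eqP x1|/eqP x1]; last first.
  exists k^T => // c; rewrite refl_mxE.
  have cE : c = projh b c + (dot b c / dot b b) *: b by rewrite subrK.
  rewrite {1}cE incD mulmxDr kTfix ?dot_projh // incZ -scalemxAr -/u uE dE x1.
  rewrite -incZ -incD scaleN1r scalerN /projh -mulrA mulrDl mul1r scalerDl opprD addrA.
  by [].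
(* If [x = 1], the minimum of [<h b, b>] is also its maximum, so every element of [H] fixes [b];
   this contradicts [X_l b = <b, b> e_l]. *)
have bmax h : H h -> dot (h *m inc b) (inc b) = dot b b.
  have kb : dot (k *m inc b) (inc b) = dot b b.
    by rewrite dot_mulmx -/u uE dE x1 scale1r dot_inc.
  move=> Hh; apply/eqP; rewrite eq_le -{2}kb kmin // andbT.
  rewrite -subr_ge0; have := dot_ge0 (h *m inc b - inc b).
  rewrite dotBl !dotBr [dot (inc b) (h *m _)]dotC dot_inc.
  have -> : dot (h *m inc b) (h *m inc b) = dot b b.
    by rewrite dot_mulmx mulmxA (cg_orth cgH Hh) mul1mx dot_inc.
  by lra.
have [[E oE KE] XlE] := XrP l.
have Eb t : E t *m inc b = inc b.
  have Ht := HE l E erefl oE KE t.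
  apply/eqP; rewrite -subr_eq0 -dot_eq0 dotBl !dotBr [dot (inc b) (E t *m _)]dotC dot_inc bmax //.
  have -> : dot (E t *m inc b) (E t *m inc b) = dot b b.
    by rewrite dot_mulmx mulmxA (cg_orth cgH Ht) mul1mx dot_inc.
  by rewrite !subrr.
have d0 n : n.+1%:R^-1 != 0 :> R by rewrite invr_eq0 pnatr_eq0.
have := mlimM (onep_tan oE d0 (@cvg_invn R)) (mlim_cst (inc b)) => lX.
have : Xr l *m inc b = 0.
  apply: mlim_unique lX _; apply: (mlim_ext _ (mlim_cst 0)) => n.
  by rewrite -scalemxAl mulmxBl Eb mul1mx subrr scaler0.
rewrite XlE -/b => /(congr1 (dot (nrm l))); rewrite dotZr nrm_norm dot0r mulr1 => bb.
by rewrite bb eqxx in bb0.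
Qed.

(** A sequence of distinct elements, divided by its limit, tends to 1; if it stayed outside the
    fixator of the section, it would have a direction [X] transversal to this fixator. But [X] maps
    the section into itself as a limit, and into its complement by polarity, so it kills the
    section. *)
Theorem weyl_mx_finite : finite_set weyl_mx.
Proof.
apply: contrapT => /infiniteP/card_leP[f0].
pose f n : 'M[R]_s := \val (f0 (SigSub (mem_set (I : [set: nat] n)))).
have Wf n : weyl_mx (f n) by apply/set_mem; exact: valP.
have finj n n' : f n = f n' -> n = n'.
  by move=> /val_inj/(@inj _ _ _ f0); rewrite !inE => /(_ I I)/(congr1 \val).
have /choice[k kP] : forall n, exists k, K k /\ forall c, k *m inc c = inc (f n *m c).
  by move=> n; have [k Kk kw] := Wf n; exists k.
have [L KL kL] := cg_seq cgK (fun n => (kP n).1).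
have dsL c : dsubmx (L *m inc c) = 0.
  apply/matrixP => i j; rewrite [LHS]mxE [RHS]mxE; have l := mlimM kL (mlim_cst (inc c)).
  apply: (norm_cvg_unique (l _ _)); rewrite (_ : (fun _ => _) = fun=> 0); first exact: cvg_cst.
  by apply/funext => n; rewrite (kP n).2 ord1 col_mxEd mxE.
pose w := ulsubmx L.
have LE c : L *m inc c = inc (w *m c).
  rewrite (inc_ds (dsL c)); congr section_incl.
  by rewrite -[X in usubmx (X *m _)]submxK mul_block_col mulmx0 addr0 col_mxKu.
have ow : orth w by apply: weyl_mx_orth; exists L.
pose H := [set h | K h /\ forall c, h *m inc c = inc c].
have cgH : closed_group H := fixator_closed_group cgK inc.
pose k' n := k n *m L^T.
have Kk' n : K (k' n) by apply: (cgM cgK); [exact: (kP n).1|exact: cgT].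
have k'1 : mlim k' 1%:M.
  by have := mlimM kL (mlim_cst L^T); rewrite (orthC (cg_orth cgK KL)).
have k'E n c : k' n *m inc c = inc (f n *m (w^T *m c)).
  by rewrite -mulmxA (weyl_mx_tr ow KL LE) (kP n).2.
have nearH : \forall n \near omega, H (k' n).
  have [//|nH] := in_ultra_setVsetC [set n | H (k' n)] omega_ultra.
  have [h [d [X [Hh d0 gX lX noX]]]] := transversal_direction cgK cgH (fun h => @proj1 _ _) Kk' nH k'1.
  exfalso; have [E oE KE] := lX; apply: (noX E oE) => t; split=> // c.
  apply: (onep_fix _ _ oE); first by move=> u; apply: (cg_orth cgK).
  rewrite -[X *m _]vsubmxK (us_lie pK) // (_ : dsubmx _ = 0) ?col_mx0 //.
  have l := mlimM gX (mlim_cst (inc c)).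
  apply/matrixP => i j; rewrite [LHS]mxE [RHS]mxE.
  apply: (norm_cvg_unique (l _ _)); rewrite (_ : (fun _ => _) = fun=> 0); first exact: cvg_cst.
  apply/funext => n; rewrite -scalemxAl mulmxBl mul1mx -mulmxA (Hh n).2 k'E.
  by rewrite ord1 mxE [X in _ * X]mxE [X in _ + X]mxE !col_mxEd mxE subr0 mulr0.
have fw : \forall n \near omega, f n = w.
  apply: filterS nearH => n [_ Hn].
  have E (c : 'cV[R]_s) : f n *m (w^T *m c) = c by have := congr1 usubmx (Hn c); rewrite k'E !us_inc.
  rewrite -[f n]mulmx1 -ow mulmxA; apply/matrixP => i j.
  rewrite -(mulmx_delta_entry _ j i) -!mulmxA E mulmx_delta_entry //.
have [n1 fn1] := filter_ex fw.
have fw2 : \forall n \near omega, f n = w /\ (n1 < n)%N.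
  apply: filterS2 fw (omega_oo (nbhs_infty_gt n1)) => n fn nn; split=> //.
have [n2 [fn2 lt]] := filter_ex fw2.
by have := finj n1 n2; rewrite fn1 fn2 => /(_ erefl) E; rewrite E ltnn in lt.
Qed.

End WeylMatrices.

Lemma finite_argmax (R : realType) (T : choiceType) (A : set T) (f : T -> R) :
  finite_set A -> A !=set0 -> exists2 x, A x & forall y, A y -> f y <= f x.
Proof.
move=> /finite_seqP[r ->]; elim: r => [[x]//|x r IH] _.
have [r0|[y0 yr]] : r = [::] \/ exists y, y \in r.
  by case: (r) => [|y r']; [left|right; exists y; rewrite mem_head].
  by exists x => [|y]; rewrite r0 /= inE // => /eqP ->.
have [|y yr' ymax] := IH; first by exists y0.
have [xy|/ltW xy] := leP (f x) (f y).
  exists y; first by rewrite /= in_cons; apply/orP; right.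
  by move=> z; rewrite /= in_cons => /orP[/eqP -> //|/ymax].
exists x; first by rewrite /= mem_head.
move=> z; rewrite /= in_cons => /orP[/eqP -> //|/ymax zy]; exact: le_trans xy.
Qed.

(** * Chambers of a finite reflection group *)

Section Chamber.
Variables (R : realType) (s m : nat) (a : 'I_m -> 'cV[R]_s) (W : set 'M[R]_s) (p : 'cV[R]_s).
Hypothesis W_fin : finite_set W.
Hypothesis W_one : W 1%:M.
Hypothesis W_mul : forall v w, W v -> W w -> W (v *m w).
Hypothesis W_orth : forall w, W w -> orth w.
Hypothesis W_refl : forall i, W (refl_mx (a i)).
Hypothesis W_perm : forall w i, W w -> exists l x, w^T *m a i = x *: a l.
Hypothesis a_p : forall i, dot (a i) p = 1.
Hypothesis a_neq0 : forall i, a i != 0.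
Hypothesis a_prop : forall k l x, a k = x *: a l -> a k = a l.

Definition word (r : seq 'I_m) : 'M[R]_s := foldr (fun i w => refl_mx (a i) *m w) 1%:M r.

Lemma word_cat r r' : word (r ++ r') = word r *m word r'.
Proof. by elim: r => [|i r IH]; rewrite ?mul1mx //= IH mulmxA. Qed.

Lemma W_word r : W (word r).
Proof. by elim: r => [|i r IH] //=; apply: W_mul. Qed.

Lemma refl_mx_sq i : refl_mx (a i) *m refl_mx (a i) = 1%:M.
Proof. by have := W_orth (W_refl i); rewrite /orth refl_mx_tr. Qed.

Lemma W_root w i : W w -> exists l, w^T *m a i = dot (a i) (w *m p) *: a l.
Proof.
move=> Ww; have [l [x xE]] := W_perm i Ww; exists l; rewrite xE; congr (_ *: _).
by rewrite dotC dot_mulmx dotC xE dotZl a_p mulr1.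
Qed.

Lemma W_reg w i : W w -> dot (a i) (w *m p) != 0.
Proof.
move=> Ww; have [l E] := W_root i Ww; apply: contraNneq (a_neq0 i) => z.
move: E; rewrite z scale0r => /(congr1 (mulmx w)).
by rewrite mulmxA (orthC (W_orth Ww)) mul1mx mulmx0 => ->.
Qed.

Lemma refl_dot i x : dot (refl_mx (a i) *m x) p = dot x p - 2 * dot (a i) x / dot (a i) (a i).
Proof. by rewrite refl_mxE dotBl dotZl a_p mulr1. Qed.

Lemma refl_dot_lt i x : dot (a i) x < 0 -> dot x p < dot (refl_mx (a i) *m x) p.
Proof.
move=> ax; rewrite refl_dot ltrDl oppr_gt0 pmulr_llt0 ?invr_gt0 ?dot_gt0 //.
by rewrite pmulr_rlt0.
Qed.

Lemma word_tr r : (word r)^T = word (rev r).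
Proof.
elim: r => [|i r IH]; first by rewrite trmx1.
by rewrite /= trmx_mul IH refl_mx_tr rev_cons -cats1 word_cat /= mulmx1.
Qed.

(** A word maximising [<w x, p>] among those with letters in [P]: reflecting in a root that is
    negative at [w x] would increase the value. It is used with all letters and with the walls
    only. *)
Lemma reach (P : 'I_m -> Prop) x : exists2 r, (forall i, i \in r -> P i) &
  forall i, P i -> 0 <= dot (a i) (word r *m x).
Proof.
pose A := [set w | exists2 r, (forall i, i \in r -> P i) & w = word r].
have fA : finite_set A by apply: sub_finite_set W_fin => w [r _ ->]; exact: W_word.
have [|_ [r rP ->] rmax] := finite_argmax (fun w => dot (w *m x) p) fA.
  by exists 1%:M; exists [::].
exists r => // i Pi; rewrite leNgt; apply/negP => /refl_dot_lt; rewrite ltNge => /negP; apply.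
rewrite mulmxA; apply: rmax; exists (i :: r) => // j; rewrite in_cons => /orP[/eqP ->|] //.
exact: rP.
Qed.

(** The hyperplane of [a i] carries a facet of the chamber; the comparison is between roots and not
    indices, as roots may be repeated. *)
Definition wall i := exists2 z, dot (a i) z = 0 & forall j, a j != a i -> 0 < dot (a j) z.

(** A perturbation [q] of [p] in the open chamber. By the second condition the segment from [q] to
    [x] crosses the hyperplanes of distinct roots at distinct points, apart from those through
    [x]. *)
Lemma generic_near x : exists q, (forall j, 0 < dot (a j) q) /\
  forall i j, dot (a i) x != 0 -> a j != a i -> dot (a j) x * dot (a i) q != dot (a i) x * dot (a j) q.
Proof.
pose b i j := dot (a j) x *: a i - dot (a i) x *: a j.
pose P (k : 'I_m * 'I_m) := (dot (a k.1) x != 0) && (a k.2 != a k.1).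
have bE i j c : dot (b i j) c = dot (a j) x * dot (a i) c - dot (a i) x * dot (a j) c.
  by rewrite dotBl !dotZl.
have pb : polyfun (fun c => \prod_(k | P k) dot (b k.1 k.2) c).
  by apply: polyfun_prod => k _; exact: polyfun_dot.
have [||v vP] := @polyfun_prod_neq0 R s _ P (fun k c => dot (b k.1 k.2) c).
- by move=> k _; exact: polyfun_dot.
- move=> [i j] /andP[/= xi ij]; exists (b i j); rewrite dot_eq0.
  apply: contraNneq ij => /eqP; rewrite /b subr_eq0 => /eqP E.
  apply/eqP/(@a_prop _ _ (dot (a j) x / dot (a i) x)).
  by rewrite mulrC -scalerA E scalerA mulVf // scale1r.
have [f fE] := polyfun_line p (v - p) pb.
have fn0 : f != 0.
  apply: contraNneq vP => f0; have := fE 1; rewrite f0 horner0 scale1r addrC subrK => ->.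
  by [].
have np : \forall n \near omega, f.[n.+1%:R^-1] != 0.
  have [//|H] := in_ultra_setVsetC [set n | f.[n.+1%:R^-1] != 0] omega_ultra.
  move: fn0; rewrite (@poly_near_eq0 R f) ?eqxx //.
  by apply: filterS H => n /= /negP; rewrite negbK => /eqP.
have pos : \forall n \near omega, forall j, 0 < dot (a j) (p + n.+1%:R^-1 *: (v - p)).
  have H j : \forall n \near omega, 0 < dot (a j) (p + n.+1%:R^-1 *: (v - p)).
    have l : (fun n => dot (a j) p + n.+1%:R^-1 * dot (a j) (v - p)) @ omega --> dot (a j) p + 0 * dot (a j) (v - p).
      apply: cvgD; first exact: cvg_cst.
      by apply: cvgM; [exact: cvg_invn|exact: cvg_cst].
    rewrite a_p mul0r addr0 in l.
    by apply: filterS (cvgr_gt 1 l 0 ltr01) => n H; rewrite dotDr dotZr a_p.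
  exact: filter_forall.
have [n [fn posn]] := filter_ex (filterI np pos).
exists (p + n.+1%:R^-1 *: (v - p)); split=> // i j xi ij.
move: fn; rewrite -fE => /prodf_neq0/(_ (i, j)); rewrite /P /= xi ij bE subr_eq0.
exact.
Qed.

(** Suppose a root is negative at [x], and let [rho] decrease from infinity along [rho q + x]. The
    first hyperplane met is met alone, so it is a wall, and its root is negative at [x]. *)
Lemma wall_ex x : (forall i, wall i -> 0 <= dot (a i) x) -> forall i, 0 <= dot (a i) x.
Proof.
move=> wx i0; rewrite leNgt; apply/negP => ai0.
have [q [q0 qx]] := generic_near x.
pose rho j := - dot (a j) x / dot (a j) q.
pose i := [arg max_(i > i0) rho i]%O.
have imax j : rho j <= rho i by rewrite /i; case: arg_maxP => // k _; apply.
have ri : 0 < rho i by apply: lt_le_trans (imax i0); rewrite divr_gt0 // oppr_gt0.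
have xi : dot (a i) x < 0 by move: ri; rewrite pmulr_lgt0 ?invr_gt0 // oppr_gt0.
have zE j : dot (a j) (rho i *: q + x) = (rho i - rho j) * dot (a j) q.
  rewrite dotDr dotZr mulrBl /rho; congr (_ + _).
  by rewrite divfK ?opprK // gt_eqF.
suff /wx : wall i by rewrite leNgt xi.
exists (rho i *: q + x) => [|j ji]; first by rewrite zE subrr mul0r.
rewrite zE mulr_gt0 // subr_gt0 lt_neqAle imax andbT.
have xn0 : dot (a i) x != 0 by rewrite lt_eqF.
have := qx i j xn0 ji; apply: contraNneq => /eqP.
by rewrite /rho !mulNr eqr_opp eqr_div ?(gt_eqF (q0 _)).
Qed.

(** The reflection in a wall permutes the other positive roots: it fixes the point [z] of the facet,
    where they are all positive. *)
Lemma wall_pos i j l x : wall i -> a j != a i -> refl_mx (a i) *m a j = x *: a l -> 0 < x.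
Proof.
move=> [z zi zj] ji E; have := zj j ji.
have -> : dot (a j) z = dot (refl_mx (a i) *m a j) z.
  by rewrite dot_refl refl_mxE zi mulr0 mul0r scale0r subr0.
rewrite E dotZl; have [->|ali] := eqVneq (a l) (a i); first by rewrite zi mulr0 ltxx.
by rewrite pmulr_lgt0 // zj.
Qed.

Lemma refl_mxZ x (v : 'cV[R]_s) : x != 0 -> refl_mx (x *: v) = refl_mx v.
Proof.
move=> x0; rewrite /refl_mx dotZl dotZr [(x *: v)^T]linearZ /= -scalemxAl -scalemxAr !scalerA.
have [v0|v0] := eqVneq (dot v v) 0.
  by move/eqP: v0; rewrite dot_eq0 => /eqP ->; rewrite mul0mx !scaler0.
by congr (_ - _ *: _); field; rewrite x0 v0.
Qed.

Lemma refl_mx_conj (u : 'M[R]_s) v : orth u -> refl_mx (u *m v) = u *m refl_mx v *m u^T.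
Proof.
move=> ou; rewrite /refl_mx dot_mulmx mulmxA ou mul1mx trmx_mul mulmxBr mulmxBl mulmx1 orthC //.
by rewrite -scalemxAr -scalemxAl !mulmxA.
Qed.

Lemma refl_commute (u : 'M[R]_s) k j x : orth u -> u^T *m a k = x *: a j ->
  refl_mx (a k) *m u = u *m refl_mx (a j).
Proof.
move=> ou E; have x0 : x != 0.
  apply: contraNneq (a_neq0 k) => x0; move: E; rewrite x0 scale0r => /(congr1 (mulmx u)).
  by rewrite mulmxA orthC // mul1mx mulmx0 => ->.
have -> : a k = u *m (x *: a j) by rewrite -E mulmxA orthC // mul1mx.
by rewrite refl_mx_conj // -mulmxA ou mulmx1 refl_mxZ.
Qed.

(** Take [z] on the hyperplane of [a l] and on no other, and move it into the chamber by a word [u]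
    in the walls. Then [u z] lies on exactly one hyperplane, a wall [i], and the reflection in [a l]
    is that in [a i] conjugated by [u]. *)
Lemma refl_wall_word l : exists2 r, (forall i, i \in r -> wall i) & refl_mx (a l) = word r.
Proof.
have [z zl zj] : exists2 z, dot (a l) z = 0 & forall i, a i != a l -> dot (a i) z != 0.
  have [||c] := @polyfun_prod_neq0 R s _ (fun i => a i != a l) (fun i c => dot (a i) (projh (a l) c)).
  - by move=> i _; apply: polyfun_projh; exact: polyfun_dot.
  - move=> i ai; exists (projh (a l) (a i)).
    rewrite projh_id ?dot_projh //.
    have -> : dot (a i) (projh (a l) (a i)) = dot (projh (a l) (a i)) (projh (a l) (a i)).
      by rewrite [RHS]dotBl dotZl dot_projh // mulr0 subr0.
    by rewrite dot_eq0 subr_eq0; apply: contraNneq ai => /a_prop ->.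
  move=> /prodf_neq0 H; exists (projh (a l) c); first exact: dot_projh.
  exact: H.
have [r rw rz] := reach wall z.
have {}rz := wall_ex rz; set u := word r in rz.
have Wu : W u := W_word r; have ou := W_orth Wu.
have ouT : orth u^T by rewrite /orth trmxK orthC.
(* [u a_l] is proportional to the only root vanishing at [u z]. *)
have [i [x uE]] : exists i x, u *m a l = x *: a i.
  by have := W_perm l (W_word (rev r)); rewrite -word_tr trmxK.
have iz : dot (a i) (u *m z) = 0.
  have : dot (x *: a i) (u *m z) = 0 by rewrite -uE dot_mulmx mulmxA ou mul1mx.
  rewrite dotZl => /eqP; rewrite mulf_eq0 => /orP[/eqP x0|/eqP //].
  move: uE; rewrite x0 scale0r => /(congr1 (mulmx u^T)); rewrite mulmxA ou mul1mx mulmx0 => al.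
  by move: (a_neq0 l); rewrite al eqxx.
have wi : wall i.
  exists (u *m z) => // j ji; rewrite lt_def rz andbT; apply/eqP => jz.
  have [l' E] := W_root j Wu.
  have : dot (u^T *m a j) z = 0 by rewrite dot_mulmx trmxK.
  rewrite E dotZl => /eqP; rewrite mulf_eq0 (negPf (W_reg j Wu)) /= => l'z.
  have ll : a l' = a l by apply/eqP/negPn/negP => /zj; rewrite l'z.
  move: E; rewrite ll => /(congr1 (mulmx u)); rewrite mulmxA orthC // mul1mx -scalemxAr uE scalerA.
  by move=> /a_prop E; move: ji; rewrite E eqxx.
exists (rev r ++ i :: r).
  move=> j; rewrite mem_cat mem_rev in_cons => /or3P[|/eqP ->|] //; exact: rw.
rewrite word_cat -word_tr /= -/u mulmxA.
have -> : u^T *m refl_mx (a i) = refl_mx (a l) *m u^T.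
  by symmetry; apply: (@refl_commute u^T l i x) => //; rewrite trmxK.
by rewrite -mulmxA ou mulmx1.
Qed.

Lemma word_wall r : exists2 r', (forall i, i \in r' -> wall i) & word r = word r'.
Proof.
elim: r => [|i r [r' r'w rE]]; first by exists [::].
have [t tw E] := refl_wall_word i; exists (t ++ r'); last by rewrite /= rE E word_cat.
by move=> j; rewrite mem_cat => /orP[/tw|/r'w].
Qed.

(** The exchange condition. The sign of [a k] turns negative when some letter [j] is appended to a
    prefix [r1]; by [wall_pos], reflection in [j] changes the sign of no other root, so
    [(word r1)^T a_k] is proportional to [a j]. *)
Lemma exchange k r : (forall i, i \in r -> wall i) -> dot (a k) (word r *m p) < 0 ->
  exists r1 j r2 x, r = r1 ++ j :: r2 /\ (word r1)^T *m a k = x *: a j.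
Proof.
elim/last_ind: r => [|r j IH] rw; first by rewrite mul1mx a_p ltNge ler01.
rewrite -cats1 word_cat /= mulmx1 => neg.
have [|pos] := ltP (dot (a k) (word r *m p)) 0.
  move=> /IH[|r1 [i [r2 [x [-> E]]]]].
    by move=> i ir; apply: rw; rewrite mem_rcons in_cons ir orbT.
  by exists r1, i, (r2 ++ [:: j]), x; split=> //; rewrite -catA.
have {}pos : 0 < dot (a k) (word r *m p) by rewrite lt_def pos W_reg //; exact: W_word.
have [l E] := W_root k (W_word r); set x := dot _ _ in E pos.
have wj : wall j by apply: rw; rewrite mem_rcons mem_head.
have [al|al] := eqVneq (a l) (a j).
  by exists r, j, [::], x; split; rewrite ?cats1 // E al.
have [l' [y yE]] := W_perm l (W_refl j); rewrite refl_mx_tr in yE.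
have y0 := wall_pos wj al yE.
move: neg; rewrite -mulmxA dotC dot_mulmx dotC E dotZl pmulr_rlt0 //.
by rewrite dotC dot_refl dotC yE dotZl a_p mulr1 ltNge ltW.
Qed.

(** Induction on the length of a word in the walls: its first letter [k] makes [a k] negative on the
    rest, and by [exchange] this letter can be moved to the right until it cancels another. *)
Lemma word_chamber r : (forall i, 0 < dot (a i) (word r *m p)) -> word r = 1%:M.
Proof.
have [r' rw ->] := word_wall r; move: rw; have [n] := ubnP (size r').
elim: n => // n IH in r' *; rewrite ltnS; case: r' => [//|k r'] rn rw pos.
have neg : dot (a k) (word r' *m p) < 0.
  have := pos k; rewrite /= -mulmxA dotC dot_refl refl_mxE mulfK ?dot_eq0 //.
  have -> : a k - 2 *: a k = - a k by rewrite scaler_nat mulr2n opprD addrA subrr sub0r.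
  by rewrite dotNr oppr_gt0 dotC.
have [|r1 [j [r2 [x [rE E]]]]] := exchange _ neg.
  by move=> i ir; apply: rw; rewrite in_cons ir orbT.
have wE : word (k :: r') = word (r1 ++ r2).
  rewrite rE /= !word_cat /= mulmxA (refl_commute (W_orth (W_word r1)) E).
  by rewrite -[word r1 *m _ *m _]mulmxA [refl_mx _ *m (_ *m _)]mulmxA refl_mx_sq mul1mx.
rewrite wE; apply: IH; last by rewrite -wE.
  by move: rn; rewrite rE /= !size_cat /= => /(leq_trans _); apply; rewrite ltnS leq_add2l leqnSn.
move=> i; rewrite mem_cat => ir; apply: rw; rewrite in_cons rE mem_cat in_cons.
by case/orP: ir => ->; rewrite !orbT.
Qed.

Definition in_chamber c := forall i, 0 <= dot (a i) c.

Theorem chamber_reach c : exists r, in_chamber (word r *m c).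
Proof. by have [r _ H] := reach (fun=> True) c; exists r => i; exact: H. Qed.

(** Among the [w] with the same value [w c], take one maximising [<w p, p>]. A root negative at
    [w p] is at most 0 at [w c] as [c] is in the chamber, and at least 0 as [w c] is; its reflection
    thus fixes [w c] and would increase the maximum. So [w p] is in the open chamber and [w = 1]. *)
Theorem chamber_unique c r : in_chamber c -> in_chamber (word r *m c) -> word r *m c = c.
Proof.
move=> Cc Cwc; pose A := [set w | (exists r', w = word r') /\ w *m c = word r *m c].
have fA : finite_set A by apply: sub_finite_set W_fin => w [[r' ->] _]; exact: W_word.
have [|_ [[t ->] tE] tmax] := finite_argmax (fun w => dot (w *m p) p) fA.
  by exists (word r); split=> //; exists r.
rewrite -tE word_chamber ?mul1mx // => i; rewrite lt_def W_reg ?leNgt; last exact: W_word.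
apply/negP => neg; have := refl_dot_lt neg; rewrite ltNge => /negP; apply.
rewrite mulmxA; apply: tmax; split; first by exists (i :: t).
rewrite -mulmxA tE refl_mxE -tE.
suff -> : dot (a i) (word t *m c) = 0 by rewrite mulr0 mul0r scale0r subr0.
apply/eqP; rewrite eq_le; apply/andP; split; last by rewrite tE.
have [l E] := W_root i (W_word t).
by rewrite dotC dot_mulmx dotC E dotZl mulr_le0_ge0 // ltW.
Qed.

End Chamber.

(** * Coordinates adapted to the section *)

Section Inner.
Variables (R : realType) (V : euclideanType R).
Implicit Types u v w : V.

Lemma innerZr k u v : inner u (k *: v) = k * inner u v.
Proof. by rewrite innerC innerZl innerC. Qed.

Lemma inner0l v : inner 0 v = 0.
Proof. by rewrite -(scale0r 0) innerZl mul0r. Qed.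

Lemma innerBl u v w : inner (u - v) w = inner u w - inner v w.
Proof. by rewrite innerDl -scaleN1r innerZl mulN1r. Qed.

Lemma innerBr u v w : inner w (u - v) = inner w u - inner w v.
Proof. by rewrite innerC innerBl !(innerC w). Qed.

Lemma inner_suml (I : Type) (r : seq I) (P : pred I) (F : I -> V) w :
  inner (\sum_(i <- r | P i) F i) w = \sum_(i <- r | P i) inner (F i) w.
Proof. by apply: (big_morph (fun u => inner u w)); [move=> u v; rewrite innerDl|rewrite inner0l]. Qed.

Lemma inner_ge0 v : 0 <= inner v v.
Proof. by rewrite inner_norm sqr_ge0. Qed.

Lemma inner_le u v : inner v v = 1 -> `|inner u v| <= `|u|.
Proof.
move=> v1; rewrite -(@ler_pXn2r _ 2) ?nnegrE // real_normK ?num_real // -inner_norm -subr_ge0.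
have := inner_ge0 (u - inner u v *: v).
by rewrite innerBl !innerBr !innerZl !innerZr v1 [inner v u]innerC mulr1 subrr subr0 expr2.
Qed.

Definition orthonormal (r : seq V) := forall i j, (i < size r)%N -> (j < size r)%N ->
  inner r`_i r`_j = (i == j)%:R.

Lemma orthonormal_free r : orthonormal r -> free r.
Proof.
move=> or; apply/(@freeP _ _ _ (in_tuple r)) => k k0 i.
have := congr1 (fun v => inner v r`_i) k0; rewrite inner0l inner_suml (bigD1 i) //=.
rewrite innerZl or // eqxx mulr1 big1 ?addr0 // => j ji.
by rewrite innerZl or // (negPf (_ : (j : nat) != i)) ?mulr0 // (inj_eq val_inj).
Qed.

Lemma orthonormal_extend (U : {vspace V}) (r : seq V) : orthonormal r -> {subset r <= U} ->
  exists r', [/\ orthonormal (r ++ r'), {subset r ++ r' <= U} & size (r ++ r') = \dim U].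
Proof.
have [n] := ubnP (\dim U - size r); elim: n => // n IH in r *; rewrite ltnS => rn or rU.
have sr : ((span r) <= U)%VS by apply/span_subvP.
have dr : \dim (span r) = size r by apply/eqP; exact: orthonormal_free.
have [eq|neq] := eqVneq (size r) (\dim U); first by exists [::]; rewrite cats0.
have lt : (size r < \dim U)%N by rewrite ltn_neqAle neq -dr dimvS.
have [x xU xr] : exists2 x, x \in U & x \notin (span r)%VS.
  have : ~~ (U <= (span r))%VS by apply: contraTN lt => /dimvS; rewrite dr leqNgt.
  case/subvPn => x xU xr; by exists x.
pose y := x - \sum_(i < size r) inner x r`_i *: r`_i.
have ry i : (i < size r)%N -> inner y r`_i = 0.
  move=> ir; rewrite innerBl inner_suml (bigD1 (Ordinal ir)) //= innerZl or // eqxx mulr1.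
  rewrite big1 ?addr0 ?subrr // => j ji; rewrite innerZl or // (negPf (_ : (j : nat) != i)) ?mulr0 //.
have rr i : (i < size r)%N -> r`_i \in (span r)%VS by move=> ir; rewrite memv_span // mem_nth.
have y0 : y != 0.
  apply: contraNneq xr => /eqP; rewrite subr_eq0 => /eqP ->.
  by apply: memv_suml => i _; rewrite memvZ // rr.
pose z := `|y|^-1 *: y.
have yn : `|y| != 0 by rewrite normr_eq0.
have zz : inner z z = 1.
  by rewrite innerZl innerZr inner_norm expr2 mulKf // mulVf.
have zU : z \in U.
  rewrite memvZ // memvB // memv_suml // => i _; rewrite memvZ //.
  by apply: (subvP sr); exact: rr.
have [|||r' [or' rU' sz]] := IH (rcons r z).
- by rewrite size_rcons subnS prednK ?subn_gt0.
- move=> i j; rewrite size_rcons !ltnS [(i <= _)%N]leq_eqVlt [(j <= _)%N]leq_eqVlt !nth_rcons.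
  move=> /orP[/eqP ->|ir] /orP[/eqP ->|jr].
  + by rewrite ltnn !eqxx zz.
  + by rewrite ltnn eqxx jr innerZl ry // mulr0 gtn_eqF.
  + by rewrite ltnn eqxx ir innerC innerZl ry // mulr0 ltn_eqF.
  + by rewrite ir jr or.
- by move=> u; rewrite mem_rcons in_cons => /orP[/eqP -> //|/rU].
by exists (z :: r'); rewrite -cat_rcons.
Qed.

Record isometry_onto N (iota : 'cV[R]_N -> V) : Prop := IsometryOnto {
  iso_lin : forall k (c d : 'cV[R]_N), iota (k *: c + d) = k *: iota c + iota d;
  iso_dot : forall c d, inner (iota c) (iota d) = dot c d;
  iso_onto : forall x, exists c, iota c = x
}.

Lemma sum_cast_ord n n' (e : n = n') (F : 'I_n' -> V) :
  \sum_(i < n) F (cast_ord e i) = \sum_(i < n') F i.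
Proof. by case: n' / e F => F; apply: eq_bigr => i _; rewrite cast_ord_id. Qed.

Lemma adapted_isometry (S : {vspace V}) : exists m (iota : 'cV[R]_(\dim S + m) -> V),
  isometry_onto iota /\ forall x, x \in S <-> exists c, x = iota (section_incl m c).
Proof.
have o0 : orthonormal [::] by [].
have [|r [or rS sr]] := orthonormal_extend (U := S) o0; first by [].
rewrite cat0s in or rS sr.
have [|r' [or' _ sr']] := orthonormal_extend (U := fullv) or; first by move=> x _; exact: memvf.
have szs : size (r ++ r') = (\dim S + size r')%N by rewrite size_cat sr.
pose e (i : 'I_(\dim S + size r')) := (r ++ r')`_i.
have eo i j : inner (e i) (e j) = (i == j)%:R by rewrite or' ?szs.
exists (size r'), (fun c => \sum_i c i 0 *: e i).
have lin k (u v : 'cV[R]_(\dim S + size r')) : \sum_i (k *: u + v) i 0 *: e i = k *: \sum_i u i 0 *: e i + \sum_i v i 0 *: e i.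
  rewrite scaler_sumr -big_split; apply: eq_bigr => i _ /=.
  by rewrite !mxE scalerDl scalerA.
have frS : basis_of S r.
  rewrite basisEfree orthonormal_free //= sr leqnn andbT; exact/span_subvP.
have frV : basis_of fullv (r ++ r').
  by rewrite basisEfree orthonormal_free //= subvf sr' leqnn.
split.
  split=> [//|u v|x].
    rewrite inner_suml; apply: eq_bigr => i _; rewrite innerZl innerC inner_suml (bigD1 i) //=.
    rewrite innerZl eo eqxx mulr1 big1 ?addr0 // => j ji.
    by rewrite innerZl eo (negPf ji) mulr0.
  have xs : x \in span (r ++ r') by rewrite (span_basis frV) memvf.
  have := coord_span (X := in_tuple (r ++ r')) xs => ->.
  exists (\col_i coord (in_tuple (r ++ r')) (cast_ord (esym szs) i) x).
  rewrite -(sum_cast_ord szs); apply: eq_bigr => i _.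
  by rewrite mxE cast_ordK.
have incE c : \sum_i (section_incl (size r') c) i 0 *: e i = \sum_(i < \dim S) c i 0 *: r`_i.
  rewrite big_split_ord /= [X in _ + X]big1 ?addr0 => [|i _]; last by rewrite col_mxEd mxE scale0r.
  by apply: eq_bigr => i _; rewrite col_mxEu /e nth_cat /= sr ltn_ord.
move=> x; split=> [xS|[c ->]]; last first.
  by rewrite incE; apply: memv_suml => i _; rewrite memvZ // rS // mem_nth // sr.
have xs : x \in span r by rewrite (span_basis frS).
have xE := coord_span (X := in_tuple r) xs.
exists (\col_i coord (in_tuple r) (cast_ord (esym sr) i) x); rewrite incE {1}xE.
rewrite -(sum_cast_ord sr); apply: eq_bigr => i _.
by rewrite mxE cast_ordK.
Qed.

End Inner.

(** * The group in orthonormal coordinates *)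

Section GroupMatrices.
Variables (R : realType) (G : lieGroupType R) (V : euclideanType R).
Variable rho : orthrep G (@inner R V).
Hypothesis G_compact : compact [set: G].
Hypothesis G_connected : connected [set: G].
Hypothesis rho_continuous : continuous_rep rho.
Variables (N : nat) (iota : 'cV[R]_N -> V).
Hypothesis iotaP : isometry_onto iota.

Lemma iotaD c d : iota (c + d) = iota c + iota d.
Proof. by rewrite -[c]scale1r (iso_lin iotaP) !scale1r. Qed.

Lemma iota0 : iota 0 = 0.
Proof. by apply: (addrI (iota 0)); rewrite -iotaD !addr0. Qed.

Lemma iotaZ k c : iota (k *: c) = k *: iota c.
Proof. by rewrite -[k *: c]addr0 (iso_lin iotaP) iota0 addr0. Qed.

Lemma iotaB c d : iota (c - d) = iota c - iota d.
Proof. by rewrite -scaleN1r iotaD iotaZ scaleN1r. Qed.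

Lemma iota_sum (I : Type) (r : seq I) (P : pred I) (F : I -> 'cV[R]_N) :
  iota (\sum_(i <- r | P i) F i) = \sum_(i <- r | P i) iota (F i).
Proof. by apply: (big_morph iota); [exact: iotaD|exact: iota0]. Qed.

Lemma iota_inj : injective iota.
Proof.
move=> c d cd; apply/eqP; rewrite -subr_eq0 -dot_eq0 -(iso_dot iotaP) iotaB cd subrr.
by rewrite inner0l.
Qed.

Lemma iota_norm c : `|iota c| <= mn c.
Proof.
rewrite -(@ler_pXn2r _ 2) ?nnegrE ?mn_ge0 // -inner_norm (iso_dot iotaP).
by rewrite expr2 (le_trans (ler_norm _)) // dot_le_mn.
Qed.

Let e i := iota (delta_mx i 0).

Lemma iota_coord c i : inner (iota c) (e i) = c i 0.
Proof. by rewrite (iso_dot iotaP) dot_delta. Qed.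

Definition matG g : 'M[R]_N := \matrix_(i, j) inner (rho g (e j)) (e i).

Lemma matGE g c : rho g (iota c) = iota (matG g *m c).
Proof.
have [d dE] := iso_onto iotaP (rho g (iota c)); rewrite -dE; congr iota.
apply/matrixP => i j; rewrite ord1 -(iota_coord d) dE {1}(colv_sum c) iota_sum linear_sum.
rewrite inner_suml mxE; apply: eq_bigr => k _; rewrite iotaZ linearZ innerZl mulrC.
by rewrite /matG mxE.
Qed.

Lemma matG_eq g (A : 'M[R]_N) : (forall c, rho g (iota c) = iota (A *m c)) -> matG g = A.
Proof.
move=> gA; apply/matrixP => i j; rewrite -!(mulmx_delta_entry _ j i).
by have := gA (delta_mx j 0); rewrite matGE => /iota_inj ->.
Qed.

Lemma matG_coord g i j : matG g i j = inner (rho g (e j)) (e i).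
Proof. by rewrite mxE. Qed.

Lemma matGM g h : matG (g * h)%g = matG g *m matG h.
Proof. by apply: matG_eq => c; rewrite repM lfunE /= !matGE mulmxA. Qed.

Lemma matG1 : matG 1%g = 1%:M.
Proof. by apply: matG_eq => c; rewrite rep1 lfunE mul1mx. Qed.

Lemma matG_orth g : orth (matG g).
Proof.
apply: orth_dot => c d.
by rewrite -!(iso_dot iotaP) -!matGE rep_orth.
Qed.

Lemma matGV g : matG g^-1%g = (matG g)^T.
Proof.
by rewrite -[LHS]mulmx1 -(orthC (matG_orth g)) mulmxA -matGM mulVg matG1 mul1mx.
Qed.

Lemma inner_cvg (T : Type) (F : set_system T) (FF : Filter F) (u : T -> V) (x : V) i :
  u @ F --> x -> (fun t => inner (u t) (e i)) @ F --> inner x (e i).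
Proof.
move=> ux; apply/cvgrPdist_le => d d0; have /cvgrPdist_le/(_ d d0) := ux.
apply: filterS => t; apply: le_trans; rewrite -innerBl; apply: inner_le.
by rewrite (iso_dot iotaP) dot_delta mxE !eqxx.
Qed.

Lemma matG_cvg (T : Type) (F : set_system T) (FF : Filter F) (u : T -> G) (g : G) i j :
  u @ F --> g -> (fun t => matG (u t) i j) @ F --> matG g i j.
Proof.
move=> ug; rewrite matG_coord (_ : (fun _ => _) = fun t => inner (rho (u t) (e j)) (e i)).
  apply: inner_cvg; apply: (cvg_comp u (fun g => rho g (e j)) ug).
  exact: rho_continuous.
by apply/funext => t; rewrite matG_coord.
Qed.

Lemma matGv_cvg (T : Type) (F : set_system T) (FF : Filter F) (u : T -> G) (g : G) v i :
  u @ F --> g -> (fun t => (matG (u t) *m v) i 0) @ F --> (matG g *m v) i (0 : 'I_1).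
Proof.
move=> ug; rewrite mxE (_ : (fun _ => _) = fun t => \sum_j matG (u t) i j * v j 0).
  by apply: cvg_bigsum => j; apply: cvgM; [exact: matG_cvg|exact: cvg_cst].
by apply/funext => t; rewrite mxE.
Qed.

Lemma G_limit (u : nat -> G) : exists g : G, u @ omega --> g.
Proof.
have FP : ProperFilter (u @ omega) by exact: fmap_proper_filter.
have [|g [_ gF]] := G_compact FP; first exact: filterT.
exists g => B Bg; rewrite /nbhs /=.
have [//|FN] := in_ultra_setVsetC (u @^-1` B) omega_ultra.
have FN' : omega (u @^-1` (u @` (~` (u @^-1` B)))) by apply: filterS FN => x nBx; exists x.
have [_ [[x nBx <-] Bx]] := gF _ _ FN' Bg.
by have := nBx.
Qed.

Definition KG := range matG.

Lemma KG_closed_group : closed_group KG.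
Proof.
split.
- by exists 1%g => //; exact: matG1.
- by move=> _ _ [g _ <-] [h _ <-]; exists (g * h)%g => //; exact: matGM.
- by move=> _ [g _ <-]; exists g^-1%g => //; exact: matGV.
- by move=> _ [g _ <-]; exact: matG_orth.
- move=> k L Kk kL; have /choice[u uE] : forall n, exists g, matG g = k n.
    by move=> n; have [g _ gk] := Kk n; exists g.
  have [g ug] := G_limit u; exists g => //; apply: (mlim_unique _ kL) => i j.
  have := matG_cvg (i := i) (j := j) omega_filter ug; rewrite (_ : (fun _ => _) = (fun n => k n i j)) //.
  by apply/funext => n; rewrite uE.
Qed.

(** Connectedness: the [g] that preserve [P] form a closed set. If it were not open, elements
    outside it converging to a point [h] of it would yield a direction [X] transversal to the
    stabiliser [H] of [P]; but the one-parameter group of [X] preserves [P]. *)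
Theorem lie_invariant (P : 'cV[R]_N -> R) : polyfun P ->
  (forall X, lie KG X -> forall v, pder (X *m v) P v = 0) -> forall g v, P (matG g *m v) = P v.
Proof.
move=> pP PX; pose H := [set A | KG A /\ forall v, P (A *m v) = P v].
have cgK := KG_closed_group.
have Pc (T : Type) (F : set_system T) (FF : Filter F) (u : T -> 'M[R]_N) A v :
    (forall i, (fun t => (u t *m v) i 0) @ F --> (A *m v) i (0 : 'I_1)) ->
    (fun t => P (u t *m v)) @ F --> P (A *m v).
  by move=> uA; apply: (@polyfun_cvg R T F FF N P (fun t => u t *m v)).
have cgH : closed_group H.
  split.
  - by split; [exact: cg1|move=> v; rewrite mul1mx].
  - by move=> A B [KA PA] [KB PB]; split; [exact: cgM|move=> v; rewrite -mulmxA PA PB].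
  - move=> A [KA PA]; split; first exact: cgT.
    by move=> v; rewrite -PA mulmxA (orthC (cg_orth cgK KA)) mul1mx.
  - by move=> A [KA _]; apply: (cg_orth cgK).
  - move=> A L HA AL; split; first by apply: (cg_lim cgK) AL => n; have [] := HA n.
    move=> v; have l := mlimM AL (mlim_cst v).
    have l' := Pc _ _ omega_filter A L v (fun i => l i 0).
    apply: norm_cvg_unique l' _; rewrite (_ : (fun _ => _) = fun=> P v); first exact: cvg_cst.
    by apply/funext => n; have [_ ->] := HA n.
pose GH := [set g | H (matG g)].
have opGH : open GH.
  rewrite openE => h Hh; rewrite /interior; apply: contrapT => nH.
  have /choice[u uP] : forall n : nat, exists g, ~ GH g /\ mn (matG g - matG h) < n.+1%:R^-1.
    move=> n; apply: contrapT => /forallNP noG; apply: nH.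
    have : (fun g => mn (matG g - matG h)) @ nbhs h --> (0 : R).
      have -> : (0 : R) = mn (matG h - matG h) by rewrite subrr mn0.
      apply: cvg_bigsum => i; apply: cvg_bigsum => j; apply: cvg_norm.
      rewrite (_ : (fun _ => _) = fun g => matG g i j - matG h i j).
        by rewrite !mxE; apply: cvgB; [rewrite -matG_coord; apply: (@matG_cvg G (nbhs h) _ id)|exact: cvg_cst].
      by apply/funext => g; rewrite !mxE.
    move=> /cvgr_lt/(_ n.+1%:R^-1); rewrite invr_gt0 ltr0n => /(_ isT); apply: filterS => g gn.
    by apply: contrapT => nGH; apply: (noG g).
  pose k n := (matG h)^T *m matG (u n).
  have Kk n : KG (k n) by exists (h^-1 * u n)%g => //; rewrite matGM matGV.
  have kH n : ~ H (k n).
    move=> Hk; have [nG _] := uP n; apply: nG; rewrite /GH /=.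
    have := cgM cgH Hh Hk; rewrite /k mulmxA (orthC (matG_orth h)) mul1mx //.
  have k1 : mlim k 1%:M.
    have l : mlim (fun n => matG (u n)) (matG h).
      by apply: mlim_squeeze (@cvg_invn R) _; apply: nearW => n; have [_ /ltW] := uP n.
    by have := mlimM (mlim_cst (matG h)^T) l; rewrite matG_orth.
  have [h' [d [X [_ _ _ [E oE KE] noE]]]] :=
    transversal_direction cgK cgH (fun A => @proj1 _ _) Kk (nearW _ kH) k1.
  apply: (noE E oE) => t; split=> // v.
  by apply: (onep_polyfun _ _ _ oE) => // [t'|w]; [apply: (cg_orth cgK)|apply: PX; exists E].
have clGH : closed GH.
  rewrite -openC openE => h nHh; rewrite /interior.
  have [v Pv] : exists v, P (matG h *m v) <> P v.
    apply: contrapT => /forallNP noP; apply: nHh; split; first by exists h.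
    by move=> v; apply: contrapT; exact: noP.
  have l : (fun g => P (matG g *m v)) @ nbhs h --> P (matG h *m v).
    by apply: Pc => i; apply: (@matGv_cvg G (nbhs h) _ id).
  have /l : nbhs (P (matG h *m v)) [set x | x != P v].
    apply: open_nbhs_nbhs; split; last exact/eqP.
    by have := @open_neq R^o (P v).
  move=> Hn; apply: (@filterS _ _ (@nbhs_filter G h) _ _ _ Hn) => g /eqP Pg [_ /(_ v)].
  exact: Pg.
have GT : GH = setT.
  apply: G_connected.
  - exists 1%g; rewrite /GH /= matG1; exact: (cg1 cgH).
  - by exists GH; rewrite ?setTI.
  - by exists GH; rewrite ?setTI.
by move=> g v; have [_] : GH g by rewrite GT.
Qed.

Lemma orbit_curve_C_on (E : R -> 'M[R]_N) X : onep E X -> (forall t, orth (E t)) ->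
  forall k w, C_on k setT (fun t : R => iota (E t *m w)) /\
    forall t : R, 'D_1 (fun t : R => iota (E t *m w)) t = iota (E t *m (X *m w)).
Proof.
move=> oE orE.
have D w (t : R) : is_derive t 1 (fun t : R => iota (E t *m w)) (iota (E t *m (X *m w))).
  have [E0 ED [C EC]] := oE; apply: (@quad_derive _ _ _ ((N * N)%:R * C * mn w)) => h.
  have -> : iota (E (t + h) *m w) - iota (E t *m w) - h *: iota (E t *m (X *m w)) =
      iota (E t *m ((E h - 1%:M - h *: X) *m w)).
    rewrite -iotaZ -!iotaB; congr iota.
    by rewrite ED !mulmxBl mul1mx -scalemxAl !mulmxBr -scalemxAr !mulmxA.
  rewrite (le_trans (iota_norm _)) // (le_trans (mnM _ _)) // -!mulrA ler_pM ?mn_ge0 ?orth_mn //.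
  rewrite (le_trans (mnM _ _)) // [leRHS]mulrCA mulrC ler_wpM2l ?mn_ge0 // mulrC; exact: EC.
have df w (t : R) : differentiable (fun t : R => iota (E t *m w)) t.
  by apply/derivable1_diffP; have := D w t => ?; apply: ex_derive.
move=> k w; split; last by move=> t; have := D w t => ?; rewrite derive_val.
elim: k w => [|k IH] w.
  by move=> t _; apply: differentiable_continuous.
split=> [t _|v]; first exact: df.
have -> : (fun t : R => 'D_v (fun t : R => iota (E t *m w)) t) = (fun t : R => iota (E t *m (X *m (v *: w)))).
  apply/funext => t; rewrite deriveE // -[v]mulr1 -[v * 1]/(v *: (1 : R)) linearZ /= -deriveE //.
  by have := D w t => ?; rewrite derive_val -iotaZ !scalemxAr [v *: 1]mulr1.
exact: IH.
Qed.

Lemma orbit_tangent_lie X c : lie KG X -> orbit_tangent rho (iota c) (iota (X *m c)).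
Proof.
move=> [E oE KE]; have orE t : orth (E t) := cg_orth KG_closed_group (KE t).
have [E0 _ _] := oE.
exists (fun t => iota (E t *m c)); split.
- by move=> k; have [] := orbit_curve_C_on oE orE k c.
- by move=> t; have [g _ gE] := KE t; exists g => //; rewrite matGE gE.
- by rewrite E0 mul1mx.
- by have [_ ->] := orbit_curve_C_on oE orE 0 c; rewrite E0 mul1mx.
Qed.

End GroupMatrices.

Section PolarMatrices.
Variables (R : realType) (G : lieGroupType R) (V : euclideanType R).
Variable rho : orthrep G (@inner R V).
Hypothesis G_compact : compact [set: G].
Hypothesis rho_continuous : continuous_rep rho.
Variable S : {vspace V}.
Hypothesis S_section : is_section rho S.

Theorem polar_coordinates : exists m (iota : 'cV[R]_(\dim S + m) -> V) a,
  [/\ isometry_onto iota, forall x, x \in S <-> exists c, x = iota (section_incl m c) &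
    root_data (KG rho iota) a].
Proof.
have [m [iota [iotaP iotaS]]] := adapted_isometry S.
have cgK := KG_closed_group G_compact rho_continuous iotaP.
have pK : polar (KG rho iota).
  split=> // [v|X c c' lX].
    have [w [g _ gv] /iotaS[c wc]] := S_section.1 (iota v).
    exists (matG rho iota g); first by exists g.
    by exists c; apply: (iota_inj iotaP); rewrite -matGE // gv wc.
  have cS : iota (section_incl m c) \in S by apply/iotaS; exists c.
  have c'S : iota (section_incl m c') \in S by apply/iotaS; exists c'.
  rewrite dotC -(iso_dot iotaP); apply: (S_section.2 _ cS) => //.
  exact: orbit_tangent_lie.
have [Q oQ [a rd]] := polar_normal_form pK.
set B := block_mx _ _ _ _ in rd.
have oB : orth B.
  rewrite /orth tr_block_mx mulmx_block !trmx0 trmx1 !mulmx0 !mul0mx oQ.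
  by rewrite mulmx1 !add0r addr0 -scalar_mx_block.
have Binc c : B *m section_incl m c = section_incl m c by rewrite mul_block_col mul1mx !mulmx0 mul0mx !addr0.
have iotaP' : isometry_onto (fun c => iota (B *m c)).
  split=> [k c d|c d|x].
  - by rewrite mulmxDr -scalemxAr (iso_lin iotaP).
  - by rewrite (iso_dot iotaP) dot_mulmx mulmxA oB mul1mx.
  - by have [c <-] := iso_onto iotaP x; exists (B^T *m c); rewrite mulmxA orthC // mul1mx.
exists m, (fun c => iota (B *m c)), a; split=> //.
  by move=> x; rewrite iotaS; split=> -[c ->]; exists c; rewrite Binc.
suff -> : KG rho (fun c => iota (B *m c)) = conj_set B (KG rho iota) by [].
apply/seteqP; split=> A.
  move=> [g _ <-]; exists (matG rho iota g); first by exists g.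
  apply/esym/(matG_eq iotaP') => c.
  by rewrite matGE // !mulmxA orthC // mul1mx.
move=> [_ [g _ <-] <-]; exists g => //; apply/(matG_eq iotaP') => c.
by rewrite matGE // !mulmxA orthC // mul1mx.
Qed.

End PolarMatrices.

(** * Separation of the points of a chamber *)

Section PolynomialInvariants.
Variables (R : realType) (G : lieGroupType R) (V : euclideanType R).
Variable rho : orthrep G (@inner R V).
Variables (N : nat) (iota : 'cV[R]_N -> V).
Hypothesis iotaP : isometry_onto iota.

Lemma polyfun_exp k (f : 'cV[R]_k -> R) j : polyfun f -> polyfun (fun c => f c ^+ j).
Proof.
move=> pf; elim: j => [|j IH].
  by apply: polyfun_eq (polyfun_cst _ 1) => c; rewrite expr0.
by apply: polyfun_eq (polyfunM pf IH) => c; rewrite exprS.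
Qed.

Lemma polyfun_meval k n (f : 'cV[R]_k -> 'I_n -> R) (p : mpoly.mpoly n R) :
  (forall i, polyfun (fun c => f c i)) -> polyfun (fun c => mpoly.meval (f c) p).
Proof.
move=> pf; apply: (@polyfun_eq _ _ (fun c => \sum_(m <- mpoly.msupp p)
    mpoly.mcoeff m p * \prod_(i < n) f c i ^+ m i)).
  by move=> c; rewrite mpoly.mevalE.
apply: polyfun_sum => m _; apply: polyfunZ; apply: polyfun_prod => i _.
exact: polyfun_exp.
Qed.

Lemma polyfun_peval p : polyfun (fun c => peval p (iota c)).
Proof.
apply: polyfun_meval => i.
apply: (@polyfun_eq _ _ (fun c => \sum_j coord (vbasis fullv) i (iota (delta_mx j 0)) * c j 0)).
  move=> c; rewrite [in RHS](colv_sum c) (iota_sum iotaP) linear_sum.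
  by apply: eq_bigr => j _; rewrite (iotaZ iotaP) linearZ mulrC.
by apply: polyfun_sum => j _; apply: polyfunZ; exact: polyfun_coord.
Qed.

Lemma polyfun_pevalV (P : 'cV[R]_N -> R) : polyfun P ->
  exists p : mpoly.mpoly (\dim {:V}) R, forall c, peval p (iota c) = P c.
Proof.
elim=> {P} [k|i|f g _ [p pE] _ [q qE]|f g _ [p pE] _ [q qE]|f g fg _ [p pE]].
- by exists (mpoly.mpolyC _ k) => c; rewrite /peval mpoly.mevalC.
- exists (\sum_(j < \dim {:V}) inner (vbasis fullv)`_j (iota (delta_mx i 0)) *: mpoly.mpolyX R (mpoly.mnm1 j)) => c.
  rewrite /peval raddf_sum /= -(iota_coord iotaP c i) {2}(coord_vbasis (memvf (iota c))) inner_suml.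
  by apply: eq_bigr => j _; rewrite mpoly.mevalZ mpoly.mevalXU innerZl mulrC.
- by exists (p + q) => c; rewrite -pE -qE /peval mpoly.mevalD.
- by exists (p * q) => c; rewrite -pE -qE /peval mpoly.mevalM.
- by exists p => c; rewrite pE fg.
Qed.

Variables (n : nat) (sigma : n.-tuple (mpoly.mpoly (\dim {:V}) R)).
Hypothesis sigmaP : minimal_generators rho sigma.

Definition evalsig (Q : mpoly.mpoly n R) (y : 'rV[R]_n) := mpoly.meval (fun i => y 0 i) Q.

Lemma orbit_map_inv g x : orbit_map sigma (rho g x) = orbit_map sigma x.
Proof.
have [inv _ _ _] := sigmaP; apply/rowP => i; rewrite !mxE; apply: inv.
exact: mem_tnth.
Qed.

Lemma polyfun_orbit_map i : polyfun (fun c => orbit_map sigma (iota c) 0 i).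
Proof. by apply: polyfun_eq (polyfun_peval (tnth sigma i)) => c; rewrite mxE. Qed.

Lemma invariant_evalsig (P : 'cV[R]_N -> R) : polyfun P ->
  (forall g v, P (matG rho iota g *m v) = P v) ->
  exists Q, forall c, P c = evalsig Q (orbit_map sigma (iota c)).
Proof.
move=> pP PG; have [p pE] := polyfun_pevalV pP; have [_ _ gen _] := sigmaP.
have [|Q QE] := gen p.
  move=> g x; have [c <-] := iso_onto iotaP x.
  by rewrite (matGE rho iotaP) !pE PG.
exists Q => c; rewrite -pE QE /peval mpoly.comp_mpoly_meval /evalsig.
by apply: mpoly.meval_eq => i; rewrite mxE.
Qed.

End PolynomialInvariants.

Lemma homogeneous_euler (R : realType) k (h : 'cV[R]_k -> R) d : polyfun h ->
  (forall t c, h (t *: c) = t ^+ d * h c) -> forall c, pder c h c = d%:R * h c.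
Proof.
move=> ph hh c; pose p : {poly R} := ('X - (-1)%:P) ^+ d * (h c)%:P.
have pE t : h (c + t *: c) = p.[t].
  by rewrite -{1}[c]scale1r -scalerDl hh /p hornerM horner_exp hornerXsubC hornerC opprK addrC.
have := derive_line 0 pE; rewrite scale0r addr0 => ->.
rewrite /p derivM derivC mulr0 addr0 deriv_exp derivXsubC mul1r hornerM hornerMn hornerC.
by rewrite horner_exp hornerXsubC sub0r opprK expr1n.
Qed.

Section ChamberInvariants.
Variables (R : realType) (G : lieGroupType R) (V : euclideanType R).
Variable rho : orthrep G (@inner R V).
Hypothesis G_compact : compact [set: G].
Hypothesis G_connected : connected [set: G].
Hypothesis rho_continuous : continuous_rep rho.
Variables (s m : nat) (iota : 'cV[R]_(s + m) -> V) (a : 'I_m -> 'cV[R]_s).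
Hypothesis iotaP : isometry_onto iota.
Hypothesis rd : root_data (KG rho iota) a.
Variables (n : nat) (sigma : n.-tuple (mpoly.mpoly (\dim {:V}) R)).
Hypothesis sigmaP : minimal_generators rho sigma.
Let K := KG rho iota.
Let cgK : closed_group K := polar_cg (root_polar rd).

Lemma rpoly_coef_polyfun (us : seq 'cV[R]_s) j : polyfun (fun c => (rpoly us (dot c))`_j).
Proof.
elim: us j => [|u us IH] j.
  by apply: polyfun_eq (polyfun_cst _ (1 : {poly R})`_j) => c; rewrite /rpoly big_nil.
pose F c := (if j is j'.+1 then (rpoly us (dot c))`_j' else 0) - dot u c * (rpoly us (dot c))`_j.
apply: (@polyfun_eq _ _ F) => [c|].
  by rewrite /F rpoly_cons coef_XsubCM dotC.
apply: polyfunB; last by apply: polyfunM => //; exact: polyfun_dot.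
by case: j {F} => [|j]; [exact: polyfun_cst|exact: IH].
Qed.

(** The reflections permute [us], so the coefficients, which are homogeneous of degree
    [size us - j], are reflection invariant; they extend to invariants on the whole space, which are
    polynomials in the generators. *)
Lemma invariant_coefs (us : seq 'cV[R]_s) :
  (forall i, perm_eq [seq refl_mx (a i) *m u | u <- us] us) ->
  forall j, exists Q, forall c,
    (rpoly us (dot c))`_j = evalsig Q (orbit_map sigma (iota (section_incl m c))).
Proof.
move=> usP j; have [jus|jus] := leqP j (size us); last first.
  exists 0 => c; rewrite rpoly_over // /evalsig raddf0 //.
pose h c := (rpoly us (dot c))`_j.
have ph : polyfun h := rpoly_coef_polyfun us j.
have hr : refl_invariant a h.
  move=> i c; rewrite /h /rpoly -[in RHS](perm_big _ (usP i)) big_map.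
  by congr ((_ : {poly R})`_j); apply: eq_bigr => u _; rewrite dot_refl.
have hE c : pder c h c = (size us - j)%:R * h c.
  apply: homogeneous_euler => // t d; rewrite /h -rpoly_scale //.
  by congr ((_ : {poly R})`_j); apply: eq_bigr => u _; rewrite dotZl.
have [Xr XrP] := root_elt rd.
have [P [pP PE PX]] := @refl_invariant_extends R s m (lie K) a Xr (lie0 cgK)
  (fun X Y => @lieD _ _ _ cgK X Y) (fun k X => @lieZ _ _ _ k X) (lie_skew cgK)
  (fun X Y => @lie_br _ _ _ cgK X Y) (root_expand rd) (fun l => (XrP l).1)
  (fun l => (XrP l).2) (root_neq0 rd) (root_proportional rd)
  (fun k => weyl_root_perm rd (weyl_refl rd k)) (size us - j)%N h ph hr hE.
have PG := lie_invariant G_compact G_connected rho_continuous iotaP pP PX.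
have [Q QE] := invariant_evalsig iotaP sigmaP pP PG.
by exists Q => c; rewrite -QE PE.
Qed.

Lemma weyl_mx_perm w i : weyl_mx K w -> exists l x, w^T *m a i = x *: a l.
Proof.
move=> Ww; have [W' [W1 _ WP]] := weyl_root_perm rd (weyl_mxT rd Ww).
have [l Wl|W0] := pickP (fun l => W' i l != 0).
  by have [x _ xE] := WP i l Wl; exists l, x.
have := W1 i; rewrite big1 => [/esym/eqP|l _]; first by rewrite oner_eq0.
by have /negbT := W0 l; rewrite negbK => /eqP ->; rewrite expr0n.
Qed.

Lemma chamber_point c : exists g c', in_chamber a c' /\ rho g (iota (section_incl m c)) = iota (section_incl m c').
Proof.
have [p ap] := root_reg rd.
have [r Cr] := chamber_reach (weyl_mx_finite rd) (weyl_mx1 rd) (@weyl_mxM _ _ _ _ _ rd)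
  (weyl_refl rd) ap (root_neq0 rd) c.
have [_ [g _ <-] gE] := W_word (weyl_mx1 rd) (@weyl_mxM _ _ _ _ _ rd) (weyl_refl rd) r.
by exists g, (word a r *m c); split=> //; rewrite (matGE rho iotaP) gE.
Qed.

(** For each [u], the polynomial with roots [<c, w u>], with [w] in the group generated by the
    reflections, is determined by the orbit map. As [<c, u>] is a root, it equals some [<c', w u>];
    for generic [u] this forces [c = w^T c'], and the chamber meets each orbit of this group
    once. *)
Theorem chamber_separated c c' : in_chamber a c -> in_chamber a c' ->
  orbit_map sigma (iota (section_incl m c)) = orbit_map sigma (iota (section_incl m c')) -> c = c'.
Proof.
move=> Cc Cc' cc'; have [p ap] := root_reg rd.
have Wr r : weyl_mx K (word a r).
  exact: (W_word (weyl_mx1 rd) (@weyl_mxM _ _ _ _ _ rd) (weyl_refl rd)).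
have Worth r : orth (word a r) := weyl_mx_orth rd (Wr r).
pose W0 := [set w | exists r, w = word a r].
have /finite_seqP[ws0 wsE0] : finite_set W0.
  by apply: sub_finite_set (weyl_mx_finite rd) => w [r ->].
pose ws := undup ws0.
have wsE w : reflect (W0 w) (w \in ws) by rewrite mem_undup wsE0; apply: idP.
have us_perm (u : 'cV[R]_s) i : perm_eq [seq refl_mx (a i) *m v | v <- [seq w *m u | w <- ws]] [seq w *m u | w <- ws].
  have -> : [seq refl_mx (a i) *m v | v <- [seq w *m u | w <- ws]]
      = [seq w *m u | w <- [seq refl_mx (a i) *m w | w <- ws]].
    by rewrite -!map_comp; apply: eq_map => w /=; rewrite mulmxA.
  have rr w : refl_mx (a i) *m (refl_mx (a i) *m w) = w.
    by rewrite mulmxA (refl_mx_sq (weyl_mx_orth rd) (weyl_refl rd)) mul1mx.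
  have rW w : W0 w -> W0 (refl_mx (a i) *m w) by move=> [r ->]; exists (i :: r).
  apply: perm_map; apply: uniq_perm; rewrite ?undup_uniq //.
    by rewrite map_inj_uniq ?undup_uniq // => w w' E; rewrite -(rr _ w) E rr.
  move=> w; apply/mapP/idP => [[w' /wsE Ww' ->]|/wsE Ww]; first exact/wsE/rW.
  by exists (refl_mx (a i) *m w); [exact/wsE/rW|rewrite rr].
have eqp (u : 'cV[R]_s) : rpoly [seq w *m u | w <- ws] (dot c) = rpoly [seq w *m u | w <- ws] (dot c').
  apply/polyP => j; have [Q QE] := invariant_coefs (us_perm u) j.
  by rewrite !QE cc'.
have [w [r wr] cw] : exists2 w, W0 w & c = w^T *m c'.
  apply: contrapT => H.
  have [||u] := @polyfun_prod_neq0 R s 'I_(size ws) predT (fun i u => dot (c - (ws`_i)^T *m c') u).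
  - by move=> i _; exact: polyfun_dot.
  - move=> i _; exists (c - (ws`_i)^T *m c'); rewrite dot_eq0 subr_eq0; apply/eqP => E.
    by apply: H; exists ws`_i => //; apply/wsE; exact: mem_nth.
  move=> /prodf_neq0 un0; have := congr1 (fun f : {poly R} => f.[dot c u]) (eqp u).
  rewrite /= !rpoly_horner !big_map (big_rem 1%:M) /=; last by apply/wsE; exists [::].
  rewrite mul1mx subrr mul0r => /esym/eqP; rewrite prodf_seq_eq0 => /hasP[w ww].
  rewrite /= subr_eq0 => /eqP cw; have iw : (index w ws < size ws)%N by rewrite index_mem.
  have := un0 (Ordinal iw) isT; rewrite /= nth_index // dotBl dot_mulmx trmxK.
  by rewrite cw subrr eqxx.
have wc : c' = w *m c by rewrite cw mulmxA orthC ?mul1mx // wr; exact: Worth.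
rewrite wc wr; symmetry.
apply: (chamber_unique (weyl_mx_finite rd) (weyl_mx1 rd) (@weyl_mxM _ _ _ _ _ rd)
  (@weyl_mx_orth _ _ _ _ _ rd) (weyl_refl rd) weyl_mx_perm ap (root_neq0 rd)
  (root_proportional rd) Cc).
by rewrite -wr -wc.
Qed.

End ChamberInvariants.

(** * Lipschitz lifts *)

Section Lines.
Variables (R : realType) (q : nat).
Implicit Types (x y h : 'rV[R]_q).

Lemma norm_entry k l (M : 'M[R]_(k, l)) i j : `|M i j| <= `|M|.
Proof.
rewrite [leRHS]mx_normrE; exact: (le_bigmax _ (fun ij => `|M ij.1 ij.2|) (i, j)).
Qed.

(* [(y, h)] stands for the segment [y + t h], [|t| < 1]. *)
Definition lines (x0 : 'rV[R]_q) (r : R) :=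
  {w : 'rV[R]_q * 'rV[R]_q | `|w.1 - x0| <= r / 2 /\ `|w.2| <= r / 2}.

Definition line x0 r (w : lines x0 r) (t : R) := (projT1 w).1 + t *: (projT1 w).2.

Lemma line_ball x0 r (w : lines x0 r) (t : R) : 0 < r -> `|t| < 1 -> ball x0 r (line w t).
Proof.
move=> r0 t1; rewrite -ball_normE /= distrC /line addrAC.
case: w => -[y h] [/= yr hr]; apply: le_lt_trans (ler_normD _ _) _.
rewrite normrZ; have := normr_ge0 h; have := normr_ge0 t; set a := `|t| in t1 *.
set b := `|h| in hr *; move=> a0 b0.
have : a * b < r / 2.
  have [->|bn0] := eqVneq b 0; first by rewrite mulr0 divr_gt0.
  by apply: lt_le_trans hr; rewrite gtr_pMl // lt_def bn0.
lra.
Qed.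

Lemma UCB_comp_fam (Om Om' : Type) (g : Om' -> Om) n (f : Om -> R -> R) :
  UCB n f -> UCB n (fun w t => f (g w) t).
Proof. by move=> [B B0 fB]; exists B => // w; exact: fB. Qed.

Lemma lines_le x0 (r r' : R) : r' <= r ->
  exists g : lines x0 r' -> lines x0 r, forall w t, line (g w) t = line w t.
Proof.
move=> rr; have H (w : lines x0 r') : `|(projT1 w).1 - x0| <= r / 2 /\ `|(projT1 w).2| <= r / 2.
  by case: w => w [/= h1 h2]; split; lra.
by exists (fun w : lines x0 r' => exist _ (projT1 w) (H w)).
Qed.

Lemma line_derive p (f : 'rV[R]_q -> 'rV[R]_p) x0 r (w : lines x0 r) (t : R) i :
  differentiable f (line w t) ->
  is_derive t 1 (fun t => f (line w t) 0 i) (\sum_j (projT1 w).2 0 j * ('D_(delta_mx 0 j) f (line w t)) 0 i).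
Proof.
set h := (projT1 w).2; set y := (projT1 w).1 => df.
have -> : \sum_j h 0 j * ('D_(delta_mx 0 j) f (line w t)) 0 i = ('D_h f (line w t)) 0 i.
  rewrite deriveE // {2}[h]row_sum_delta linear_sum summxE; apply: eq_bigr => j _.
  by rewrite linearZ /= mxE deriveE.
have D : (fun s => s^-1 *: ((f \o shift (line w t)) (s *: h) - f (line w t))) @ 0^' --> 'D_h f (line w t).
  exact: (@diff_derivable _ _ _ f (line w t) h df).
have Dc : (fun s => (s^-1 *: ((f \o shift (line w t)) (s *: h) - f (line w t))) 0 i) @ 0^'
    --> ('D_h f (line w t)) 0 i.
  apply: (cvg_comp _ (fun M : 'rV[R]_p => M 0 i) D); exact: coord_continuous.
have E : (fun s => (s^-1 *: ((f \o shift (line w t)) (s *: h) - f (line w t))) 0 i) =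
    (fun s : R => s^-1 *: (((fun t => f (line w t) 0 i) \o shift t) (s *: 1) - f (line w t) 0 i)).
  apply/funext => s; rewrite !mxE /= [s *: 1]mulr1; congr (_ * (f _ 0 i - _)).
  by rewrite /line -/h -/y scalerDl addrCA.
rewrite E in Dc.
by split; [exact: cvgP Dc|exact: cvg_lim Dc].
Qed.

Lemma C_on_continuous (V W : normedModType R) k (U : set V) (f : V -> W) (x : V) :
  C_on k U f -> U x -> {for x, continuous f}.
Proof.
case: k => [|k] /=; first exact.
by move=> [df _] Ux; apply: differentiable_continuous; exact: df.
Qed.

(** Induction on [k]: the derivative along a segment is the sum of the partial derivatives weighted
    by the entries of the direction, which are bounded because [r <= 1]. Boundedness comes from
    continuity at [x0], at the price of shrinking [r]. *)
Lemma C_on_UCB p k (U : set 'rV[R]_q) (f : 'rV[R]_q -> 'rV[R]_p) x0 :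
  open U -> U x0 -> C_on k U f ->
  exists2 r, 0 < r <= 1 & ball x0 r `<=` U /\
    forall i, UCB k (fun (w : lines x0 r) t => f (line w t) 0 i).
Proof.
move=> oU Ux0.
have [r0 /andP[r00 r01] r0U] : exists2 r, 0 < r <= 1 & ball x0 r `<=` U.
  have /nbhs_ballP[r r0 rU] : nbhs x0 U by apply: open_nbhs_nbhs.
  exists (Num.min r 1); first by rewrite lt_min r0 ltr01 ge_min lexx orbT.
  by apply: subset_trans rU; apply: le_ball; rewrite ge_min lexx.
have restrict k' (f' : 'rV[R]_q -> 'rV[R]_p) (r r' : R) : r' <= r ->
    (forall i, UCB k' (fun (w : lines x0 r) t => f' (line w t) 0 i)) ->
    forall i, UCB k' (fun (w : lines x0 r') t => f' (line w t) 0 i).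
  move=> rr H i; have [g gE] := lines_le x0 rr; have := UCB_comp_fam g (H i).
  by congr UCB; apply/funext => w; apply/funext => t; rewrite gE.
have C0 (f' : 'rV[R]_q -> 'rV[R]_p) : {for x0, continuous f'} ->
    exists2 r, 0 < r <= r0 & forall i, UCB 0 (fun (w : lines x0 r) t => f' (line w t) 0 i).
  move=> /cvgr_norm_lt/(_ (`|f' x0| + 1)).
  have lt1 : `|f' x0| < `|f' x0| + 1 by rewrite ltrDl.
  move=> /(_ lt1)/nbhs_ballP[r rpos rf]; exists (Num.min r r0).
    by rewrite lt_min rpos r00 ge_min lexx orbT.
  move=> i; apply/UCB0; exists (`|f' x0| + 1) => [|w t t1]; first by rewrite addr_ge0.
  apply: le_trans (norm_entry _ _ _) _; apply/ltW/rf.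
  have mr : Num.min r r0 <= r by rewrite ge_min lexx.
  apply: (le_ball mr); apply: line_ball => //.
  by rewrite lt_min rpos r00.
elim: k f => [|k IH] f Cf.
  have [r /andP[rpos rr0] rf] := C0 f (Cf x0 Ux0).
  exists r; first by rewrite rpos (le_trans rr0).
  by split=> //; apply: subset_trans r0U; exact: le_ball.
have [df Df] := Cf.
have [rc /andP[rcpos rcr0] rcf] := C0 f (C_on_continuous Cf Ux0).
have /choice[rj rjP] : forall j : 'I_q, exists r, 0 < r /\
    forall i, UCB k (fun (w : lines x0 r) t => ('D_(delta_mx 0 j) f (line w t)) 0 i).
  by move=> j; have [r /andP[rpos _] [_ H]] := IH _ (Df (delta_mx 0 j)); exists r.
pose r := \big[Num.min/rc]_j rj j.
have rpos : 0 < r by rewrite /r; elim/big_ind: _ => // [x y x0' y0|j _]; rewrite ?lt_min ?x0' //; have [] := rjP j.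
have rrc : r <= rc by exact: bigmin_le_id.
have rrj j : r <= rj j by exact: bigmin_le.
have rU : ball x0 r `<=` U by apply: subset_trans r0U; apply: le_ball; apply: le_trans rcr0.
exists r; first by rewrite rpos (le_trans rrc) // (le_trans rcr0).
split=> // i; apply/UCBS; split; first exact: (restrict 0%N f rc).
exists (fun (w : lines x0 r) t => \sum_j (projT1 w).2 0 j * ('D_(delta_mx 0 j) f (line w t)) 0 i).
  by move=> w t t1; apply: line_derive; apply: df; apply: rU; exact: line_ball.
apply: UCB_sum => j _; apply: UCB_M; last exact: (restrict k ('D_(delta_mx 0 j) f) _ _ (rrj j) (rjP j).2 i).
apply: (UCB_cst k (B := 1)) => -[w [/= _ wr]].
rewrite (le_trans (norm_entry _ _ _)) // (le_trans wr) //.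
have : r <= 1 by rewrite (le_trans rrc) // (le_trans rcr0).
lra.
Qed.

Lemma UCB_evalsig (Om : Type) k n (Q : mpoly.mpoly n R) (g : Om -> R -> 'rV[R]_n) :
  (forall i, UCB k (fun w t => g w t 0 i)) -> UCB k (fun w t => evalsig Q (g w t)).
Proof.
move=> ug; rewrite (_ : (fun _ _ => _) = (fun w t => \sum_(m <- mpoly.msupp Q)
    mpoly.mcoeff m Q * \prod_(i < n) g w t 0 i ^+ m i)); last first.
  by apply/funext => w; apply/funext => t; rewrite /evalsig mpoly.mevalE.
have uc (c : R) : @UCB R Om k (fun _ _ => c) by apply: (UCB_cst k (B := `|c|)).
apply: UCB_sum => m _; apply: UCB_M => //.
elim: (index_enum _) => [|i r IH].
  rewrite (_ : (fun _ _ => _) = (fun _ _ => 1)) //.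
  by apply/funext => w; apply/funext => t; rewrite big_nil.
rewrite (_ : (fun _ _ => _) = (fun w t => g w t 0 i ^+ m i * \prod_(j <- r) g w t 0 j ^+ m j)).
  apply: UCB_M => //; elim: (m i) => [|e IHe].
    exact: (uc 1).
  rewrite (_ : (fun _ _ => _) = (fun w t => g w t 0 i * g w t 0 i ^+ e)); first exact: UCB_M.
  by apply/funext => w; apply/funext => t; rewrite exprS.
by apply/funext => w; apply/funext => t; rewrite big_cons.
Qed.

Theorem roots_lipschitz n k (U : set 'rV[R]_q) (f : 'rV[R]_q -> 'rV[R]_n) s
    (cb : 'rV[R]_q -> 'cV[R]_s) (us : seq 'cV[R]_s) :
  open U -> C_on k U f -> (size us <= k)%N ->
  (forall x i, U x -> (fun y => cb y i 0) @ nbhs x --> cb x i 0) ->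
  (forall j, exists Q, forall x, U x -> (rpoly us (dot (cb x)))`_j = evalsig Q (f x)) ->
  forall x0, U x0 -> exists r L : R, [/\ 0 < r, 0 <= L & forall x y, ball x0 r x -> ball x0 r y ->
    forall u, u \in us -> `|dot (cb x) u - dot (cb y) u| <= L * `|x - y|].
Proof.
move=> oU Cf usk cbc usQ x0 Ux0.
have [r /andP[r0 r1] [rU uf]] := C_on_UCB oU Ux0 Cf.
pose I := 'I_(size us).
pose x (w : lines x0 r) (i : I) t := dot (cb (line w t)) us`_i.
have rpE w t : rpoly (enum I) (x w ^~ t) = rpoly us (dot (cb (line w t))).
  by rewrite /rpoly big_enum /= [RHS](big_nth 0) big_mkord.
have [||L L0 LP] := bronshtein (r := enum I) (x := x).
- move=> w i t t1; have Ul : U (line w t) by apply: rU; exact: line_ball.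
  apply: cvg_bigsum => j; apply: cvgM; last exact: cvg_cst.
  apply: (cvg_comp (line w) (fun y => cb y j 0) _ (cbc _ j Ul)).
  apply: cvgD; first exact: cvg_cst.
  exact: scalel_continuous.
- move=> j; have [Q QE] := usQ j; rewrite size_enum_ord.
  have [B B0 HB] := UCB_le usk (UCB_evalsig Q uf).
  exists B => // w; have [v [v0 cv vB]] := HB w.
  (* The coefficient agrees with [v 0] only for [|t| < 1], where the segment lies in [U]; the
     sequence of derivatives is made to start with the coefficient itself. *)
  pose v' i := if i is i'.+1 then v i'.+1 else fun t => (rpoly (enum I) (x w ^~ t))`_j.
  have vv (t : R) : `|t| < 1 -> v' 0%N t = v 0%N t.
    by move=> t1; rewrite /v' /= rpE QE ?v0 //; apply: rU; exact: line_ball.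
  exists v'; split=> // [[|i] ik t t1|[|i] ik t t1]; last first.
  + exact: vB.
  + by rewrite vv // vB.
  + exact: cv.
  have d := cv 0%N ik t t1.
  have nE : \forall t' \near t, v 0%N t' = v' 0%N t'.
    have : nbhs t (ball (0 : R) 1).
      by apply: open_nbhs_nbhs; split; [exact: ball_open|rewrite -ball_normE /= sub0r normrN].
    by apply: filterS => t'; rewrite -ball_normE /= sub0r normrN => t'1; exact/esym/vv.
  exact: near_eq_is_derive nE d.
have hr : 0 < r / 2 by rewrite divr_gt0.
(* Two points of the smaller ball are at distance less than [r / 8]. On the segment from [y] in the
   direction of [y'] with [|h| = r / 2], the point [y'] is thus reached before time 1/4, within the
   range [|t| < 1 / 2] of [bronshtein]. *)
exists (r / 16), (L / (r / 2)); split; rewrite ?divr_ge0 ?divr_gt0 //; first exact: ltW.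
move=> y y'; rewrite -!ball_normE /= => yr y'r u uus.
have [->|yy] := eqVneq y y'; first by rewrite !subrr !normr0 mulr0.
set D := `|y - y'|; have D0 : 0 < D by rewrite normr_gt0 subr_eq0.
have D8 : D < r / 8.
  have -> : D = `|(x0 - y') - (x0 - y)| by rewrite opprB addrC addrA subrK.
  by rewrite (le_lt_trans (ler_normB _ _)) //; lra.
pose h := (r / 2 / D) *: (y' - y).
have wP : `|y - x0| <= r / 2 /\ `|h| <= r / 2.
  split; first by rewrite distrC; lra.
  rewrite normrZ ger0_norm; last by rewrite divr_ge0 // ltW.
  by rewrite (distrC y' y) -/D divfK // gt_eqF.
pose w : lines x0 r := exist _ (y, h) wP.
pose t := D / (r / 2).
have iu : (index u us < size us)%N by rewrite index_mem.
have l0 : line w 0 = y by rewrite /line /= scale0r addr0.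
have lt : line w t = y'.
  rewrite /line /= /h scalerA /t mulrA divfK ?gt_eqF // divff ?gt_eqF // scale1r.
  by rewrite addrC subrK.
have t0 : 0 <= t by rewrite divr_ge0 // ltW.
have th : `|t| < 1 / 2.
  by rewrite ger0_norm // ltr_pdivrMr //; lra.
have h0 : `|0 : R| < 1 / 2 by rewrite normr0; lra.
have := LP w (Ordinal iu) (mem_enum _ _) 0 t h0 th.
rewrite /x l0 lt /= nth_index // sub0r normrN (ger0_norm t0) => H.
by apply: le_trans H _; rewrite /t mulrA mulrAC.
Qed.

End Lines.

(** * The generalized Weyl group in coordinates *)

Section WeylGroup.
Variables (R : realType) (G : lieGroupType R) (V : euclideanType R).
Variable rho : orthrep G (@inner R V).
Variable S : {vspace V}.
Variables (s m : nat) (iota : 'cV[R]_(s + m) -> V) (a : 'I_m -> 'cV[R]_s).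
Hypothesis iotaP : isometry_onto iota.
Hypothesis iotaS : forall x, x \in S <-> exists c, x = iota (section_incl m c).
Hypothesis rd : root_data (KG rho iota) a.
Local Notation tau := (weyl_rep rho S).
Local Notation W := (weyl rho S).

Lemma coords_ex : exists cu : subvs_of S -> 'cV[R]_s,
  [/\ forall u, vsval u = iota (section_incl m (cu u)),
      forall k u v, cu (k *: u + v) = k *: cu u + cu v & forall c, exists u, cu u = c].
Proof.
have /choice[cu cuE] : forall u : subvs_of S, exists c, vsval u = iota (section_incl m c).
  by move=> u; have /iotaS[c cE] := subvsP u; exists c.
have cuI u c : vsval u = iota (section_incl m c) -> cu u = c.
  by move=> E; rewrite -[LHS](us_inc m) -[RHS](us_inc m); congr usubmx; apply: (iota_inj iotaP); rewrite -cuE.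
exists cu; split=> // [k u v|c].
  by apply: cuI; rewrite linearP /= !cuE inc_lin (iso_lin iotaP).
have cS : iota (section_incl m c) \in S by apply/iotaS; exists c.
by exists (vsproj S (iota (section_incl m c))); apply: cuI; rewrite vsprojK.
Qed.

Variable cu : subvs_of S -> 'cV[R]_s.
Hypothesis cuE : forall u, vsval u = iota (section_incl m (cu u)).
Hypothesis cu_lin : forall k u v, cu (k *: u + v) = k *: cu u + cu v.
Hypothesis cu_onto : forall c, exists u, cu u = c.

Lemma cu_inj : injective cu.
Proof. by move=> u v uv; apply: (can_inj (@vsvalK _ _ _)); rewrite !cuE uv. Qed.

Lemma weyl_coord (x : W) : exists w, weyl_mx (KG rho iota) w /\ forall u, cu (tau x u) = w *m cu u.
Proof.
elim/weyl_ind: x => g; set k := matG rho iota (val g).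
have kE c : exists c', k *m section_incl m c = section_incl m c'.
  have cS : iota (section_incl m c) \in S by apply/iotaS; exists c.
  have /iotaS[c' cE] := normalizer_stable g cS; exists c'.
  by apply: (iota_inj iotaP); rewrite -cE (matGE rho iotaP).
have kw c : k *m section_incl m c = section_incl m (ulsubmx k *m c).
  have [c' cE] := kE c; rewrite cE; congr section_incl.
  have := congr1 usubmx cE; rewrite us_inc => <-.
  by rewrite -[X in usubmx (X *m _)]submxK mul_block_col mulmx0 addr0 col_mxKu.
exists (ulsubmx k); split; first by exists k => //; exists (val g).
move=> u; rewrite -[LHS](us_inc m) -[RHS](us_inc m); congr usubmx; apply: (iota_inj iotaP).
by rewrite -cuE /= weyl_funE cuE (matGE rho iotaP) kw.
Qed.

Lemma coord_weyl w : weyl_mx (KG rho iota) w -> exists x : W, forall u, cu (tau x u) = w *m cu u.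
Proof.
move=> Ww; have [_ [g _ <-] gw] := Ww; have [_ [h _ <-] hw] := weyl_mxT rd Ww.
have stab (g' : G) w' : (forall c, matG rho iota g' *m section_incl m c = section_incl m (w' *m c)) ->
    (rho g' @: S <= S)%VS.
  move=> gw'; apply/subvP => _ /memv_imgP[x /iotaS[c ->] ->]; apply/iotaS; exists (w' *m c).
  by rewrite (matGE rho iotaP) gw'.
have gN : normalizer_pred rho S g.
  rewrite /normalizer_pred eqEsubv (stab g w gw) /=; apply/subvP => x xS.
  have [c xE] := (iotaS x).1 xS.
  have -> : x = rho g (rho h x).
    by rewrite xE !(matGE rho iotaP) hw gw mulmxA (orthC (weyl_mx_orth rd Ww)) mul1mx.
  apply: memv_img; apply: (subvP (stab h _ hw)); exact: memv_img.
exists (weyl_pi (Normalizer gN)) => u.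
rewrite -[LHS](us_inc m) -[RHS](us_inc m); congr usubmx; apply: (iota_inj iotaP).
by rewrite -cuE /= weyl_funE /= cuE (matGE rho iotaP) gw.
Qed.

Lemma weyl_faithful (x y : W) : (forall u, tau x u = tau y u) -> x = y.
Proof.
elim/weyl_ind: x => g; elim/weyl_ind: y => h gh; apply/weyl_piP/weyl_relP => t tS.
have := congr1 vsval (gh (vsproj S t)).
by rewrite /= !weyl_funE vsprojK.
Qed.

Lemma weyl_finite : finite_set [set: W].
Proof.
have /choice[wm wmP] := weyl_coord.
have wm_inj x y : wm x = wm y -> x = y.
  move=> xy; apply: weyl_faithful => u; apply: cu_inj.
  by rewrite (wmP x).2 (wmP y).2 xy.
pose inv M := if pselect (exists x, wm x = M) is left E then projT1 (cid E) else 1%g.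
have invK x : inv (wm x) = x.
  rewrite /inv; case: pselect => [E|[]]; last by exists x.
  by apply: wm_inj; rewrite (projT2 (cid E)).
have : finite_set (inv @` weyl_mx (KG rho iota)).
  by apply: finite_image; exact: (weyl_mx_finite rd).
apply: sub_finite_set => x _; exists (wm x); first exact: (wmP x).1.
exact: invK.
Qed.

Definition weyl_seq : seq W := enum_fset (fset_set [set: W]).

Lemma mem_weyl_seq x : x \in weyl_seq.
Proof.
have : x \in fset_set [set: W] by rewrite in_fset_set; [rewrite inE|exact: weyl_finite].
by [].
Qed.

Lemma tau1 u : tau 1%g u = u.
Proof. by rewrite (rep1 tau) lfunE. Qed.

Lemma tauM x y u : tau (x * y)%g u = tau x (tau y u).
Proof. by rewrite (repM tau) lfunE. Qed.

(** Choose an element of the group for each point of the orbit: its products with the elements of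
    the stabiliser of [v] are pairwise distinct. *)
Lemma orbit_size v : let O := undup [seq tau x v | x <- weyl_seq] in
  (size O <= card_set [set: W] %/ card_set (isotropy tau v))%N.
Proof.
set O' := undup _ => /=; set St := enum_fset (fset_set (isotropy tau v)).
have fSt : finite_set (isotropy tau v) by apply: sub_finite_set weyl_finite.
have memSt x : (x \in St) = (x \in isotropy tau v) by have := in_fset_set fSt x.
have St0 : (0 < card_set (isotropy tau v))%N.
  rewrite -has_predT; apply/hasP; exists 1%g => //; rewrite memSt inE.
  exact: tau1.
rewrite leq_divRL //.
have /choice[pick pickP'] : forall u, exists x, u \in O' -> tau x v = u.
  move=> u; case: (boolP (u \in O')) => [|_]; last by exists 1%g.
  by rewrite mem_undup => /mapP[x _ ->]; exists x.
have -> : card_set (isotropy tau v) = size St by [].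
have -> : card_set [set: W] = size weyl_seq by [].
have <- : size [seq (pick u * h)%g | u <- O', h <- St] = (size O' * size St)%N by rewrite size_allpairs.
apply: uniq_leq_size; last by move=> x _; exact: mem_weyl_seq.
apply: allpairs_uniq; [exact: undup_uniq|exact: fset_uniq|].
move=> [u h] [u' h'] /allpairsP[[u1 h1] /= [u1O h1S [-> ->]]] /allpairsP[[u2 h2] /= [u2O h2S [-> ->]]] E.
have fix_h t : t \in St -> tau t v = v by rewrite memSt inE.
have uu : u1 = u2.
  by have := congr1 (fun x => tau x v) E; rewrite !tauM (fix_h h1) // (fix_h h2) // !pickP'.
by move: E; rewrite uu => /mulgI ->.
Qed.

(** The span of the orbit of [v i] is a nonzero stable subspace of [F i], hence all of it by
    irreducibility. *)
Lemma weyl_span (l : nat) (F : 'I_l -> {vspace subvs_of S}) (v : 'I_l -> subvs_of S)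
    (P : subvs_of S -> Prop) :
  (forall i, irreducible_subspace tau (F i)) -> (forall i, v i \in F i /\ v i != 0) ->
  (\sum_i F i)%VS = fullv -> P 0 -> (forall k u u', P u -> P u' -> P (k *: u + u')) ->
  (forall i x, P (tau x (v i))) -> forall u, P u.
Proof.
move=> Firr vF Fsum P0 Plin Pv u.
pose T i := span [seq tau x (v i) | x <- weyl_seq].
have Tstab i x : (tau x @: T i <= T i)%VS.
  rewrite limg_span; apply/span_subvP => _ /mapP[_ /mapP[y _ ->] ->].
  by rewrite -tauM; apply: memv_span; apply: map_f; exact: mem_weyl_seq.
have vT i : v i \in T i.
  apply: memv_span; apply/mapP; exists 1%g; first exact: mem_weyl_seq.
  by rewrite tau1.
have TF i : T i = F i.
  have [_ Fst Fmin] := Firr i.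
  have sub : (T i <= F i)%VS.
    apply/span_subvP => _ /mapP[x _ ->]; apply: (subvP (Fst x)); apply: memv_img.
    by have [] := vF i.
  case: (Fmin _ sub (Tstab i)) => // T0; have := vT i; rewrite T0 memv0.
  by have [_ /negPf ->] := vF i.
have PT i t : t \in T i -> P t.
  move=> tT; rewrite (coord_span (X := in_tuple [seq tau x (v i) | x <- weyl_seq]) tT).
  elim/big_ind: _ => // [t1 t2 P1 P2|j _]; first by rewrite -[t1]scale1r; apply: Plin.
  rewrite -[_ *: _]addr0; apply: Plin => //=.
  have : [seq tau x (v i) | x <- weyl_seq]`_j \in [seq tau x (v i) | x <- weyl_seq] by rewrite mem_nth.
  by move=> /mapP[x _ ->].
have : u \in (\sum_i T i)%VS.
  by rewrite (eq_bigr F) ?Fsum ?memvf // => i _; rewrite TF.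
case/memv_sumP => w wT ->.
elim/big_ind: _ => // [t1 t2 P1 P2|j _]; first by rewrite -[t1]scale1r; apply: Plin.
by apply: (PT j); exact: wT.
Qed.

Lemma orbit_refl_stable v i :
  let us := [seq cu u | u <- undup [seq tau x v | x <- weyl_seq]] in
  perm_eq [seq refl_mx (a i) *m u | u <- us] us.
Proof.
set O' := undup _ => /=; have [y yE] := coord_weyl (weyl_refl rd i).
have -> : [seq refl_mx (a i) *m u | u <- [seq cu u | u <- O']] = [seq cu u | u <- [seq tau y u | u <- O']].
  by rewrite -!map_comp; apply: eq_map => u /=; rewrite yE.
have tau_inj x : injective (tau x).
  move=> u u' /(congr1 (tau x^-1%g)); rewrite -!tauM mulVg.
  by rewrite !tau1.
have tauO x u : u \in O' -> tau x u \in O'.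
  rewrite !mem_undup => /mapP[z _ ->]; rewrite -tauM; apply: map_f; exact: mem_weyl_seq.
apply: perm_map; apply: uniq_perm; rewrite ?undup_uniq //.
  by rewrite map_inj_uniq ?undup_uniq.
move=> u; apply/mapP/idP => [[u' u'O ->]|uO]; first exact: tauO.
exists (tau y^-1%g u); first exact: tauO.
by rewrite -tauM mulgV tau1.
Qed.

End WeylGroup.

(** * Continuity of the chamber lift *)

Section ChamberLift.
Variables (R : realType) (G : lieGroupType R) (V : euclideanType R).
Variable rho : orthrep G (@inner R V).
Hypothesis G_compact : compact [set: G].
Hypothesis G_connected : connected [set: G].
Hypothesis rho_continuous : continuous_rep rho.
Variables (s m : nat) (iota : 'cV[R]_(s + m) -> V) (a : 'I_m -> 'cV[R]_s).
Hypothesis iotaP : isometry_onto iota.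
Hypothesis rd : root_data (KG rho iota) a.
Variables (n : nat) (sigma : n.-tuple (mpoly.mpoly (\dim {:V}) R)).
Hypothesis sigmaP : minimal_generators rho sigma.
Variables (q : nat) (U : set 'rV[R]_q) (f : 'rV[R]_q -> 'rV[R]_n) (cb : 'rV[R]_q -> 'cV[R]_s).
Hypothesis U_open : open U.
Hypothesis cbC : forall x, U x -> in_chamber a (cb x).
Hypothesis cbE : forall x, U x -> orbit_map sigma (iota (section_incl m (cb x))) = f x.

Lemma norm_invariant : exists Q, forall c, dot c c = evalsig Q (orbit_map sigma (iota c)).
Proof.
apply: (invariant_evalsig iotaP sigmaP (P := fun c => dot c c)).
  by apply: polyfun_sum => i _; apply: polyfunM; exact: polyfun_coord.
by move=> g v; rewrite dot_mulmx mulmxA matG_orth // mul1mx.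
Qed.

Lemma mlim_inc (c : nat -> 'cV[R]_s) l : mlim c l -> mlim (fun k => section_incl m (c k)) (section_incl m l).
Proof.
move=> cl i j; case: (split_ordP i) => i' ->.
  rewrite col_mxEu (_ : (fun _ => _) = fun k => c k i' j); first exact: cl.
  by apply/funext => k; rewrite col_mxEu.
rewrite col_mxEd (_ : (fun _ => _) = fun=> (0 : 'cV[R]_m) i' j); first exact: cvg_cst.
by apply/funext => k; rewrite col_mxEd.
Qed.

Lemma chamber_lift_continuous x i : U x -> {for x, continuous f} ->
  (fun y => cb y i 0) @ nbhs x --> cb x i 0.
Proof.
move=> Ux fx; apply: contrapT => ncvg.
have [e e0 bad] : exists2 e : R, 0 < e & ~ \forall y \near x, `|cb x i 0 - cb y i 0| <= e.
  apply: contrapT => H; apply: ncvg; apply/cvgrPdist_le => e e0; apply: contrapT => H'.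
  by apply: H; exists e.
have /choice[y yP] : forall k : nat, exists y, [/\ U y, ball x k.+1%:R^-1 y & e <= `|cb x i 0 - cb y i 0|].
  move=> k; apply: contrapT => /forallNP none; apply: bad.
  have k0 : (0 : R) < k.+1%:R^-1 by rewrite invr_gt0.
  have : nbhs x (U `&` ball x k.+1%:R^-1).
    by apply: filterI; [exact: open_nbhs_nbhs|exact: nbhsx_ballx].
  apply: filterS => y [Uy xy]; rewrite leNgt; apply/negP => /ltW lt.
  by apply: (none y).
have yx : y @ omega --> x.
  apply/cvgrPdist_le => d d0; have /cvgr_lt/(_ d d0) := @cvg_invn R.
  apply: filterS => k kd; have [_ + _] := yP k; rewrite -ball_normE /= => /ltW H.
  exact: le_trans H (ltW kd).
have fy : (fun k => f (y k)) @ omega --> f x by apply: (cvg_comp y f yx); exact: fx.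
have fyi j : (fun k => f (y k) 0 j) @ omega --> f x 0 j.
  by apply: (cvg_comp _ (fun M : 'rV[R]_n => M 0 j) fy); exact: coord_continuous.
have [Q QE] := norm_invariant.
have dl : (fun k => dot (cb (y k)) (cb (y k))) @ omega --> evalsig Q (f x).
  have pQ : polyfun (fun c : 'cV[R]_n => evalsig Q c^T).
    by apply: polyfun_meval => j; apply: polyfun_eq (polyfun_coord _ j) => c; rewrite mxE.
  have l : (fun k => evalsig Q ((f (y k))^T)^T) @ omega --> evalsig Q ((f x)^T)^T.
    apply: (@polyfun_cvg R nat omega _ n (fun c => evalsig Q c^T) (fun k => (f (y k))^T) _ pQ) => j.
    rewrite mxE (_ : (fun _ => _) = fun k => f (y k) 0 j); first exact: fyi.
    by apply/funext => k; rewrite mxE.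
  rewrite trmxK in l; rewrite (_ : (fun _ => _) = fun k => evalsig Q ((f (y k))^T)^T) //.
  apply/funext => k; have [Uy _ _] := yP k.
  by rewrite trmxK -(cbE Uy) -QE dot_inc.
(* Each entry [u] satisfies [|u| <= 1 + u ^ 2], and [u ^ 2] is eventually below
   [evalsig Q (f x) + 1]. *)
have [|l cl] := mlim_ex (g := fun k => cb (y k)) (M := s%:R * (2 + evalsig Q (f x))).
  have lt : evalsig Q (f x) < evalsig Q (f x) + 1 by rewrite ltrDl.
  apply: filterS (cvgr_lt _ dl _ lt) => k dk.
  apply: (@le_trans _ _ (\sum_(j < s) (2 + evalsig Q (f x)))); last by rewrite sumr_const card_ord mulr_natl.
  apply: ler_sum => j _; rewrite big_ord1.
  have : cb (y k) j 0 ^+ 2 <= dot (cb (y k)) (cb (y k)).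
    rewrite /dot (bigD1 j) //= -expr2 lerDl; apply: sumr_ge0 => j' _.
    by rewrite -expr2 sqr_ge0.
  rewrite -(real_normK (num_real _)); set u := `| _ | => u2.
  have := sqr_ge0 (u - 1); rewrite sqrrB1 => H; have u0 : 0 <= u by apply: normr_ge0.
  have : 0 <= u ^+ 2 by apply: sqr_ge0.
  move: H; rewrite mulr2n; lra.
have Cl : in_chamber a l.
  move=> j; apply: (cvgr_to_ge (mlim_dot (mlim_cst (a j)) cl)); apply: nearW => k.
  by have [Uy _ _] := yP k; apply: cbC.
have sl : orbit_map sigma (iota (section_incl m l)) = f x.
  apply/rowP => j.
  have pj : polyfun (fun c => orbit_map sigma (iota c) 0 j) := polyfun_orbit_map iotaP sigma j.
  have l1 : (fun k => orbit_map sigma (iota (section_incl m (cb (y k)))) 0 j) @ omega -->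
      orbit_map sigma (iota (section_incl m l)) 0 j.
    exact: (@polyfun_cvg R nat omega _ _ _ (fun k => section_incl m (cb (y k))) _ pj (fun i => @mlim_inc _ _ cl i 0)).
  apply: (norm_cvg_unique l1); rewrite (_ : (fun _ => _) = fun k => f (y k) 0 j); first exact: fyi.
  by apply/funext => k; have [Uy _ _] := yP k; rewrite (cbE Uy).
have lE : l = cb x.
  apply: (chamber_separated G_compact G_connected rho_continuous iotaP rd sigmaP Cl (cbC Ux)).
  by rewrite sl cbE.
have : e <= `|cb x i 0 - l i 0|.
  have l1 : (fun k => `|cb x i 0 - cb (y k) i 0|) @ omega --> `|cb x i 0 - l i 0|.
    by apply: cvg_norm; apply: cvgB; [exact: cvg_cst|exact: cl].
  by apply: (cvgr_to_ge l1); apply: nearW => k; have [] := yP k.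
by rewrite lE subrr normr0 leNgt e0.
Qed.

End ChamberLift.

Theorem corollary5 (R : realType) (G : lieGroupType R) (V : euclideanType R)
    (rho : orthrep G (@inner R V))
    (G_compact : compact [set: G]) (G_connected : connected [set: G])
    (rho_continuous : continuous_rep rho)
    (S : {vspace V}) (S_section : is_section rho S)
    (n : nat) (sigma : n.-tuple (mpoly.mpoly (\dim {:V}) R))
    (sigma_generators : minimal_generators rho sigma)
    (k : nat) (k_eq : is_k (weyl_rep rho S) k)
    (q : nat) (U : set 'rV[R]_q) (U_open : open U)
    (f : 'rV[R]_q -> 'rV[R]_n)
    (f_orbit : forall x, U x -> range (orbit_map sigma) (f x))
    (f_Ck : C_on k U f) :
  exists fbar : 'rV[R]_q -> V,
    [/\ forall x, U x -> orbit_map sigma (fbar x) = f x,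
        locally_lipschitz U fbar &
        orthogonal_on rho U fbar].
Proof.
have [m [iota [a [iotaP iotaS rd]]]] := polar_coordinates G_compact rho_continuous S_section.
have [cu [cuE cu_lin cu_onto]] := coords_ex iotaP iotaS.
have /choice[cb cbP] : forall x, exists c, U x ->
    in_chamber a c /\ orbit_map sigma (iota (section_incl m c)) = f x.
  move=> x; have [Ux|nUx] := pselect (U x); last by exists 0.
  (* The orbit over [f x] meets the section, and the Weyl group moves the intersection point into
     the chamber. *)
  have [v _ vx] := f_orbit x Ux; have [w [g _ gv] wS] := S_section.1 v.
  have [c wc] := (iotaS w).1 wS; have [h [c' [Cc' hc]]] := chamber_point iotaP rd c.
  exists c' => _; split=> //.
  by rewrite -hc (orbit_map_inv sigma_generators) -wc -gv (orbit_map_inv sigma_generators).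
have cbC x : U x -> in_chamber a (cb x) by move=> /cbP[].
have cbE x : U x -> orbit_map sigma (iota (section_incl m (cb x))) = f x by move=> /cbP[].
have fbS x : iota (section_incl m (cb x)) \in S by apply/iotaS; exists (cb x).
have cbc x i : U x -> (fun y => cb y i 0) @ nbhs x --> cb x i 0.
  move=> Ux; apply: (chamber_lift_continuous G_compact G_connected rho_continuous iotaP rd
    sigma_generators U_open cbC cbE Ux).
  exact: C_on_continuous f_Ck Ux.
exists (fun x => iota (section_incl m (cb x))); split=> //.
  have [d [l [F [v [_ Firr [_ Fsum] vP kE]]]]] := k_eq.
  pose O i := undup [seq weyl_rep rho S x (v i) | x <- weyl_seq rho S].
  pose us i := [seq cu u | u <- O i].
  move=> x0 Ux0.
  (* The vectors [c] for which [<fbar, c>] is Lipschitz near [x0] form a linear subspace, which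
     contains the Weyl orbits of the [v i]. *)
  pose good c := exists r L : R, [/\ 0 < r, 0 <= L & forall x y, ball x0 r x -> ball x0 r y ->
    `|dot (cb x) c - dot (cb y) c| <= L * `|x - y|].
  have good_orbit i x : good (cu (weyl_rep rho S x (v i))).
    have usk : (size (us i) <= k)%N.
      rewrite size_map (leq_trans (orbit_size iotaP iotaS rd cuE (v i))) // kE leq_max.
      apply/orP; right; exact: (leq_bigmax (F := fun i => (card_set _ %/ card_set (isotropy _ (v i)))%N) i).
    have [|r [L [r0 L0 rL]]] := roots_lipschitz U_open f_Ck usk cbc _ Ux0.
      move=> j; have [Q QE] := invariant_coefs G_compact G_connected rho_continuous iotaP rd
        sigma_generators (orbit_refl_stable iotaP iotaS rd cuE (v i)) j.
      by exists Q => y Uy; rewrite QE cbE.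
    exists r, L; split=> // y y' yr y'r; apply: rL => //; apply: map_f.
    by rewrite mem_undup; apply: map_f; exact: (mem_weyl_seq iotaP iotaS rd cuE).
  have good_lin b c c' : good c -> good c' -> good (b *: c + c').
    move=> [r [L [r0 L0 rL]]] [r' [L' [r'0 L'0 rL']]].
    exists (Num.min r r'), (`|b| * L + L'); split; rewrite ?lt_min ?r0 ?addr_ge0 ?mulr_ge0 //.
    move=> y y' yr y'r.
    have mr : Num.min r r' <= r by rewrite ge_min lexx.
    have mr' : Num.min r r' <= r' by rewrite ge_min lexx orbT.
    have H := rL y y' (le_ball mr yr) (le_ball mr y'r).
    have H' := rL' y y' (le_ball mr' yr) (le_ball mr' y'r).
    have -> : dot (cb y) (b *: c + c') - dot (cb y') (b *: c + c') =
        b * (dot (cb y) c - dot (cb y') c) + (dot (cb y) c' - dot (cb y') c').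
      by rewrite !dotDr !dotZr; ring.
    rewrite (le_trans (ler_normD _ _)) // mulrDl lerD // normrM -mulrA.
    by rewrite ler_wpM2l.
  have cu0 : cu 0 = 0.
    have E := cu_lin 1 0 0; rewrite !scale1r addr0 in E.
    by apply: (addrI (cu 0)); rewrite -E addr0.
  have good_all c : good c.
    have [u <-] := cu_onto c.
    apply: (weyl_span iotaP iotaS rd cuE (P := fun u => good (cu u)) Firr _ Fsum) => //.
    - by move=> i; have [] := vP i.
    - rewrite cu0; exists 1, 0; split=> // y y' _ _; by rewrite !dot0r subrr normr0 mul0r.
    - by move=> b u1 u2 g1 g2; rewrite cu_lin; apply: good_lin.
  have /choice[r rP] : forall i : 'I_(\dim S), exists r : R, 0 < r /\ exists L : R, 0 <= L /\
      forall x y, ball x0 r x -> ball x0 r y -> `|cb x i 0 - cb y i 0| <= L * `|x - y|.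
    move=> i; have [r [L [r0 L0 rL]]] := good_all (delta_mx i 0); exists r; split=> //.
    by exists L; split=> // x y xr yr; have := rL x y xr yr; rewrite !dot_delta.
  have /choice[L LP] : forall i, exists L : R, 0 <= L /\
      forall x y, ball x0 (r i) x -> ball x0 (r i) y -> `|cb x i 0 - cb y i 0| <= L * `|x - y|.
    by move=> i; have [_] := rP i.
  pose r1 := \big[Num.min/1]_i r i.
  have r1pos : 0 < r1.
    by rewrite /r1; elim/big_ind: _ => // [b c b0 c0|i _]; [rewrite lt_min b0|have [] := rP i].
  have x0r : ball x0 r1 x0 by exact: ballxx.
  exists (ball x0 r1); first exact: nbhsx_ballx.
  have PF : ProperFilter (globally ((ball x0 r1 `&` U) `*` (ball x0 r1 `&` U))).
    by apply: (@globally_properfilter _ _ (x0, x0)).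
  apply: (@klipschitzW _ _ _ (\sum_i L i)) => -[y y'] [/= [yr _] [y'r _]].
  rewrite -(iotaB iotaP); have -> : section_incl m (cb y) - section_incl m (cb y') = section_incl m (cb y - cb y').
    by rewrite -[cb y - _]addrC -[- cb y']scaleN1r inc_lin scaleN1r addrC.
  rewrite (le_trans (iota_norm iotaP _)) // mulr_suml.
  have -> : mn (section_incl m (cb y - cb y')) = mn (cb y - cb y').
    rewrite /mn big_split_ord /= [X in _ + X]big1 ?addr0 => [|i _].
      by apply: eq_bigr => i _; apply: eq_bigr => j _; rewrite col_mxEu.
    by rewrite big1 // => j _; rewrite col_mxEd mxE normr0.
  apply: ler_sum => i _; rewrite big_ord1 !mxE.
  have ri : r1 <= r i by exact: bigmin_le.
  by apply: (LP i).2; apply: (le_ball ri).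
move=> x Ux dfx h w tw; apply: (S_section.2 _ (fbS x)) => //.
(* The normal coordinates of the lift are identically zero, hence so are those of its directional
   derivatives: these lie in the section, which is orthogonal to the orbit. *)
rewrite -deriveE //; have [c cE] := iso_onto iotaP ('D_h (fun x => iota (section_incl m (cb x))) x).
apply/iotaS; exists (usubmx c); rewrite -cE; congr iota; apply: inc_ds.
apply/matrixP => i j; rewrite ord1 [LHS]mxE [RHS]mxE -(iota_coord iotaP) cE.
have D := diff_derivable (v := h) dfx.
have l := inner_cvg iotaP (i := rshift _ i) _ D.
apply: norm_cvg_unique (l _) _.
rewrite (_ : (fun _ => _) = fun=> 0); first exact: cvg_cst.
apply/funext => t; rewrite innerZl innerBl /= !(iota_coord iotaP) !col_mxEd !mxE subr0.
by rewrite mulr0.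
Qed.
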